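(* Let $\alpha_0>1$ be an integer and let $$P(z,w)=\left(z-z^2,\;w+w^2+\left(\frac14+\frac{\pi^2}{(\ln\alpha_0)^2}\right)z^2\right).$$ Let $(h_\lambda)_{\lambda\in\mathbb{C}^*}$ be the family $h_\lambda=\lambda\,\hat h^{\alpha_0}$, where $\hat h$ is the horn map of $q_0(w)=w+w^2$. To each hyperbolic component $U$ of the family $(h_\lambda)_{\lambda\in\mathbb{C}^*}$ one can associate a wandering Fatou component $\Omega_U$ of $P$, in such a way that if $U_1\neq U_2$, then $\Omega_{U_1}$ and $\Omega_{U_2}$ are in different grand orbits of $P$.
   Context: Fatou components. The Fatou set of $P$ is the largest open subset of $\mathbb{C}^2$ on which $(P^n)_{n\in\mathbb{N}}$ is normal; a Fatou component is a connected component of it. A Fatou component $\Omega$ is wandering if $P^{k+m}(\Omega)\cap P^k(\Omega)=\emptyset$ for all integers $k\ge0,m\ge1$. Two Fatou components $\Omega_1,\Omega_2$ are in the same grand orbit if $P^{n_1}(\Omega_1)=P^{n_2}(\Omega_2)$ for some $n_1,n_2\in\mathbb{N}$. Horn map of $q_0(w)=w+w^2$. For small $r>0$ let $\mathcal{P}^\iota=\{|w+r|<r\}$, $\mathcal{P}^o=\{|w-r|<r\}$, and let $\mathcal{B}_{q_0}=\bigcup_{n\ge0}q_0^{-n}(\mathcal{P}^\iota)$ be the parabolic basin. The Fatou coordinates $\phi^\iota_{q_0},\phi^o_{q_0}$ are the univalent maps on $\mathcal{P}^\iota$, $\mathcal{P}^o$ with $\phi_{q_0}^{\iota/o}\circ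 q_0=\phi_{q_0}^{\iota/o}+1$, normalized by $\phi^\iota_{q_0}(w)=-\frac1w+\log(-w)+o(1)$ and $\phi^o_{q_0}(w)=-\frac1w+\log(w)+o(1)$ as $w\to 0$. The map $\phi^\iota_{q_0}$ extends to $\mathcal{B}_{q_0}$ and the inverse of $\phi^o_{q_0}$ extends to an entire function $(\phi^o_{q_0})^{-1}$. The lifted horn map $\mathcal{E}:=\phi^\iota_{q_0}\circ(\phi^o_{q_0})^{-1}$ is defined on the open set of $W\in\mathbb{C}$ with $(\phi^o_{q_0})^{-1}(W)\in\mathcal{B}_{q_0}$ and commutes with $W\mapsto W+1$; the horn map $\hat h$ is the holomorphic map, defined on an open subset of $\mathbb{C}^*$, with $\hat h(e^{2i\pi W})=e^{2i\pi\mathcal{E}(W)}$, and it extends holomorphically to $0$ and $\infty$, fixing them. Here $\hat h^{\alpha_0}$ is the $\alpha_0$-th power (pointwise product), not an iterate. A hyperbolic component of period $m$ of $(h_\lambda)_{\lambda\in\mathbb{C}^*}$ is a connected component of the set of $\lambda\in\mathbb{C}^*$ such that $h_\lambda$ has an attracting cycle of period $m$ different from $0$ and $\infty$ (attracting: multiplier of modulus $<1$, possibly $0$). A hyperbolic component is a hyperbolic component of some period $m\ge1$. *)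

(* Defs.v *)
From HB Require Import structures.
From mathcomp Require Import all_boot all_order all_algebra.
From mathcomp Require Import all_classical all_reals all_analysis.
From mathcomp Require Import complex.

Set Implicit Arguments.
Unset Strict Implicit.
Unset Printing Implicit Defensive.

Import Order.TTheory GRing.Theory Num.Theory.
Import numFieldNormedType.Exports.

Local Open Scope classical_set_scope.
Local Open Scope ring_scope.
Local Open Scope complex_scope.

(* R[i] receives the norm topology of a numFieldType, as a normed space over
   itself, so that [derivable f x 1] and [derive1 f x] are complex differentiability
   and the complex derivative. *)
HB.instance Definition _ (R : realType) := NormedModule.copy R[i] R[i]^o.

Section ComplexAnalysis.
Variable R : realType.
Local Notation C := R[i].

Definition cexp (z : C) : C :=
  let: x +i* y := z in (expR x)%:C * (cos y +i* sin y).

(* Principal branch: imaginary part in ]-pi, pi] when z != 0. *)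
Definition clog (z : C) : C :=
  let: x +i* y := z in
  let rho := Num.sqrt (x ^+ 2 + y ^+ 2) in
  ln rho +i* ((if 0 <= y then 1 else -1) * acos (x / rho)).

Definition holomorphic_on (D : set C) (f : C -> C) : Prop :=
  open D /\ forall z, D z -> derivable f z 1.

Definition univalent_on (D : set C) (f : C -> C) : Prop :=
  holomorphic_on D f /\ {in D &, injective f}.

End ComplexAnalysis.

Section FatouComponents.
Variables (T : uniformType) (P : T -> T).

(* Normality of the iterates, for a non-compact target: every sequence of
   iterates has a subsequence that, uniformly on the compact subsets of U,
   either converges or diverges to infinity. *)
Definition normal_on (U : set T) : Prop :=
  forall n : nat -> nat, exists k : nat -> nat,
    {homo k : i j / (i < j)%N >-> (i < j)%N} /\
    let g := fun j => iter (n (k j)) P in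
    (exists l : T -> T, {family compactly_in U, g @ \oo --> l}) \/
    (forall K L : set T, compact K -> K `<=` U -> compact L ->
       \forall j \near \oo, (g j @` K) `&` L = set0).

Definition fatou_set : set T :=
  \bigcup_(U in [set U | open U /\ normal_on U]) U.

Definition fatou_component (Omega : set T) : Prop :=
  exists2 p, fatou_set p & Omega = connected_component fatou_set p.

Definition wandering (Omega : set T) : Prop :=
  forall k m : nat, (1 <= m)%N ->
    (iter (k + m) P @` Omega) `&` (iter k P @` Omega) = set0.

Definition same_grand_orbit (Omega1 Omega2 : set T) : Prop :=
  exists n1 n2 : nat, iter n1 P @` Omega1 = iter n2 P @` Omega2.

End FatouComponents.

Section HornMap.
Variable R : realType.
Local Notation C := R[i].

Definition q0 (w : C) : C := w + w ^+ 2.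

Definition petal_in (r : R) : set C := [set w | `|w + r%:C| < r%:C].
Definition petal_out (r : R) : set C := [set w | `|w - r%:C| < r%:C].

Definition parabolic_basin (r : R) : set C :=
  \bigcup_n (iter n q0 @^-1` petal_in r).

(* phi_in is the incoming coordinate already extended to the basin, and psi is
   the entire extension of the inverse of the outgoing coordinate phi_out. On
   the two petals -w, respectively w, has positive real part. Values of phi_in
   off the basin and of phi_out off its petal are never used. The functional
   equations force r <= 1/4 (phi_in takes the same value at w and -1 - w), and
   for each such r they determine phi_in on the basin, phi_out and psi. *)
Record fatou_coordinates (r : R) (phi_in phi_out psi : C -> C) : Prop := {
  phi_in_univalent : univalent_on (petal_in r) phi_in;
  phi_in_normalized :
    phi_in w - (- w^-1 + clog (- w)) @[w --> within (petal_in r) (nbhs 0)]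
      --> (0 : C);
  phi_in_holomorphic : holomorphic_on (parabolic_basin r) phi_in;
  phi_in_abel :
    forall w, parabolic_basin r w -> phi_in (q0 w) = phi_in w + 1;
  phi_out_univalent : univalent_on (petal_out r) phi_out;
  phi_out_normalized :
    phi_out w - (- w^-1 + clog w) @[w --> within (petal_out r) (nbhs 0)]
      --> (0 : C);
  phi_out_abel :
    forall w, petal_out r w -> petal_out r (q0 w) ->
      phi_out (q0 w) = phi_out w + 1;
  psi_entire : holomorphic_on setT psi;
  psi_inverse : forall w, petal_out r w -> psi (phi_out w) = w
}.

Definition lifted_horn_dom (r : R) (psi : C -> C) : set C :=
  psi @^-1` parabolic_basin r.

Definition lifted_horn (phi_in psi : C -> C) : C -> C := phi_in \o psi.

Definition exp2ipi (W : C) : C := cexp ((0 +i* (2 * pi)) * W).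

Definition horn_dom (r : R) (psi : C -> C) : set C :=
  exp2ipi @` lifted_horn_dom r psi.

(* The horn map away from 0 and infinity. horn_dom lies in C^*, and h maps it
   into C^*; the extension of h only adds the two fixed points 0 and infinity,
   which are exactly the cycles discarded in the hyperbolic components. *)
Definition horn_map (r : R) (phi_in psi h : C -> C) : Prop :=
  holomorphic_on (horn_dom r psi) h /\
  forall W, lifted_horn_dom r psi W ->
    h (exp2ipi W) = exp2ipi (lifted_horn phi_in psi W).

End HornMap.

Section HyperbolicComponents.
Variable R : realType.
Local Notation C := R[i].

Definition horn_family (h : C -> C) (alpha0 : nat) (lam x : C) : C :=
  lam * h x ^+ alpha0.

(* f is only meaningful on the open set D, so the orbit must stay in D; the
   multiplier of the cycle is the derivative of the m-th iterate. *)
Definition attracting_periodic (D : set C) (f : C -> C) (m : nat) (x : C)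
    : Prop :=
  [/\ forall j, D (iter j f x),
      iter m f x = x,
      forall j, (0 < j < m)%N -> iter j f x <> x &
      `|derive1 (iter m f) x| < 1].

Definition hyperbolic_locus (D : set C) (h : C -> C) (alpha0 m : nat)
    : set C :=
  [set lam | lam != 0 /\
     exists x, attracting_periodic D (horn_family h alpha0 lam) m x].

Definition hyperbolic_component (D : set C) (h : C -> C) (alpha0 : nat)
    (U : set C) : Prop :=
  exists2 m : nat, (1 <= m)%N &
    exists2 lam, hyperbolic_locus D h alpha0 m lam &
      U = connected_component (hyperbolic_locus D h alpha0 m) lam.

End HyperbolicComponents.

Definition skew_product (R : realType) (alpha0 : nat) (p : R[i] * R[i])
    : R[i] * R[i] :=
  let: (z, w) := p in
  (z - z ^+ 2,
   w + w ^+ 2 + (1 / 4 + pi ^+ 2 / ln (alpha0%:R : R) ^+ 2)%:C * z ^+ 2).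

(* Submission.v *)
(* With T = 1/z and u = w T, the second coordinate of P becomes
   u' = u + (u^2 + u + c) / (T - 1) with c = 1/4 + b^2 and b = pi / ln alpha0.
   This is close to the flow du / d(ln T) = (u + 1/2)^2 + b^2, of which
   theta(u) - ln T is a first integral, theta(u) = atan((u + 1/2) / b) / b, so
   that a passage of u from -oo to +oo multiplies T by exp(pi / b) = alpha0. With
   the next term of the expansion, the phase on exit of the passage is, up to
   o(1), the affine function alpha0 X + (1 - alpha0) Z + const of the phase X of
   w on entry and of the phase Z of z.

   Let y0 = (-1 + i)/2, a preimage of the critical point -1/2 of q0, so that
   q0^2 (y0 + x) depends on x only to second order. For every large i, y0 has a
   backward orbit that stays close to 0 for about i steps, comes from near -1 and
   from there from the repelling petal. Hence a point of the fibre near y0 + x at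
   time N is at time alpha0 N + i + 4 near some y0 + x', where after rescaling
   x' = x^2 + D, with D an affine function of Z and an arbitrarily small error.
   Near D = 0, at Z = Z_i, this traps the orbit: the orbits are bounded on an
   open set, which lies in a Fatou component. On that component |D| < 10: for
   |D| >= 10 two bounded orbits in the same fibre would be expanded by each
   return, against equicontinuity. Therefore Z stays in a disc of radius
   O(i^-4) around Z_i, while the gaps between the Z_i are at least of order
   i^-2 and the Z_i are close to each other. Since P shifts time, hence Z, by an
   integer, the components are wandering and their grand orbits are distinct.

   Attracting cycles persist under perturbation, so there are only countably many
   hyperbolic components, and they can be numbered injectively. *)

(* The error of a return has to be small against the size [rho i] of the trap, which is of order
   i^-2, and it becomes so only when the starting time n is large. Hence i is fixed first and n
   afterwards. This is harmless because the phase Z is constant along an orbit, so that one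
   quadratic map governs all the returns. A passage has two parameters. The transit between the
   times n + J and al n - J carries an error of order 1/J that does not improve with n; so J is
   chosen before n, and the J steps at either end are treated as finitely many perturbed steps of
   [q0]. Complex orbits are not estimated directly. They are compared with a real one, on which [G]
   is positive and u increases: the errors of the steps are of the size of tau^2 times the increment
   of u, and telescope. A phase is defined without logarithms, as the limit of the difference
   between an orbit and a fixed real orbit ([F] or [SS]) of the same recursion. Such a difference is
   an infinite product, which yields at once the existence of the phase, its differentiability and a
   derivative that is not zero. *)
From HB Require Import structures.
From mathcomp Require Import all_boot all_order all_algebra.
From mathcomp Require Import all_classical all_reals all_analysis.
From mathcomp Require Import complex ring lra.
From mathcomp Require Import zify.
Require Import Defs.
Set Implicit Arguments.
Unset Strict Implicit.
Unset Printing Implicit Defensive.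
Import Order.TTheory GRing.Theory Num.Theory.
Import numFieldNormedType.Exports.
Local Open Scope classical_set_scope.
Local Open Scope ring_scope.
Local Open Scope complex_scope.

(* Each order hypothesis in the context makes lra noticeably slower. Section
   hypotheses must be spared: lra fails in a context where one was cleared. *)
Ltac keep_hyp H := idtac.
Ltac drop := repeat match goal with H : is_true _ |- _ => keep_hyp H; clear H end.

(** * Complex derivatives as first order expansions *)

Section Modulus.
Variable R : realType.
Local Notation C := R[i].
(** The norm of [R[i]] is itself [R[i]]-valued; a real-valued modulus is what [lra] and [nra] can
    handle. *)
Definition md (z : C) : R := ComplexField.Normc.normc z.
#[global] Arguments md : simpl never.
Lemma mdE (z : C) : `|z| = (md z)%:C.
Proof. by rewrite normc_def; case: z. Qed.
Lemma md_ge0 z : 0 <= md z.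
Proof. by case: z => a b; rewrite /md /= sqrtr_ge0. Qed.
Lemma mdM z w : md (z * w) = md z * md w.
Proof. exact: ComplexField.Normc.normcM. Qed.
Lemma mdD z w : md (z + w) <= md z + md w.
Proof. by rewrite -lecR rmorphD /= -!mdE ler_normD. Qed.
Lemma mdN z : md (- z) = md z.
Proof. by apply: complexI; rewrite -!mdE normrN. Qed.
Lemma md_distC z w : md (z - w) = md (w - z).
Proof. by rewrite -mdN opprB. Qed.
Lemma mdB z w : md (z - w) <= md z + md w.
Proof. by rewrite -(mdN w) mdD. Qed.
Lemma md0 : md 0 = 0.
Proof. by apply: complexI; rewrite -mdE normr0. Qed.
Lemma md1 : md 1 = 1.
Proof. by apply: complexI; rewrite -mdE normr1. Qed.
Lemma md_eq0 z : (md z == 0) = (z == 0).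
Proof. by rewrite -(normr_eq0 z) mdE; apply/eqP/eqP => [->//|]; apply: complexI. Qed.
Lemma md_gt0 z : (0 < md z) = (z != 0).
Proof. by rewrite lt_neqAle md_ge0 andbT eq_sym md_eq0. Qed.
Lemma mdV z : md z^-1 = (md z)^-1.
Proof. by apply: complexI; rewrite -mdE normfV mdE fmorphV. Qed.
Lemma mdf z w : md (z / w) = md z / md w.
Proof. by rewrite mdM mdV. Qed.
Lemma mdX z n : md (z ^+ n) = md z ^+ n.
Proof. by elim: n => [|n IH]; rewrite ?md1 // !exprS mdM IH. Qed.
Lemma md_real (x : R) : md x%:C = `|x|.
Proof. by rewrite /md /= expr0n addr0 sqrtr_sqr. Qed.
Lemma mdn n : md n%:R = n%:R.
Proof. by apply: complexI; rewrite -mdE normr_nat rmorph_nat. Qed.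
Lemma md_i : md 'i%C = 1.
Proof. by rewrite /md /= expr0n add0r expr1n sqrtr1. Qed.
Lemma md_sq (z : C) : md z ^+ 2 = complex.Re z ^+ 2 + complex.Im z ^+ 2.
Proof. by case: z => a b; rewrite /md /= sqr_sqrtr ?addr_ge0 ?sqr_ge0. Qed.
Lemma Re_md (z : C) : `|complex.Re z| <= md z.
Proof.
rewrite -(ler_pXn2r (_ : (0 < 2)%N)) ?nnegrE ?md_ge0 // md_sq real_normK ?num_real //.
by rewrite lerDl sqr_ge0.
Qed.
Lemma Im_md (z : C) : `|complex.Im z| <= md z.
Proof.
rewrite -(ler_pXn2r (_ : (0 < 2)%N)) ?nnegrE ?md_ge0 // md_sq real_normK ?num_real //.
by rewrite lerDr sqr_ge0.
Qed.
Lemma md_ReIm (z : C) : md z <= `|complex.Re z| + `|complex.Im z|.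
Proof.
rewrite -(ler_pXn2r (_ : (0 < 2)%N)) ?nnegrE ?md_ge0 ?addr_ge0 // md_sq sqrrD.
rewrite !real_normK ?num_real // addrAC lerDl mulrn_wge0 //.
Qed.
Lemma ReD (z w : C) : complex.Re (z + w) = complex.Re z + complex.Re w.
Proof. by case: z; case: w. Qed.
Lemma ImD (z w : C) : complex.Im (z + w) = complex.Im z + complex.Im w.
Proof. by case: z; case: w. Qed.
Lemma ReN (z : C) : complex.Re (- z) = - complex.Re z.
Proof. by case: z. Qed.
Lemma ImN (z : C) : complex.Im (- z) = - complex.Im z.
Proof. by case: z. Qed.
Lemma ReM (z w : C) : complex.Re (z * w) =
  complex.Re z * complex.Re w - complex.Im z * complex.Im w.
Proof. by case: z; case: w. Qed.
Lemma ImM (z w : C) : complex.Im (z * w) =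
  complex.Re z * complex.Im w + complex.Im z * complex.Re w.
Proof. by case: z; case: w => a b c d /=; rewrite addrC. Qed.
Lemma md_lb (z w : C) : md z - md w <= md (z + w).
Proof. by rewrite lerBlDr -{1}(addrK w z) mdB. Qed.
Lemma md_lbB (z w : C) : md z - md w <= md (z - w).
Proof. by rewrite -(mdN w) md_lb. Qed.
Lemma md_tri (y z w : C) : md (z - w) <= md (z - y) + md (y - w).
Proof. by apply: le_trans (mdD _ _); rewrite addrA subrK. Qed.

Lemma ltc_real (e : C) : 0 < e -> exists2 r : R, 0 < r & e = r%:C.
Proof. by case: e => a b; rewrite ltcE /= => /andP[/eqP -> a0]; exists a. Qed.

(** The increment h = 0 is allowed and the inequality is not strict, so that the calculus below
    needs no punctured neighbourhoods; [cderivP] and [cderiv_derivable] translate from and to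
    [derivable]. *)
Definition cderiv (f : C -> C) (z l : C) := forall e : R, 0 < e ->
  exists2 d : R, 0 < d & forall h, md h < d -> md (f (z + h) - f z - l * h) <= e * md h.

Lemma nbhs_mdP (z : C) (A : set C) :
  nbhs z A <-> exists2 d : R, 0 < d & forall w, md (w - z) < d -> A w.
Proof.
split.
  move=> /nbhs_ballP[e /= /ltc_real[r r0 ->] H]; exists r => // w hw.
  by apply: H; rewrite -ball_normE /= distrC mdE ltcR.
move=> [d d0 H]; apply/nbhs_ballP; exists d%:C => /=; first by rewrite ltcR.
by move=> w; rewrite -ball_normE /= distrC mdE ltcR => /H.
Qed.

Lemma open_mdP (A : set C) : open A <->
  forall z, A z -> exists2 d : R, 0 < d & forall w, md (w - z) < d -> A w.
Proof.
rewrite openE; split=> [H z /H|H z /H]; first by move/nbhs_mdP.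
by move=> h; apply/nbhs_mdP.
Qed.

Lemma cvg_mdP (T : Type) (F : set_system T) (FF : Filter F) (f : T -> C) (l : C) :
  f @ F --> l <-> forall e : R, 0 < e -> \forall x \near F, md (f x - l) < e.
Proof.
split=> H.
  move=> e e0; have /H : nbhs l [set w | md (w - l) < e].
    by apply/nbhs_mdP; exists e.
  by [].
move=> A /nbhs_mdP[d d0 Ad]; have := H d d0; rewrite !near_simpl /=.
by apply: filterS => x /Ad.
Qed.

Lemma cderivP (f : C -> C) (z : C) : derivable f z 1 -> cderiv f z (derive1 f z).
Proof.
rewrite /derivable derive1E /derive; set l := lim _ => H e e0.
have {}H : (fun h : C => h^-1 *: (f (h *: 1 + z) - f z)) h @[h --> 0^'] --> l by exact: H.
move/cvg_mdP: H => /(_ _ e0); rewrite near_withinE => /nbhs_mdP[d d0 Hd].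
exists d => // h hd; have [->|h0] := eqVneq h 0.
  by rewrite addr0 subrr mulr0 subr0 md0 mulr0.
have := Hd h; rewrite subr0 => /(_ hd h0) hh.
have -> : f (z + h) - f z - l * h = (h^-1 *: (f (h *: 1 + z) - f z) - l) * h.
  rewrite /GRing.scale /= mulr1 mulrBl mulrAC mulVf // mul1r.
  by rewrite (addrC h).
by rewrite mdM ler_wpM2r ?md_ge0 // ltW.
Qed.

Lemma cderiv_derivable (f : C -> C) (z l : C) :
  cderiv f z l -> derivable f z 1 /\ derive1 f z = l.
Proof.
move=> H; have H' : (fun h : C => h^-1 *: (f (h *: 1 + z) - f z)) h @[h --> 0^'] --> l.
  apply/cvg_mdP => e e0; rewrite near_withinE; apply/nbhs_mdP.
  have e20 : 0 < e / 2 by rewrite divr_gt0.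
  have [d d0 Hd] := H _ e20; exists d => // h; rewrite subr0 => hd /= h0.
  have -> : h^-1 *: (f (h *: 1 + z) - f z) - l = (f (z + h) - f z - l * h) / h.
    rewrite /GRing.scale /= mulr1 (addrC h); field; exact: h0.
  rewrite mdf ltr_pdivrMr ?md_gt0 //; apply: le_lt_trans (Hd _ hd) _.
  rewrite ltr_pM2r ?md_gt0 // ltr_pdivrMr // mulr_natr mulr2n ltrDl //.
split; first by apply/cvg_ex; exists l.
by rewrite derive1E /derive; apply: cvg_lim.
Qed.

Lemma cderiv_cont f z l : cderiv f z l -> forall e : R, 0 < e ->
  exists2 d : R, 0 < d & forall w, md (w - z) < d -> md (f w - f z) < e.
Proof.
move=> H e e0; have [d d0 Hd] := H 1 ltr01.
have K0 : 0 < 1 + md l by rewrite ltr_wpDr ?md_ge0.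
exists (Num.min d (e / (1 + md l))); first by rewrite lt_min d0 divr_gt0.
move=> w; rewrite lt_min => /andP[wd we].
have := Hd _ wd; rewrite subrKC mul1r => h.
have -> : f w - f z = (f w - f z - l * (w - z)) + l * (w - z) by ring.
apply: le_lt_trans (mdD _ _) _; rewrite mdM; rewrite ltr_pdivlMr // in we.
nra.
Qed.

Lemma cderiv_cst (a z : C) : cderiv (fun=> a) z 0.
Proof. by move=> e e0; exists 1 => // h _; rewrite mul0r subr0 subrr md0 mulr_ge0 ?md_ge0 // ltW. Qed.
Lemma cderiv_id (z : C) : cderiv id z 1.
Proof. by move=> e e0; exists 1 => // h _; rewrite (_ : _ - _ - _ = 0) ?md0 ?mulr_ge0 ?md_ge0 ?ltW //=; ring. Qed.
Lemma cderivD f g z l m : cderiv f z l -> cderiv g z m ->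
  cderiv (fun w => f w + g w) z (l + m).
Proof.
move=> Hf Hg e e0; have e20 : 0 < e / 2 by rewrite divr_gt0.
have [d d0 Hd] := Hf _ e20; have [d' d'0 Hd'] := Hg _ e20.
exists (Num.min d d'); first by rewrite lt_min d0.
move=> h; rewrite lt_min => /andP[/Hd h1 /Hd' h2].
have -> : f (z + h) + g (z + h) - (f z + g z) - (l + m) * h =
  (f (z + h) - f z - l * h) + (g (z + h) - g z - m * h) by ring.
apply: le_trans (mdD _ _) _; lra.
Qed.
Lemma cderivM f g z l m : cderiv f z l -> cderiv g z m ->
  cderiv (fun w => f w * g w) z (l * g z + f z * m).
Proof.
move=> Hf Hg e e0.
pose K := 1 + md l + md (f z) + md (g z) + md m.
have fz0 := md_ge0 (f z); have gz0 := md_ge0 (g z).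
have l0 := md_ge0 l; have m0 := md_ge0 m.
have K1 : 1 <= K by rewrite /K; lra.
have K0 : 0 < K by lra.
pose e1 := Num.min 1 (e / (4 * K)).
have e10 : 0 < e1 by rewrite lt_min ltr01 divr_gt0 // mulr_gt0.
have [d d0 Hd] := Hf _ e10; have [d' d'0 Hd'] := Hg _ e10.
have [d2 d20 Hd2] := cderiv_cont Hg e10.
exists (Num.min (Num.min d d2) d'); first by rewrite !lt_min d0 d20.
move=> h; rewrite !lt_min => /andP[/andP[hd hd2] hd'].
have h1 := Hd _ hd; have h2 := Hd' _ hd'.
have h3 : md (g (z + h) - g z) < e1 by apply: Hd2; rewrite addrC addKr.
have -> : f (z + h) * g (z + h) - f z * g z - (l * g z + f z * m) * h =
  (f (z + h) - f z - l * h) * (g z + (g (z + h) - g z)) + l * h * (g (z + h) - g z) +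
   f z * (g (z + h) - g z - m * h) by ring.
apply: le_trans (mdD _ _) _; rewrite mdM; apply: (@le_trans _ _ (e1 * md h * (md (g z) + 1) + md l * md h * e1 + md (f z) * (e1 * md h))).
  apply: lerD; last by rewrite ler_wpM2l.
  apply: le_trans (mdD _ _) _; rewrite !mdM; apply: lerD.
    apply: ler_pM; rewrite ?md_ge0 //; apply: le_trans (mdD _ _) _.
    rewrite lerD2l; apply: (le_trans (ltW h3)); rewrite ge_min lexx //.
  by rewrite ler_wpM2l ?mulr_ge0 ?md_ge0 // ltW.
have -> : e1 * md h * (md (g z) + 1) + md l * md h * e1 + md (f z) * (e1 * md h) =
  (e1 * (md (g z) + 1 + md l + md (f z))) * md h by ring.
rewrite ler_wpM2r ?md_ge0 //; apply: (@le_trans _ _ (e1 * K)).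
  by rewrite ler_wpM2l ?(ltW e10) // /K; lra.
have : e1 <= e / (4 * K) by rewrite ge_min lexx orbT.
rewrite ler_pdivlMr ?mulr_gt0 //; nra.
Qed.
Lemma cderiv_comp f g z l m : cderiv f z l -> cderiv g (f z) m ->
  cderiv (fun w => g (f w)) z (m * l).
Proof.
move=> Hf Hg e e0.
have l0 := md_ge0 l; have m0 := md_ge0 m.
pose e1 := Num.min 1 (e / (2 * (1 + md l + md m))).
have K0 : 0 < 1 + md l + md m by lra.
have e10 : 0 < e1 by rewrite lt_min ltr01 divr_gt0 // mulr_gt0.
have e1e : e1 * (2 * (1 + md l + md m)) <= e.
  have : e1 <= e / (2 * (1 + md l + md m)) by rewrite ge_min lexx orbT.
  by rewrite ler_pdivlMr ?mulr_gt0.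
have e11 : e1 <= 1 by rewrite ge_min lexx.
have [d d0 Hd] := Hf _ e10; have [d' d'0 Hd'] := Hg _ e10.
have [d2 d20 Hd2] := cderiv_cont Hf d'0.
exists (Num.min d d2); first by rewrite lt_min d0.
move=> h; rewrite lt_min => /andP[hd hd2].
have h1 := Hd _ hd.
have h3 : md (f (z + h) - f z) < d' by apply: Hd2; rewrite addrC addKr.
have h4 := Hd' _ h3; rewrite subrKC in h4.
have -> : g (f (z + h)) - g (f z) - m * l * h =
  (g (f (z + h)) - g (f z) - m * (f (z + h) - f z)) + m * (f (z + h) - f z - l * h) by ring.
apply: le_trans (mdD _ _) _; rewrite mdM.
have h5 : md (f (z + h) - f z) <= (1 + md l) * md h.
  have -> : f (z + h) - f z = (f (z + h) - f z - l * h) + l * h by ring.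
  apply: le_trans (mdD _ _) _; rewrite mdM; have := md_ge0 h; nra.
have := md_ge0 h; have := md_ge0 (f (z + h) - f z - l * h); nra.
Qed.
End Modulus.

(** * Mean value inequalities and primitives on the real line *)

Section RealCalc.
Variable R : realType.
Definition rderiv (f : R -> R) (x l : R) := forall e : R, 0 < e ->
  exists2 d : R, 0 < d & forall h, `|h| < d -> `|f (x + h) - f x - l * h| <= e * `|h|.

Lemma rderivP (f : R -> R) x l : rderiv f x l -> is_derive x 1 f l.
Proof.
move=> H; have H' : (fun h : R => h^-1 *: (f (h *: 1 + x) - f x)) h @[h --> 0^'] --> l.
  apply/cvgrPdist_lt => e e0; rewrite near_withinE; apply/nbhs_ballP.
  have e20 : 0 < e / 2 by rewrite divr_gt0.
  have [d d0 Hd] := H _ e20; exists d => //= h; rewrite /ball /= sub0r normrN => hd /= h0.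
  rewrite distrC (_ : _ - l = (f (x + h) - f x - l * h) / h); last first.
    by rewrite /GRing.scale /= mulr1 (addrC h); field; exact: h0.
  rewrite normrM normfV ltr_pdivrMr ?normr_gt0 //; apply: le_lt_trans (Hd _ hd) _.
  rewrite ltr_pM2r ?normr_gt0 // ltr_pdivrMr // mulr_natr mulr2n ltrDl //.
apply: DeriveDef; first by apply/cvg_ex; exists l.
by rewrite /derive; apply: cvg_lim.
Qed.

Lemma mvt (f df : R -> R) (a b : R) : a <= b ->
  (forall x, a <= x <= b -> is_derive x 1 f (df x)) ->
  exists2 c, a <= c <= b & f b - f a = df c * (b - a).
Proof.
move=> ab H; have [c||c cab E] := @MVT_segment R f df a b ab.
- by rewrite in_itv /= => /andP[/ltW h1 /ltW h2]; apply: H; rewrite h1 h2.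
- apply: derivable_within_continuous => x; rewrite in_itv /= => /H h.
  exact: ex_derive.
by exists c.
Qed.

Lemma mvt_le (f df : R -> R) (a b M : R) : a <= b ->
  (forall x, a <= x <= b -> is_derive x 1 f (df x)) ->
  (forall x, a <= x <= b -> `|df x| <= M) -> `|f b - f a| <= M * (b - a).
Proof.
move=> ab H HM; have [c cab ->] := mvt ab H.
by rewrite normrM (ger0_norm (_ : 0 <= b - a)) ?subr_ge0 // ler_wpM2r ?subr_ge0 // HM.
Qed.

Lemma deriv0_cst (f : R -> R) (a b : R) : a <= b ->
  (forall x, a <= x <= b -> is_derive x 1 f 0) -> f b = f a.
Proof.
move=> ab H; have [c _ /eqP] := mvt (df := fun=> 0) ab H.
by rewrite mul0r subr_eq0 => /eqP.
Qed.

Lemma prim_right (g : R -> R) (a : R) : continuous g ->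
  exists F : R -> R, forall x : R, a < x -> is_derive x 1 F (g x).
Proof.
move=> cg; exists (fun x => (\int[lebesgue_measure]_(t in [set` `[a, x]]) (g t))%R) => x ax.
have xu : x < x + 1 by rewrite ltrDl.
have ig : lebesgue_measure.-integrable `[a, (x + 1)] (EFin \o g).
  apply: continuous_compact_integrable; first exact: segment_compact.
  by apply: continuous_subspaceT => ?; exact: cg.
have [d <-] := continuous_FTC1_closed xu ig ax (cg x).
apply: DeriveDef; first exact: d.
by rewrite derive1E.
Qed.

(** Integration from -N gives a primitive only to the right of -N. Normalized to vanish at 0, these
    primitives agree where they overlap; near x the one of index [nn x] is used, which is valid from
    x - 1 on. *)
Lemma prim (g : R -> R) : continuous g ->
  {I : R -> R | forall x : R, is_derive x 1 I (g x)}.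
Proof.
move=> cg; apply: cid.
have /choice[F HF] : forall N : nat, exists F : R -> R, forall x : R, - N%:R < x -> is_derive x 1 F (g x).
  by move=> N; exact: prim_right.
pose G N x := F N x - F N 0.
have HG N (x : R) : - N%:R < x -> is_derive x 1 (G N) (g x).
  move=> h; rewrite -[g x]subr0; have h' := HF _ _ h.
  exact: is_deriveB.
have GE N M (x : R) : (0 < N)%N -> (0 < M)%N -> - N%:R < x -> - M%:R < x -> G N x = G M x.
  move=> N0 M0 Nx Mx; pose D y := G N y - G M y.
  have HD (y : R) : - N%:R < y -> - M%:R < y -> is_derive y 1 D 0.
    by move=> h1 h2; rewrite -(subrr (g y)); apply: is_deriveB; apply: HG.
  have D0 : D 0 = 0 by rewrite /D /G !subrr.
  have N0' : - (N%:R : R) < 0 by rewrite oppr_lt0 ltr0n.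
  have M0' : - (M%:R : R) < 0 by rewrite oppr_lt0 ltr0n.
  suff : D x = 0 by move/eqP; rewrite subr_eq0 => /eqP.
  have [x0|x0] := leP 0 x.
    by rewrite -D0; apply: deriv0_cst => // y /andP[y1 y2]; apply: HD; apply: lt_le_trans y1.
  by rewrite -D0; symmetry; apply: deriv0_cst; [exact: ltW|] => y /andP[y1 y2]; apply: HD; apply: lt_le_trans y1.
pose nn (x : R) := (Num.bound `|x|).+1.
have nnP (x : R) : - (nn x)%:R < x - 1.
  rewrite /nn -natr1 opprD ltrD2r ltrNl.
  by apply: le_lt_trans (archi_boundP (normr_ge0 x)) ; rewrite -normrN ler_norm.
exists (fun x => G (nn x) x) => x.
have H := HG (nn x) x _; apply: near_eq_is_derive (H _) => //.
  have : \forall y \near x, x - 1 < y.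
    by apply: lt_nbhsr; rewrite ltrBlDr ltrDl.
  apply: filterS => y xy; apply: GE => //.
    exact: lt_trans (nnP x) _.
  by apply: lt_trans (nnP y) _; rewrite ltrBlDr ltrDl.
by apply: lt_trans (nnP x) _; rewrite ltrBlDr ltrDl.
Qed.
End RealCalc.

(** * Mean value inequality for complex functions *)

Section ComplexMVT.
Variable R : realType.
Local Notation C := R[i].
Lemma md_conj (z : C) : md z^*%C = md z.
Proof. by case: z => a b; rewrite /md /= sqrrN. Qed.

Lemma mul_conj (z : C) : z^*%C * z = (md z ^+ 2)%:C.
Proof.
rewrite md_sq; case: z => a b; apply/eqP; rewrite eq_complex /=.
by rewrite !mulNr opprK !expr2 eqxx /= (mulrC b) subrr.
Qed.

(** The real mean value theorem is applied along the segment to the real part of conj(v) f, with v =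
    f b - f a: its total increment is |v|^2, and one factor |v| cancels. *)
Lemma cderiv_lip (f f' : C -> C) (a b : C) (M : R) :
  (forall t : R, 0 <= t <= 1 -> cderiv f (a + t%:C * (b - a)) (f' (a + t%:C * (b - a)))) ->
  (forall t : R, 0 <= t <= 1 -> md (f' (a + t%:C * (b - a))) <= M) ->
  md (f b - f a) <= M * md (b - a).
Proof.
move=> Hf HM; set v : C := f b - f a.
pose p (t : R) : R := complex.Re (v^*%C * f (a + t%:C * (b - a))).
pose dp (t : R) : R := complex.Re (v^*%C * (f' (a + t%:C * (b - a)) * (b - a))).
have Hp (t : R) : 0 <= t <= 1 -> is_derive t 1 p (dp t).
  move=> t01; apply: rderivP => e e0.
  have e0' : 0 < e / (1 + md v * md (b - a)).
    by rewrite divr_gt0 // ltr_wpDr // mulr_ge0 ?md_ge0.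
  have [d d0 Hd] := Hf t t01 _ e0'.
  exists (d / (1 + md (b - a))) => [|h].
    by rewrite divr_gt0 // ltr_wpDr // md_ge0.
  have ba0 := md_ge0 (b - a); have v0 := md_ge0 v.
  rewrite ltr_pdivlMr ?ltr_wpDr // => hd.
  have hd' : md (h%:C * (b - a)) < d.
    by rewrite mdM md_real; apply: le_lt_trans hd; rewrite ler_wpM2l // lerDr.
  have := Hd _ hd'.
  have -> : a + t%:C * (b - a) + h%:C * (b - a) = a + (t + h)%:C * (b - a).
    by rewrite rmorphD /= mulrDl addrA.
  rewrite mdM md_real => H.
  rewrite (_ : p (t + h) - p t - dp t * h = complex.Re (v^*%C * (f (a + (t + h)%:C * (b - a)) -
     f (a + t%:C * (b - a)) - f' (a + t%:C * (b - a)) * (h%:C * (b - a))))); last first.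
    rewrite /p /dp.
    move: (f (a + (t + h)%:C * (b - a))) (f (a + t%:C * (b - a))) (f' (a + t%:C * (b - a))) => u1 u2 u3.
    by move: u1 u2 u3 (v^*%C) (b - a)
      => [? ?] [? ?] [? ?] [? ?] [? ?] /=; ring.
  apply: le_trans (Re_md _) _; rewrite mdM md_conj.
  apply: le_trans (ler_wpM2l v0 H) _.
  have -> : md v * (e / (1 + md v * md (b - a)) * (`|h| * md (b - a))) =
    (e * `|h|) * (md v * md (b - a) / (1 + md v * md (b - a))) by ring.
  rewrite ler_piMr ?mulr_ge0 ?(ltW e0) // ler_pdivrMr ?ltr_wpDr ?mulr_ge0 //.
  by rewrite mul1r lerDr.
have Hdp (t : R) : 0 <= t <= 1 -> `|dp t| <= md v * M * md (b - a).
  move=> t01; apply: le_trans (Re_md _) _; rewrite !mdM md_conj -mulrA.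
  by rewrite ler_wpM2l ?md_ge0 // ler_wpM2r ?md_ge0 // HM.
have := mvt_le ler01 Hp Hdp; rewrite subr0 mulr1.
have -> : p 1 - p 0 = md v ^+ 2.
  rewrite /p mul1r mul0r addr0 subrKC -ReN -ReD -mulrN -mulrDr -/v mul_conj //.
rewrite ger0_norm ?sqr_ge0 // expr2 -mulrA => H.
have [->|v0] := eqVneq v 0.
  rewrite md0 mulr_ge0 ?md_ge0 //.
  by apply: le_trans (HM 0 _); rewrite ?md_ge0 // lexx ler01.
by rewrite ler_pM2l ?md_gt0 // in H.
Qed.

Lemma cball_cvx (z a b : C) (r t : R) : md (a - z) < r -> md (b - z) < r ->
  0 <= t <= 1 -> md (a + t%:C * (b - a) - z) < r.
Proof.
move=> ha hb /andP[t0 t1].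
have -> : a + t%:C * (b - a) - z = (1 - t)%:C * (a - z) + t%:C * (b - z).
  by rewrite rmorphB rmorph1; ring.
apply: le_lt_trans (mdD _ _) _; rewrite !mdM !md_real !ger0_norm ?subr_ge0 //.
have := md_ge0 (a - z); have := md_ge0 (b - z).
have [->|t0'] := eqVneq t 0; first by rewrite subr0 mul1r mul0r addr0.
have : 0 < t by rewrite lt_neqAle eq_sym t0'.
nra.
Qed.

Lemma cderiv_lip_ball (f f' : C -> C) (z : C) (r M : R) :
  (forall w, md (w - z) < r -> cderiv f w (f' w)) ->
  (forall w, md (w - z) < r -> md (f' w) <= M) ->
  forall a b, md (a - z) < r -> md (b - z) < r -> md (f b - f a) <= M * md (b - a).
Proof.
move=> Hf HM a b ha hb; apply: (cderiv_lip (f' := f')) => t t01.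
- by apply: Hf; apply: cball_cvx.
- by apply: HM; apply: cball_cvx.
Qed.
End ComplexMVT.

(** * Cauchy's formula for the derivative *)

Section Integral.
Variable R : realType.
Local Notation C := R[i].

(** With the integral defined through a chosen primitive, additivity and bounds come directly from
    the mean value theorem. The value 0 is a default, for functions without a primitive on the whole
    line. *)
Definition rint (g : R -> R) (a b : R) : R :=
  if pselect (exists I : R -> R, forall x : R, is_derive x 1 I (g x)) is left h
  then projT1 (cid h) b - projT1 (cid h) a else 0.

Lemma rintE (g I : R -> R) (a b : R) : (forall x : R, is_derive x 1 I (g x)) ->
  rint g a b = I b - I a.
Proof.
move=> HI; rewrite /rint; case: pselect => [h|[]]; last by exists I.
case: (cid h) => J HJ /=.
have H (x : R) : is_derive x 1 (J - I) 0.
  by rewrite -(subrr (g x)); have := HJ x; have := HI x => *; exact: is_deriveB.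
have E (x y : R) : x <= y -> J y - I y = J x - I x.
  by move=> xy; apply: (deriv0_cst (f := J - I)) => // t _.
by case: (leP a b) => [/E|/ltW/E] h'; lra.
Qed.

Definition ccont (g : R -> C) := forall (x e : R), 0 < e ->
  exists2 d : R, 0 < d & forall y, `|y - x| < d -> md (g y - g x) < e.

Lemma ccontRe g : ccont g -> continuous (fun x => complex.Re (g x)).
Proof.
move=> cg x; apply/cvgrPdist_lt => e e0; apply/nbhs_ballP.
have [d d0 H] := cg x e e0; exists d => //= y; rewrite /ball /= distrC => /H h.
by apply: le_lt_trans h; rewrite distrC -ReN -ReD Re_md.
Qed.
Lemma ccontIm g : ccont g -> continuous (fun x => complex.Im (g x)).
Proof.
move=> cg x; apply/cvgrPdist_lt => e e0; apply/nbhs_ballP.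
have [d d0 H] := cg x e e0; exists d => //= y; rewrite /ball /= distrC => /H h.
by apply: le_lt_trans h; rewrite distrC -ImN -ImD Im_md.
Qed.
Lemma ccontD f g : ccont f -> ccont g -> ccont (fun x => f x + g x).
Proof.
move=> cf cg x e e0; have e2 : 0 < e / 2 by rewrite divr_gt0.
have [d d0 H] := cf x _ e2; have [d' d'0 H'] := cg x _ e2.
exists (Num.min d d'); first by rewrite lt_min d0.
move=> y; rewrite lt_min => /andP[/H h1 /H' h2].
rewrite (_ : _ - _ = (f y - f x) + (g y - g x)); last by ring.
by apply: le_lt_trans (mdD _ _) _; lra.
Qed.
Lemma ccontM (k : C) f : ccont f -> ccont (fun x => k * f x).
Proof.
move=> cf x e e0; have k0 := md_ge0 k.
have e2 : 0 < e / (1 + md k) by rewrite divr_gt0 // ltr_wpDr.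
have [d d0 H] := cf x _ e2; exists d => // y /H.
rewrite ltr_pdivlMr ?ltr_wpDr // -mulrBr mdM => h; have := md_ge0 (f y - f x); nra.
Qed.
Lemma ccont_cst (k : C) : ccont (fun=> k).
Proof. by move=> x e e0; exists 1 => // y _; rewrite subrr md0. Qed.
Lemma ccontN f : ccont f -> ccont (fun x => - f x).
Proof. by move=> /(ccontM (-1)) H; rewrite (_ : (fun _ => _) = (fun x => -1 * f x)) //; apply/funext => x; rewrite mulN1r. Qed.
Lemma ccontB f g : ccont f -> ccont g -> ccont (fun x => f x - g x).
Proof. by move=> cf cg; apply: ccontD cf (ccontN cg). Qed.

Definition cint (g : R -> C) (a b : R) : C :=
  rint (fun x => complex.Re (g x)) a b +i* rint (fun x => complex.Im (g x)) a b.

Lemma cintP g : ccont g -> exists Ir Ii : R -> R,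
  [/\ forall x : R, is_derive x 1 Ir (complex.Re (g x)),
      forall x : R, is_derive x 1 Ii (complex.Im (g x)) &
      forall a b, cint g a b = (Ir b - Ir a) +i* (Ii b - Ii a)].
Proof.
move=> cg; have [Ir HIr] := prim (ccontRe cg); have [Ii HIi] := prim (ccontIm cg).
by exists Ir, Ii; split=> // a b; rewrite /cint (rintE _ _ HIr) (rintE _ _ HIi).
Qed.

Lemma cint_cat g a b c : ccont g -> cint g a b + cint g b c = cint g a c.
Proof.
move=> /cintP[Ir [Ii [_ _ E]]]; rewrite !E; apply/eqP; rewrite eq_complex /=.
by apply/andP; split; apply/eqP; ring.
Qed.

Lemma cintD f g a b : ccont f -> ccont g ->
  cint (fun x => f x + g x) a b = cint f a b + cint g a b.
Proof.
move=> /cintP[Ir [Ii [H1 H2 E]]] /cintP[Jr [Ji [H3 H4 F]]]; rewrite E F /cint.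
have e1 : rint (fun x => complex.Re (f x + g x)) a b = (Ir + Jr) b - (Ir + Jr) a.
  by apply: rintE => x; rewrite ReD; have := H1 x; have := H3 x => *; exact: is_deriveD.
have e2 : rint (fun x => complex.Im (f x + g x)) a b = (Ii + Ji) b - (Ii + Ji) a.
  by apply: rintE => x; rewrite ImD; have := H2 x; have := H4 x => *; exact: is_deriveD.
by rewrite e1 e2; apply/eqP; rewrite eq_complex /= !fctE; apply/andP; split; apply/eqP; ring.
Qed.

Lemma cint_cst (k : C) a b : cint (fun=> k) a b = k * (b - a)%:C.
Proof.
have e1 (l : R) : rint (fun x => l) a b = l * b - l * a.
  apply: (rintE (I := fun x => l * x)) => x; apply: rderivP => e e0; exists 1 => // h _.
  by rewrite (_ : _ - _ - _ = 0) ?normr0 ?mulr_ge0 ?(ltW e0) //; ring.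
rewrite /cint !e1.
by case: k => k k'; apply/eqP; rewrite eq_complex /=; apply/andP; split; apply/eqP; ring.
Qed.

(** The factor 2 comes from bounding the real and imaginary parts separately; it reappears in
    Cauchy's estimates. *)
Lemma cint_bound g a b M : ccont g -> a <= b -> (forall x, a <= x <= b -> md (g x) <= M) ->
  md (cint g a b) <= 2 * M * (b - a).
Proof.
move=> /cintP[Ir [Ii [H1 H2 ->]]] ab HM.
apply: le_trans (md_ReIm _) _ => /=.
have h1 := mvt_le ab (fun x _ => H1 x) (fun x h => le_trans (Re_md _) (HM x h)).
have h2 := mvt_le ab (fun x _ => H2 x) (fun x h => le_trans (Im_md _) (HM x h)).
lra.
Qed.

Lemma cintN g a b : ccont g -> cint (fun x => - g x) a b = - cint g a b.
Proof.
move=> cg; apply/eqP; rewrite -addr_eq0 -cintD //; last exact: ccontN.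
rewrite (_ : (fun _ => _) = (fun=> 0)) ?cint_cst ?mul0r //.
by apply/funext => x; rewrite addNr.
Qed.

Lemma cintB f g a b : ccont f -> ccont g ->
  cint (fun x => f x - g x) a b = cint f a b - cint g a b.
Proof. by move=> cf cg; rewrite cintD ?cintN //; exact: ccontN. Qed.
End Integral.

Lemma pow2_small (R : realType) (K d : R) : 0 < d -> 0 <= K -> exists n, K * 2 ^- n < d.
Proof.
move=> d0 K0; have Kd0 : 0 <= K / d by rewrite divr_ge0 // ltW.
exists (Num.bound (K / d)); set n := Num.bound _.
have h1 : K / d < n%:R by exact: archi_boundP.
rewrite ltr_pdivrMr ?exprn_gt0 //.
rewrite ltr_pdivrMr // in h1; apply: lt_le_trans h1 _; rewrite mulrC ler_pM2l //.
by rewrite -natrX ler_nat ltnW // ltn_expl.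
Qed.

(** * Goursat's theorem for rectangles, by bisection *)

Section Goursat.
Variable R : realType.
Local Notation C := R[i].
Variables (H : R -> R -> C) (S : R).
Hypothesis HD : forall s0 t0 : R, s0 <= S -> exists l : C, forall e : R, 0 < e ->
  exists2 d : R, 0 < d & forall s t : R, s <= S -> `|s - s0| < d -> `|t - t0| < d ->
  md (H s t - H s0 t0 - l * ((s - s0) +i* (t - t0))) <= e * (`|s - s0| + `|t - t0|).

Ltac keep_hyp H ::= tryif first [constr_eq H HD] then fail else idtac.
Lemma HDcont (s0 t0 e : R) : s0 <= S -> 0 < e -> exists2 d : R, 0 < d &
  forall s t : R, s <= S -> `|s - s0| < d -> `|t - t0| < d -> md (H s t - H s0 t0) < e.
Proof.
move=> sS e0; have [l Hl] := HD t0 sS; have [d d0 Hd] := Hl 1 ltr01.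
have l0 := md_ge0 l.
exists (Num.min d (e / (2 * (1 + md l)))).
  by rewrite lt_min d0 divr_gt0 // mulr_gt0 // ltr_wpDr.
move=> s t hs; rewrite !lt_min => /andP[h1 h1'] /andP[h2 h2'].
have := Hd s t hs h1 h2; rewrite mul1r => h.
move: h1' h2'; rewrite !ltr_pdivlMr ?mulr_gt0 ?ltr_wpDr // => h1' h2'.
rewrite -(subrK (l * ((s - s0) +i* (t - t0))) (H s t - _)).
apply: le_lt_trans (mdD _ _) _; rewrite mdM.
have := md_ReIm ((s - s0) +i* (t - t0)) => /= h3.
have := md_ge0 ((s - s0) +i* (t - t0)).
(move: l0 h h1' h2' h3; drop; nra).
Qed.

(** [H] is controlled only for s <= S, while [cint] asks for continuity on the whole line; hence the
    clamp at S. *)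
Definition K (s t : R) : C := H (Num.min s S) t.
Lemma KcontS t : ccont (fun s => K s t).
Proof.
move=> s e e0; have mS : Num.min s S <= S by rewrite ge_min lexx orbT.
have [d d0 Hd] := HDcont t mS e0; exists d => // y hy; apply: Hd.
- by rewrite ge_min lexx orbT.
- apply: le_lt_trans hy.
  by case: (leP y S); case: (leP s S) => h1 h2;
    case: (ler0P (y - s)) => h3; rewrite ?ler_norml; try (apply/andP; split); lra.
- by rewrite subrr normr0.
Qed.
Lemma KcontT s : ccont (fun t => K s t).
Proof.
move=> t e e0; have mS : Num.min s S <= S by rewrite ge_min lexx orbT.
have [d d0 Hd] := HDcont t mS e0; exists d => // y hy; apply: Hd => //.
by rewrite subrr normr0.
Qed.

(** The integral of [K] over the boundary of a rectangle, in the complex variable s + it. *)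
Definition J (s1 s2 t1 t2 : R) : C := 'i%C * cint (fun t => K s2 t - K s1 t) t1 t2 -
   cint (fun s => K s t2 - K s t1) s1 s2.

#[local] Arguments J : simpl never.
Lemma J_splits s1 m s2 t1 t2 : J s1 m t1 t2 + J m s2 t1 t2 = J s1 s2 t1 t2.
Proof.
have cT s := KcontT s; have cS t := KcontS t.
rewrite /J !cintB //.
rewrite -(cint_cat s1 m s2 (cS t2)) -(cint_cat s1 m s2 (cS t1)); ring.
Qed.
Lemma J_splitt s1 s2 t1 m t2 : J s1 s2 t1 m + J s1 s2 m t2 = J s1 s2 t1 t2.
Proof.
have cT s := KcontT s; have cS t := KcontS t.
rewrite /J !cintB //.
rewrite -(cint_cat t1 m t2 (cT s2)) -(cint_cat t1 m t2 (cT s1)); ring.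
Qed.

Lemma J_small (s0 t0 : R) : s0 <= S -> forall e : R, 0 < e -> exists2 d : R, 0 < d &
  forall s1 s2 t1 t2 : R, s1 <= s0 <= s2 -> t1 <= t0 <= t2 -> s2 <= S -> s2 - s1 < d -> t2 - t1 < d ->
  md (J s1 s2 t1 t2) <= e * ((s2 - s1) + (t2 - t1)) ^+ 2.
Proof.
move=> sS e e0; have [l Hl] := HD t0 sS.
have e4 : 0 < e / 4 by rewrite divr_gt0.
have [d d0 Hd] := Hl _ e4; exists d => // s1 s2 t1 t2 /andP[s1s s2s] /andP[t1t t2t] s2S ds dt.
set D := s2 - s1 + (t2 - t1).
have s12 : s1 <= s2 by (move: s1s s2s; drop; lra).
have t12 : t1 <= t2 by (move: t1t t2t; drop; lra).
pose E (s t : R) : C := K s t - H s0 t0 - l * ((s - s0) +i* (t - t0)).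
have HE (s t : R) : s1 <= s <= s2 -> t1 <= t <= t2 -> md (E s t) <= e / 4 * D.
  move=> /andP[h1 h2] /andP[h3 h4].
  have as0 : `|s - s0| <= s2 - s1 by rewrite ler_norml; lra.
  have at0 : `|t - t0| <= t2 - t1 by rewrite ler_norml; (move: t1t t2t h3 h4; drop; lra).
  rewrite /E /K min_l; last by (move: s2S h2; drop; lra).
  apply: le_trans (Hd s t _ _ _) _; [(move: s2S ds dt h2 as0 at0; drop; lra)..|].
  by apply: ler_wpM2l; [exact: ltW | rewrite /D; (move: as0 at0; drop; lra)].
have s1i : s1 <= s1 <= s2 by rewrite lexx.
have s2i : s1 <= s2 <= s2 by rewrite lexx andbT.
have t1i : t1 <= t1 <= t2 by rewrite lexx.
have t2i : t1 <= t2 <= t2 by rewrite lexx andbT.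
(* The linear part of the expansion contributes l i (s2 - s1)(t2 - t1) to both terms and drops
   out. *)
have -> : J s1 s2 t1 t2 = 'i%C * cint (fun t => K s2 t - K s1 t - l * (s2 - s1)%:C) t1 t2 -
   cint (fun s => K s t2 - K s t1 - l * ('i%C * (t2 - t1)%:C)) s1 s2.
  have cT s := KcontT s; have cS t := KcontS t.
  rewrite /J !cintB ?cint_cst //; try exact: ccont_cst; try exact: ccontB.
  ring.
have b1 : md (cint (fun t => K s2 t - K s1 t - l * (s2 - s1)%:C) t1 t2) <= 2 * (e / 2 * D) * (t2 - t1).
  apply: cint_bound => // [|t ht].
    by apply: ccontB; [apply: ccontB; exact: KcontT | exact: ccont_cst].
  rewrite (_ : _ - _ = E s2 t - E s1 t); last first.
    rewrite /E (_ : (s2 - s1)%:C = ((s2 - s0) +i* (t - t0)) - ((s1 - s0) +i* (t - t0))).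
      by ring.
    by apply/eqP; rewrite eq_complex /=; apply/andP; split; apply/eqP; ring.
  apply: le_trans (mdB _ _) _; have := HE _ _ s2i ht; have := HE _ _ s1i ht; (drop; lra).
have b2 : md (cint (fun s => K s t2 - K s t1 - l * ('i%C * (t2 - t1)%:C)) s1 s2) <= 2 * (e / 2 * D) * (s2 - s1).
  apply: cint_bound => // [|s hs].
    by apply: ccontB; [apply: ccontB; exact: KcontS | exact: ccont_cst].
  rewrite (_ : _ - _ = E s t2 - E s t1); last first.
    rewrite /E (_ : 'i%C * (t2 - t1)%:C = ((s - s0) +i* (t2 - t0)) - ((s - s0) +i* (t1 - t0))).
      by ring.
    by apply/eqP; rewrite eq_complex /=; apply/andP; split; apply/eqP; ring.
  apply: le_trans (mdB _ _) _; have := HE _ _ hs t2i; have := HE _ _ hs t1i; (drop; lra).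
apply: le_trans (mdB _ _) _; rewrite mdM md_i mul1r.
rewrite /D in b1 b2 *; (move: b1 b2; drop; lra).
Qed.

(** If the integral were not zero, then some quarter of each rectangle would carry at least a
    quarter of it. The nested quarters shrink to a point, near which [J_small] bounds the integral
    by a small multiple of 4^-n. *)
Lemma J_eq0 (s1 s2 t1 t2 : R) : s1 <= s2 -> s2 <= S -> t1 <= t2 -> J s1 s2 t1 t2 = 0.
Proof.
move=> s12 s2S t12; apply/eqP; rewrite -md_eq0; apply: contrapT => /negP nJ.
set a := s2 - s1; set b := t2 - t1.
pose h n : R := 2 ^- n.
pose bad n (p : R * R) := md (J s1 s2 t1 t2) / 4 ^+ n <=
  md (J p.1 (p.1 + a * h n) p.2 (p.2 + b * h n)).
have hS n : h n = h n.+1 + h n.+1.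
  by rewrite /h exprS invfM; field; rewrite expf_neq0 // pnatr_eq0.
have step (np : nat * (R * R)) : exists q : R * R, bad np.1 np.2 -> bad np.1.+1 q /\
   (np.2.1 <= q.1 /\ q.1 + a * h np.1.+1 <= np.2.1 + a * h np.1) /\
   (np.2.2 <= q.2 /\ q.2 + b * h np.1.+1 <= np.2.2 + b * h np.1).
  case: np => n [s t] /=; rewrite /bad /=.
  set A := a * h n.+1; set B := b * h n.+1.
  have h0 : 0 < h n.+1 by rewrite /h invr_gt0 exprn_gt0.
  have A0 : 0 <= A by rewrite /A mulr_ge0 ?subr_ge0 // ltW.
  have B0 : 0 <= B by rewrite /B mulr_ge0 ?subr_ge0 // ltW.
  have -> : a * h n = A + A by rewrite hS mulrDr.
  have -> : b * h n = B + B by rewrite hS mulrDr.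
  rewrite exprS invfM.
  set m := md (J s1 s2 t1 t2) / 4 ^+ n.
  have -> : md (J s1 s2 t1 t2) * (4^-1 / 4 ^+ n) = m / 4 by rewrite /m; ring.
  apply: contrapT => /forallNP nq.
  have E : J s (s + (A + A)) t (t + (B + B)) =
     J s (s + A) t (t + B) + J (s + A) (s + A + A) t (t + B) +
     J s (s + A) (t + B) (t + B + B) + J (s + A) (s + A + A) (t + B) (t + B + B).
    rewrite !(addrA s) !(addrA t) -(J_splitt s (s + A + A) t (t + B) (t + B + B)).
    rewrite -(J_splits s (s + A) (s + A + A) t (t + B)).
    by rewrite -(J_splits s (s + A) (s + A + A) (t + B) (t + B + B)) [LHS]addrA.
  have nq' q1 q2 : s <= q1 -> q1 + A <= s + (A + A) -> t <= q2 -> q2 + B <= t + (B + B) ->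
     m <= md (J s (s + (A + A)) t (t + (B + B))) -> md (J q1 (q1 + A) q2 (q2 + B)) < m / 4.
    move=> *; rewrite ltNge; apply/negP => ?; apply: (nq (q1, q2)) => /=; split => //.
    idtac.
  have [mm|mm] := leP m (md (J s (s + (A + A)) t (t + (B + B)))); last first.
    apply: (nq (s, t)) => /= bb; exfalso.
    move: bb; apply/negP; rewrite -ltNge //.
  have q1 : md (J s (s + A) t (t + B)) < m / 4 by apply: nq' => //; (move: A0 B0; drop; lra).
  have q2 : md (J (s + A) (s + A + A) t (t + B)) < m / 4 by apply: nq' => //; (move: A0 B0; drop; lra).
  have q3 : md (J s (s + A) (t + B) (t + B + B)) < m / 4 by apply: nq' => //; (move: A0 B0; drop; lra).
  have q4 : md (J (s + A) (s + A + A) (t + B) (t + B + B)) < m / 4 by apply: nq' => //; lra.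
  move: mm; apply/negP; rewrite -ltNge E.
  have d1 := mdD (J s (s + A) t (t + B) + J (s + A) (s + A + A) t (t + B) +
     J s (s + A) (t + B) (t + B + B)) (J (s + A) (s + A + A) (t + B) (t + B + B)).
  have d2 := mdD (J s (s + A) t (t + B) + J (s + A) (s + A + A) t (t + B))
     (J s (s + A) (t + B) (t + B + B)).
  have d3 := mdD (J s (s + A) t (t + B)) (J (s + A) (s + A + A) t (t + B)).
  (move: q1 q2 q3 q4 d1 d2 d3; drop; lra).
have [nx Hnx] := choice step.
pose p := fix p n := if n is n'.+1 then nx (n', p n') else (s1, t1).
have Hbad n : bad n (p n).
  elim: n => [|n IH] /=; last by have [] := Hnx (n, p n) IH.
  rewrite /bad /h /= !expr0 !invr1 !mulr1 /a /b !subrKC //.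
have stepP n : ((p n).1 <= (p n.+1).1 /\ (p n.+1).1 + a * h n.+1 <= (p n).1 + a * h n) /\
   ((p n).2 <= (p n.+1).2 /\ (p n.+1).2 + b * h n.+1 <= (p n).2 + b * h n).
  by have [_ [? ?]] := Hnx (n, p n) (Hbad n).
have nest (u : nat -> R) (w : R) : 0 <= w -> (forall n, u n <= u n.+1 /\ u n.+1 + w * h n.+1 <= u n + w * h n) ->
   exists x : R, forall n, u n <= x <= u n + w * h n.
  move=> w0 Hu.
  have mono : nondecreasing_seq u by apply/nondecreasing_seqP => n; have [] := Hu n.
  have hp n : 0 <= w * h n by rewrite mulr_ge0 // invr_ge0 exprn_ge0.
  have ub n m : u m <= u n + w * h n.
    have dec k : u (n + k)%N + w * h (n + k)%N <= u n + w * h n.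
      by elim: k => [|k IH]; rewrite ?addn0 // addnS; apply: le_trans IH; have [] := Hu (n + k)%N.
    apply: (@le_trans _ _ (u (n + m)%N)); first by apply: mono; exact: leq_addl.
    by apply: le_trans (dec m); rewrite lerDl.
  have cu : cvgn u.
    apply: nondecreasing_is_cvgn => //; exists (u 0%N + w * h 0%N) => _ [n _ <-]; exact: ub.
  exists (limn u) => n; apply/andP; split; first exact: nondecreasing_cvgn_le.
  by apply: limr_le => //; near=> k; exact: ub.
have a0 : 0 <= a by rewrite subr_ge0.
have b0 : 0 <= b by rewrite subr_ge0.
have [s0 Hs0] := nest _ a a0 (fun n => (stepP n).1).
have [t0 Ht0] := nest _ b b0 (fun n => (stepP n).2).
have s0S : s0 <= S.
  have /andP[_ h1] := Hs0 0%N; rewrite /h expr0 invr1 mulr1 /a /= subrKC in h1.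
  exact: le_trans h1 s2S.
set M := md (J s1 s2 t1 t2).
have M0 : 0 < M by rewrite lt_neqAle md_ge0 andbT eq_sym.
have ab1 : 0 < (a + b) ^+ 2 + 1 by rewrite ltr_wpDl // sqr_ge0.
have e0 : 0 < M / ((a + b) ^+ 2 + 1) by rewrite divr_gt0.
have [d d0 Hd] := J_small t0 s0S e0.
have [n Hn0] := pow2_small d0 (addr_ge0 a0 b0).
have Hn : (a + b) * h n < d := Hn0.
have h0 : 0 < h n by rewrite /h invr_gt0 exprn_gt0.
have hah : a * h n < d by (move: b0 Hn h0; drop; nra).
have hbh : b * h n < d by nra.
have upS k : (p k).1 + a * h k <= s2.
  elim: k => [|k IH]; first by rewrite /h expr0 invr1 mulr1 /a /= subrKC.
  by apply: le_trans IH; have [[_ ?] _] := stepP k.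
have := Hd (p n).1 ((p n).1 + a * h n) (p n).2 ((p n).2 + b * h n) (Hs0 n) (Ht0 n).
rewrite ![_ + _ * _ - _]addrC !addKr => /(_ (le_trans (upS n) s2S) hah hbh) h1.
have := le_trans (Hbad n) h1; apply/negP; rewrite -ltNge -mulrDl exprMn.
have -> : (h n) ^+ 2 = (4 ^+ n)^-1.
  by rewrite /h exprVn -exprM mulnC exprM -natrX.
rewrite mulrA ltr_pM2r ?invr_gt0 ?exprn_gt0 //.
rewrite -mulrA gtr_pMr // mulrC ltr_pdivrMr // mul1r ltrDl //.
Unshelve. all: by end_near. Qed.

(** By periodicity the sides t = 0 and t = T of the rectangle cancel. *)
Lemma circle_int_cst (T s1 s2 : R) : 0 <= T -> (forall s t : R, H s (t + T) = H s t) ->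
  s1 <= s2 -> s2 <= S -> cint (H s2) 0 T = cint (H s1) 0 T.
Proof.
move=> T0 per s12 s2S; have := J_eq0 s12 s2S T0; rewrite /J.
rewrite [X in _ - X](_ : _ = 0); last first.
  rewrite (_ : (fun _ => _) = (fun=> 0)) ?cint_cst ?mul0r //.
  by apply/funext => s; rewrite /K -{1}(add0r T) per subrr.
rewrite subr0 => /eqP; rewrite mulf_eq0 => /orP[/eqP h|].
  by have := md_i R; rewrite h md0 => /eqP; rewrite eq_sym oner_eq0.
rewrite cintB; try exact: KcontT.
rewrite subr_eq0 => /eqP; rewrite /K !min_l //; exact: le_trans s2S.
Qed.
Ltac keep_hyp H ::= idtac.
End Goursat.

(** * The complex exponential and Cauchy's estimate for the derivative *)

Section Cauchy.
Variable R : realType.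
Local Notation C := R[i].

Lemma is_derive_rderiv (f : R -> R) (x l : R) : is_derive x 1 f l -> rderiv f x l.
Proof.
move=> [df fl] e e0.
have : (fun h : R => h^-1 *: (f (h *: 1 + x) - f x)) h @[h --> 0^'] --> l.
  by rewrite -fl; exact: df.
move=> /cvgrPdist_lt/(_ _ e0); rewrite near_withinE => /nbhs_ballP[d /= d0 Hd].
exists d => // h hd; have [->|h0] := eqVneq h 0.
  by rewrite addr0 subrr mulr0 subr0 normr0 mulr0.
have := Hd h; rewrite /ball /= sub0r normrN => /(_ hd h0) hh.
have -> : f (x + h) - f x - l * h = - (l - h^-1 *: (f (h *: 1 + x) - f x)) * h.
  by rewrite /GRing.scale /= mulr1 (addrC h); field; exact: h0.
by rewrite normrM normrN ler_wpM2r // ltW.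
Qed.

Definition cis (t : R) : C := cos t +i* sin t.
Lemma md_cis t : md (cis t) = 1.
Proof.
apply/eqP; rewrite -(@eqrXn2 _ 2) ?md_ge0 // md_sq /= cos2Dsin2 expr1n //.
Qed.
Lemma cexpE (z : C) : cexp z = (expR (complex.Re z))%:C * cis (complex.Im z).
Proof. by case: z. Qed.
Lemma md_cexp (z : C) : md (cexp z) = expR (complex.Re z).
Proof. by rewrite cexpE mdM md_cis mulr1 md_real ger0_norm // expR_ge0. Qed.
Lemma cisD s t : cis (s + t) = cis s * cis t.
Proof.
rewrite /cis cosD sinD; apply/eqP; rewrite eq_complex /=; apply/andP; split => //.
by apply/eqP; ring.
Qed.
Lemma cexpD (z w : C) : cexp (z + w) = cexp z * cexp w.
Proof. by rewrite !cexpE ReD ImD expRD cisD rmorphM /=; ring. Qed.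
Lemma cexp0 : cexp 0 = 1 :> C.
Proof. by rewrite cexpE /= expR0 /cis cos0 sin0 mul1r. Qed.
Lemma cis2pi t : cis (t + pi *+ 2) = cis t.
Proof. by rewrite /cis cosD2pi sinD2pi. Qed.

Lemma cexp_cderiv0 : cderiv (@cexp R) 0 1.
Proof.
move=> e e0; pose e1 := Num.min 1 (e / 16).
have e10 : 0 < e1 by rewrite lt_min ltr01 divr_gt0.
have e11 : e1 <= 1 by rewrite ge_min lexx.
have e1e : e1 <= e / 16 by rewrite ge_min lexx orbT.
have [d1 d10 H1] := is_derive_rderiv (is_derive_expR (0 : R)) e10.
have [d2 d20 H2] := is_derive_rderiv (is_derive_sin (0 : R)) e10.
have [d3 d30 H3] := is_derive_rderiv (is_derive_cos (0 : R)) e10.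
exists (Num.min (Num.min d1 d2) (Num.min d3 e1)).
  by rewrite !lt_min d10 d20 d30 ltr01 divr_gt0.
move=> h; rewrite !lt_min => /andP[/andP[h1 h2] /andP[h3 h4]].
have Rh := Re_md h; have Ih := Im_md h.
have {}H1 := H1 _ (le_lt_trans Rh h1).
have {}H2 := H2 _ (le_lt_trans Ih h2).
have {}H3 := H3 _ (le_lt_trans Ih h3).
rewrite !add0r !expR0 ?sin0 ?cos0 ?mul1r ?subr0 ?oppr0 ?mul0r ?subr0 in H1 H2 H3.
rewrite add0r cexp0 mul1r cexpE.
set x := complex.Re h in H1 H2 H3 Rh Ih *; set y := complex.Im h in H1 H2 H3 Rh Ih *.
have m0 := md_ge0 h.
have -> : (expR x)%:C * cis y - 1 - h =
  (expR x - 1 - x)%:C + (expR x)%:C * ((cos y - 1) +i* (sin y - y)) + (expR x - 1)%:C * (0 +i* y).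
  rewrite [in X in _ - X](_ : h = x +i* y); last by rewrite /x /y; case: (h).
  by rewrite /cis; apply/eqP; rewrite eq_complex /=; apply/andP; split; apply/eqP; ring.
have b1 : `|expR x - 1| <= 2 * md h.
  rewrite -(subrK x (expR x - 1)); apply: le_trans (ler_normD _ _) _.
  apply: (@le_trans _ _ (e1 * `|x| + `|x|)); first by rewrite lerD2r.
  (move: e10 e11 Rh m0; drop; nra).
have b2 : `|expR x| <= 3.
  rewrite -(subrK 1 (expR x)); apply: le_trans (ler_normD _ _) _; rewrite normr1; (move: h4 b1; drop; lra).
apply: le_trans (mdD _ _) _; apply: (@le_trans _ _ (e1 * md h + 3 * (2 * e1 * md h) + 2 * md h * e1)); last first.
  (move: e0 e1e m0; drop; nra).
apply: lerD.
  apply: le_trans (mdD _ _) _; apply: lerD.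
    by rewrite md_real; apply: le_trans H1 _; rewrite ler_pM2l.
  rewrite mdM md_real; apply: ler_pM => //; rewrite ?md_ge0 //.
  apply: le_trans (md_ReIm _) _ => /=.
  have : e1 * `|y| <= e1 * md h by rewrite ler_pM2l.
  (move: H2 H3; drop; lra).
rewrite mdM md_real; apply: ler_pM => //; rewrite ?md_ge0 //.
have he1 : md h < e1 by rewrite lt_min.
by apply: le_trans (md_ReIm _) _ => /=; rewrite normr0 add0r; (move: Ih he1; drop; lra).
Qed.

Lemma cexp_cderiv (z : C) : cderiv (@cexp R) z (cexp z).
Proof.
move=> e e0; have k0 := md_ge0 (cexp z).
have e1 : 0 < e / (1 + md (cexp z)) by rewrite divr_gt0 // ltr_wpDr.
have [d d0 Hd] := cexp_cderiv0 e1; exists d => // h /Hd.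
rewrite add0r cexp0 mul1r cexpD => H.
have -> : cexp z * cexp h - cexp z - cexp z * h = cexp z * (cexp h - 1 - h) by ring.
rewrite mdM; apply: le_trans (ler_wpM2l k0 H) _.
have h0 := md_ge0 h.
rewrite mulrA ler_wpM2r // mulrCA; apply: ler_piMr; first exact: ltW.
by rewrite ler_pdivrMr ?ltr_wpDr // mul1r lerDr.
Qed.

Lemma half_pi_id (p e : R) : p != 0 -> 2 * (e / (8 * p)) * (p *+ 2) = e / 2.
Proof. by move=> p0; rewrite -mulr_natr; field. Qed.

Section Formula.
Variables (f : C -> C) (z lz : C) (r : R).
Hypothesis Hf : forall w, md (w - z) < r -> exists l, cderiv f w l.
Hypothesis Hz : cderiv f z lz.

Ltac keep_hyp H ::= tryif first [constr_eq H Hf | constr_eq H Hz] then fail else idtac.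
Definition circle_quot (rho t : R) : C := (f (z + rho%:C * cis t) - f z) / (rho%:C * cis t).

(** The difference quotient of f at z with increment exp w. Circles around z become vertical
    segments, and the punctured disc becomes a half plane, to which the theorem on rectangles
    applies. *)
Let phi (w : C) := (f (z + cexp w) - f z) * cexp (- w).
Let H (s t : R) := phi (s +i* t).

Lemma phi_cderiv (S : R) : expR S < r -> forall w : C, complex.Re w <= S -> exists l, cderiv phi w l.
Proof.
move=> Sr w wS.
have [l Hl] : exists l, cderiv f (z + cexp w) l.
  apply: Hf; rewrite addrC addKr md_cexp; apply: le_lt_trans Sr; by rewrite ler_expR.
have h1 : cderiv (fun w => z + cexp w) w (0 + cexp w).
  by apply: cderivD; [exact: cderiv_cst | exact: cexp_cderiv].
have h2 := cderiv_comp h1 Hl.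
have h3 := cderivD h2 (cderiv_cst (- f z) w).
have hN : cderiv (fun w : C => - w) w (-1).
  have := cderivM (cderiv_cst (-1) w) (cderiv_id w).
  rewrite (_ : (fun _ => _) = (fun w : C => - w)) ?mul0r ?add0r ?mulr1 //.
  by apply/funext => x; rewrite mulN1r.
have h4 := cderiv_comp hN (cexp_cderiv (- w)).
by have := cderivM h3 h4; set l' := (X in cderiv _ _ X) => h5; exists l'.
Qed.

Lemma HDphi (S : R) : expR S < r -> forall s0 t0 : R, s0 <= S -> exists l : C, forall e : R, 0 < e ->
  exists2 d : R, 0 < d & forall s t : R, s <= S -> `|s - s0| < d -> `|t - t0| < d ->
  md (H s t - H s0 t0 - l * ((s - s0) +i* (t - t0))) <= e * (`|s - s0| + `|t - t0|).
Proof.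
move=> Sr s0 t0 sS; have [l Hl] := phi_cderiv Sr (w := s0 +i* t0) sS.
exists l => e e0; have [d d0 Hd] := Hl e e0; exists (d / 2); first by rewrite divr_gt0.
move=> s t _ hs ht; have m := md_ReIm ((s - s0) +i* (t - t0)).
have := Hd ((s - s0) +i* (t - t0)); rewrite (_ : s0 +i* t0 + _ = s +i* t); last first.
  by apply/eqP; rewrite eq_complex /= !subrKC !eqxx.
move=> h; apply: le_trans (h _) _; first by move: m => /=; lra.
by rewrite ler_pM2l.
Qed.

Lemma HE (rho : R) t : 0 < rho -> H (ln rho) t = circle_quot rho t.
Proof.
move=> r0; have E : cexp (ln rho +i* t) = rho%:C * cis t by rewrite cexpE /= lnK.
rewrite /H /phi /circle_quot E; congr (_ * _).
have h : cexp (ln rho +i* t) * cexp (- (ln rho +i* t)) = 1 by rewrite -cexpD subrr cexp0.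
rewrite E in h; apply: (mulfI (x := rho%:C * cis t)); last first.
  rewrite h divff // -md_eq0 mdM md_cis mulr1 md_real gtr0_norm //; exact: lt0r_neq0.
by rewrite -md_eq0 mdM md_cis mulr1 md_real gtr0_norm //; exact: lt0r_neq0.
Qed.

Lemma circle_quot_cont (rho : R) : 0 < rho -> rho < r -> ccont (circle_quot rho).
Proof.
move=> r0 rr; have E : expR (ln rho) < r by rewrite lnK.
have := KcontT (HDphi E) (ln rho); rewrite /K minxx => h.
by rewrite (_ : circle_quot rho = H (ln rho)) //; apply/funext => t; rewrite HE.
Qed.

(** The mean of the difference quotient over a circle does not depend on the radius, and it tends to
    the derivative as the radius tends to 0. *)
Lemma cauchy_derivative (rho : R) : 0 < rho -> rho < r ->
  (pi *+ 2)%:C * lz = cint (circle_quot rho) 0 (pi *+ 2).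
Proof.
move=> r0 rr; have E : expR (ln rho) < r by rewrite lnK.
have HDS := HDphi E.
have pi20 : 0 <= pi *+ 2 :> R by rewrite mulrn_wge0 // pi_ge0.
have per (s t : R) : H s (t + pi *+ 2) = H s t.
  rewrite /H /phi; have e1 : cexp (s +i* (t + pi *+ 2)) = cexp (s +i* t).
    by rewrite !cexpE /= cis2pi.
  have -> : cexp (- (s +i* (t + pi *+ 2))) = cexp (- (s +i* t)); last by rewrite e1.
  have := cexpD (s +i* t) (- (s +i* t)); rewrite subrr => h1.
  have := cexpD (s +i* (t + pi *+ 2)) (- (s +i* (t + pi *+ 2))); rewrite subrr e1 h1 => /esym h2.
  apply: (mulfI (x := cexp (s +i* t))) => //.
  by rewrite -md_eq0 md_cexp lt0r_neq0 // expR_gt0.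
rewrite (_ : circle_quot rho = H (ln rho)); last by apply/funext => t; rewrite HE.
apply/eqP; rewrite -subr_eq0 -md_eq0; apply/eqP/le_anti; rewrite md_ge0 andbT.
apply/ler_addgt0Pr => e e0; rewrite add0r.
have pi8 : 0 < 8 * pi :> R by rewrite mulr_gt0 // pi_gt0.
have e1 : 0 < e / (8 * pi) by rewrite divr_gt0.
have [d d0 Hd] := Hz e1.
(* A circle inside the given one and inside the disc where the first order expansion holds with
   relative error e / (8 pi). *)
pose s := Num.min (ln rho) (ln (d / 2)).
have sr : s <= ln rho by rewrite ge_min lexx.
have sd : expR s < d.
  apply: (@le_lt_trans _ _ (expR (ln (d / 2)))); first by rewrite ler_expR ge_min lexx orbT.
  by rewrite lnK ?posrE ?divr_gt0 // ltr_pdivrMr // mulr_natr mulr2n ltrDl.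
rewrite (circle_int_cst HDS pi20 per sr (lexx _)).
have ccH : ccont (H s).
  by have := KcontT HDS s; rewrite /K min_l.
have -> : (pi *+ 2)%:C * lz = cint (fun=> lz) 0 (pi *+ 2) by rewrite cint_cst subr0 mulrC.
rewrite -cintB //; last exact: ccont_cst.
apply: le_trans (@cint_bound _ _ _ _ (e / (8 * pi)) _ _ _) _ => //.
- by apply: ccontB => //; exact: ccont_cst.
- move=> t _; set h := cexp (s +i* t).
  have h0 : h != 0 by rewrite -md_eq0 md_cexp lt0r_neq0 // expR_gt0.
  have hV : cexp (- (s +i* t)) = h^-1.
    by apply: (mulfI h0); rewrite -cexpD subrr cexp0 divff.
  rewrite /H /phi -/h hV.
  have -> : lz - (f (z + h) - f z) / h = - ((f (z + h) - f z - lz * h) / h) by field.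
  rewrite mdN mdf ler_pdivrMr ?md_gt0 //; apply: Hd; rewrite md_cexp //.
rewrite subr0 [leLHS](_ : _ = e / 2); first lra.
have pi0 : pi != 0 :> R by apply: lt0r_neq0; exact: pi_gt0.
exact: half_pi_id.
Qed.
Ltac keep_hyp H ::= idtac.
End Formula.

Lemma cauchy_bound (f : C -> C) (z lz : C) (r rho M : R) :
  (forall w, md (w - z) < r -> exists l, cderiv f w l) -> cderiv f z lz ->
  0 < rho -> rho < r -> (forall w, md (w - z) = rho -> md (f w - f z) <= M) ->
  md lz <= 2 * M / rho.
Proof.
move=> Hf Hz r0 rr HM; have E := cauchy_derivative Hf Hz r0 rr.
have cc := circle_quot_cont Hf r0 rr.
have pi20 : 0 <= pi *+ 2 :> R by rewrite mulrn_wge0 // pi_ge0.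
have pi2 : 0 < pi *+ 2 :> R by rewrite pmulrn_lgt0 // pi_gt0.
have b t : 0 <= t <= pi *+ 2 -> md (circle_quot f z rho t) <= M / rho.
  move=> _; rewrite /circle_quot mdf mdM md_cis mulr1 md_real gtr0_norm //.
  apply: ler_wpM2r; first by rewrite invr_ge0 ltW.
  by apply: HM; rewrite addrC addKr mdM md_cis mulr1 md_real gtr0_norm.
have := cint_bound cc pi20 b; rewrite -E subr0 mdM md_real ger0_norm //.
rewrite [leRHS]mulrC ler_pM2l // => h; apply: le_trans h _; by rewrite mulrA.
Qed.

(** Cauchy's estimate at 0 for the difference of the two translates of f. *)
Lemma cauchy_diff_bound (f : C -> C) (z z' lz lz' : C) (r rho M : R) :
  (forall w, md (w - z) < r -> exists l, cderiv f w l) -> cderiv f z lz ->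
  (forall w, md (w - z') < r -> exists l, cderiv f w l) -> cderiv f z' lz' ->
  0 < rho -> rho < r ->
  (forall w, md w = rho -> md ((f (z + w) - f z) - (f (z' + w) - f z')) <= M) ->
  md (lz - lz') <= 2 * M / rho.
Proof.
move=> Hf Hz Hf' Hz' r0 rr HM.
pose g w := f (z + w) - f (z' + w).
have sh (y a l : C) : cderiv f (y + a) l -> cderiv (fun w => f (y + w)) a l.
  by move=> H e /H[d d0 Hd]; exists d => // h /Hd; rewrite addrA.
have Hs y a l : cderiv (fun w => f (y + w)) a l -> cderiv (fun w => - f (y + w)) a (- l).
  move=> H e /H[d d0 Hd]; exists d => // h /Hd.
  by rewrite -mdN (_ : - (_ - _) = - f (y + (a + h)) - - f (y + a) - - l * h) //; ring.
have Hg w : md (w - 0) < r -> exists l, cderiv g w l.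
  rewrite subr0 => hw.
  have [l Hl] : exists l, cderiv f (z + w) l by apply: Hf; rewrite addrC addKr.
  have [l' Hl'] : exists l, cderiv f (z' + w) l by apply: Hf'; rewrite addrC addKr.
  by exists (l - l'); apply: cderivD; [apply: sh | apply: Hs; apply: sh].
have Hg0 : cderiv g 0 (lz - lz').
  by apply: cderivD; [apply: sh | apply: Hs; apply: sh]; rewrite addr0.
apply: (cauchy_bound Hg Hg0 r0 rr) => w; rewrite subr0 => /HM.
rewrite /g !addr0; congr (_ <= _); congr md; ring.
Qed.

(** Cauchy's estimate bounds the derivative, so f is Lipschitz; the estimate for the difference of
    two translates then makes the derivative Lipschitz too. *)
Lemma holo_C1 (f f' : C -> C) (z : C) (r : R) : 0 < r ->
  (forall w, md (w - z) < r -> cderiv f w (f' w)) ->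
  exists d K : R, [/\ 0 < d, 0 < K, d < r,
    forall a b, md (a - z) < d -> md (b - z) < d -> md (f a - f b) <= K * md (a - b) &
    forall a b, md (a - z) < d -> md (b - z) < d -> md (f' a - f' b) <= K * md (a - b)].
Proof.
move=> r0 Hf.
have zr : md (z - z) < r by rewrite subrr md0.
have [d1 d10 H1] := cderiv_cont (Hf z zr) ltr01.
pose d : R := Num.min d1 r / 4.
have dm : 0 < Num.min d1 r by rewrite lt_min d10.
have d0 : 0 < d by rewrite divr_gt0.
have d41 : 4 * d <= d1 by rewrite /d mulrC divfK // ge_min lexx.
have d4r : 4 * d <= r by rewrite /d mulrC divfK // ge_min lexx orbT.
have Hex (y : C) : md (y - z) < 2 * d -> forall w, md (w - y) < 2 * d -> exists l, cderiv f w l.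
  move=> hy w hw; exists (f' w); apply: Hf; apply: le_lt_trans (md_tri y _ _) _; lra.
have B (y : C) : md (y - z) < 2 * d -> md (f' y) <= 2 * 2 / d.
  move=> hy.
  have dd : d < 2 * d by lra.
  apply: (cauchy_bound (Hex y hy) _ d0 dd) => [|w hw].
    by apply: Hf; lra.
  apply: (le_trans (md_tri (f z) _ _)); rewrite (md_distC (f z)).
  have a1 : md (f w - f z) < 1.
    apply: H1; apply: (le_lt_trans (md_tri y _ _)); lra.
  have a2 : md (f y - f z) < 1 by apply: H1; lra.
  lra.
have [K1 K1E K10] : exists2 K1 : R, 2 * 2 / d = K1 & 0 < K1.
  by exists (2 * 2 / d) => //; rewrite !divr_gt0 // mulr_gt0.
rewrite K1E in B.
have Lip a b : md (a - z) < 2 * d -> md (b - z) < 2 * d -> md (f a - f b) <= K1 * md (a - b).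
  move=> ha hb; apply: (@cderiv_lip_ball _ f f' z (2 * d) K1 _ B b a) => // w hw.
  by apply: Hf; lra.
have d20 : 0 < d / 2 by rewrite divr_gt0.
have K20 : 0 < 2 * (2 * K1) / (d / 2).
  by apply: divr_gt0 => //; apply: mulr_gt0 => //; apply: mulr_gt0.
exists d, (K1 + 2 * (2 * K1) / (d / 2)); split=> //.
- by rewrite addr_gt0.
- lra.
- move=> a b ha hb; apply: le_trans (Lip a b _ _) _; [lra|lra|].
  by rewrite ler_wpM2r ?md_ge0 // lerDl ltW.
move=> a b ha hb.
have d2d : d / 2 < d by lra.
apply: (@le_trans _ _ (2 * (2 * K1 * md (a - b)) / (d / 2))); last first.
  rewrite (mulrDl K1) -[leLHS]add0r; apply: lerD; first by rewrite mulr_ge0 ?md_ge0 // ltW.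
  by rewrite le_eqVlt; apply/orP; left; apply/eqP; ring.
have ha' : md (a - z) < 2 * d by (move: d0 ha; drop; lra).
have hb' : md (b - z) < 2 * d by (move: d0 hb; drop; lra).
apply: (@cauchy_diff_bound f a b _ _ (2 * d) (d / 2)) => //.
- exact: Hex.
- by apply: Hf; (move: r0 d4r ha; drop; lra).
- exact: Hex.
- by apply: Hf; (move: r0 d4r hb; drop; lra).
- (move: d0; drop; lra).
move=> w hw.
rewrite (_ : _ - _ - _ = (f (a + w) - f (b + w)) - (f a - f b)); last by ring.
apply: le_trans (mdB _ _) _.
have l1 : md (f (a + w) - f (b + w)) <= K1 * md (a - b).
  rewrite (_ : a - b = (a + w) - (b + w)); last by ring.
  apply: Lip; rewrite addrAC; apply: le_lt_trans (mdD _ _) _; (move: d0 ha hb; drop; lra).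
have := Lip a b ha' hb'; (move: l1; drop; lra).
Qed.
End Cauchy.

(** * Countability of the hyperbolic components *)

Section Complete.
Variable R : realType.
Local Notation C := R[i].

Lemma rcauchy (u : nat -> R) (b : nat -> R) :
  (forall n m, (n <= m)%N -> `|u m - u n| <= b n) ->
  (forall e : R, 0 < e -> exists n, b n < e) ->
  exists l, forall n, `|u n - l| <= b n.
Proof.
move=> H Hb.
have cu : cvgn u.
  apply: cauchy_cvg; apply: cauchy_exP => e e0; have [n bn] := Hb _ e0.
  exists (u n); exists n => //= m nm; rewrite /ball /= distrC.
  by apply: le_lt_trans bn; exact: H.
exists (limn u) => n.
have h1 : limn u <= u n + b n.
  by apply: limr_le => //; exists n => //= m nm; have := H n m nm; rewrite ler_norml => /andP[]; lra.
have h2 : u n - b n <= limn u.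
  by apply: limr_ge => //; exists n => //= m nm; have := H n m nm; rewrite ler_norml => /andP[]; lra.
by rewrite ler_norml; lra.
Qed.

Lemma ccauchy (u : nat -> C) (b : nat -> R) :
  (forall n m, (n <= m)%N -> md (u m - u n) <= b n) ->
  (forall e : R, 0 < e -> exists n, b n < e) ->
  exists l, forall n, md (u n - l) <= b n.
Proof.
move=> H Hb.
have [lr Hr] : exists l, forall n, `|complex.Re (u n) - l| <= b n.
  apply: rcauchy => // n m nm; rewrite -ReN -ReD; exact: le_trans (Re_md _) (H _ _ nm).
have [li Hi] : exists l, forall n, `|complex.Im (u n) - l| <= b n.
  apply: rcauchy => // n m nm; rewrite -ImN -ImD; exact: le_trans (Im_md _) (H _ _ nm).
exists (lr +i* li) => n; apply/ler_addgt0Pr => e e0.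
have e4 : 0 < e / 4 by rewrite divr_gt0.
have [N HN] := Hb _ e4; pose M := maxn n N.
have nM : (n <= M)%N by exact: leq_maxl.
have NM : (N <= M)%N by exact: leq_maxr.
rewrite md_distC; apply: (le_trans (md_tri (u M) _ _)); rewrite addrC.
apply: lerD; first exact: H.
rewrite md_distC; apply: le_trans (md_ReIm _) _; rewrite !ReD !ImD !ReN !ImN /=.
have hM := H _ _ NM.
have h1 := Hr N; have h2 := Hi N.
have h3 := le_trans (Re_md _) hM; have h4 := le_trans (Im_md _) hM.
rewrite !ReD !ImD !ReN !ImN in h3 h4.
have h5 : `|complex.Re (u M) - lr| <= b N + b N.
  rewrite -(subrK (complex.Re (u N)) (complex.Re (u M))) -addrA.
  by apply: le_trans (ler_normD _ _) _; exact: lerD.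
have h6 : `|complex.Im (u M) - li| <= b N + b N.
  rewrite -(subrK (complex.Im (u N)) (complex.Im (u M))) -addrA.
  by apply: le_trans (ler_normD _ _) _; exact: lerD.
(move: HN h5 h6; drop; lra).
Qed.

Lemma geom_small (q A e : R) : 0 <= q -> q < 1 -> 0 <= A -> 0 < e -> exists n : nat, A * q ^+ n < e.
Proof.
move=> q0 q1 A0 e0.
have : (fun n => A * q ^+ n) @ \oo --> (A * 0 : R).
  by apply: cvgMr; apply: cvg_expr; rewrite ger0_norm.
rewrite mulr0 => /cvgrPdist_lt/(_ _ e0)[N _ HN]; exists N.
have := HN N (leqnn N); rewrite /= sub0r normrN ger0_norm //.
by rewrite mulr_ge0 // exprn_ge0.
Qed.

(** The bound on the first displacement keeps the iterates in the ball, where alone [G] is known to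
    contract. *)
Lemma banach_ball (G : C -> C) (x0 : C) (rho q : R) : 0 <= q -> q < 1 -> 0 <= rho ->
  (forall a b, md (a - x0) <= rho -> md (b - x0) <= rho -> md (G a - G b) <= q * md (a - b)) ->
  md (G x0 - x0) <= (1 - q) * rho -> exists2 x, md (x - x0) <= rho & G x = x.
Proof.
move=> q0 q1 rho0 HG H0.
pose y n := iter n G x0.
have x0in : md (x0 - x0) <= rho by rewrite subrr md0.
have yin n : md (y n - x0) <= rho.
  elim: n => [//|n IH]; rewrite /y iterS -/(y n).
  apply: (le_trans (md_tri (G x0) _ _)).
  have := HG _ _ IH x0in; nra.
have tail n k : md (y (n + k)%N - y n) <= q ^+ n * rho.
  elim: n => [|n IH]; first by rewrite expr0 mul1r add0n.
  rewrite addSn /y !iterS -/(y n) -/(y (n + k)%N) exprS -mulrA.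
  by apply: le_trans (HG _ _ (yin _) (yin _)) _; rewrite ler_wpM2l.
have [|e e0|x Hx] := @ccauchy y (fun n => q ^+ n * rho).
- by move=> n m nm; rewrite -(subnKC nm); exact: tail.
- by have [n Hn] := geom_small q0 q1 rho0 e0; exists n; rewrite mulrC.
have xin : md (x - x0) <= rho.
  by have := Hx 0%N; rewrite /y /= expr0 mul1r md_distC.
exists x => //; apply/eqP; rewrite -subr_eq0 -md_eq0; apply/eqP/le_anti; rewrite md_ge0 andbT.
apply/ler_addgt0Pr => e e0; rewrite add0r.
have e2 : 0 < e / 2 by rewrite divr_gt0.
have [n Hn] := geom_small q0 q1 rho0 e2.
rewrite mulrC in Hn.
apply: (le_trans (md_tri (y n.+1) _ _)).
have h1 : md (G x - y n.+1) <= q ^+ n * rho.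
  rewrite /y iterS -/(y n); apply: (le_trans (HG _ _ xin (yin _))).
  rewrite md_distC; have := Hx n; have := md_ge0 (y n - x); nra.
have h2 : md (y n.+1 - x) <= q ^+ n * rho.
  apply: le_trans (Hx n.+1) _; rewrite exprS ler_wpM2r // ler_piMl ?exprn_ge0 //; exact: ltW.
lra.
Qed.
End Complete.

(** * Local Lipschitz functions of a parameter and a point *)

Section LocLip.
Variable R : realType.
Local Notation C := R[i].
Definition dd (p q : C * C) : R := md (p.1 - q.1) + md (p.2 - q.2).
Lemma dd_ge0 p q : 0 <= dd p q. Proof. by rewrite addr_ge0 ?md_ge0. Qed.
(** Persistence of a cycle asks for joint continuity of the iterates and of their multipliers in the
    parameter and the point; this property implies it and is stable under products and
    composition. *)
Definition LL (F : C * C -> C) (p : C * C) := exists d K : R, [/\ 0 < d, 0 < K &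
  forall a b, dd a p < d -> dd b p < d -> md (F a - F b) <= K * dd a b].
Definition L1 (f : C -> C) (z : C) := exists d K : R, [/\ 0 < d, 0 < K &
  forall a b, md (a - z) < d -> md (b - z) < d -> md (f a - f b) <= K * md (a - b)].
Lemma dd_refl p : dd p p = 0. Proof. by rewrite /dd !subrr !md0 addr0. Qed.
Lemma LL_near F p (e : R) : LL F p -> 0 < e -> exists2 d : R, 0 < d & forall a, dd a p < d -> md (F a - F p) < e.
Proof.
move=> [d [K [d0 K0 H]]] e0; exists (Num.min d (e / K)); first by rewrite lt_min d0 divr_gt0.
move=> a; rewrite lt_min => /andP[ad ae]; apply: le_lt_trans (H _ _ ad _) _; first by rewrite dd_refl.
by rewrite mulrC -ltr_pdivlMr.
Qed.
Lemma LL_cst k p : LL (fun=> k) p.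
Proof. by exists 1, 1; split=> // a b _ _; rewrite subrr md0 mul1r dd_ge0. Qed.
Lemma LL_fst p : LL fst p.
Proof. by exists 1, 1; split=> // a b _ _; rewrite mul1r lerDl md_ge0. Qed.
Lemma LL_snd p : LL snd p.
Proof. by exists 1, 1; split=> // a b _ _; rewrite mul1r lerDr md_ge0. Qed.
Lemma LL_comp F f p : LL F p -> L1 f (F p) -> LL (fun a => f (F a)) p.
Proof.
move=> HF [d' [K' [d'0 K'0 H']]]; have [d2 d20 H2] := LL_near HF d'0.
have [d [K [d0 K0 H]]] := HF.
exists (Num.min d d2), (K' * K); split; [by rewrite lt_min d0|by rewrite mulr_gt0|].
move=> a b; rewrite !lt_min => /andP[a1 a2] /andP[b1 b2].
apply: (le_trans (H' _ _ (H2 _ a2) (H2 _ b2))); rewrite -mulrA ler_pM2l //; exact: H.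
Qed.
Lemma LL_mul F G p : LL F p -> LL G p -> LL (fun a => F a * G a) p.
Proof.
move=> HF HG.
have [d1 d10 H1] := LL_near HF ltr01; have [d2 d20 H2] := LL_near HG ltr01.
have [d3 [K3 [d30 K30 H3]]] := HF; have [d4 [K4 [d40 K40 H4]]] := HG.
have f0 := md_ge0 (F p); have g0 := md_ge0 (G p).
exists (Num.min (Num.min d1 d2) (Num.min d3 d4)), (K3 * (1 + md (G p)) + (1 + md (F p)) * K4); split.
- by rewrite !lt_min d10 d20 d30.
- by apply: addr_gt0; apply: mulr_gt0 => //; lra.
move=> a b; rewrite !lt_min => /andP[/andP[a1 a2] /andP[a3 a4]] /andP[/andP[b1 b2] /andP[b3 b4]].
rewrite (_ : _ - _ = (F a - F b) * G a + F b * (G a - G b)); last by ring.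
apply: le_trans (mdD _ _) _; rewrite !mdM mulrDl.
have k1 : md (G a) <= 1 + md (G p).
  by rewrite -(subrK (G p) (G a)); apply: le_trans (mdD _ _) _; rewrite lerD2r ltW // H2.
have k2 : md (F b) <= 1 + md (F p).
  by rewrite -(subrK (F p) (F b)); apply: le_trans (mdD _ _) _; rewrite lerD2r ltW // H1.
apply: lerD.
  rewrite mulrAC; apply: ler_pM; rewrite ?md_ge0 //; exact: H3.
by rewrite -mulrA; apply: ler_pM; rewrite ?md_ge0 //; exact: H4.
Qed.
Lemma LL_exp F p n : LL F p -> LL (fun a => F a ^+ n) p.
Proof.
move=> HF; elim: n => [|n IH].
  rewrite (_ : (fun _ => _) = (fun=> 1)); first exact: LL_cst.
  by apply/funext => a; rewrite expr0.
rewrite (_ : (fun _ => _) = (fun a => F a * F a ^+ n)); first exact: LL_mul.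
by apply/funext => a; rewrite exprS.
Qed.
Lemma cderivX (f : C -> C) z l n : cderiv f z l -> cderiv (fun w => f w ^+ n) z (n%:R * f z ^+ n.-1 * l).
Proof.
move=> H; elim: n => [|n IH].
  rewrite (_ : (fun _ => _) = (fun=> 1)) ?mul0r; first exact: cderiv_cst.
  by apply/funext => a; rewrite expr0.
rewrite (_ : (fun _ => _) = (fun w => f w * f w ^+ n)); last by apply/funext => a; rewrite exprS.
have := cderivM H IH; rewrite (_ : _ + _ = n.+1%:R * f z ^+ n.+1.-1 * l) //.
case: n {IH} => [|n]; first by rewrite /= !expr0; ring.
by rewrite /= exprS -[n.+2%:R]natr1; ring.
Qed.
End LocLip.

(** * Persistence of attracting cycles, and a numbering of the components *)

Section Hyp.
Variable R : realType.
Local Notation C := R[i].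
Variables (D : set C) (h : C -> C) (al : nat).
Hypothesis hD : holomorphic_on D h.
Ltac keep_hyp H ::= tryif first [constr_eq H hD] then fail else idtac.
Let f (lam : C) := horn_family h al lam.
Let h' := derive1 h.

Lemma hcd x : D x -> cderiv h x (h' x).
Proof. by move=> Dx; apply: cderivP; apply: hD.2. Qed.

Lemma h_L1 x : D x -> L1 h x /\ L1 h' x.
Proof.
move=> Dx; have [r r0 Hr] := (open_mdP D).1 hD.1 x Dx.
have [w hw|d [K [d0 K0 dr H1 H2]]] := @holo_C1 R h h' x r r0; first exact/hcd/Hr.
by split; exists d, K.
Qed.

Definition df (lam x : C) := lam * (al%:R * h x ^+ al.-1 * h' x).
Fixpoint dfi (lam x : C) (n : nat) :=
  if n is n'.+1 then df lam (iter n' (f lam) x) * dfi lam x n' else 1.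

Lemma f_cderiv lam x : D x -> cderiv (f lam) x (df lam x).
Proof.
move=> Dx; have := cderivM (cderiv_cst lam x) (cderivX al (hcd Dx)).
by rewrite mul0r add0r.
Qed.

Lemma iter_cderiv lam x n : (forall j, (j < n)%N -> D (iter j (f lam) x)) ->
  cderiv (iter n (f lam)) x (dfi lam x n).
Proof.
elim: n => [|n IH] HDn; first exact: cderiv_id.
have H1 := IH (fun j jn => HDn j (ltnW jn)).
exact: (cderiv_comp H1 (f_cderiv lam (HDn n (leqnn _)))).
Qed.

Lemma iter_LL (p : C * C) n : (forall j, (j < n)%N -> D (iter j (f p.1) p.2)) ->
  LL (fun q => iter n (f q.1) q.2) p /\ LL (fun q => dfi q.1 q.2 n) p.
Proof.
elim: n => [|n IH] HDn; first by split; [exact: LL_snd | exact: LL_cst].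
have [H1 H2] := IH (fun j jn => HDn j (ltnW jn)).
have [L1h L1h'] := h_L1 (HDn n (leqnn _)).
have H3 := LL_comp H1 L1h; have H4 := LL_comp H1 L1h'.
split; first by apply: LL_mul (LL_fst _) (LL_exp _ H3).
apply: LL_mul => //=; apply: LL_mul (LL_fst _) _; apply: LL_mul => //.
by apply: LL_mul (LL_cst _ _) (LL_exp _ H3).
Qed.

Lemma LL_nearD (F : C * C -> C) p : LL F p -> D (F p) ->
  exists2 d : R, 0 < d & forall a, dd a p < d -> D (F a).
Proof.
move=> HF DF; have [r r0 Hr] := (open_mdP D).1 hD.1 _ DF.
by have [d d0 Hd] := LL_near HF r0; exists d => // a /Hd /Hr.
Qed.

Lemma all_near n (P : nat -> C * C -> Prop) p :
  (forall j, (j < n)%N -> exists2 d : R, 0 < d & forall a, dd a p < d -> P j a) ->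
  exists2 d : R, 0 < d & forall a, dd a p < d -> forall j, (j < n)%N -> P j a.
Proof.
elim: n => [|n IH] H; first by exists 1.
have [d d0 Hd] := IH (fun j jn => H j (ltnW jn)); have [d' d'0 Hd'] := H n (leqnn _).
exists (Num.min d d'); first by rewrite lt_min d0.
move=> a; rewrite lt_min => /andP[/Hd h1 /Hd' h2] j.
by rewrite ltnS leq_eqVlt => /orP[/eqP -> //|]; apply: h1.
Qed.

(** Near the cycle and for nearby parameters the derivative of the m-th iterate has modulus at most
    q < 1, so the iterate contracts a small disc and has a fixed point there. That the orbit stays
    in [D] and does not return before time m amounts to finitely many open conditions. *)
Lemma attracting_persist m lam0 x0 : (0 < m)%N -> attracting_periodic D (f lam0) m x0 ->
  exists2 d : R, 0 < d & forall lam, md (lam - lam0) < d ->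
    exists x, attracting_periodic D (f lam) m x.
Proof.
move=> m0 [HDo Hper Hmin Hatt]; pose p := (lam0, x0).
have cd0 := iter_cderiv (fun j (_ : (j < m)%N) => HDo j).
have [_ E] := cderiv_derivable cd0; rewrite E mdE in Hatt.
have {}Hatt : md (dfi lam0 x0 m) < 1 by rewrite -ltcR.
set k := md _ in Hatt; pose q := (1 + k) / 2.
have k0 : 0 <= k by exact: md_ge0.
have q1 : q < 1 by rewrite /q; lra.
have q0 : 0 <= q by rewrite /q; lra.
have kq : 0 < q - k by rewrite /q; lra.
have LLi n : LL (fun a => iter n (f a.1) a.2) p by have [] := @iter_LL p n (fun j _ => HDo j).
have LLd : LL (fun a => dfi a.1 a.2 m) p by have [] := @iter_LL p m (fun j _ => HDo j).
have [d1 d10 H1] := all_near (fun j (_ : (j < m)%N) => LL_nearD (LLi j) (HDo j)).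
have [d2 d20 H2] := LL_near LLd kq.
have [j jm|d3 d30 H3] := @all_near m (fun j a => (0 < j)%N -> iter j (f a.1) a.2 <> a.2) p.
  case: j jm => [|j] jm; first by exists 1.
  have nz : iter j.+1 (f lam0) x0 - x0 != 0 by rewrite subr_eq0; apply/eqP; apply: Hmin.
  have e0 : 0 < md (iter j.+1 (f lam0) x0 - x0) / 2 by rewrite divr_gt0 // md_gt0.
  have [da da0 Ha] := LL_near (LLi j.+1) e0.
  have [db db0 Hb] := LL_near (LL_snd p) e0.
  exists (Num.min da db); first by rewrite lt_min da0.
  move=> a; rewrite lt_min => /andP[/Ha h1 /Hb h2] _ E'; rewrite E' in h1.
  have := md_tri a.2 (iter j.+1 (f lam0) x0) x0.
  by rewrite (md_distC _ a.2); move: h1 h2 => /=; lra.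
pose d := Num.min (Num.min d1 d2) d3.
have d0 : 0 < d by rewrite !lt_min d10 d20.
have dP a : dd a p < d -> [/\ dd a p < d1, dd a p < d2 & dd a p < d3].
  by rewrite !lt_min => /andP[/andP[? ?] ?].
have qd : 0 < (1 - q) * (d / 4) by rewrite mulr_gt0 ?subr_gt0 // divr_gt0.
have [d4 d40 H4] := LL_near (LLi m) qd.
exists (Num.min (d / 2) d4); first by rewrite lt_min divr_gt0.
move=> lam; rewrite lt_min => /andP[ld ld4].
have Hin x : md (x - x0) < d / 2 -> dd (lam, x) p < d.
  by rewrite /dd /=; (move: ld; drop; lra).
have d4d : d / 4 < d / 2 by (move: d0; drop; lra).
have d40' : 0 <= d / 4 by (move: d0; drop; lra).
have [a b ha hb||x hx Gx] := @banach_ball R (iter m (f lam)) x0 (d / 4) q q0 q1 d40'.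
- apply: (@cderiv_lip_ball _ _ (fun x => dfi lam x m) x0 (d / 2) q) => [w hw|w hw||].
  + have [h1 _ _] := dP _ (Hin _ hw); apply: iter_cderiv => j jm; exact: (H1 _ h1 j jm).
  + have [_ h2 _] := dP _ (Hin _ hw); have := H2 _ h2 => /= h3.
    have := mdD (dfi lam w m - dfi lam0 x0 m) (dfi lam0 x0 m); rewrite subrK -/k; (move: h3; drop; lra).
  + exact: le_lt_trans hb d4d.
  + exact: le_lt_trans ha d4d.
- apply: ltW; rewrite -[X in _ - X]Hper; apply: (H4 (lam, x0)).
  by rewrite /dd /= subrr md0 addr0.
have hx' : md (x - x0) < d / 2 by (move: d0 hx; drop; lra).
have [h1 h2 h3] := dP _ (Hin _ hx'); exists x.
have Dj j : (j < m)%N -> D (iter j (f lam) x) by exact: (H1 _ h1 j).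
have cdx := iter_cderiv Dj.
split=> //.
- move=> j; rewrite (divn_eq j m) addnC iterD.
  have -> : iter (j %/ m * m) (f lam) x = x by elim: (j %/ m)%N => //= n IH; rewrite mulSn iterD IH.
  by apply: Dj; rewrite ltn_mod.
- by move=> j /andP[j0 jm]; apply: (H3 _ h3 j jm j0).
have [_ ->] := cderiv_derivable cdx; rewrite mdE -(rmorph1 (real_complex R)) ltcR.
have := H2 _ h2 => /= h4.
have := mdD (dfi lam x m - dfi lam0 x0 m) (dfi lam0 x0 m); rewrite subrK -/k; (move: q1 h4; drop; lra).
Qed.

Lemma ball_connected (z : C) (r : R) : connected [set w | md (w - z) < r].
Proof.
have [r0|r0] := ltP 0 r; last first.
  rewrite (_ : [set w | _] = set0); first exact: connected0.
  by rewrite -subset0 => w /= hw; have := md_ge0 (w - z); lra.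
have -> : [set w | md (w - z) < r] = \bigcup_(w in [set w | md (w - z) < r])
    ((fun t : R => z + t%:C * (w - z)) @` `[0, 1]).
  apply/seteqP; split=> [w /= hw|w /= [v hv [t]]].
    exists w => //; exists 1; first by rewrite /= in_itv /= ler01 lexx.
    by rewrite mul1r subrKC.
  rewrite /= in_itv /= => t01 <-; have := @cball_cvx R z z v r t; rewrite subrr md0; exact.
apply: bigcup_connected.
  exists z => v _; exists 0; first by rewrite /= in_itv /= lexx ler01.
  by rewrite mul0r addr0.
move=> v _; apply: connected_continuous_connected; first exact: segment_connected.
apply: continuous_subspaceT => t; apply/cvg_mdP => e e0.
have k0 := md_ge0 (v - z).
apply/nbhs_ballP; exists (e / (1 + md (v - z))) => /=; first by rewrite divr_gt0 // ltr_wpDr.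
move=> s; rewrite /ball /= distrC ltr_pdivlMr ?ltr_wpDr // => hs.
rewrite (_ : _ - _ = (s - t)%:C * (v - z)); last by rewrite rmorphB /=; ring.
by rewrite mdM md_real; have := normr_ge0 (s - t); nra.
Qed.

Lemma rat_dense (z : C) (r : R) : 0 < r -> exists q : rat * rat,
  md ((ratr q.1 +i* ratr q.2) - z) < r.
Proof.
move=> r0; have r2 : 0 < r / 2 by rewrite divr_gt0.
have dense1 (x : R) : exists q : rat, `|ratr q - x| < r / 2.
  have xr : x - r / 2 < x + r / 2 by lra.
  have [q] := rat_in_itvoo xr.
  by rewrite in_itv /= => /andP[h1 h2]; exists q; rewrite ltr_norml; lra.
have [q1 h1] := dense1 (complex.Re z); have [q2 h2] := dense1 (complex.Im z).
exists (q1, q2) => /=; apply: le_lt_trans (md_ReIm _) _.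
by rewrite ReD ImD ReN ImN /=; lra.
Qed.

(** By persistence a component contains a disc, hence a parameter with rational coordinates; the
    period and this parameter determine it. *)
Lemma hyp_code : exists code : set C -> nat, forall U1 U2,
  hyperbolic_component D h al U1 -> hyperbolic_component D h al U2 -> code U1 = code U2 -> U1 = U2.
Proof.
have key U : exists t : nat * (rat * rat), hyperbolic_component D h al U ->
   hyperbolic_locus D h al t.1 (ratr t.2.1 +i* ratr t.2.2) /\
   U = connected_component (hyperbolic_locus D h al t.1) (ratr t.2.1 +i* ratr t.2.2).
  have [[m m1 [lam [l0 [x0 Hx]] ->]]|nh] := pselect (hyperbolic_component D h al U); last by exists (0%N, (0, 0)).
  have [d d0 Hd] := attracting_persist m1 Hx.
  have l0' : 0 < md lam by rewrite md_gt0.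
  pose r := Num.min d (md lam).
  have r0 : 0 < r by rewrite lt_min d0.
  have [q Hq] := rat_dense lam r0.
  exists (m, q) => _ /=; set lq := (ratr q.1 +i* ratr q.2) in Hq *.
  have sub : [set w | md (w - lam) < r] `<=` hyperbolic_locus D h al m.
    move=> w /=; rewrite lt_min => /andP[h1 h2]; split; last exact: Hd.
    by apply/eqP => w0; rewrite w0 sub0r mdN ltxx in h2.
  split; first exact: sub.
  apply: same_connected_component.
  exists [set w | md (w - lam) < r] => //; split => //; last exact: ball_connected.
  by rewrite /= subrr md0.
have [c Hc] := choice key.
exists (fun U => pickle (c U)) => U1 U2 h1 h2 /(pcan_inj pickleK) E.
by rewrite (Hc _ h1).2 (Hc _ h2).2 E.
Qed.
Ltac keep_hyp H ::= idtac.
End Hyp.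

(** * The real passage through the gate *)

Section Rd.
Variable R : realType.
Implicit Types (f g : R -> R) (x a b s t u v e : R).
Lemma rd_eq f x a b : is_derive x 1 f a -> a = b -> is_derive x 1 f b.
Proof. by move=> h <-. Qed.
Lemma rdK (k : R) x : is_derive x 1 (fun _ : R => k) 0.
Proof. exact: is_derive_cst. Qed.
Lemma rdD f g x a b : is_derive x 1 f a -> is_derive x 1 g b ->
  is_derive x 1 (fun y => f y + g y) (a + b).
Proof. by move=> *; exact: is_deriveD. Qed.
Lemma rdN f x a : is_derive x 1 f a -> is_derive x 1 (fun y => - f y) (- a).
Proof. by move=> *; exact: is_deriveN. Qed.
Lemma rdB f g x a b : is_derive x 1 f a -> is_derive x 1 g b ->
  is_derive x 1 (fun y => f y - g y) (a - b).
Proof. by move=> *; exact: is_deriveB. Qed.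
Lemma rdM f g x a b : is_derive x 1 f a -> is_derive x 1 g b ->
  is_derive x 1 (fun y => f y * g y) (a * g x + f x * b).
Proof.
move=> h1 h2; have h : is_derive x 1 (fun y => f y * g y) _ := is_deriveM h1 h2.
by apply: (rd_eq h); rewrite /GRing.scale /=; ring.
Qed.
Lemma rdZ f x a k : is_derive x 1 f a -> is_derive x 1 (fun y => k * f y) (k * a).
Proof. by move=> h; have := rdM (rdK k x) h; rewrite mul0r add0r. Qed.
Lemma rdV f x a : f x != 0 -> is_derive x 1 f a -> is_derive x 1 (fun y => (f y)^-1) (- a / f x ^+ 2).
Proof.
move=> h0 h1; have h : is_derive x 1 (fun y => (f y)^-1) _ := is_deriveV h0 h1.
by apply: (rd_eq h); rewrite /GRing.scale /=; ring.
Qed.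
Lemma rdC f g x a b : is_derive (g x) 1 f a -> is_derive x 1 g b ->
  is_derive x 1 (fun y => f (g y)) (a * b).
Proof. by move=> h1 h2; exact: (is_derive1_comp h1 h2). Qed.
Lemma rdI x : is_derive x 1 (fun y : R => y) 1.
Proof. exact: is_derive_id. Qed.
Lemma mvt_mono f (df : R -> R) a b : a <= b ->
  (forall x, a <= x <= b -> is_derive x 1 f (df x)) ->
  (forall x, a <= x <= b -> df x <= 0) -> f b <= f a.
Proof.
move=> ab H Hle; have [c cab E] := mvt ab H.
by rewrite -subr_le0 E mulr_le0_ge0 ?subr_ge0 // Hle.
Qed.

(** With a = t^4 the logarithm is 4 ln t < 4 t, so its square is of order sqrt a. *)
Lemma ln_sq_small (K e : R) : 0 < e -> exists2 U : R, 1 <= U &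
  forall a, U <= a -> (K + ln a) ^+ 2 <= e * a.
Proof.
move=> e0; pose k := `|K| + 4.
pose q := k ^+ 2 / e; have q0 : 0 <= q by rewrite divr_ge0 ?sqr_ge0 // ltW.
exists ((1 + q) ^+ 2); first by rewrite expr_ge1 //; lra.
move=> a Ua; have a0 : 0 < a.
  apply: lt_le_trans Ua; rewrite exprn_gt0 //; lra.
have a1 : 1 <= a by apply: le_trans Ua; rewrite expr_ge1 //; lra.
pose s := Num.sqrt a; pose t := Num.sqrt s.
have s2 : s ^+ 2 = a by rewrite sqr_sqrtr // ltW.
have sq : 1 + q <= s.
  by rewrite -(@ler_pXn2r _ 2) ?nnegrE ?sqrtr_ge0 ?s2 //; lra.
have t2 : t ^+ 2 = s by rewrite sqr_sqrtr // sqrtr_ge0.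
have t1 : 1 <= t by rewrite -(@ler_pXn2r _ 2) ?nnegrE ?sqrtr_ge0 ?t2 //; lra.
have t0 : 0 < t by lra.
have la : ln a = 4 * ln t.
  rewrite -s2 -t2 -exprM lnXn //; ring.
have lt0 : 0 <= ln t by rewrite ln_ge0.
have ltt : ln t < t := ln_sublinear t0.
have kK : `|K + ln a| <= k * t.
  apply: le_trans (ler_normD _ _) _; rewrite la (ger0_norm (_ : 0 <= 4 * _)); last lra.
  have : `|K| <= `|K| * t by rewrite ler_peMr.
  rewrite /k; (move: ltt; drop; nra).
have -> : (K + ln a) ^+ 2 = `|K + ln a| ^+ 2 by rewrite real_normK ?num_real.
apply: (@le_trans _ _ ((k * t) ^+ 2)).
  by rewrite ler_pXn2r ?nnegrE ?mulr_ge0 ?(ltW t0) // /k; have := normr_ge0 K; (drop; lra).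
rewrite exprMn t2 -s2 (expr2 s) mulrA ler_wpM2r ?sqrtr_ge0 //.
have : q <= s by (move: sq; drop; lra).
by rewrite /q ler_pdivrMr // mulrC.
Qed.

(** The bound on [dI] is minus the derivative of K (ln s + 2) / s. Added to [I] or to its opposite,
    this function therefore gives a nonincreasing one. *)
Lemma tail_bound (I dI : R -> R) (K : R) :
  (forall s, 1 <= s -> is_derive s 1 I (dI s)) ->
  (forall s, 1 <= s -> `|dI s| <= K * ((ln s + 1) / s ^+ 2)) -> 0 <= K ->
  forall a b, 1 <= a -> a <= b -> `|I b - I a| <= K * ((ln a + 2) / a).
Proof.
move=> HI Hb K0 a b a1 ab.
pose B s := K * ((ln s + 2) / s).
have dB s : 1 <= s -> is_derive s 1 B (- (K * ((ln s + 1) / s ^+ 2))).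
  move=> s1; have s0 : 0 < s by lra.
  have h := rdZ K (rdM (rdD (is_derive1_ln s0) (rdK 2 s)) (rdV (lt0r_neq0 s0) (rdI s))).
  apply: (rd_eq h); field; exact: lt0r_neq0.
have Bpos s : 1 <= s -> 0 <= B s.
  move=> s1; have l0 := ln_ge0 s1; rewrite /B mulr_ge0 // divr_ge0 //; lra.
have up : I b + B b <= I a + B a.
  apply: (@mvt_mono (fun s => I s + B s) (fun s => dI s + - (K * ((ln s + 1) / s ^+ 2)))) => // s /andP[s1 _].
    by apply: rdD; [apply: HI | apply: dB]; lra.
  have s1' : 1 <= s by lra.
  have := Hb s s1'; rewrite ler_norml; lra.
have lo : - I b + B b <= - I a + B a.
  apply: (@mvt_mono (fun s => - I s + B s) (fun s => - dI s + - (K * ((ln s + 1) / s ^+ 2)))) => // s /andP[s1 _].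
    by apply: rdD; [apply: rdN; apply: HI | apply: dB]; lra.
  have s1' : 1 <= s by lra.
  have := Hb s s1'; rewrite ler_norml; lra.
have := Bpos b (le_trans a1 ab); rewrite -/(B a) ler_norml; lra.
Qed.
End Rd.

(** * The limit flow, its time, and the second order correction *)

Section Theta.
Variables (R : realType) (b : R).
Hypothesis b0 : 0 < b.
Ltac keep_hyp H ::= tryif first [constr_eq H b0] then fail else idtac.
Implicit Types (s t u v e x : R).
Definition cc : R := 1 / 4 + b ^+ 2.
Definition G (u : R) : R := u ^+ 2 + u + cc.
Definition Lb : R := pi / b.
Definition th (u : R) : R := atan ((u + 1 / 2) / b) / b.
Lemma GE u : G u = (u + 1 / 2) ^+ 2 + b ^+ 2.
Proof. by rewrite /G /cc; field. Qed.
Lemma b2 : 0 < b ^+ 2. Proof. exact: exprn_gt0. Qed.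
Lemma G_ge u : b ^+ 2 <= G u.
Proof. by rewrite GE lerDr sqr_ge0. Qed.
Lemma G_gt0 u : 0 < G u.
Proof. exact: lt_le_trans b2 (G_ge u). Qed.
Lemma G_sym u : G (-1 - u) = G u.
Proof. by rewrite /G /cc; ring. Qed.
Lemma G_der u : is_derive u 1 G (2 * u + 1).
Proof.
have h := rdD (rdD (rdM (rdI u) (rdI u)) (rdI u)) (rdK cc u).
have -> : G = (fun y => y * y + y + cc) by apply/funext => y; rewrite /G expr2.
by apply: (rd_eq h); ring.
Qed.
Lemma th_der u : is_derive u 1 th (G u)^-1.
Proof.
have bn := lt0r_neq0 b0.
have h1 : is_derive u 1 (fun y => (y + 1 / 2) / b) (1 / b).
  have h := rdM (rdD (rdI u) (rdK (1 / 2) u)) (rdK b^-1 u).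
  by apply: (rd_eq h); rewrite mulr0 !addr0.
have h := rdM (rdC (is_derive1_atan _) h1) (rdK b^-1 u).
apply: (rd_eq h); rewrite GE; field.
by rewrite bn andbT lt0r_neq0 // ltr_wpDl ?sqr_ge0 // mulr_gt0 // b2.
Qed.
Lemma th_lt u : th u < Lb / 2.
Proof. by rewrite /th /Lb mulrAC ltr_pM2r ?invr_gt0 // atan_ltpi2. Qed.
Lemma th_gt u : - (Lb / 2) < th u.
Proof. by rewrite /th /Lb mulrAC -mulNr ltr_pM2r ?invr_gt0 // atan_gtNpi2. Qed.
Lemma th_sym u : th (-1 - u) = - th u.
Proof.
rewrite /th -mulNr -atanN; congr (atan _ / _); field; exact: lt0r_neq0.
Qed.
Lemma th_lim (u e : R) : 0 < e -> exists2 v, u < v & Lb / 2 - e < th v.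
Proof.
move=> e0; have eb : 0 < e * b by rewrite mulr_gt0.
have := @cvgy_atan R; move=> /cvgrPdist_lt/(_ _ eb)[M [_ HM]].
pose x := Num.max (M + 1) ((u + 1 / 2) / b + 1).
exists (x * b - 1 / 2).
  have : (u + 1 / 2) / b < x by rewrite /x lt_max; apply/orP; right; rewrite ltrDl.
  by rewrite ltr_pdivrMr //; lra.
have Mx : M < x by rewrite /x lt_max; apply/orP; left; rewrite ltrDl.
have := HM x Mx => /=; rewrite ltr_norml => /andP[_ h].
rewrite /th subrK mulfK ?lt0r_neq0 // /Lb mulrAC.
rewrite ltrBlDr -ltrBlDl -mulrBl ltr_pdivrMr //.
Qed.

(** th t + 1 / t is nonincreasing because G t >= t^2 for t > 0, while [th] comes close to [Lb / 2]
    at infinity. The lower bound [th_lo] compares [G t] with (t + 1 + cc)^2 in the same way. *)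
Lemma th_up u : 0 < u -> Lb / 2 - th u <= 1 / u.
Proof.
move=> u0; apply/ler_addgt0Pr => e e0; have [v uv hv] := th_lim u e0.
have h : th v + 1 / v <= th u + 1 / u.
  apply: (@mvt_mono _ (fun t => th t + 1 / t) (fun t => (G t)^-1 + (1 * (- 1 / t ^+ 2)))) => [|t /andP[t1 _]|t /andP[t1 _]].
  - exact: ltW.
  - have t0 : t != 0 by apply: lt0r_neq0; lra.
    by apply: rdD; [exact: th_der | apply: rdZ; apply: rdV (rdI t)].
  have t0 : 0 < t by lra.
  rewrite mul1r mulN1r subr_le0 lef_pV2 ?posrE ?exprn_gt0 ?G_gt0 //.
  by rewrite /G -addrA lerDl addr_ge0 ?(ltW t0) // /cc addr_ge0 ?(ltW b2).
have : 0 < 1 / v by rewrite divr_gt0 //; lra.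
lra.
Qed.

Lemma cc_gt0 : 0 < cc. Proof. by rewrite /cc ltr_wpDl ?b2 // divr_ge0. Qed.

Lemma th_lo u : 0 < u -> 1 / (u + 1 + cc) <= Lb / 2 - th u.
Proof.
move=> u0; have c0 := cc_gt0; set k := 1 + cc; rewrite -addrA -/k.
have k1 : 1 < k by rewrite /k; lra.
apply/ler_addgt0Pr => e e0.
pose v := u + 1 / e.
have e1 : 0 < 1 / e by rewrite divr_gt0.
have uv : u <= v by rewrite /v; lra.
have h : - th v - 1 / (v + k) <= - th u - 1 / (u + k).
  apply: (@mvt_mono _ (fun t => - th t - 1 / (t + k)) (fun t => - (G t)^-1 - (1 * (- (1 + 0) / (t + k) ^+ 2)))) => [|t /andP[t1 _]|t /andP[t1 _]].
  - exact: uv.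
  - have t0 : t + k != 0 by apply: lt0r_neq0; lra.
    apply: rdB; first by apply: rdN; exact: th_der.
    by apply: rdZ; apply: rdV => //; apply: rdD (rdI t) (rdK _ _).
  have t0 : 0 < t by lra.
  have tk : 0 < t + k by lra.
  rewrite mul1r addr0 mulN1r opprK addrC subr_le0 lef_pV2 ?posrE ?exprn_gt0 ?G_gt0 //.
  rewrite /G /k; nra.
have : 1 / (v + k) <= e.
  rewrite ler_pdivrMr; last lra.
  rewrite /v mulrDr mulrDr mulrCA divff ?lt0r_neq0 // mulr1; nra.
have := th_lt v; lra.
Qed.

(** The source term of the equation G k' = k + ff, chosen so that the terms of order tau^2 cancel in
    the increment of [Theta]: ln(G)/2 stems from the decrease of the factor 1/T, and -1/2 from the
    second order term of ln T. *)
Definition ff u : R := ln (G u) / 2 - 1 / 2.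
Definition FF u : R := expR (- th u) * ff u / G u.

Lemma ff_der u : is_derive u 1 ff ((2 * u + 1) / (2 * G u)).
Proof.
have g0 := G_gt0 u.
have h := rdB (rdM (rdC (is_derive1_ln g0) (G_der u)) (rdK (1 / 2) u)) (rdK (1 / 2) u).
have -> : ff = (fun y => ln (G y) * (1 / 2) - 1 / 2) by apply/funext => y; rewrite /ff mul1r.
apply: (rd_eq h); field; exact: lt0r_neq0.
Qed.

Lemma FF_cont : continuous FF.
Proof.
move=> u; apply: differentiable_continuous; apply/derivable1_diffP.
have h := rdM (rdM (rdC (is_derive_expR _) (rdN (th_der u))) (ff_der u)) (rdV (lt0r_neq0 (G_gt0 u)) (G_der u)).
exact: (@ex_derive _ _ _ _ _ _ _ h).
Qed.

Lemma ln2cc : 0 <= ln (2 + cc).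
Proof. by apply: ln_ge0; have := cc_gt0; lra. Qed.

Lemma FF_bound s : 1 <= s ->
  `|ff s| / G s <= (1 + ln (2 + cc)) * ((ln s + 1) / s ^+ 2).
Proof.
move=> s1; have c0 := cc_gt0; have s0 : 0 < s by lra.
have G1 : s ^+ 2 <= G s by rewrite /G; lra.
have s2 : 1 <= s ^+ 2 by rewrite expr_ge1 //; lra.
have ls := ln_ge0 s1; have lc := ln2cc.
have l1 : 0 <= ln (G s) by rewrite ln_ge0; lra.
have l2 : ln (G s) <= ln (2 + cc) + 2 * ln s.
  have -> : 2 * ln s = ln (s ^+ 2) by rewrite lnXn // mulr_natl.
  rewrite -lnM ?posrE ?exprn_gt0 //; last by lra.
  rewrite ler_ln ?posrE ?G_gt0 ?mulr_gt0 ?exprn_gt0 //; last by lra.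
  rewrite /G; nra.
have fb : `|ff s| <= (1 + ln (2 + cc)) * (ln s + 1).
  rewrite /ff ler_norml; apply/andP; split; nra.
rewrite mulrA; apply: ler_pM => //; first by rewrite invr_ge0 ltW // G_gt0.
by rewrite lef_pV2 ?posrE ?G_gt0 ?exprn_gt0.
Qed.

(** By variation of constants k is exp(th) times a primitive [I] of [FF]. As [FF] is of order ln s /
    s^2 at both ends, [I] and k are bounded and have limits; the limits of k make up the constant in
    the exit phase. *)
Lemma k_exists : exists k : R -> R, [/\ forall u, is_derive u 1 k ((k u + ff u) / G u),
  exists2 M : R, 0 < M & forall u, `|k u| <= M &
  exists kp km : R, forall e, 0 < e -> exists2 U : R, 1 <= U &
    forall u, U <= u -> `|k u - kp| < e /\ `|k (- u) - km| < e].
Proof.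
have [I HI] := prim FF_cont.
pose E := expR (Lb / 2); have E0 : 0 < E by exact: expR_gt0.
pose K := E * (1 + ln (2 + cc)).
have K0 : 0 <= K by rewrite mulr_ge0 ?(ltW E0) // addr_ge0 // ln2cc.
have eE u : expR (- th u) <= E by rewrite ler_expR; have := th_gt u; lra.
have eE' u : expR (th u) <= E by rewrite ler_expR; have := th_lt u; lra.
have FB s : 1 <= s -> `|FF s| <= K * ((ln s + 1) / s ^+ 2).
  move=> s1; rewrite /FF -mulrA normrM ger0_norm ?expR_ge0 // normrM (ger0_norm (_ : 0 <= (G s)^-1)).
    rewrite /K -mulrA; apply: ler_pM; rewrite ?expR_ge0 ?mulr_ge0 ?invr_ge0 ?(ltW (G_gt0 s)) //.
    exact: FF_bound.
  by rewrite invr_ge0 ltW // G_gt0.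
have FB' s : 1 <= s -> `|- FF (-1 - s)| <= K * ((ln s + 1) / s ^+ 2).
  move=> s1; rewrite normrN /FF G_sym th_sym opprK.
  have -> : ff (-1 - s) = ff s by rewrite /ff G_sym.
  rewrite -mulrA normrM ger0_norm ?expR_ge0 // normrM (ger0_norm (_ : 0 <= (G s)^-1)).
    rewrite /K -mulrA; apply: ler_pM; rewrite ?expR_ge0 ?mulr_ge0 ?invr_ge0 ?(ltW (G_gt0 s)) //.
    exact: FF_bound.
  by rewrite invr_ge0 ltW // G_gt0.
(* By the symmetry u -> -1 - u, the end -oo of [I] is the end +oo of this function. *)
pose J s := I (-1 - s).
have HJ s : is_derive s 1 J (- FF (-1 - s)).
  have h := @rdC _ I (fun y => -1 - y) s _ _ (HI (-1 - s)) (rdB (rdK (-1) s) (rdI s)).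
  by apply: (rd_eq h); rewrite sub0r mulrN1.
have TI := tail_bound (fun s _ => HI s) FB K0.
have TJ := tail_bound (fun s _ => HJ s) FB' K0.
have tail0 e : 0 < e -> exists n : nat, K * ((ln n.+1%:R + 2) / n.+1%:R) < e.
  move=> e0; have e1 : 0 < e / (1 + K) by rewrite divr_gt0 //; lra.
  have [U U1 HU] := ln_sq_small 2 e1.
  exists (Num.bound U).
  have nU : U <= (Num.bound U).+1%:R.
    by apply: ltW; apply: lt_trans (archi_boundP _) _; [(move: U1; drop; lra) | rewrite ltr_nat].
  set a : R := (Num.bound U).+1%:R in nU *.
  have a1 : 1 <= a by (move: U1 nU; drop; lra).
  have la := ln_ge0 a1; have := HU a nU.
  have a0 : 0 < a by (move: U1 nU; drop; lra).
  rewrite mulrA ltr_pdivrMr // addrC => h.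
  have h2 : (ln a + 2) <= e / (1 + K) * a by apply: le_trans h; rewrite expr2; nra.
  apply: (@le_lt_trans _ _ (K * (e / (1 + K) * a))); first by rewrite ler_wpM2l.
  rewrite mulrA ltr_pM2r // mulrCA -{2}(mulr1 e) ltr_pM2l // ltr_pdivrMr; (move: K0; drop; lra).
have lim (Q : R -> R) : (forall a c, 1 <= a -> a <= c -> `|Q c - Q a| <= K * ((ln a + 2) / a)) ->
    exists l : R, forall e, 0 < e -> exists2 U : R, 1 <= U & forall u, U <= u -> `|Q u - l| < e.
  move=> TQ.
  have n1 n : 1 <= (n.+1%:R : R) by rewrite ler1n.
  have [n m nm||l Hl] := @rcauchy R (fun n => Q n.+1%:R) (fun n => K * ((ln n.+1%:R + 2) / n.+1%:R)).
  - by apply: TQ => //; rewrite ler_nat.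
  - exact: tail0.
  exists l => e e0; have e2 : 0 < e / 2 by lra.
  have [n Hn] := tail0 _ e2; exists n.+1%:R => // u nu.
  have -> : Q u - l = (Q u - Q n.+1%:R) + (Q n.+1%:R - l) by ring.
  apply: le_lt_trans (ler_normD _ _) _.
  move: Hn (TQ _ _ (n1 n) nu) (Hl n).
  move: (K * _) `|Q u - _| `|_ - l| => x1 x2 x3; (drop; lra).
have [Ip HIp] := lim I TI; have [Jp HJp] := lim J TJ.
(* The tails bound [I] for u >= 1 and u <= -2; in between [FF] is bounded. *)
have IM : exists2 M : R, 0 < M & forall u, `|I u| <= M.
  pose M1 : R := `|I 1| + 2 * K; pose M2 : R := `|J 1| + 2 * K.
  have h1 u : 1 <= u -> `|I u| <= M1.
    move=> u1; rewrite -(subrK (I 1) (I u)) addrC; apply: le_trans (ler_normD _ _) _.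
    by rewrite lerD2l; have := TI _ _ (lexx 1) u1; rewrite ln1 add0r divr1; (drop; lra).
  have h2 u : u <= -2 -> `|I u| <= M2.
    move=> u2; have -> : I u = J (-1 - u) by rewrite /J; congr I; ring.
    rewrite -(subrK (J 1) (J _)) addrC; apply: le_trans (ler_normD _ _) _.
    have u1 : 1 <= -1 - u by (move: u2; drop; lra).
    by rewrite lerD2l; have := TJ _ _ (lexx 1) u1; rewrite ln1 add0r divr1; (drop; lra).
  pose B := E * (`|ln (b ^+ 2)| + `|ln (9 / 4 + b ^+ 2)| + 1) / b ^+ 2.
  have bp := b2.
  have hB u : -2 <= u <= 1 -> `|FF u| <= B.
    move=> /andP[u1 u2]; have g0 := G_gt0 u; have g1 := G_ge u.
    have g2 : G u <= 9 / 4 + b ^+ 2 by rewrite GE; (move: u1 u2; drop; nra).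
    have l1 : ln (b ^+ 2) <= ln (G u) by rewrite ler_ln ?posrE.
    have l2 : ln (G u) <= ln (9 / 4 + b ^+ 2) by rewrite ler_ln ?posrE //; (move: bp; drop; lra).
    have n1 := ler_norm (ln (9 / 4 + b ^+ 2)); have n2 := ler_norm (- ln (b ^+ 2)).
    rewrite normrN in n2.
    have m1 := normr_ge0 (ln (9 / 4 + b ^+ 2)); have m2 := normr_ge0 (ln (b ^+ 2)).
    rewrite /FF normrM normrM (ger0_norm (_ : 0 <= (G u)^-1)) ?invr_ge0 ?(ltW g0) //.
    rewrite (ger0_norm (expR_ge0 _)) /B.
    apply: ler_pM; rewrite ?mulr_ge0 ?expR_ge0 ?invr_ge0 ?(ltW g0) //; last by rewrite lef_pV2 ?posrE.
    apply: ler_pM; rewrite ?expR_ge0 //.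
    by rewrite /ff ler_norml; apply/andP; split; (move: l1 l2 n1 n2 m1 m2; drop; lra).
  have B0 : 0 <= B.
    by rewrite /B divr_ge0 ?(ltW bp) // mulr_ge0 ?(ltW E0) // !addr_ge0.
  have h3 u : -2 <= u <= 1 -> `|I u| <= `|I 1| + B * 3.
    move=> /andP[u1 u2]; rewrite -(subrK (I 1) (I u)) addrC; apply: le_trans (ler_normD _ _) _.
    rewrite lerD2l distrC.
    have h4 : `|I 1 - I u| <= B * (1 - u).
      apply: (mvt_le u2) => t /andP[t1 t2].
      by apply: hB; (move: u1 t1 t2; drop; lra).
    apply: le_trans h4 _; apply: ler_wpM2l => //; lra.
  exists (M1 + M2 + (`|I 1| + B * 3) + 1).
    rewrite /M1 /M2; have := normr_ge0 (I 1); have := normr_ge0 (J 1); (move: K0 B0; drop; lra).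
  move=> u; have nI := normr_ge0 (I 1); have nJ := normr_ge0 (J 1).
  have M10 : 0 <= M1 by rewrite /M1; lra.
  have M20 : 0 <= M2 by rewrite /M2; (move: K0 nJ; drop; lra).
  have [u1|u1] := leP 1 u; first by have := h1 u u1; (move: B0 nI M20; drop; lra).
  have [u2|u2] := leP u (-2); first by have := h2 u u2; (move: B0 nI M10; drop; lra).
  have u3 : -2 <= u <= 1 by (move: u1 u2; drop; lra).
  have := h3 u u3; (move: M10 M20; drop; lra).
have [M M0 HM] := IM.
have dexp x y : x <= y -> y <= Lb / 2 -> `|expR y - expR x| <= E * (y - x).
  move=> xy yL; apply: mvt_le => // t /andP[t1 t2].
  by rewrite ger0_norm ?expR_ge0 // ler_expR; (move: yL t2; drop; lra).
pose k u := expR (th u) * I u.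
exists k; split.
- move=> u; have h := rdM (rdC (is_derive_expR _) (th_der u)) (HI u).
  apply: (rd_eq h); rewrite /FF /k expRN; field.
  by rewrite (lt0r_neq0 (G_gt0 u)) lt0r_neq0 // expR_gt0.
- exists (E * M); first by rewrite mulr_gt0.
  by move=> u; rewrite normrM ger0_norm ?expR_ge0 //; apply: ler_pM; rewrite ?expR_ge0.
exists (E * Ip), (expR (- (Lb / 2)) * Jp) => e e0.
pose W := 2 * E * (1 + `|Ip| + `|Jp|).
have np := normr_ge0 Ip; have nj := normr_ge0 Jp.
have W0 : 0 < W by rewrite /W !mulr_gt0 //; lra.
have e2E : 0 < e / (2 * E) by rewrite divr_gt0 // mulr_gt0.
have [U1 U11 HU1] := HIp _ e2E; have [U2 U21 HU2] := HJp _ e2E.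
pose U := U1 + U2 + W / e + 1.
have We : 0 < W / e by rewrite divr_gt0.
exists U; first by rewrite /U; (move: U11 U21 We; drop; lra).
move=> u Uu.
have uw (v : R) : W / e < v -> E * (1 / v) * (1 + `|Ip| + `|Jp|) < e / 2.
  move=> hv; have v0 : 0 < v by lra.
  rewrite ltr_pdivrMr // in hv.
  have -> : E * (1 / v) * (1 + `|Ip| + `|Jp|) = W / v / 2 by rewrite /W; field; exact: lt0r_neq0.
  by rewrite ltr_pM2r ?invr_gt0 // ltr_pdivrMr // mulrC.
have comb (x : R) (Q l : R) (y : R) : x <= y -> y <= Lb / 2 -> `|Q - l| < e / (2 * E) ->
    E * (y - x) * `|l| < e / 2 -> `|expR x * Q - expR y * l| < e.
  move=> xy yL Ql h.
  have -> : expR x * Q - expR y * l = expR x * (Q - l) - (expR y - expR x) * l by ring.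
  apply: le_lt_trans (ler_normB _ _) _; rewrite !normrM (ger0_norm (expR_ge0 _)).
  have h1 : expR x * `|Q - l| <= e / 2.
    apply: (@le_trans _ _ (E * (e / (2 * E)))).
      by apply: ler_pM; [exact: expR_ge0 | exact: normr_ge0 | rewrite ler_expR; (move: xy yL; drop; lra) | exact: ltW].
    by rewrite le_eqVlt; apply/orP; left; apply/eqP; field; exact: lt0r_neq0.
  have h2 : `|expR y - expR x| * `|l| <= E * (y - x) * `|l| by apply: ler_wpM2r => //; exact: dexp.
  (move: h h1 h2; drop; lra).
split.
  rewrite /k; have u0 : 0 < u by rewrite /U in Uu; (move: U11 U21 We Uu; drop; lra).
  apply: comb; [by have := th_lt u; (move: U21 We Uu; drop; lra)|(move: U21 We Uu; drop; lra)|by apply: HU1; rewrite /U in Uu; (move: U21 We Uu; drop; lra)|].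
  have Wu : W / e < u by rewrite /U in Uu; (move: U11 U21 Uu; drop; lra).
  apply: le_lt_trans (uw u Wu); have h := th_up u0; have h' := th_lt u.
  by apply: ler_pM; rewrite ?mulr_ge0 ?(ltW E0) //; [(move: nj h h'; drop; lra)|apply: ler_wpM2l; [exact: ltW|(move: nj h h'; drop; lra)]|(move: nj h h'; drop; lra)].
have -> : - u = -1 - (u - 1) by ring.
rewrite /k th_sym -/(J (u - 1)); set v := u - 1.
have v0 : 0 < v by rewrite /v /U in Uu *; (move: U11 U21 We Uu; drop; lra).
have Wv : W / e < v by rewrite /v /U in Uu *; (move: U11 U21 Uu; drop; lra).
have h := th_up v0; have h' := th_lt v.
have hJ : `|J v - Jp| < e / (2 * E) by apply: HU2; rewrite /v /U in Uu *; (move: U11 We Uu; drop; lra).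
have -> : expR (- th v) * J v - expR (- (Lb / 2)) * Jp =
   expR (- th v) * (J v - Jp) + (expR (- th v) - expR (- (Lb / 2))) * Jp by ring.
apply: le_lt_trans (ler_normD _ _) _; rewrite !normrM (ger0_norm (expR_ge0 _)).
have h1 : expR (- th v) * `|J v - Jp| <= e / 2.
  apply: (@le_trans _ _ (E * (e / (2 * E)))).
    by apply: ler_pM; [exact: expR_ge0 | exact: normr_ge0 | exact: eE | exact: ltW].
  by rewrite le_eqVlt; apply/orP; left; apply/eqP; field; exact: lt0r_neq0.
have h2 : `|expR (- th v) - expR (- (Lb / 2))| <= E * (1 / v).
  apply: le_trans (dexp _ _ _ _) _; [(move: h h'; drop; lra)| |by apply: ler_wpM2l; [exact: ltW | (move: h h'; drop; lra)]].
  by have := th_gt v; (drop; lra).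
have h3 := uw v Wv.
have : `|expR (- th v) - expR (- (Lb / 2))| * `|Jp| <= E * (1 / v) * (1 + `|Ip| + `|Jp|).
  apply: ler_pM => //; (move: np; drop; lra).
(move: h1 h3; drop; lra).
Qed.
Ltac keep_hyp H ::= idtac.
End Theta.

(** * One step of the recursion, and the increment of the first integral *)

Section Step.
Variables (R : realType) (b : R).
Hypothesis b0 : 0 < b.
Ltac keep_hyp H ::= tryif first [constr_eq H b0] then fail else idtac.
Implicit Types (s t u v e x tau : R).
Let G := G b.
Let th := th b.
Let ff := ff b.
Let Lb := Lb b.

Lemma ln1_quad x : `|x| <= 1 / 2 -> `|ln (1 + x) - x| <= 2 * x ^+ 2.
Proof.
move=> hx; have x12 : - (1 / 2) <= x <= 1 / 2 by rewrite -ler_norml.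
pose p t := ln (1 + t * x) - t * x.
have dp t : 0 <= t <= 1 -> is_derive t 1 p ((1 + t * x)^-1 * x - x).
  move=> /andP[t0 t1]; have h0 : 0 < 1 + t * x by nra.
  have hl := @rdC _ (@ln R) (fun t => 1 + t * x) t _ _ (is_derive1_ln h0) (rdD (rdK 1 t) (rdM (rdI t) (rdK x t))).
  have h := rdB hl (rdM (rdI t) (rdK x t)).
  by apply: (rd_eq h); ring.
have := @mvt_le _ p _ 0 1 (2 * x ^+ 2) ler01 dp.
rewrite subr0 mulr1 /p mul1r mul0r addr0 ln1 subr0 subr0; apply => t /andP[t0 t1].
have h0 : 1 / 2 <= 1 + t * x by nra.
have h1 : 0 < 1 + t * x by lra.
have -> : (1 + t * x)^-1 * x - x = - (t * x ^+ 2 / (1 + t * x)) by field; exact: lt0r_neq0.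
have x2 := sqr_ge0 x.
rewrite normrN ger0_norm; last by apply: divr_ge0; [exact: mulr_ge0 | exact: ltW].
rewrite ler_pdivrMr //; nra.
Qed.

Lemma ln1_cubic x : 0 <= x -> `|ln (1 + x) - x + x ^+ 2 / 2| <= x ^+ 3.
Proof.
move=> x0.
pose p t := ln (1 + t) - t + t ^+ 2 / 2.
have dp t : 0 <= t <= x -> is_derive t 1 p (t ^+ 2 / (1 + t)).
  move=> /andP[t0 t1]; have h0 : 0 < 1 + t by lra.
  have hl := @rdC _ (@ln R) (fun t => 1 + t) t _ _ (is_derive1_ln h0) (rdD (rdK 1 t) (rdI t)).
  have h := rdD (rdB hl (rdI t)) (rdM (rdM (rdI t) (rdI t)) (rdK (2^-1) t)).
  have -> : p = (fun y => ln (1 + y) - y + y * y * 2^-1) by apply/funext => y; rewrite /p expr2.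
  by apply: (rd_eq h); field; exact: lt0r_neq0.
have := @mvt_le _ p _ 0 x (x ^+ 2) x0 dp.
rewrite subr0 /p addr0 ln1 subr0 expr0n mul0r addr0 subr0 -exprSr; apply => t /andP[t0 t1].
rewrite ger0_norm; last by rewrite divr_ge0 ?sqr_ge0 //; lra.
rewrite ler_pdivrMr; last by lra.
have tx : t ^+ 2 <= x ^+ 2 by rewrite ler_pXn2r ?nnegrE.
by have := sqr_ge0 x; nra.
Qed.

(** The square of the step tau G measured against sqrt G, the scale on which [G] varies; since (2u +
    1)^2 <= 4 G, it controls the relative change of [G] during a step. *)
Definition sg (tau u : R) : R := tau ^+ 2 * G u.

Lemma sgB tau u : (tau * (2 * u + 1)) ^+ 2 <= 4 * sg tau u.
Proof. by rewrite /sg /G GE; have := b2 b0; have := sqr_ge0 tau; nra. Qed.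

Lemma GD u x : G (u + x) = G u + x * (2 * u + 1) + x ^+ 2.
Proof. by rewrite /G /Submission.G; ring. Qed.

Lemma seg_facts tau u t : 0 <= tau -> sg tau u <= 1 / 64 -> 0 <= t <= 1 ->
  [/\ `|tau * (2 * u + 1)| <= 1 / 4, G (u + t * (tau * G u)) =
   G u * (1 + (t * (tau * (2 * u + 1)) + t ^+ 2 * sg tau u)) &
   1 / 2 <= 1 + (t * (tau * (2 * u + 1)) + t ^+ 2 * sg tau u)].
Proof.
move=> tau0 s64 /andP[t0 t1]; have B2 := sgB tau u.
have Bb : `|tau * (2 * u + 1)| <= 1 / 4.
  by rewrite -(@ler_pXn2r _ 2) ?nnegrE ?normr_ge0 // real_normK ?num_real //; lra.
split=> //; first by rewrite GD /sg; ring.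
have s0 : 0 <= sg tau u by rewrite /sg mulr_ge0 ?sqr_ge0 // ltW // G_gt0.
move: Bb; rewrite ler_norml => /andP[b1 b2]; have := sqr_ge0 t; nra.
Qed.

Lemma th_step tau u : 0 <= tau -> sg tau u <= 1 / 64 ->
  `|th (u + tau * G u) - th u - tau + tau ^+ 2 * (2 * u + 1) / 2| <= 12 * (tau * sg tau u).
Proof.
move=> tau0 s64; set B := tau * (2 * u + 1).
pose p t := th (u + t * (tau * G u)) - t * tau + t ^+ 2 * (tau * B) / 2.
have s0 : 0 <= sg tau u by rewrite /sg mulr_ge0 ?sqr_ge0 // ltW // G_gt0.
have B2 := sgB tau u; rewrite -/B in B2.
have dp t : 0 <= t <= 1 -> is_derive t 1 p ((G (u + t * (tau * G u)))^-1 * (tau * G u) - tau + t * (tau * B)).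
  move=> _.
  have hl := @rdC _ th (fun t => u + t * (tau * G u)) t _ _ (th_der b0 _) (rdD (rdK u t) (rdM (rdI t) (rdK (tau * G u) t))).
  have h := rdD (rdB hl (rdM (rdI t) (rdK tau t))) (rdM (rdM (rdI t) (rdI t)) (rdK (tau * B / 2) t)).
  have -> : p = (fun y => th (u + y * (tau * G u)) - y * tau + y * y * (tau * B / 2)).
    by apply/funext => y; rewrite /p; congr (_ + _); ring.
  by apply: (rd_eq h); rewrite /G; field; rewrite lt0r_neq0 // G_gt0.
have := @mvt_le _ p _ 0 1 (12 * (tau * sg tau u)) ler01 dp.
rewrite subr0 mulr1 /p !mul1r !mul0r addr0 expr1n expr0n /= !mul0r mul1r subr0 addr0.
have -> : th (u + tau * G u) - tau + tau * B / 2 - th u =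
   th (u + tau * G u) - th u - tau + tau ^+ 2 * (2 * u + 1) / 2 by rewrite /B; ring.
apply => t t01; have [Bb GEt h12] := seg_facts tau0 s64 t01.
have /andP[t0 t1] := t01.
rewrite -/B in Bb GEt h12; set A := t * B + t ^+ 2 * sg tau u in GEt h12 *.
have h1 : 0 < 1 + A by lra.
have g0 := lt0r_neq0 (G_gt0 b0 u).
have -> : (G (u + t * (tau * G u)))^-1 * (tau * G u) - tau + t * (tau * B) =
   tau * ((- (t ^+ 2 * sg tau u) + t * B * A) / (1 + A)).
  rewrite GEt /A; field; rewrite -/A (lt0r_neq0 h1) //.
rewrite normrM (ger0_norm tau0) (_ : 12 * (tau * sg tau u) = tau * (12 * sg tau u)); last by ring.
apply: ler_wpM2l => //.
rewrite normrM (ger0_norm (_ : 0 <= (1 + A)^-1)); last by rewrite invr_ge0 ltW.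
rewrite ler_pdivrMr //.
have e1 : `|- (t ^+ 2 * sg tau u) + t * B * A| <= 6 * sg tau u.
  move: Bb; rewrite ler_norml => /andP[bb1 bb2].
  have t2 : 0 <= t ^+ 2 <= 1 by rewrite sqr_ge0 expr_le1.
  move: t2 => /andP[t20 t21].
  have x1 : 0 <= t ^+ 2 * sg tau u <= sg tau u by apply/andP; split; (move: s0 t21; drop; nra).
  have x2 : t * B * A = t ^+ 2 * B ^+ 2 + t ^+ 2 * (t * B) * sg tau u by rewrite /A; ring.
  have x3 : 0 <= t ^+ 2 * B ^+ 2 <= 4 * sg tau u.
    have := sqr_ge0 B; move=> ?; apply/andP; split; (move: B2 t21; drop; nra).
  have x4 : - sg tau u <= t ^+ 2 * (t * B) * sg tau u <= sg tau u.
    have : -1 <= t ^+ 2 * (t * B) <= 1.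
      have : -1 <= t * B <= 1 by apply/andP; split; (move: s64 B2 t01; drop; nra).
      move=> /andP[? ?]; apply/andP; split; nra.
    move=> /andP[? ?]; apply/andP; split; nra.
  move: x1 x3 x4 => /andP[? ?] /andP[? ?] /andP[? ?]; rewrite x2 ler_norml; apply/andP; split; lra.
apply: le_trans e1 _; nra.
Qed.

Variables (k : R -> R) (M : R).
Hypothesis k_der : forall u, is_derive u 1 k ((k u + ff u) / G u).
Hypothesis k_bd : forall u, `|k u| <= M.

Ltac keep_hyp H ::= tryif first [constr_eq H b0 | constr_eq H k_der | constr_eq H k_bd] then fail else idtac.
Lemma sqrtG u : exists q : R, [/\ Num.sqrt (G u) = q, 0 < q, q ^+ 2 = G u & b <= q].
Proof.
have g0 := G_gt0 b0 u.
have q2 : Num.sqrt (G u) ^+ 2 = G u by rewrite sqr_sqrtr // ltW.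
have bq : b <= Num.sqrt (G u).
  by rewrite -(@ler_pXn2r _ 2) ?nnegrE ?sqrtr_ge0 ?(ltW b0) // q2 G_ge.
by exists (Num.sqrt (G u)); split=> //; apply: lt_le_trans bq.
Qed.

Lemma ff_sqrt u : `|ff u| <= Num.sqrt (G u) + `|ln b| + 1 / 2.
Proof.
have [q [-> q0 q2 bq]] := sqrtG u.
have E : ff u = ln q - 1 / 2 by rewrite /ff /Submission.ff -/G -q2 lnXn //; field.
have l1 := ln_sublinear q0.
have l2 : ln b <= ln q by rewrite ler_ln ?posrE.
have l3 := ler_norm (- ln b); rewrite normrN in l3.
have l4 := normr_ge0 (ln b).
by rewrite E ler_norml; apply/andP; split; (move: q0 l1 l2 l3 l4; drop; lra).
Qed.

Definition C1 : R := 1 + (M + `|ln b| + 1 / 2) / b.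
Definition C2 : R := (C1 + 1) / b + 2 * C1.

Lemma M_ge0 : 0 <= M. Proof. exact: le_trans (normr_ge0 _) (k_bd 0). Qed.
Lemma C1_ge1 : 1 <= C1.
Proof.
rewrite /C1 lerDl divr_ge0 ?(ltW b0) //.
have := M_ge0; have := normr_ge0 (ln b); lra.
Qed.
Lemma C2_ge0 : 0 <= C2.
Proof. have h := C1_ge1; rewrite /C2; apply: addr_ge0; last by lra.
by apply: divr_ge0; [lra | exact: ltW]. Qed.

Lemma kf_sqrt u : `|k u + ff u| <= C1 * Num.sqrt (G u).
Proof.
have fs := ff_sqrt u; have kb := k_bd u.
have [q [qE q0 q2 bq]] := sqrtG u; rewrite qE in fs *.
apply: le_trans (ler_normD _ _) _.
apply: (@le_trans _ _ (q + (M + `|ln b| + 1 / 2))); first lra.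
have -> : C1 * q = q + (M + `|ln b| + 1 / 2) * (q / b).
  by rewrite /C1; field; exact: lt0r_neq0.
have h1 : 1 <= q / b by rewrite ler_pdivlMr // mul1r.
have := M_ge0; have := normr_ge0 (ln b); nra.
Qed.

(** During one step [G] stays above half its initial value, so the derivative of k' = (k + ff) / G
    is at most 2 C2 / G u there. *)
Lemma k_step tau u : 0 <= tau -> sg tau u <= 1 / 64 ->
  `|k (u + tau * G u) - k u - tau * (k u + ff u)| <= 2 * C2 * sg tau u.
Proof.
move=> tau0 s64; set x := tau * G u.
have g0 := G_gt0 b0 u; have x0 : 0 <= x by rewrite mulr_ge0 // ltW.
pose h v := (k v + ff v) / G v.
have dh v : is_derive v 1 h (((k v + ff v) / G v + (2 * v + 1) / (2 * G v)) / G v -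
   (k v + ff v) * (2 * v + 1) / G v ^+ 2).
  have gn := lt0r_neq0 (G_gt0 b0 v).
  have hh := rdM (rdD (k_der v) (ff_der b0 v)) (rdV gn (G_der b v)).
  by apply: (rd_eq hh); rewrite /G /ff; field.
have c1 := C1_ge1.
have dhb v : `|((k v + ff v) / G v + (2 * v + 1) / (2 * G v)) / G v -
   (k v + ff v) * (2 * v + 1) / G v ^+ 2| <= C2 / G v.
  have gv := G_gt0 b0 v; rewrite -/G in gv.
  have kf := kf_sqrt v.
  have [q [qE q0 q2 bq]] := sqrtG v; rewrite qE in kf.
  have v2 : `|2 * v + 1| <= 2 * q.
    rewrite -(@ler_pXn2r _ 2) ?nnegrE ?normr_ge0 ?mulr_ge0 ?(ltW q0) // real_normK ?num_real //.
    by rewrite exprMn q2 /G GE; have := b2 b0; (drop; nra).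
  have -> : ((k v + ff v) / G v + (2 * v + 1) / (2 * G v)) / G v - (k v + ff v) * (2 * v + 1) / G v ^+ 2 =
     ((k v + ff v) + (2 * v + 1) / 2 - (k v + ff v) * (2 * v + 1)) / G v ^+ 2.
    by field; exact: lt0r_neq0.
  rewrite normrM (ger0_norm (_ : 0 <= (G v ^+ 2)^-1)); last by rewrite invr_ge0 sqr_ge0.
  have -> : C2 / G v = C2 * G v / G v ^+ 2 by field; exact: lt0r_neq0.
  rewrite ler_pM2r ?invr_gt0 ?exprn_gt0 //.
  apply: (@le_trans _ _ (C1 * q + q + C1 * q * (2 * q))).
    apply: le_trans (ler_normB _ _) _; apply: lerD.
      apply: le_trans (ler_normD _ _) _; apply: lerD => //.
      by rewrite normrM (ger0_norm (_ : 0 <= 2^-1 :> R)) // ler_pdivrMr // [q * 2]mulrC.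
    by rewrite normrM; apply: ler_pM.
  have e1 : C2 * q ^+ 2 = (C1 + 1) * (q ^+ 2 / b) + C1 * q * (2 * q).
    by rewrite /C2; field; exact: lt0r_neq0.
  have e2 : q <= q ^+ 2 / b by rewrite ler_pdivlMr // expr2 ler_pM2l.
  by rewrite -q2 e1 lerD2r; nra.
have c2 := C2_ge0.
have gx v : u <= v <= u + x -> G u <= 2 * G v.
  move=> /andP[uv vx]; have [x00|xn0] := eqVneq x 0.
    have -> : v = u by (move: uv vx; drop; lra).
    have : 0 < G u by []. lra.
  have xp : 0 < x by rewrite lt_neqAle eq_sym xn0.
  have tp : 0 < tau by rewrite lt_neqAle eq_sym tau0 andbT; apply: contra xn0 => /eqP t0; rewrite /x t0 mul0r.
  have t01 : 0 <= (v - u) / x <= 1.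
    by apply/andP; split; [apply: divr_ge0; (move: uv vx; drop; lra) | rewrite ler_pdivrMr //; (move: uv vx; drop; lra)].
  have [_ E h12] := seg_facts tau0 s64 t01.
  rewrite divfK // subrKC in E.
  rewrite E; have : 0 < G u by []. (move: h12; drop; nra).
have hlip v : u <= v <= u + x -> `|h v - h u| <= C2 * (2 / G u) * (v - u).
  move=> /andP[uv vx]; apply: (mvt_le uv) => w /andP[uw wv].
  apply: le_trans (dhb w) _; apply: ler_wpM2l => //.
  have h1 : G u <= 2 * G w by apply: gx; apply/andP; split; (move: vx uw wv; drop; lra).
  have gw := G_gt0 b0 w; rewrite -/G in gw.
  by rewrite ler_pdivlMr // mulrC ler_pdivrMr.
have ux : u <= u + x by lra.
have := @mvt_le _ (fun v => k v - v * h u) (fun v => h v - h u) u (u + x) (C2 * (2 / G u) * x) ux.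
have -> : k (u + x) - (u + x) * h u - (k u - u * h u) = k (u + x) - k u - tau * (k u + ff u).
  by rewrite /h /x; field; exact: lt0r_neq0.
rewrite (_ : u + x - u = x); last by ring.
have -> : C2 * (2 / G u) * x * x = 2 * C2 * sg tau u.
  by rewrite /x /sg; field; exact: lt0r_neq0.
apply.
  move=> v _; have hh := rdB (k_der v) (rdM (rdI v) (rdK (h u) v)).
  by apply: (rd_eq hh); rewrite /h; ring.
move=> v hv; apply: le_trans (hlip v hv) _; apply: ler_wpM2l.
  by rewrite mulr_ge0 // divr_ge0 // ltW.
by move: hv => /andP[_]; lra.
Qed.

Definition gg u := ln (G u) / 2 + k u.
Definition Theta u T : R := th u - ln T + gg u / T.

Definition C3 : R := 40 + 2 * C2 + 8 / b ^+ 2.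

(** The terms of order tau^2 in the increment of th - ln T are -(2u + 1)/2 and 1/2 times tau^2; gg /
    T is built to compensate both. The remainder tau sg = tau^2 (tau G) is tau^2 times the increment
    of u, which can be summed over a passage. *)
Lemma Theta_step u T : 9 <= T -> sg (T - 1)^-1 u <= 1 / 64 ->
  `|Theta (u + (T - 1)^-1 * G u) (T + 1 + (T - 1)^-1) - Theta u T| <=
  C3 * ((T - 1)^-1 * sg (T - 1)^-1 u).
Proof.
move=> T9 s64; set tau := (T - 1)^-1 in s64 *.
have T1 : 0 < T - 1 by lra.
have tau0 : 0 < tau by rewrite invr_gt0.
have tT : tau * (T - 1) = 1 by rewrite /tau mulVf // lt0r_neq0.
have tau8 : tau <= 1 / 8.
  by rewrite -(ler_pM2r T1) tT; lra.
set T' := T + 1 + tau.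
have T'E : T' = T * (1 + tau) by rewrite /T'; lra.
have T'0 : 0 < T' by rewrite /T'; lra.
have T0 : 0 < T by lra.
set u' := u + tau * G u; set S := sg tau u in s64 *.
have g0 : 0 < G u by exact: G_gt0.
have S0 : 0 <= S by rewrite /S /sg mulr_ge0 ?sqr_ge0 // ltW.
have a1 := th_step (ltW tau0) s64; rewrite -/u' -/S in a1.
have a2 := ln1_cubic (ltW tau0).
have a3 := k_step (ltW tau0) s64; rewrite -/u' -/S in a3.
set B := tau * (2 * u + 1).
have t01 : 0 <= (1 : R) <= 1 by rewrite ler01 lexx.
have [Bb GE1 h12] := seg_facts (ltW tau0) s64 t01.
rewrite -/B -/S expr1n !mul1r -/u' in Bb GE1 h12.
have B2 : B ^+ 2 <= 4 * S by exact: sgB.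
have xb : `|B + S| <= 1 / 2.
  by move: Bb; rewrite !ler_norml => /andP[? ?]; apply/andP; split; lra.
have a4 := ln1_quad xb.
have BS2 : (B + S) ^+ 2 <= 10 * S by have := sqr_ge0 (B - S); (move: s64 B2; drop; nra).
have lG : ln (G u') = ln (G u) + ln (1 + (B + S)) by rewrite GE1 lnM ?posrE //; (move: h12; drop; lra).
have lT : ln T' = ln T + ln (1 + tau) by rewrite T'E lnM ?posrE //; (move: tau0; drop; lra).
have iT : T'^-1 = tau - tau ^+ 2 * ((2 * T - 1) / T ^+ 2 / tau).
  have -> : T' = T ^+ 2 * tau by rewrite T'E /tau; field; exact: lt0r_neq0.
  by rewrite /tau; field; rewrite !lt0r_neq0.
have iTb : `|T'^-1 - tau| <= 4 * tau ^+ 2.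
  have -> : T'^-1 - tau = - (tau * ((2 * T - 1) / T ^+ 2)).
    have -> : T' = T ^+ 2 * tau by rewrite T'E /tau; field; exact: lt0r_neq0.
    by rewrite /tau; field; rewrite !lt0r_neq0.
  rewrite normrN ger0_norm; last by rewrite mulr_ge0 ?(ltW tau0) // divr_ge0 ?sqr_ge0 //; (move: T9; drop; lra).
  have hh : (2 * T - 1) / T ^+ 2 <= 4 * tau.
    rewrite ler_pdivrMr ?exprn_gt0 //; have tT1 : tau * T = 1 + tau by (drop; lra).
    rewrite (_ : 4 * tau * T ^+ 2 = 4 * (tau * T) * T); last by ring.
    rewrite tT1; (move: T9; drop; nra).
  by rewrite [leRHS](_ : _ = tau * (4 * tau)) ?ler_pM2l //; ring.
have iT1 : T'^-1 <= tau.
  rewrite -(ler_pM2r T'0) mulVf ?lt0r_neq0 // T'E.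
  have : tau * T = 1 + tau by (drop; lra). move=> h; rewrite mulrA h; (move: T9; drop; nra).
have iT0 : 0 < T'^-1 by rewrite invr_gt0.
have ub : `|u| <= (1 + 1 / b ^+ 2) * G u.
  have bp := b2 b0.
  have h1 : `|u| <= G u + 1.
    rewrite /G GE ler_norml; have g1 := sqr_ge0 (u + 1); have g2 := sqr_ge0 u.
    by apply/andP; split; (move: g1 g2 bp; drop; nra).
  have h2 : 1 <= 1 / b ^+ 2 * G u by rewrite mulrAC ler_pdivlMr // !mul1r G_ge.
  (move: h1 h2; drop; lra).
have tS : tau ^+ 3 <= 1 / b ^+ 2 * (tau * S).
  rewrite /S /sg mulrAC ler_pdivlMr ?b2 // !mul1r exprS -mulrA ler_pM2l //.
  by rewrite ler_pM2l ?exprn_gt0 // G_ge.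
(* residue of the three second order terms, and the five error terms *)
have -> : Theta u' T' - Theta u T =
   (th u' - th u - tau + tau ^+ 2 * (2 * u + 1) / 2) - (ln (1 + tau) - tau + tau ^+ 2 / 2) +
   T'^-1 * ((ln (1 + (B + S)) - (B + S)) / 2 + S / 2 + (k u' - k u - tau * (k u + ff u))) +
   tau * u * (T'^-1 - tau).
  rewrite /Theta lT /gg lG.
  have -> : (ln (G u) / 2 + k u) / T = (ln (G u) / 2 + k u) * T'^-1 * (1 + tau).
    by rewrite T'E; field; rewrite !lt0r_neq0 //; (move: tau0; drop; lra).
  by rewrite /B /ff /Submission.ff -/G; field; exact: lt0r_neq0.
have n1 : `|tau * u * (T'^-1 - tau)| <= (4 + 4 / b ^+ 2) * (tau * S).
  rewrite normrM normrM (ger0_norm (ltW tau0)).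
  apply: (@le_trans _ _ (tau * ((1 + 1 / b ^+ 2) * G u) * (4 * tau ^+ 2))).
    by apply: ler_pM; rewrite ?mulr_ge0 ?(ltW tau0) // ler_pM2l.
  by rewrite le_eqVlt; apply/orP; left; apply/eqP; rewrite /S /sg; field; exact: lt0r_neq0.
have n2 : `|T'^-1 * ((ln (1 + (B + S)) - (B + S)) / 2 + S / 2 + (k u' - k u - tau * (k u + ff u)))| <=
   (11 + 2 * C2) * (tau * S).
  rewrite normrM (ger0_norm (ltW iT0)) (_ : _ * (tau * S) = tau * ((11 + 2 * C2) * S)); last by ring.
  apply: ler_pM => //; first exact: ltW.
  apply: le_trans (ler_normD _ _) _.
  apply: (@le_trans _ _ (11 * S + 2 * C2 * S)).
    2: by rewrite le_eqVlt; apply/orP; left; apply/eqP; ring.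
  apply: lerD => //.
  by move: a4; rewrite !ler_norml => /andP[x y]; apply/andP; split; (move: x y BS2; drop; lra).
have n3 : `|ln (1 + tau) - tau + tau ^+ 2 / 2| <= 1 / b ^+ 2 * (tau * S) := le_trans a2 tS.
apply: le_trans (ler_normD _ _) _.
apply: (@le_trans _ _ (12 * (tau * S) + 1 / b ^+ 2 * (tau * S) + (11 + 2 * C2) * (tau * S) + (4 + 4 / b ^+ 2) * (tau * S))).
  apply: lerD => //; apply: le_trans (ler_normD _ _) _; apply: lerD => //.
  by apply: le_trans (ler_normB _ _) _; apply: lerD.
have tS0 : 0 <= tau * S by rewrite mulr_ge0 // ltW.
have b20 : 0 <= (b ^+ 2)^-1 * (tau * S) by rewrite mulr_ge0 // invr_ge0 sqr_ge0.
rewrite /C3; (move: tS0 b20; drop; lra).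
Qed.
Ltac keep_hyp H ::= idtac.
End Step.

(** * Summation over the steps of a real orbit *)

Section Passage.
Variables (R : realType) (b : R).
Hypothesis b0 : 0 < b.
Implicit Types (s t u v e x tau : R).
Let G := G b.
Let th := th b.
Let ff := ff b.
Let Lb := Lb b.
Let c := cc b.
Variables (k : R -> R) (M : R).
Hypothesis k_der : forall u, is_derive u 1 k ((k u + ff u) / G u).
Hypothesis k_bd : forall u, `|k u| <= M.
Let C3 := C3 b M.
Let gg := gg b k.
Let Theta := Theta b k.

Lemma C3_ge0 : 0 <= C3.
Proof.
rewrite /C3 /Submission.C3 !addr_ge0 ?mulr_ge0 ?(C2_ge0 b0 k_bd) //.
by rewrite invr_ge0 sqr_ge0.
Qed.

Lemma lnG_asym u : 2 * (1 + c) <= `|u| -> `|ln (G u) / 2 - ln `|u| | <= (1 + c) / `|u|.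
Proof.
have c0 : 0 < c by exact: cc_gt0.
move=> hu; have u0 : 0 < `|u| by lra.
pose x := (u + c) / u ^+ 2.
have u2 : u ^+ 2 = `|u| ^+ 2 by rewrite real_normK ?num_real.
have un : u != 0 by rewrite -normr_gt0.
have xb : `|x| <= (1 + c) / `|u|.
  rewrite /x normrM normfV u2 (ger0_norm (sqr_ge0 `|u|)) ler_pdivrMr ?exprn_gt0 //.
  rewrite expr2 mulrA divfK ?lt0r_neq0 //.
  by apply: le_trans (ler_normD _ _) _; rewrite (ger0_norm (ltW c0)); nra.
have x12 : (1 + c) / `|u| <= 1 / 2 by rewrite ler_pdivrMr //; lra.
have xh : `|x| <= 1 / 2 by exact: le_trans x12.
have E : G u = `|u| ^+ 2 * (1 + x) by rewrite /x -u2 /G /Submission.G -/c; field.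
have x1 : 0 < 1 + x by move: xh; rewrite ler_norml => /andP[]; lra.
rewrite E lnM ?posrE ?exprn_gt0 // lnXn // mulr2n.
have -> : (ln `|u| + ln `|u| + ln (1 + x)) / 2 - ln `|u| = (ln (1 + x) - x + x) / 2 by field.
have h1 := ln1_quad xh; rewrite normrM (ger0_norm (_ : 0 <= 2^-1 :> R)) //.
rewrite ler_pdivrMr //; apply: le_trans (ler_normD _ _) _.
have x2 : x ^+ 2 = `|x| * `|x| by rewrite -expr2 real_normK ?num_real.
have xn := normr_ge0 x.
rewrite x2 in h1; nra.
Qed.

(** The bounds of [th] near +oo, carried to -oo by the symmetry u -> -1 - u. *)
Lemma th_entry v : 1 < v -> - (Lb / 2) + 1 / (v + c) <= th (- v) <= - (Lb / 2) + 1 / (v - 1).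
Proof.
move=> v1; have v10 : 0 < v - 1 by lra.
have -> : - v = -1 - (v - 1) by ring.
rewrite /th th_sym //; have h1 := th_up b0 v10; have h2 := th_lo b0 v10.
have E : v - 1 + 1 + cc b = v + c by rewrite /c; ring.
by rewrite E in h2; apply/andP; split; rewrite /Lb; lra.
Qed.

Variables (T u : nat -> R).
Hypothesis T_rec : forall m, T m.+1 = T m + 1 + (T m - 1)^-1.
Hypothesis u_rec : forall m, u m.+1 = u m + (T m - 1)^-1 * G (u m).
Hypothesis T9 : 9 <= T 0.

Lemma T_incr m : T 0 <= T m /\ 9 <= T m.
Proof.
elim: m => [//|m [h1 h2]].
have : 0 < (T m - 1)^-1 by rewrite invr_gt0; lra.
by rewrite T_rec; lra.
Qed.
Lemma T_le m n : (m <= n)%N -> T m <= T n.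
Proof.
move=> mn; rewrite -(subnK mn); elim: (n - m)%N => [//|j IH]; rewrite addSn T_rec.
have [_ h2] := T_incr (j + m)%N.
have : 0 < (T (j + m)%N - 1)^-1 by rewrite invr_gt0; lra.
lra.
Qed.
Lemma tau_gt0 m : 0 < (T m - 1)^-1.
Proof. by have [_ h] := T_incr m; rewrite invr_gt0; lra. Qed.
Lemma tau_le m : (T m - 1)^-1 <= 2 / T 0.
Proof.
have [h1 h2] := T_incr m.
have T0 := T9; rewrite ler_pdivlMr; last by lra.
rewrite mulrC ler_pdivrMr; lra.
Qed.
Lemma u_incr m : u m <= u m.+1.
Proof. by rewrite u_rec lerDl mulr_ge0 ?(ltW (tau_gt0 m)) // ltW // G_gt0. Qed.
Lemma u_ge0 m : u 0 <= u m.
Proof. by elim: m => // m IH; apply: le_trans IH (u_incr m). Qed.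

(** Each error is at most a constant times tau^2 (u_(i+1) - u_i) with tau <= 2 / T 0; as u
    increases, these bounds telescope. *)
Lemma Theta_sum m : (forall i, (i < m)%N -> sg b (T i - 1)^-1 (u i) <= 1 / 64) ->
  `|Theta (u m) (T m) - Theta (u 0) (T 0)| <= C3 * (4 / T 0 ^+ 2) * (u m - u 0).
Proof.
elim: m => [|m IH] H; first by rewrite !subrr normr0 mulr0.
have {}IH := IH (fun i im => H i (ltnW im)).
have s64 := H m (leqnn _).
have [h1 h2] := T_incr m.
have := Theta_step b0 k_der k_bd h2 s64; rewrite -u_rec -T_rec -/Theta -/C3 => h3.
rewrite -(subrK (Theta (u m) (T m)) (Theta (u m.+1) _)) -addrA.
apply: le_trans (ler_normD _ _) _.
have -> : u m.+1 - u 0 = (u m.+1 - u m) + (u m - u 0) by ring.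
rewrite mulrDr; apply: lerD => //; apply: le_trans h3 _.
rewrite -mulrA; apply: ler_wpM2l; first exact: C3_ge0.
rewrite u_rec /sg mulrA.
have -> : (T m - 1)^-1 * (T m - 1)^-1 ^+ 2 * G (u m) = (T m - 1)^-1 ^+ 2 * ((T m - 1)^-1 * G (u m)) by ring.
rewrite (_ : u m + _ - u m = (T m - 1)^-1 * G (u m)); last by ring.
apply: ler_wpM2r; first by rewrite mulr_ge0 ?(ltW (tau_gt0 m)) // ltW // G_gt0.
have T0 := T9; have -> : 4 / T 0 ^+ 2 = (2 / T 0) ^+ 2 by field; apply: lt0r_neq0; lra.
rewrite ler_pXn2r ?nnegrE ?(ltW (tau_gt0 m)) ?tau_le // divr_ge0 //; lra.
Qed.

Lemma G_le v (U : R) : `|v| <= U -> G v <= 2 * U ^+ 2 + (1 / 2 + b ^+ 2).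
Proof.
move=> hv; have v2 : v ^+ 2 <= U ^+ 2.
  by rewrite -(real_normK (num_real v)) ler_pXn2r ?nnegrE // (le_trans _ hv).
by rewrite /G GE; have := sqr_ge0 (v - 1 / 2); nra.
Qed.

End Passage.

(** * Entry and exit phases of a real passage *)

Section RealPassage.
Variables (R : realType) (b : R).
Hypothesis b0 : 0 < b.
Ltac keep_hyp H ::= tryif first [constr_eq H b0] then fail else idtac.
Implicit Types (x v e tau : R).
Let G := G b.
Let th := th b.
Let ff := ff b.
Let Lb := Lb b.
Let c := cc b.
Variables (k : R -> R) (M : R).
Hypothesis k_der : forall u : R, is_derive u 1 k ((k u + ff u) / G u).
Hypothesis k_bd : forall u, `|k u| <= M.
Ltac keep_hyp H ::= tryif first [constr_eq H b0 | constr_eq H k_der | constr_eq H k_bd] then fail else idtac.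
Let C3 := C3 b M.
Let gg := gg b k.
Let Theta := Theta b k.
Variables (A kap : R).
Hypothesis A1 : 1 <= A.
Hypothesis LA : Lb = ln A.

Ltac keep_hyp H ::= tryif first [constr_eq H b0 | constr_eq H k_der | constr_eq H k_bd | constr_eq H A1 | constr_eq H LA] then fail else idtac.
(** A bound for all that grows like J or like ln t, in particular for the deviation of T N from A T
    0. The hypothesis [Wdl] makes its square negligible against t. *)
Definition Wp (J t : R) : R := (A + 1) * (3 * J + ln t) + 2 * A + `|kap| + 1.
(** 136 = 4 * (17 / 8) * 16: an error 4 C3 / t^2 per unit of u is collected over a length of at most
    2 U + U / 8, where U = 16 A t / J. *)
Definition C4 : R := 136 * Submission.C3 b M * A.

Variables (J dl X0 : R) (T u : nat -> R) (N : nat).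
Hypothesis T_rec : forall m, T m.+1 = T m + 1 + (T m - 1)^-1.
Hypothesis u_rec : forall m, u m.+1 = u m + (T m - 1)^-1 * G (u m).
Ltac keep_hyp H ::= tryif first [constr_eq H b0 | constr_eq H k_der | constr_eq H k_bd | constr_eq H A1 | constr_eq H LA | constr_eq H T_rec | constr_eq H u_rec] then fail else idtac.
Let t : R := T 0.
Let s : R := T N.
Let W : R := Wp J t.
Let U : R := 16 * A * t / J.
(** The predicted exit phase. Both T - ln T and X - ln X increase by about one per step, and X0 is
    the coordinate -1/w of w = u / T on entry. *)
Let Yp : R := s - ln s - A * (t - ln t) + A * (X0 - ln X0) + kap.
Hypothesis u0E : u 0 = - (t / X0).
Hypothesis J512 : 512 * A <= J.
Hypothesis cJ : 4 * (1 + c) <= J.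
Hypothesis t1 : 1 <= t.
Hypothesis Wdl : W ^+ 2 <= dl * t.
Hypothesis dl16 : dl <= 1 / 16.
Hypothesis X0J : J / 2 <= X0 <= 3 * J.
Hypothesis YJ : - (3 * J) <= Yp <= - (J / 2).
Hypothesis s2 : s <= 2 * A * t.

Ltac keep_hyp H ::= tryif first [constr_eq H b0 | constr_eq H k_der | constr_eq H k_bd | constr_eq H A1 | constr_eq H LA | constr_eq H T_rec | constr_eq H u_rec | constr_eq H u0E | constr_eq H J512 | constr_eq H cJ | constr_eq H t1 | constr_eq H Wdl | constr_eq H dl16 | constr_eq H X0J | constr_eq H YJ | constr_eq H s2] then fail else idtac.
Lemma J_ge : 512 <= J.
Proof. have a := A1; have j := J512; lra. Qed.
Lemma lnt0 : 0 <= ln t.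
Proof. exact: ln_ge0. Qed.
Lemma W_facts : [/\ 3 * J + ln t <= W, J <= W, 1 <= W & (A + 1) * (3 * J + ln t) + 2 * A + `|kap| <= W].
Proof.
have a := A1; have j := J_ge; have l := lnt0; have kn := normr_ge0 kap.
have h : 3 * J + ln t <= (A + 1) * (3 * J + ln t) by nra.
by rewrite /W /Wp; split; (move: a j l kn h; drop; lra).
Qed.
Lemma t_big : [/\ 16 * W <= t, 16 * J ^+ 2 <= t, 9 <= t & W / t <= 1 / 16].
Proof.
have [h1 h2 h3 _] := W_facts; have j := J_ge; have w := Wdl; have d := dl16; have tt := t1.
have hw : 16 * W ^+ 2 <= t by (move: w d tt; drop; nra).
have h4 : J ^+ 2 <= W ^+ 2 by (move: h2 j; drop; nra).
have h5 : 16 * W <= t by apply: le_trans hw; rewrite expr2; nra.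
split => //; first by (move: hw h4; drop; lra).
  by (move: h3 h5; drop; lra).
by rewrite ler_pdivrMr; (move: h3 h5; drop; lra).
Qed.

Lemma X0_facts : [/\ 1 <= X0, 0 <= ln X0, ln X0 <= X0 & X0 - ln X0 <= 3 * J].
Proof.
have /andP[h1 h2] := X0J; have j := J_ge.
have x1 : 1 <= X0 by lra.
have l0 : 0 <= ln X0 by exact: ln_ge0.
have l1 : ln X0 <= X0 by apply: ltW; apply: ln_sublinear; lra.
by split => //; (move: h2 l0; drop; lra).
Qed.

Lemma s_ge : t <= s.
Proof. by have [_ _ t9 _] := t_big; case: (@T_incr _ T T_rec t9 N). Qed.

Let D : R := s - A * t.
(** Solving the definition of [Yp] for s - A t leaves only phases and logarithms. *)
Lemma Delta_le : `|D| <= W.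
Proof.
have [x1 l0 l1 x3] := X0_facts; have [_ _ _ hW] := W_facts; have l := lnt0.
have a := A1; have st := s_ge; have tt := t1; have j := J_ge.
have E : D = Yp + ln s - A * ln t - A * (X0 - ln X0) - kap by rewrite /D /Yp; ring.
have ls0 : 0 <= ln s by apply: ln_ge0; (move: st tt; drop; lra).
have ls : ln s <= 2 * A + ln t.
  have h : ln s <= ln (2 * A * t) by rewrite ler_ln ?posrE //; (move: a st tt; drop; nra).
  apply: le_trans h _; rewrite lnM ?posrE; [|lra|lra].
  by rewrite lerD2r; apply: ltW; apply: ln_sublinear; (move: a; drop; lra).
have /andP[y1 y2] := YJ.
have kn := ler_norm kap; have kn' := ler_norm (- kap); rewrite normrN in kn'.
have p1 : 0 <= A * ln t by (move: l a; drop; nra).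
have p2 : 0 <= A * (X0 - ln X0) by (move: l1 a; drop; nra).
have p3 : A * (X0 - ln X0) <= A * (3 * J) by apply: ler_wpM2l; (move: x3 a; drop; lra).
rewrite E ler_norml; apply/andP; split; (move: hW ls0 ls y1 y2 kn kn' p1 p2 p3; drop; lra).
Qed.

Lemma r_facts : `|s / t - A| <= W / t /\ A - 1 / 16 <= s / t <= A + 1 / 16.
Proof.
have [_ _ t9 wt] := t_big; have t0 : 0 < t by lra.
have E : s / t - A = D / t by rewrite /D; field; exact: lt0r_neq0.
have h : `|s / t - A| <= W / t.
  by rewrite E normrM normfV (gtr0_norm t0) ler_pM2r ?invr_gt0 // Delta_le.
split => //; have := le_trans h wt; rewrite ler_norml => /andP[]; lra.
Qed.

Lemma dl_ge0 : 0 <= dl.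
Proof. by have := Wdl; have := sqr_ge0 W; have := t1; nra. Qed.

Lemma W2t : W * (W / t) <= dl.
Proof. by have tt := t1; rewrite mulrA -expr2 ler_pdivrMr //; lra. Qed.

(** Because exp Lb = A, the difference of logarithms is ln(1 + x) with x = D / (A t); the quadratic
    remainder is of order W^2 / t <= dl. *)
Lemma s_ln : `|s * (ln s - ln t - Lb) - D| <= 4 * dl.
Proof.
have [h1 h2 t9 wt] := t_big; have t0 : 0 < t by lra.
have a := A1; have dW := Delta_le; have [_ _ w1 _] := W_facts.
pose x := D / (A * t).
have At : 0 < A * t by nra.
have xW : `|x| <= W / t.
  rewrite /x normrM normfV (gtr0_norm At) ler_pdivrMr //.
  apply: le_trans dW _; rewrite mulrCA divfK ?lt0r_neq0 //; nra.
have x2 : `|x| <= 1 / 2 by (move: wt xW; drop; lra).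
have sE : s = A * t * (1 + x) by rewrite /x /D; field; rewrite !lt0r_neq0 //; (move: a; drop; lra).
have x1 : 0 < 1 + x by move: x2; rewrite ler_norml => /andP[]; lra.
have lE : ln s - ln t - Lb = ln (1 + x).
  by rewrite sE lnM ?posrE // lnM ?posrE ?LA; [ring|(move: a; drop; lra)|].
have hl := ln1_quad x2; rewrite lE.
have DE : D = A * t * x by rewrite /x; field; rewrite !lt0r_neq0 //; (move: a; drop; lra).
have E : s * ln (1 + x) - D = (A * t) * (x ^+ 2 + (1 + x) * (ln (1 + x) - x)).
  by rewrite sE DE; ring.
have x2n : x ^+ 2 = `|x| ^+ 2 by rewrite real_normK ?num_real.
have B : `|x ^+ 2 + (1 + x) * (ln (1 + x) - x)| <= 4 * x ^+ 2.
  apply: le_trans (ler_normD _ _) _; rewrite (ger0_norm (sqr_ge0 x)) normrM (gtr0_norm x1).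
  have : (1 + x) * `|ln (1 + x) - x| <= (3 / 2) * (2 * x ^+ 2).
    apply: ler_pM => //; [exact: ltW|move: x2; rewrite ler_norml => /andP[]; lra].
  by (drop; lra).
rewrite E normrM (gtr0_norm At).
apply: le_trans (_ : _ <= A * t * (4 * x ^+ 2)) _; first by rewrite ler_pM2l.
have -> : A * t * (4 * x ^+ 2) = 4 * (D * x) by rewrite DE; ring.
have h3 : D * x <= `|D| * `|x| by rewrite -normrM ler_norm.
have h4 : `|D| * `|x| <= W * (W / t) by apply: ler_pM.
by have h5 := W2t; lra.
Qed.

Let Kc : R := 21 * (1 + c).
(** At u = -v with v = t / X0, [th] is -Lb/2 + 1/v up to O(v^-2), and ln(G)/2 is ln v up to O(1/v).
    Both t v^-2 and 1/v are O(dl). *)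
Lemma entry_Theta : `|t * (Theta (u 0) t + Lb / 2 + ln t) - (X0 + ln t - ln X0 + k (u 0))| <= Kc * dl.
Proof.
have [h1 h2 t9 wt] := t_big; have t0 : 0 < t by lra.
have [x1 l0 l1 x3] := X0_facts; have c0 : 0 < c by exact: cc_gt0.
have [_ jW w1 _] := W_facts; have j := J_ge; have /andP[_ X3] := X0J.
have jc := cJ; have X00 : 0 < X0 by (move: x1; drop; lra).
pose v := t / X0.
have v0 : 0 < v by exact: divr_gt0.
have v4 : 4 * (1 + c) <= v by rewrite ler_pdivlMr //; (move: h2 x1 X3 jc; drop; nra).
have tv : t = v * X0 by rewrite /v divfK // lt0r_neq0.
have v1 : 1 < v by (move: c0 v4; drop; lra).
have := th_entry b0 v1; rewrite -/th -/Lb -/c => /andP[e1 e2].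
have lE := lnG_asym b0 (_ : 2 * (1 + cc b) <= `|- v|).
rewrite normrN (gtr0_norm v0) -/c in lE; have {}lE := lE _; rewrite -/G in lE.
have {lE} lE : `|ln (G (- v)) / 2 - ln v| <= (1 + c) / v by apply: lE; lra.
have lv : ln v = ln t - ln X0 by rewrite /v ln_div ?posrE.
have iv : X0 / t = v^-1 by rewrite /v invf_div.
have E : t * (Theta (- v) t + Lb / 2 + ln t) - (X0 + ln t - ln X0 + k (- v)) =
   t * (th (- v) + Lb / 2 - v^-1) + (ln (G (- v)) / 2 - ln v).
  rewrite lv -iv /Theta /Submission.Theta /gg /Submission.gg -/th -/G; field; exact: lt0r_neq0.
rewrite u0E -/v E; apply: le_trans (ler_normD _ _) _.
have V : v^-1 * v = 1 by rewrite mulVf // lt0r_neq0.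
have V0 : 0 < v^-1 by rewrite invr_gt0.
have B1 : `|th (- v) + Lb / 2 - v^-1| <= (2 + c) * v^-1 ^+ 2.
  have i1 : 1 / (v - 1) <= v^-1 + 2 * v^-1 ^+ 2.
    rewrite ler_pdivrMr; last by (move: c0 v4; drop; lra).
    have -> : (v^-1 + 2 * v^-1 ^+ 2) * (v - 1) = v^-1 * v + 2 * v^-1 * (v^-1 * v) - v^-1 - 2 * v^-1 ^+ 2 by ring.
    rewrite V; have : v^-1 <= 1 / 2 by rewrite -[v^-1]mul1r ler_pdivrMr //; (move: c0 v4; drop; lra).
    by (move: v0; drop; nra).
  have i2 : v^-1 - c * v^-1 ^+ 2 <= 1 / (v + c).
    rewrite ler_pdivlMr; last by (move: c0 v0; drop; lra).
    have -> : (v^-1 - c * v^-1 ^+ 2) * (v + c) = v^-1 * v + c * v^-1 - c * v^-1 * (v^-1 * v) - c ^+ 2 * v^-1 ^+ 2 by ring.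
    by rewrite V; (drop; nra).
  have V2 := sqr_ge0 v^-1; have cV : 0 <= c * v^-1 ^+ 2 by rewrite mulr_ge0 // ltW.
  rewrite ler_norml mulrDl; apply/andP; split; (move: e1 e2 i1 i2 V2 cV; drop; lra).
have vX : v^-1 = X0 / t by rewrite iv.
have B2 : t * v^-1 ^+ 2 <= 9 * dl.
  have -> : t * v^-1 ^+ 2 = X0 * (X0 / t) by rewrite vX; field; exact: lt0r_neq0.
  have h3 : X0 * (X0 / t) <= (3 * W) * (3 * W / t).
    apply: ler_pM; rewrite ?divr_ge0 //; [(move: h1 x1 jW X3; drop; lra)|(move: h1 x1 jW X3; drop; lra)|(move: h1 x1 jW X3; drop; lra)|(move: h1 x1 jW X3; drop; lra)|].
    by rewrite ler_pM2r ?invr_gt0 //; (move: jW X3; drop; lra).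

  have h4 := W2t; apply: le_trans h3 _.
  have -> : 3 * W * (3 * W / t) = 9 * (W * (W / t)) by ring.
  by (move: h4; drop; lra).
have B3 : v^-1 <= 3 * dl.
  rewrite vX; apply: le_trans (_ : _ <= 3 * (W * (W / t))) _; last by have := W2t; (drop; lra).
  rewrite !mulrA ler_pM2r ?invr_gt0 //; (move: jW w1 X3; drop; nra).
rewrite normrM (gtr0_norm t0).
have B4 : t * `|th (- v) + Lb / 2 - v^-1| <= (2 + c) * (9 * dl).
  apply: le_trans (_ : _ <= t * ((2 + c) * v^-1 ^+ 2)) _; first by rewrite ler_pM2l.
  rewrite mulrCA; apply: ler_wpM2l => //; (move: c0; drop; lra).
have B5 : (1 + c) / v <= (1 + c) * (3 * dl) by apply: ler_wpM2l => //; (move: c0; drop; lra).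
have d0 := dl_ge0.
rewrite /Kc; (move: h2 c0 lE V0 B1 B2 B3; drop; nra).
Qed.

Lemma U_facts : [/\ 0 < U, U * J = 16 * A * t, 16 <= U, U <= t / 32 & t / J <= U / 16].
Proof.
have [h1 h2 t9 wt] := t_big; have t0 : 0 < t by lra.
have a := A1; have j := J_ge; have j5 := J512; have J0 : 0 < J by lra.
have UJ : U * J = 16 * A * t by rewrite /U divfK // lt0r_neq0.
have U0 : 0 < U by rewrite /U divr_gt0 // !mulr_gt0 //; (move: a; drop; lra).
have tJ : t / J * J = t by rewrite divfK // lt0r_neq0.
have At : 1 * t <= A * t by rewrite ler_pM2r.
split => //.
- by rewrite -(ler_pM2r J0) UJ; (move: h2 a j; drop; nra).
- have h : 512 * A * t <= J * t by rewrite ler_pM2r.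
  by rewrite -(ler_pM2r J0) UJ; (move: h; drop; lra).
- by rewrite -(ler_pM2r J0) tJ mulrAC UJ; (move: At; drop; lra).
Qed.

Lemma u0_le : - (U / 8) <= u 0 <= 0.
Proof.
have [x1 l0 l1 x3] := X0_facts; have j := J_ge; have /andP[X2 _] := X0J.
have [U0 _ _ _ tJ] := U_facts; have t0 : 0 < t by have := t1; (drop; lra).
have h : t / X0 <= 2 * (t / J).
  rewrite ler_pdivrMr; last by (move: x1; drop; lra).
  have -> : 2 * (t / J) * X0 = t / J * (2 * X0) by ring.
  rewrite -[leLHS](@divfK _ J) ?lt0r_neq0 //; [|(move: j; drop; lra)].
  by apply: ler_wpM2l; [apply: divr_ge0|]; (move: l1 x3 X2 t0; drop; lra).
have h0 : 0 <= t / X0 by apply: divr_ge0; (move: x1 t0; drop; lra).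
by rewrite u0E; apply/andP; split; (move: tJ h h0; drop; lra).
Qed.

(** While |u| <= U a step is short enough for [Theta_step], and it moves u to at most 5 U / 4. *)
Lemma tauG_le i : `|u i| <= U ->
  (T i - 1)^-1 * G (u i) <= U / 4 /\ sg b (T i - 1)^-1 (u i) <= 1 / 64.
Proof.
move=> hu; have [h1 h2 t9 wt] := t_big; have t0 : 0 < t by lra.
have [U0 UJ U16 Ut tJ] := U_facts; have j := J_ge; have jc := cJ.
have h3 := tau_le T_rec t9 i; have h4 := tau_gt0 T_rec t9 i.
have h5 := G_le b hu; have h6 := G_gt0 b0 (u i).
have cE : 1 / 2 + b ^+ 2 <= J / 4 by move: jc; rewrite /c /cc; lra.
have JU : J / 4 <= U ^+ 2.
  have At : 1 * t <= A * t by rewrite ler_pM2r //; exact: A1.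
  have J0 : 0 < J by (move: j; drop; lra).
  have hU : 256 * J <= U by rewrite -(ler_pM2r J0) UJ; move: h2; rewrite expr2; lra.
  have : 1 * U <= U * U by rewrite ler_pM2r //; (move: U16; drop; lra).
  by rewrite expr2; (move: U0 hU; drop; lra).
have hG : G (u i) <= 3 * U ^+ 2 by rewrite /G; (move: h5 cE JU; drop; lra).
rewrite -/t in h3; set tau := (T i - 1)^-1 in h3 h4 *.
have tt : tau * t <= 2 by rewrite -ler_pdivlMr.
have tU : tau * U <= 1 / 16.
  have : tau * U <= tau * (t / 32) by rewrite ler_pM2l.
  by rewrite mulrA; (move: tt; drop; lra).
have tG : tau * G (u i) <= (3 * (tau * U)) * U.
  apply: le_trans (_ : _ <= tau * (3 * U ^+ 2)) _; first by rewrite ler_pM2l.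
  by rewrite le_eqVlt; apply/orP; left; apply/eqP; ring.
have tU0 : 0 < tau * U by exact: mulr_gt0.
split.
  apply: le_trans tG _; have : 3 * (tau * U) * U <= (3 / 16) * U by rewrite ler_pM2r //; lra.
  by (move: U0; drop; lra).
have -> : sg b tau (u i) = tau * (tau * G (u i)) by rewrite /sg expr2 mulrA.
apply: le_trans (_ : _ <= tau * (3 * (tau * U) * U)) _; first by rewrite ler_pM2l.
have -> : tau * (3 * (tau * U) * U) = 3 * ((tau * U) * (tau * U)) by ring.
have : (tau * U) * (tau * U) <= (1 / 16) * (1 / 16) by apply: ler_pM => //; exact: ltW.
by (drop; lra).
Qed.

Lemma Theta_near m : (forall i, (i < m)%N -> `|u i| <= U) ->
  `|Theta (u m) (T m) - Theta (u 0) t| <= C4 / (t * J).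
Proof.
move=> H; have [h1 h2 t9 wt] := t_big; have t0 : 0 < t by lra.
have [U0 UJ U16 Ut tJ] := U_facts; have j := J_ge; have J0 : 0 < J by lra.
have /andP[u0l u0r] := u0_le.
have um : u m <= 2 * U.
  case: m H => [_|m H]; first by (move: U0 u0r; drop; lra).
  have [h _] := tauG_le (H m (leqnn _)); have := H m (leqnn _).
  by rewrite u_rec ler_norml => /andP[]; (move: h; drop; lra).
have S := Theta_sum b0 k_der k_bd T_rec u_rec t9 (fun i im => proj2 (tauG_le (H i im))).
apply: le_trans S _; rewrite -/t -/C3.
have C30 : 0 <= C3 by exact: C3_ge0.
apply: le_trans (_ : _ <= C3 * (4 / t ^+ 2) * (2 * U + U / 8)) _.
  apply: ler_wpM2l; last by (move: u0l um; drop; lra).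
  by rewrite mulr_ge0 // divr_ge0 // sqr_ge0.
rewrite le_eqVlt; apply/orP; left; apply/eqP; rewrite /C4 -/C3 /U.
by field; rewrite !lt0r_neq0.
Qed.

Lemma gg_ge v : 0 < v -> ln v - M <= gg v.
Proof.
move=> v0; have c0 : 0 < c by exact: cc_gt0.
have h : 2 * ln v <= ln (G v).
  have -> : 2 * ln v = ln (v ^+ 2) by rewrite lnXn // mulr_natl.
  rewrite ler_ln ?posrE ?exprn_gt0 ?(G_gt0 b0) //; rewrite /G /Submission.G -/c; lra.
by have := k_bd v; rewrite ler_norml /gg /Submission.gg -/G => /andP[]; lra.
Qed.

Lemma C4_ge0 : 0 <= C4.
Proof. by rewrite /C4 !mulr_ge0 ?(C3_ge0 b0 k_bd) //; have := A1; lra. Qed.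

Hypothesis lnJ : ln J <= J / 8.
Hypothesis JK : 8 * (M * (4 * A) + `|kap| + 2 * A * C4 + 1) <= J.
Hypothesis dK : (5 + 2 * A * Kc) * dl <= 1.

Ltac keep_hyp H ::= tryif first [constr_eq H b0 | constr_eq H k_der | constr_eq H k_bd | constr_eq H A1 | constr_eq H LA | constr_eq H T_rec | constr_eq H u_rec | constr_eq H u0E | constr_eq H J512 | constr_eq H cJ | constr_eq H t1 | constr_eq H Wdl | constr_eq H dl16 | constr_eq H X0J | constr_eq H YJ | constr_eq H s2 | constr_eq H lnJ | constr_eq H JK | constr_eq H dK] then fail else idtac.
Let r : R := s / t.
Lemma r2 : 0 < r <= 2 * A.
Proof.
have [h1 h2 t9 wt] := t_big; have t0 : 0 < t by lra.
have s0 : 0 < s by have := s_ge; lra.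
by rewrite divr_gt0 //= ler_pdivrMr.
Qed.

Lemma r_mul x K : `|x| <= K -> `|r * x| <= 2 * A * K.
Proof. by move=> h; have /andP[r0 rA] := r2; rewrite normrM (gtr0_norm r0) ler_pM // ltW. Qed.

(** Phases are flow times multiplied by s or t, so the near constancy of [Theta] is used after
    multiplication by s = r t. *)
Lemma Theta_end m : (forall i, (i < m)%N -> `|u i| <= U) ->
  `|s * Theta (u m) (T m) + s * (Lb / 2) + s * ln t - r * (X0 + ln t - ln X0 + k (u 0))|
    <= 2 * A * (C4 / J) + 2 * A * (Kc * dl).
Proof.
move=> H; have h := Theta_near H; have [h1 h2 t9 wt] := t_big; have t0 : 0 < t by lra.
have j := J_ge.
have -> : s * Theta (u m) (T m) + s * (Lb / 2) + s * ln t - r * (X0 + ln t - ln X0 + k (u 0))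
  = r * (t * (Theta (u m) (T m) - Theta (u 0) t)) +
    r * (t * (Theta (u 0) t + Lb / 2 + ln t) - (X0 + ln t - ln X0 + k (u 0))).
  by rewrite /r; field; exact: lt0r_neq0.
apply: le_trans (ler_normD _ _) _; apply: lerD; apply: r_mul; last exact: entry_Theta.
rewrite normrM (gtr0_norm t0).
apply: le_trans (_ : _ <= t * (C4 / (t * J))) _; first by rewrite ler_pM2l.
by rewrite le_eqVlt; apply/orP; left; apply/eqP; field; rewrite !lt0r_neq0 //; (move: j; drop; lra).
Qed.

Lemma rA_le K x : `|x| <= K -> `|(r - A) * x| <= W / t * K.
Proof. by move=> h; have [rA _] := r_facts; rewrite normrM ler_pM. Qed.

Lemma rA_dl : `|(r - A) * (X0 + ln t - ln X0)| <= dl.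
Proof.
have h : `|X0 + ln t - ln X0| <= W.
  have [x1 l0 l1 x3] := X0_facts; have [w1 _ _ _] := W_facts; have l := lnt0.
  by rewrite ger0_norm; (move: l1 x3 w1 l; drop; lra).
by apply: le_trans (rA_le h) _; rewrite mulrC; exact: W2t.
Qed.

Lemma DE : D = Yp + ln s - A * ln t - A * (X0 - ln X0) - kap.
Proof. by rewrite /D /Yp; ring. Qed.

(** If u exceeded U before time N, the flow time left would be at most 1 / U, and s / U <= J / 8.
    But [Theta] is nearly constant, and by its value on entry Yp <= -J / 2 leaves more than that. *)
Lemma no_escape m : (m < N)%N -> (forall i, (i < m.+1)%N -> `|u i| <= U) -> u m.+1 <= U.
Proof.
move=> mN H; case: (leP (u m.+1) U) => // Uu; exfalso.
have [h1 h2 t9 wt] := t_big; have t0 : 0 < t by lra.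
have [U0 UJ U16 Ut tJ] := U_facts; have j := J_ge; have J0 : 0 < J by lra.
have [T1 T2] := T_incr T_rec t9 m.+1.
have Ts : T m.+1 <= s by exact: (T_le T_rec t9).
have s0 : 0 < s by (move: T2 Ts; drop; lra).
have E := Theta_end H.
have u0 : 0 < u m.+1 by (move: Uu U0; drop; lra).
have M0 : 0 <= M by exact: M_ge0 k_bd.
have a := A1; have c40 := C4_ge0.
have hq : 0 <= ln U - M + M by rewrite subrK ln_ge0 //; (move: U16; drop; lra).
have g1 := gg_ge u0.
have lU : ln U <= ln (u m.+1) by rewrite ler_ln ?posrE // ltW.
have th1 := th_up b0 u0; rewrite -/th -/Lb in th1.
have iU : 1 / u m.+1 <= 1 / U by rewrite !div1r lef_pV2 ?posrE // ltW.
have lT : ln (T m.+1) <= ln s by rewrite ler_ln ?posrE //; (move: T2; drop; lra).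
have Tn0 : 0 < T m.+1 by (move: T2; drop; lra).
have g2 : (ln U) / s <= ln U / T m.+1.
  by apply: ler_wpM2l; [(move: hq; drop; lra)|rewrite lef_pV2 ?posrE].
have g3 : (ln U - M) / T m.+1 <= gg (u m.+1) / T m.+1 by rewrite ler_pM2r ?invr_gt0 //; (move: g1 lU; drop; lra).
have g4 : M / T m.+1 <= M / t by apply: ler_wpM2l => //; rewrite lef_pV2 ?posrE.
have k1 : Lb / 2 - 1 / U - ln s + ln U / s - M / t <= Theta (u m.+1) (T m.+1).
  rewrite /Theta /Submission.Theta -/th -/gg; rewrite mulrBl in g3; (move: th1 iU lT g2 g3 g4; drop; lra).
have k2 : s * (Lb / 2 - 1 / U - ln s + ln U / s - M / t) <= s * Theta (u m.+1) (T m.+1).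
  by rewrite ler_pM2l.
have k3 : s * (Lb / 2 - 1 / U - ln s + ln U / s - M / t) =
   s * (Lb / 2) - s / U - s * ln s + ln U - r * M.
  by rewrite /r; field; rewrite !lt0r_neq0.
have sU : s / U <= J / 8.
  by rewrite ler_pdivrMr // mulrAC [J * U]mulrC UJ; have := s2; (drop; lra).
have lUs : ln s - ln J <= ln U.
  have sUJ : s <= U * J by rewrite UJ; have := s2; (move: U0 j; drop; nra).
  have UJ0 : 0 < U * J by exact: mulr_gt0.
  have : ln s <= ln (U * J) by rewrite ler_ln ?posrE.
  by rewrite lnM ?posrE //; (drop; lra).
have eD := s_ln; have rA := rA_dl; have dl0 := dl_ge0.
have rk := r_mul (k_bd (u 0)).
have rM : r * M <= 2 * A * M.
  have /andP[r0 rA2] := r2; exact: ler_wpM2r.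
have q1 : r * (X0 + ln t - ln X0 + k (u 0)) =
  A * (X0 - ln X0) + A * ln t + (r - A) * (X0 + ln t - ln X0) + r * k (u 0) by ring.
rewrite q1 in E; rewrite k3 in k2.
move: E; rewrite ler_norml => /andP[_ E].
move: eD; rewrite ler_norml DE => /andP[_ eD].
move: rA; rewrite ler_norml => /andP[_ rA].
move: rk; rewrite ler_norml => /andP[_ rk].
have cJ1 : 2 * A * (C4 / J) <= 2 * A * C4.
  apply: ler_wpM2l; first by (move: a; drop; lra).
  by rewrite ler_pdivrMr //; (move: j c40; drop; nra).
have /andP[_ y2] := YJ; have lj := lnJ; have jk := JK; have dk := dK.
have kn := ler_norm (- kap); rewrite normrN in kn.
have q2 : s * (ln s - ln t - Lb) = s * ln s - s * ln t - s * (Lb / 2) - s * (Lb / 2) by field.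
rewrite q2 in eD.
have dE : (5 + 2 * A * Kc) * dl = 5 * dl + 2 * A * (Kc * dl) by ring.
rewrite dE in dk.
have mE : M * (4 * A) = 2 * A * M + 2 * A * M by ring.
rewrite mE in jk.
move: E eD rA rk k2 rM sU lUs cJ1 y2 lj jk dk kn dl0 j a c40 M0 s0; drop; lra.
Qed.

Lemma u_bound m : (m <= N)%N -> `|u m| <= U.
Proof.
have [U0 _ _ _ _] := U_facts; have /andP[l0 l1] := u0_le; have [_ _ t9 _] := t_big.
suff H : forall m, (m <= N)%N -> forall i, (i <= m)%N -> `|u i| <= U by move=> mN; apply: (H m).
elim=> [_ i|{}m IH mN i]; first by rewrite leqn0 => /eqP ->; rewrite ler_norml; lra.
rewrite leq_eqVlt => /orP[/eqP -> |]; last by rewrite ltnS; apply: IH; exact: ltnW.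
have h := no_escape mN (IH (ltnW mN)).
have h2 := u_ge0 b0 T_rec u_rec t9 m.+1.
by rewrite ler_norml h; apply/andP; split => //; lra.
Qed.

Definition K5 : R := 3 + M * (1 + 2 * A) + 2 * A * C4.
Hypothesis dK5 : 4 * (2 + c) * K5 * dl <= 1.

Ltac keep_hyp H ::= tryif first [constr_eq H b0 | constr_eq H k_der | constr_eq H k_bd | constr_eq H A1 | constr_eq H LA | constr_eq H T_rec | constr_eq H u_rec | constr_eq H u0E | constr_eq H J512 | constr_eq H cJ | constr_eq H t1 | constr_eq H Wdl | constr_eq H dl16 | constr_eq H X0J | constr_eq H YJ | constr_eq H s2 | constr_eq H lnJ | constr_eq H JK | constr_eq H dK | constr_eq H dK5] then fail else idtac.
Lemma K5_ge : 3 <= K5.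
Proof.
have M0 : 0 <= M by exact: M_ge0 k_bd.
have a := A1; have c40 := C4_ge0.
have h1 : 0 <= M * (1 + 2 * A) by apply: mulr_ge0 => //; lra.
have h2 : 0 <= 2 * A * C4 by apply: mulr_ge0 => //; lra.
by rewrite /K5; lra.
Qed.

Lemma W_dl : W <= dl * s.
Proof.
have [_ _ w1 _] := W_facts; have w := Wdl; have d := dl_ge0; have st := s_ge.
have : dl * t <= dl * s by apply: ler_wpM2l.
by nra.
Qed.

Lemma gg_end : gg (u N) <= ln t + M.
Proof.
have hu := u_bound (leqnn N); have h5 := G_le b hu.
have [h1 h2 t9 wt] := t_big; have t0 : 0 < t by lra.
have [U0 UJ U16 Ut tJ] := U_facts; have j := J_ge; have jc := cJ.
have cE : 1 / 2 + b ^+ 2 <= J / 4 by move: jc; rewrite /c /cc; lra.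
have h : ln (G (u N)) <= 2 * ln t.
  have -> : 2 * ln t = ln (t ^+ 2) by rewrite lnXn // mulr_natl.
  rewrite ler_ln ?posrE ?exprn_gt0 ?(G_gt0 b0) //; apply: le_trans h5 _.
  have : U * U <= (t / 32) * (t / 32) by apply: ler_pM => //; exact: ltW.
  have : J <= t * t by (move: h2 t9 j; drop; nra).
  by rewrite !expr2; (move: j cE; drop; lra).
by have := k_bd (u N); rewrite ler_norml /gg /Submission.gg -/G => /andP[]; (move: h; drop; lra).
Qed.

(** The flow time left at time N. It is about 1 / u N, so that s eta is about the exit coordinate s
    / u N. *)
Let eta : R := Lb / 2 - th (u N).
Lemma eta_eq : s * Theta (u N) (T N) = s * (Lb / 2) - s * eta - s * ln s + gg (u N).
Proof.
have s0 : s != 0 by apply: lt0r_neq0; have := s_ge; have := t1; lra.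
by rewrite /Theta /Submission.Theta -/gg -/th /eta -/s; field.
Qed.

Lemma eta_le : s * eta <= K5 * W.
Proof.
have E := Theta_end (fun i iN => u_bound (ltnW iN)).
rewrite eta_eq in E; have g := gg_end.
have eD := s_ln; have D1 := Delta_le; have rk := r_mul (k_bd (u 0)).
have [x1 l0 l1 x3] := X0_facts; have l := lnt0; have [w1 w2 w3 _] := W_facts.
have /andP[r0 rA2] := r2; have M0 : 0 <= M by exact: M_ge0 k_bd.
have a := A1; have c40 := C4_ge0; have j := J_ge; have J0 : 0 < J by lra.
have hr : 0 <= r * (X0 + ln t - ln X0) by rewrite mulr_ge0 //; [exact: ltW|(move: l1 l; drop; lra)].
have cJ1 : 2 * A * (C4 / J) <= 2 * A * C4.
  apply: ler_wpM2l; first by (move: r0 rA2; drop; lra).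
  by rewrite ler_pdivrMr //; (move: c40 j; drop; nra).
have q1 : r * (X0 + ln t - ln X0 + k (u 0)) = r * (X0 + ln t - ln X0) + r * k (u 0) by ring.
rewrite q1 in E.
have q2 : s * (ln s - ln t - Lb) = s * ln s - s * ln t - s * (Lb / 2) - s * (Lb / 2) by field.
rewrite q2 in eD.
move: E; rewrite ler_norml => /andP[E _].
move: eD; rewrite ler_norml => /andP[eD _].
move: D1; rewrite ler_norml => /andP[D1 _].
move: rk; rewrite ler_norml => /andP[rk _].
have dk := dK; have d0 := dl_ge0.
have dE : (5 + 2 * A * Kc) * dl = 5 * dl + 2 * A * (Kc * dl) by ring.
rewrite dE in dk.
have : (K5 - 2) * 1 <= (K5 - 2) * W by apply: ler_wpM2l => //; have := K5_ge; (drop; lra).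
have mE : K5 = 3 + (M + 2 * A * M) + 2 * A * C4 by rewrite /K5; ring.
by rewrite mE; (move: g l1 x3 w1 hr cJ1 E eD D1 rk d0 dk; drop; lra).
Qed.

(** If u N were at most 1, the flow time left would be at least 1 / (2 + c), against [eta_le].
    Otherwise [th_lo] turns [eta_le] into a lower bound for u N. *)
Lemma uN_ge : 0 < u N /\ s <= 2 * K5 * W * u N.
Proof.
have h := eta_le; have k5 := K5_ge; have [_ _ w1 _] := W_facts.
have st := s_ge; have [_ _ t9 _] := t_big; have s0 : 0 < s by lra.
have c0 : 0 < c by exact: cc_gt0.
have wd := W_dl; have dk := dK5.
have big : 4 * (2 + c) * (K5 * W) <= s.
  have -> : 4 * (2 + c) * (K5 * W) = 4 * (2 + c) * K5 * W by ring.
  apply: le_trans (_ : _ <= 4 * (2 + c) * K5 * (dl * s)) _.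
    by apply: ler_wpM2l => //; rewrite !mulr_ge0 //; (move: k5 c0; drop; lra).
  by rewrite mulrA -[leRHS]mul1r ler_pM2r.
have KW : 0 < K5 * W by rewrite mulr_gt0 //; (move: k5 w1; drop; lra).
have cKW : 0 < c * (K5 * W) by exact: mulr_gt0.
case: (leP (u N) 1) => u1.
  exfalso; have thN : th (u N) <= th 1.
    by rewrite /th /Submission.th ler_pM2r ?invr_gt0 // le_atan // ler_pM2r ?invr_gt0 // lerD2r.
  have := th_lo b0 ltr01; rewrite -/th -/Lb -/c => t2.
  have : s * (1 / (1 + 1 + c)) <= K5 * W.
    by apply: le_trans h; rewrite ler_pM2l // /eta; lra.
  by rewrite mulrA mulr1 ler_pdivrMr; (move: st t9 c0 big; drop; lra).
have u0 : 0 < u N by (move: u1; drop; lra).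
split => //; have := th_lo b0 u0; rewrite -/th -/Lb -/c => t2.
have : s * (1 / (u N + 1 + c)) <= K5 * W.
  by apply: le_trans h; rewrite ler_pM2l.
rewrite mulrA mulr1 ler_pdivrMr; last by (move: c0 u1; drop; lra).
have -> : 2 * K5 * W * u N = 2 * (K5 * W * u N) by ring.
by (move: st t9 big KW; drop; lra).
Qed.

Lemma uN_large : 1 <= 2 * K5 * dl * u N.
Proof.
have [u0 h] := uN_ge; have wd := W_dl; have k5 := K5_ge.
have st := s_ge; have [_ _ t9 _] := t_big; have s0 : 0 < s by lra.
rewrite -(ler_pM2r s0) mul1r; apply: le_trans h _.
have -> : 2 * K5 * dl * u N * s = 2 * K5 * u N * (dl * s) by ring.
have -> : 2 * K5 * W * u N = 2 * K5 * u N * W by ring.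
by apply: ler_wpM2l => //; rewrite !mulr_ge0 //; (move: u0 k5; drop; lra).
Qed.

Variables (kp km e : R).
Hypothesis kapE : kap = A * km - kp.
Hypothesis kpe : `|k (u N) - kp| <= e.
Hypothesis kme : `|k (u 0) - km| <= e.

Ltac keep_hyp H ::= tryif first [constr_eq H b0 | constr_eq H k_der | constr_eq H k_bd | constr_eq H A1 | constr_eq H LA | constr_eq H T_rec | constr_eq H u_rec | constr_eq H u0E | constr_eq H J512 | constr_eq H cJ | constr_eq H t1 | constr_eq H Wdl | constr_eq H dl16 | constr_eq H X0J | constr_eq H YJ | constr_eq H s2 | constr_eq H lnJ | constr_eq H JK | constr_eq H dK | constr_eq H dK5 | constr_eq H kapE | constr_eq H kpe | constr_eq H kme] then fail else idtac.
Let K6 : R := 5 + M + 2 * A * Kc + (1 + c) * (4 * K5 ^+ 2) + (1 + c) * (2 * K5).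

(** [Theta] is written out at both ends. The terms of the size of s and t combine through [s_ln],
    and the limits km and kp of k leave the constant kap. The error 2 A C4 / J is the only one that
    does not vanish with dl and e. *)
Lemma exit_phase : `|- (s / u N) - ln (s / u N) - Yp| <= 2 * A * (C4 / J) + K6 * dl + (A + 1) * e.
Proof.
have [u0 uV] := uN_ge; have k5 := K5_ge; have [_ _ w1 _] := W_facts.
have st := s_ge; have [_ _ t9 wt] := t_big; have s0 : 0 < s by lra.
have t0 : 0 < t by lra.
have c0 : 0 < c by exact: cc_gt0.
have wd := W_dl; have W2 := W2t; have d0 := dl_ge0; have dk := dK5.
pose p := s / u N.
have p0 : 0 < p by exact: divr_gt0.
have pW : p <= 2 * K5 * W by rewrite /p ler_pdivrMr.
have iu : (u N)^-1 = p / s by rewrite /p; field; rewrite !lt0r_neq0.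
have ps : p / s <= 2 * K5 * dl.
  rewrite ler_pdivrMr //; apply: le_trans pW _; rewrite -[leRHS]mulrA.
  by apply: ler_wpM2l => //; (move: k5; drop; lra).
have pps : p * (p / s) <= 4 * K5 ^+ 2 * dl.
  apply: le_trans (_ : _ <= (2 * K5 * W) * (2 * K5 * W / t)) _.
    apply: ler_pM => //; [exact: ltW|by rewrite divr_ge0 // ltW|].
    apply: ler_pM => //; [exact: ltW|by rewrite invr_ge0 ltW|by rewrite lef_pV2 ?posrE].
  have -> : 2 * K5 * W * (2 * K5 * W / t) = 4 * K5 ^+ 2 * (W * (W / t)) by ring.
  by apply: ler_wpM2l => //; rewrite mulr_ge0 // sqr_ge0.
have ub : 2 * (1 + c) <= u N.
  have h := uN_large; rewrite -(ler_pM2l (_ : 0 < (u N)^-1)) ?invr_gt0 // mulVf ?lt0r_neq0 //.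
  rewrite iu; apply: le_trans (_ : _ <= 2 * K5 * dl * (2 * (1 + c))) _.
    by rewrite ler_pM2r //; (move: c0; drop; lra).
  have : 0 <= K5 * dl by rewrite mulr_ge0 //; (move: k5; drop; lra).
  by (move: dk; drop; lra).
have lE := lnG_asym b0 (_ : 2 * (1 + cc b) <= `|u N|).
rewrite (gtr0_norm u0) -/c -/G in lE; have {}lE := lE ub.
have e4 : (1 + c) / u N <= (1 + c) * (2 * K5 * dl).
  by rewrite iu; apply: ler_wpM2l => //; (move: c0; drop; lra).
have lnu : ln (u N) = ln s - ln p.
  by rewrite /p ln_div ?posrE //; ring.
have h1 := th_up b0 u0; have h2 := th_lo b0 u0; rewrite -/th -/Lb -/eta -/c in h1 h2.
have {}h1 : s * eta <= p by rewrite /p -[(u N)^-1]div1r ler_pM2l.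
have i1 : (u N)^-1 - (1 + c) * ((u N)^-1 * (u N)^-1) <= 1 / (u N + 1 + c).
  have V : (u N)^-1 * u N = 1 by rewrite mulVf // lt0r_neq0.
  have V0 : 0 < (u N)^-1 by rewrite invr_gt0.
  set v := (u N)^-1 in V V0 *.
  rewrite ler_pdivlMr; last by (move: u0 c0; drop; lra).
  have -> : (v - (1 + c) * (v * v)) * (u N + 1 + c) = v * u N + (1 + c) * v - (1 + c) * v * (v * u N) - ((1 + c) * v) ^+ 2 by ring.
  by rewrite V; have := sqr_ge0 ((1 + c) * v); (drop; lra).
have {}h2 : p - (1 + c) * (p * (p / s)) <= s * eta.
  have -> : p - (1 + c) * (p * (p / s)) = s * ((u N)^-1 - (1 + c) * ((u N)^-1 * (u N)^-1)).
    by rewrite iu; field; exact: lt0r_neq0.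
  by rewrite ler_pM2l //; (move: h2 i1; drop; lra).
have h3 : (1 + c) * (p * (p / s)) <= (1 + c) * (4 * K5 ^+ 2 * dl) by apply: ler_wpM2l => //; (move: c0; drop; lra).
have E := Theta_end (fun i iN => u_bound (ltnW iN)).
rewrite eta_eq in E.
have ggE : gg (u N) = ln (G (u N)) / 2 + k (u N) by [].
have eD := s_ln; have rA := rA_dl.
have rk : `|r * k (u 0) - A * km| <= dl * M + A * e.
  have -> : r * k (u 0) - A * km = (r - A) * k (u 0) + A * (k (u 0) - km) by ring.
  have M0 : 0 <= M by exact: M_ge0 k_bd.
  apply: le_trans (ler_normD _ _) _; apply: lerD.
    apply: le_trans (rA_le (k_bd (u 0))) _; apply: ler_wpM2r => //.
    have : 1 * (W / t) <= W * (W / t) by apply: ler_wpM2r => //; rewrite divr_ge0 //; (move: w1 t9; drop; lra).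
    by (move: W2; drop; lra).
  have a := A1; rewrite normrM ger0_norm; last by (move: a; drop; lra).
  by apply: ler_wpM2l => //; (move: a; drop; lra).
have q1 : r * (X0 + ln t - ln X0 + k (u 0)) =
  A * (X0 - ln X0) + A * ln t + (r - A) * (X0 + ln t - ln X0) + r * k (u 0) by ring.
have q2 : s * (ln s - ln t - Lb) = s * ln s - s * ln t - s * (Lb / 2) - s * (Lb / 2) by field.
rewrite q2 DE kapE in eD; rewrite q1 ggE in E; rewrite lnu in lE.
rewrite -/p.
have kpe' := kpe.
move: E; rewrite ler_norml => /andP[E1 E2].
move: eD; rewrite ler_norml => /andP[D1 D2].
move: rA; rewrite ler_norml => /andP[A3 A4].
move: rk; rewrite ler_norml => /andP[r3 r4].
move: lE; rewrite ler_norml => /andP[l3 l4].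
move: kpe'; rewrite ler_norml => /andP[k3 k4].
have K6E : K6 * dl + (A + 1) * e = 5 * dl + dl * M + 2 * A * (Kc * dl) + (1 + c) * (4 * K5 ^+ 2 * dl) +
  (1 + c) * (2 * K5 * dl) + A * e + e by rewrite /K6; ring.
by rewrite -[leRHS]addrA K6E ler_norml; apply/andP; split; (move: e4 h1 h2 h3 E1 E2 D1 D2 A3 A4 r3 r4 l3 l4 k3 k4; drop; lra).
Qed.

Ltac keep_hyp H ::= idtac.
End RealPassage.

(** * Choice of the constants of a real passage *)

Section PassagePackaged.
Variables (R : realType) (b A : R).
Hypothesis b0 : 0 < b.
Hypothesis A1 : 1 <= A.
Hypothesis LA : Lb b = ln A.

Ltac keep_hyp H ::= tryif first [constr_eq H b0 | constr_eq H A1 | constr_eq H LA] then fail else idtac.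
Definition realpass (J : R) (T u : nat -> R) : Prop :=
  (forall m : nat, T m.+1 = T m + 1 + (T m - 1)^-1) /\
  (forall m : nat, u m.+1 = u m + (T m - 1)^-1 * G b (u m)).

Lemma ln_le8 (J : R) : 256 <= J -> ln J <= J / 8.
Proof.
move=> J1; have J0 : 0 < J / 16 by lra.
have e : ln J = ln (J / 16) + ln 16 by rewrite -lnM ?posrE ?divfK //; apply: lt0r_neq0.
have h1 := ln_sublinear J0; have h2 : ln 16 < 16 :> R by apply: ln_sublinear.
by rewrite e; lra.
Qed.

(** The error of order 1 / J is made small by J and the others by the starting value of T; hence J0
    is chosen first, and t0 depends on J. *)
Lemma real_passage : exists kap : R, forall e : R, 0 < e -> exists J0 : R, 1 <= J0 /\ forall J : R, J0 <= J ->
  exists t0 : R, 1 <= t0 /\ forall (T u : nat -> R) (X0 : R) (N : nat),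
  realpass J T u -> t0 <= T 0%N -> u 0%N = - (T 0%N / X0) -> J / 2 <= X0 <= 3 * J ->
  - (3 * J) <= T N - ln (T N) - A * (T 0%N - ln (T 0%N)) + A * (X0 - ln X0) + kap <= - (J / 2) ->
  T N <= 2 * A * T 0%N ->
  [/\ forall m, (m <= N)%N -> `|u m| <= 16 * A * T 0%N / J, 0 < u N &
   `|- (T N / u N) - ln (T N / u N) - (T N - ln (T N) - A * (T 0%N - ln (T 0%N)) + A * (X0 - ln X0) + kap)| <= e].
Proof.
have [k [k_der [M M0 k_bd] [kp [km tail]]]] := k_exists b0.
pose kap : R := A * km - kp; exists kap => e e0.
pose C : R := C4 b M A; have C0 : 0 <= C by exact: (C4_ge0 b0 k_bd A1).
pose e1 : R := e / (3 * (A + 1)).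
have e10 : 0 < e1 by apply: divr_gt0 => //; apply: mulr_gt0; have := A1; (drop; lra).
have [V V1 HV] := tail e1 e10.
have c0 : 0 < cc b by exact: cc_gt0.
have K53 : 3 <= K5 b M A by exact: (K5_ge b0 k_bd A1).
pose Kc : R := 21 * (1 + cc b).
have a1 := A1; have Kc0 : 0 <= 2 * A * Kc by rewrite /Kc; apply: mulr_ge0; lra.
pose K5v : R := K5 b M A.
pose K6 : R := 5 + M + 2 * A * Kc + (1 + cc b) * (4 * K5v ^+ 2) + (1 + cc b) * (2 * K5v).
have K60 : 0 <= K6.
  have s2 : 0 <= (1 + cc b) * (4 * K5v ^+ 2) by apply: mulr_ge0; [(move: c0; drop; lra)|apply: mulr_ge0 => //; exact: sqr_ge0].
  have s3 : 0 <= (1 + cc b) * (2 * K5v) by apply: mulr_ge0; rewrite /K5v; (move: c0 K53; drop; lra).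
  by rewrite /K6; (move: M0 Kc0 s2 s3; drop; lra).
(* One summand for each smallness condition on dl = 1 / Q; [dlB] extracts them one by one. *)
pose Q : R := 16 + (5 + 2 * A * Kc) + 4 * (2 + cc b) * K5v + K6 * (3 / e) + 2 * K5v * V + 3 * V.
have p1 : 0 <= K6 * (3 / e) by rewrite mulr_ge0 // divr_ge0 // ltW.
have p2 : 0 <= 2 * K5v * V by rewrite !mulr_ge0 //; rewrite /K5v; (move: V1 K53; drop; lra).
have p3 : 0 <= 4 * (2 + cc b) * K5v by rewrite !mulr_ge0 //; rewrite /K5v; (move: c0 K53; drop; lra).
have Q16 : 16 <= Q by rewrite /Q; (move: V1 Kc0 p1 p2 p3; drop; lra).
pose dl : R := 1 / Q.
have Q0 : 0 < Q by (move: Q16; drop; lra).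
have dl0 : 0 < dl by rewrite divr_gt0.
have dlB (x : R) : x <= Q -> x * dl <= 1 by move=> h; rewrite /dl mulrA mulr1 ler_pdivrMr // mul1r.
pose J0 : R := 512 * A + 4 * (1 + cc b) + 8 * (M * (4 * A) + `|kap| + 2 * A * C + 1) + 2 * A * C * (3 / e).
have kn := normr_ge0 kap.
have q1 : 0 <= M * (4 * A) by apply: mulr_ge0; (move: M0 a1; drop; lra).
have q2 : 0 <= 2 * A * C by apply: mulr_ge0; (move: C0 a1; drop; lra).
have q3 : 0 <= 2 * A * C * (3 / e) by rewrite mulr_ge0 // divr_ge0 // ltW.
exists J0; split; first by rewrite /J0; (move: c0 a1 kn q1 q2 q3; drop; lra).
move=> J JJ.
have J512 : 512 * A <= J by move: JJ; rewrite /J0; move: c0 a1 kn q1 q2 q3; drop; lra.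
have J4 : 4 * (1 + cc b) <= J by move: JJ; rewrite /J0; move: c0 a1 kn q1 q2 q3; drop; lra.
have JK : 8 * (M * (4 * A) + `|kap| + 2 * A * C + 1) <= J by move: JJ; rewrite /J0; move: c0 a1 kn q1 q2 q3; drop; lra.
have JC : 2 * A * C * (3 / e) <= J by move: JJ; rewrite /J0; move: c0 a1 kn q1 q2 q3; drop; lra.
have J00 : 0 < J by (move: a1 J512; drop; lra).
have lJ : ln J <= J / 8 by apply: ln_le8; (move: a1 J512; drop; lra).
have A10 : 0 < A + 1 by (move: a1; drop; lra).
have [t0 t01 Ht0] := @ln_sq_small R (3 * J + (2 * A + `|kap| + 1) / (A + 1)) (dl / (A + 1) ^+ 2)
  (divr_gt0 dl0 (exprn_gt0 2 A10)).
exists t0; split => // T u X0 N [Tr ur] Tt u0 X0J YJ sA.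
have Wdl : Wp A kap J (T 0%N) ^+ 2 <= dl * T 0%N.
  have -> : Wp A kap J (T 0%N) = (A + 1) * (3 * J + (2 * A + `|kap| + 1) / (A + 1) + ln (T 0%N)).
    by rewrite /Wp; field; exact: lt0r_neq0.
  rewrite exprMn; have h := Ht0 _ Tt.
  apply: le_trans (ler_wpM2l (sqr_ge0 (A + 1)) h) _.
  by rewrite le_eqVlt; apply/orP; left; apply/eqP; field; exact: lt0r_neq0.
have t1 : 1 <= T 0%N by exact: le_trans Tt.
have d16 : dl <= 1 / 16 by rewrite /dl ler_pdivrMr // mulrC mulrA ler_pdivlMr //; (move: Q16; drop; lra).
have dK : (5 + 2 * A * Kc) * dl <= 1 by apply: dlB; rewrite /Q; (move: V1 p1 p2 p3; drop; lra).
have dK5 : 4 * (2 + cc b) * K5v * dl <= 1 by apply: dlB; rewrite /Q; (move: V1 Kc0 p1 p2; drop; lra).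
have UB := u_bound b0 k_der k_bd A1 LA Tr ur u0 J512 J4 t1 Wdl d16 X0J YJ sA lJ JK dK.
have [uN0 _] := uN_ge b0 k_der k_bd A1 LA Tr ur u0 J512 J4 t1 Wdl d16 X0J YJ sA lJ JK dK dK5.
have uNl := uN_large b0 k_der k_bd A1 LA Tr ur u0 J512 J4 t1 Wdl d16 X0J YJ sA lJ JK dK dK5.
have uNV : V <= u N.
  case: (leP V (u N)) => // h; exfalso.
  have : 2 * K5v * V * dl <= 1 by apply: dlB; rewrite /Q; (move: V1 Kc0 p1 p3; drop; lra).
  have : 2 * K5v * dl * u N < 2 * K5v * dl * V.
    by rewrite ltr_pM2l // mulr_gt0 // /K5v; (move: K53; drop; lra).
  have -> : 2 * K5v * dl * V = 2 * K5v * V * dl by ring.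
  by move: uNl; rewrite -/K5v; drop; lra.
have kpe : `|k (u N) - kp| <= e1 by have [h _] := HV _ uNV; exact: ltW.
have kme : `|k (u 0%N) - km| <= e1.
  have [W1 W2 W3 _] := W_facts kap A1 J512 t1.
  have /andP[_ X3] := X0J.
  have X00 : 0 < X0 by have /andP[h _] := X0J; (move: a1 J512 X0J; drop; lra).
  have XV : X0 * V <= T 0%N.
    have h1 : 3 * V * dl <= 1 by apply: dlB; rewrite /Q; (move: Kc0 p1 p2 p3; drop; lra).
    have h2 : X0 <= 3 * (dl * T 0%N).
      have : Wp A kap J (T 0%N) <= Wp A kap J (T 0%N) ^+ 2 by rewrite expr2; clear -W3; nra.
      by (move: X0J Wdl W2; drop; lra).
    apply: le_trans (_ : _ <= 3 * (dl * T 0%N) * V) _; first by rewrite ler_pM2r //; (move: V1; drop; lra).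
    have -> : 3 * (dl * T 0%N) * V = (3 * V * dl) * T 0%N by ring.
    by rewrite -[leRHS]mul1r ler_pM2r //; (move: t01 Tt; drop; lra).
  have h : V <= T 0%N / X0 by rewrite ler_pdivlMr // mulrC.
  by rewrite u0; have [_ h'] := HV _ h; exact: ltW.
split => //.
have E := exit_phase b0 k_der k_bd A1 LA Tr ur u0 J512 J4 t1 Wdl d16 X0J YJ sA lJ JK dK dK5 (erefl kap) kpe kme.
apply: le_trans E _; rewrite -/C -/K5v -/Kc -/K6.
have b1 : 2 * A * (C / J) <= e / 3.
  rewrite mulrA ler_pdivrMr //; move: JC.
  by rewrite mulrA ler_pdivrMr // => h; move: h; drop; lra.
have b2 : K6 * dl <= e / 3.
  have : K6 * (3 / e) * dl <= 1 by apply: dlB; rewrite /Q; (move: V1 Kc0 p2 p3; drop; lra).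
  have -> : K6 * (3 / e) * dl = K6 * dl * 3 / e by ring.
  by rewrite ler_pdivrMr // => h; move: h; drop; lra.
have b3 : (A + 1) * e1 = e / 3 by rewrite /e1; field; exact: lt0r_neq0.
by rewrite b3; clear -b1 b2; lra.
Qed.
Ltac keep_hyp H ::= idtac.
End PassagePackaged.

(** * Two real reference orbits *)

Section RefSeq.
Variable R : realType.
Implicit Types (i j n m : nat).

Lemma quad_cauchy (a : nat -> R) (K : R) : 0 <= K ->
  (forall i, `|a i.+1 - a i| <= K / ((i.+1)%:R * (i.+2)%:R)) ->
  exists l : R, forall i, `|a i - l| <= K / (i.+1)%:R.
Proof.
move=> K0 H.
have S i j : (i <= j)%N -> `|a j - a i| <= K / (i.+1)%:R - K / (j.+1)%:R.
  move=> /subnK <-; elim: (j - i)%N => [|d IH]; first by rewrite add0n !subrr normr0.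
  rewrite addSn; have -> : a (d + i).+1 - a i = (a (d + i).+1 - a (d + i)%N) + (a (d + i)%N - a i) by ring.
  apply: le_trans (ler_normD _ _) _; have := H (d + i)%N.
  have n0 : (d + i).+1%:R != 0 :> R by rewrite pnatr_eq0.
  have n1 : (d + i).+1%:R + 1 != 0 :> R by rewrite natr1 pnatr_eq0.
  have -> : K / ((d + i).+1%:R * (d + i).+2%:R) = K / (d + i).+1%:R - K / (d + i).+2%:R.
    rewrite -[(d + i).+2%:R]natr1; move: ((d + i).+1%:R : R) n0 n1 => y n0 n1.
    by field; apply/andP; split.
  move: IH (K / (d + i).+2%:R) => /[swap] y; move: (K / (d + i).+1%:R) (K / i.+1%:R) => y2 y3 h1 h2.
  by clear -h1 h2; lra.
apply: rcauchy => [i j ij|e e0].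
  by apply: le_trans (S _ _ ij) _; rewrite gerBl divr_ge0.
exists (Num.truncn (K / e)); rewrite ltr_pdivrMr ?ltr0n // mulrC -ltr_pdivrMr //.
exact: truncnS_gt.
Qed.

(** The recursion of T = 1/z, and also that of X = -1/w under [q0], so that [F] serves as a
    reference for both. Its starting value 4 is the critical value -1/4 of [q0] in the coordinate
    X. *)
Definition fx (X : R) : R := X + 1 + (X - 1)^-1.
Definition F (n : nat) : R := iter n fx 4.

Lemma F_S n : F n.+1 = F n + 1 + (F n - 1)^-1. Proof. by []. Qed.
Lemma F_ge n : n%:R + 4 <= F n.
Proof.
elim: n => [|n IH]; first by rewrite add0r.
rewrite F_S -natr1; have : 0 <= (F n - 1)^-1 by rewrite invr_ge0; have := ler0n R n; lra.
by lra.
Qed.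
Lemma F_le n : F n <= 4 + 4 / 3 * n%:R.
Proof.
elim: n => [|n IH]; first by rewrite mulr0 addr0.
rewrite F_S -natr1; have h := F_ge n; have hn := ler0n R n.
have : (F n - 1)^-1 <= 3^-1 by rewrite lef_pV2 ?posrE; (move: IH h; drop; lra).
by lra.
Qed.

Lemma F_log : exists l : R, forall i, `|F i - ln (F i) - i%:R - l| <= 2 / i.+1%:R.
Proof.
apply: quad_cauchy => // i.
have h := F_ge i; have hn := ler0n R i.
pose x : R := (F i - 1)^-1; have F1 : 0 < F i - 1 by lra.
have x0 : 0 < x by rewrite invr_gt0.
have xF : x * (F i - 1) = 1 by rewrite mulVf // lt0r_neq0.
have E : F i.+1 = F i * (1 + x) by rewrite F_S -/x; move: xF; rewrite mulrBr mulr1 => xF; lra.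
have x12 : `|x| <= 1 / 2 by rewrite gtr0_norm // /x -[leLHS]div1r ler_pdivrMr //; lra.
have -> : F i.+1 - ln (F i.+1) - i.+1%:R - (F i - ln (F i) - i%:R) = - (ln (1 + x) - x).
  by rewrite [X in ln X]E lnM ?posrE ?F_S -?natr1 -/x; [ring|(move: h hn x0; drop; lra)|(move: h hn x0; drop; lra)].
rewrite normrN; apply: le_trans (ln1_quad x12) _.
apply: ler_wpM2l => //; rewrite expr2 /x -invfM lef_pV2 ?posrE ?mulr_gt0 ?ltr0n //.
by apply: ler_pM => //; rewrite -?natr1; (move: h; drop; lra).
Qed.

(** In the coordinate 1/w, the real backward orbit of [q0] in the repelling petal: the next value S'
    is the positive root of S'^2 = S (S' + 1). *)
Fixpoint SS (n : nat) : R := if n is m.+1 then (SS m + Num.sqrt (SS m ^+ 2 + 4 * SS m)) / 2 else 4.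

Lemma SS_step n : 4 <= SS n -> SS n + 4 / 5 <= SS n.+1 /\ SS n.+1 = SS n + 1 - (SS n.+1 + 1)^-1.
Proof.
move=> h.
have [q [q0 q2 qE]] : exists q : R, [/\ 0 <= q, q ^+ 2 = SS n ^+ 2 + 4 * SS n & SS n.+1 = (SS n + q) / 2].
  exists (Num.sqrt (SS n ^+ 2 + 4 * SS n)); split => //; rewrite ?sqrtr_ge0 // sqr_sqrtr //.
  by have := sqr_ge0 (SS n); lra.
have qs : SS n <= q.
  rewrite -(@ler_pXn2r _ 2) ?nnegrE //; last by lra.
  by rewrite q2; lra.
have e : (SS n.+1 + 1) * (SS n - SS n.+1 + 1) = 1.
  rewrite qE; transitivity ((SS n ^+ 2 + 4 * SS n + 4 - q ^+ 2) / 4); first by field.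
  by rewrite q2; field.
have S1 : 4 <= SS n.+1 by rewrite qE; lra.
have iE : (SS n.+1 + 1)^-1 = SS n - SS n.+1 + 1.
  by rewrite -[RHS](mulKf (_ : SS n.+1 + 1 != 0)) ?e ?mulr1 //; apply: lt0r_neq0; lra.
have : (SS n.+1 + 1)^-1 <= 5^-1 by rewrite lef_pV2 ?posrE; lra.
by move=> h5; rewrite iE; rewrite iE in h5; split; lra.
Qed.
Lemma SS_ge n : 4 + 4 / 5 * n%:R <= SS n.
Proof.
elim: n => [|n IH]; first by rewrite mulr0 addr0.
have hn := ler0n R n; have [h _] := @SS_step n ltac:(lra).
by rewrite -natr1; lra.
Qed.
Lemma SS4 n : 4 <= SS n.
Proof. by have := SS_ge n; have := ler0n R n; lra. Qed.
Lemma SS_le n : SS n <= 4 + n%:R.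
Proof.
elim: n => [|n IH]; first by rewrite addr0.
have [_ h] := SS_step (SS4 n); have : 0 <= (SS n.+1 + 1)^-1 by rewrite invr_ge0; have := SS4 n.+1; lra.
by rewrite -natr1; lra.
Qed.

Lemma SS_log : exists l : R, forall i, `|SS i + ln (SS i) - i%:R - l| <= 4 / i.+1%:R.
Proof.
apply: quad_cauchy => // i.
have h := SS_ge i.+1; have hn := ler0n R i; rewrite -[i.+1%:R]natr1 in h.
have h4 := SS4 i; have [_ st] := SS_step h4.
pose x : R := (SS i.+1 + 1)^-1; have F1 : 0 < SS i.+1 + 1 by lra.
have x0 : 0 < x by rewrite invr_gt0.
have xF : x * (SS i.+1 + 1) = 1 by rewrite mulVf // lt0r_neq0.
have x12 : `|-x| <= 1 / 2 by rewrite normrN gtr0_norm // /x -[leLHS]div1r ler_pdivrMr //; lra.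
have x1 : 0 < 1 + - x by move: x12; rewrite normrN gtr0_norm //; lra.
have E : SS i = SS i.+1 * (1 + - x).
  by rewrite -/x in st; move: xF; rewrite mulrDr mulr1 => xF; rewrite mulrDr mulr1 mulrN; lra.
have Sp : 0 < SS i.+1 by have := SS4 i.+1; (drop; lra).
have -> : SS i.+1 + ln (SS i.+1) - i.+1%:R - (SS i + ln (SS i) - i%:R) = - (ln (1 + - x) - - x).
  rewrite [X in _ - (_ + ln X - _)]E lnM ?posrE //.
  by rewrite -natr1; rewrite -/x in st; move: st; clear; lra.
rewrite normrN; apply: le_trans (ln1_quad x12) _; rewrite sqrrN.
rewrite ler_pdivlMr ?mulr_gt0 ?ltr0n // -[i.+2%:R]natr1 -[i.+1%:R]natr1.
have h5 : x * (i%:R + 2) <= 5 / 4 by rewrite /x mulrC ler_pdivrMr //; (move: h; drop; lra).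
have h6 : 0 <= x * (i%:R + 2) by rewrite mulr_ge0 ?ltW //; lra.
have h7 : (x * (i%:R + 2)) * (x * (i%:R + 2)) <= 5 / 4 * (5 / 4) by apply: ler_pM.
have h8 : 0 <= x * (x * (i%:R + 2)) by rewrite mulr_ge0 // ltW.
by clear -h7 h8; rewrite expr2; lra.
Qed.
End RefSeq.

(** * The reference passage, with entry and exit at integer times *)

Section Reference.
Variable R : realType.

(** As x + ln x increases at least as fast as x, p is within K of S; then ln p - ln S is O(K / S),
    and p - S differs from h by just this amount. *)
Lemma ln_shift (p S h K : R) : 0 < p -> 0 < S -> p + ln p - (S + ln S) = h -> `|h| <= K -> 2 * K <= S ->
  `|p - S| <= K /\ `|p - S - h| <= 2 * K / S.
Proof.
move=> p0 S0 E hK KS.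
have h1 : ln p - ln S <= (p - S) / S.
  rewrite -ln_div ?posrE //; have -> : (p - S) / S = p / S - 1 by field; exact: lt0r_neq0.
  by have := @le_ln1Dx _ (p / S - 1); rewrite addrCA subrr addr0; apply; rewrite ltrBrDl subrr divr_gt0.
have h2 : ln S - ln p <= (S - p) / p.
  rewrite -ln_div ?posrE //; have -> : (S - p) / p = S / p - 1 by field; exact: lt0r_neq0.
  by have := @le_ln1Dx _ (S / p - 1); rewrite addrCA subrr addr0; apply; rewrite ltrBrDl subrr divr_gt0.
move: hK; rewrite ler_norml => /andP[k1 k2].
have K0 : 0 <= K by clear -k1 k2; lra.
have pS : `|p - S| <= K.
  case: (leP S p) => c.
    have l : ln S <= ln p by rewrite ler_ln.
    by rewrite ler_norml; clear -c l E k1 k2; lra.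
  have l : ln p <= ln S by rewrite ler_ln // ltW.
  by rewrite ler_norml; clear -c l E k1 k2; lra.
split=> //; move: pS; rewrite ler_norml => /andP[d1 d2].
have p2 : S / 2 <= p by clear -KS d1; lra.
have -> : p - S - h = - (ln p - ln S) by rewrite -E; ring.
rewrite normrN ler_norml; apply/andP; split.
  have : (S - p) / p <= 2 * K / S.
    rewrite ler_pdivrMr // mulrAC ler_pdivlMr //.
    apply: le_trans (_ : _ <= K * S) _; first by rewrite ler_pM2r //; clear -d1; lra.
    by have : K * (S / 2) <= K * p by [apply: ler_wpM2l]; clear; lra.
  by clear -h2; lra.
apply: le_trans h1 _; rewrite ler_pM2r ?invr_gt0 //.
by clear -d2 K0; lra.
Qed.

End Reference.

(** Entry is at time n + J with X = [F J] and exit at time al n - J. By [F_log] the predicted phase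
    is -J + const, by [SS_log] SS J + ln (SS J) is J + const, and p + ln p is minus the phase; so J
    cancels and p is [SS J] plus a constant. *)
Lemma reference (R : realType) (b : R) (al : nat) : 0 < b -> (1 < al)%N -> Lb b = ln al%:R -> exists kap : R, forall e : R, 0 < e -> exists J0 : nat, (0 < J0)%N /\ forall J : nat, (J0 <= J)%N ->
  exists n0 : nat, (2 * J <= n0)%N /\ forall n : nat, (n0 <= n)%N -> forall (u : nat -> R) (N : nat),
  u 0%N = - (F R (n + J) / F R J) ->
  (forall m, u m.+1 = u m + (F R (n + J + m) - 1)^-1 * G b (u m)) ->
  (n + J + N = al * n - J)%N ->
  [/\ forall m, (m <= N)%N -> `|u m| <= 16 * al%:R * F R (n + J) / J%:R, 0 < u N,
    J%:R / 4 <= F R (al * n - J) / u N <= 6 * J%:R &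
    `|- (F R (al * n - J) / u N) + SS R J - kap| <= e].
Proof.
move=> b0 al1 LA; set A : R := al%:R.
have A2 : 2 <= A by rewrite ler_nat.
have A1 : 1 <= A by lra.
have [kap Hk] := real_passage b0 A1 LA.
have [l0 Hl] := F_log R; have [l1 Hs] := SS_log R.
pose kp : R := l0 + kap + l1; exists kp => e e0.
pose e1 : R := Num.min (e / 4) 1.
have e10 : 0 < e1 by rewrite /e1 lt_min divr_gt0 //= ltr01.
have e11 : e1 <= 1 /\ e1 <= e / 4 by rewrite /e1 !ge_min lexx orbT; split => //; rewrite lexx.
have [J1 [J11 HJ]] := Hk _ e10.
pose K : R := `|kp| + 3.
pose Q : R := J1 + 64 + 8 * (`|l0| + `|kap|) + (6 + 4 * A) / e1 + 4 * K + 10 * K / e.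
have kn := normr_ge0 kp; have ln0 := normr_ge0 l0; have kpn := normr_ge0 kap.
have q1 : 0 <= (6 + 4 * A) / e1 by apply: divr_ge0; [clear -A2; lra|exact: ltW].
have q2 : 0 <= 10 * K / e by apply: divr_ge0; [rewrite /K; clear -kn; lra|exact: ltW].
have K3 : 3 <= K by rewrite /K lerDr.
pose J0 := (Num.truncn Q).+1; exists J0; split => // J JJ.
have QJ : Q <= J%:R.
  by apply: le_trans (_ : _ <= J0%:R) _; [exact/ltW/truncnS_gt|rewrite ler_nat].
have [JJ1 J64 Jl [JA JK JKe]] : [/\ J1 <= J%:R, 64 <= J%:R :> R, 8 * (`|l0| + `|kap|) + 64 <= J%:R &
   [/\ (6 + 4 * A) / e1 <= J%:R, 4 * K <= J%:R & 10 * K / e <= J%:R]].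
  by move: QJ; rewrite /Q => QJ; clear -QJ q1 q2 K3 ln0 kpn J11; split; [lra|lra|lra|split; lra].
have [t0 [t01 Ht]] := HJ _ JJ1.
pose n0 := maxn (2 * J) (Num.truncn t0).+1.
exists n0; split; first exact: leq_maxl.
move=> n nn u N u0 ur EN.
have nJ : (2 * J <= n)%N by exact: leq_trans (leq_maxl _ _) nn.
have nt : t0 <= n%:R.
  apply: le_trans (_ : _ <= (Num.truncn t0).+1%:R) _; first exact/ltW/truncnS_gt.
  by rewrite ler_nat; exact: leq_trans (leq_maxr _ _) nn.
have nJA : (2 * J <= al * n)%N by apply: leq_trans nJ _; rewrite leq_pmull // ltnW.
pose T m := F R (n + J + m).
have T0 : T 0%N = F R (n + J) by rewrite /T addn0.
have TN : T N = F R (al * n - J) by rewrite /T EN.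
have rp : realpass b J%:R T u.
  split=> m; first by rewrite /T addnS F_S.
  exact: ur.
have J0r : 0 <= J%:R :> R by exact: ler0n.
have n0r : 0 <= n%:R :> R by exact: ler0n.
have Tt : t0 <= T 0%N.
  by rewrite T0; apply: le_trans nt _; have := F_ge R (n + J); rewrite natrD; clear -J0r; lra.
have X0J : J%:R / 2 <= F R J <= 3 * J%:R.
  by have h1 := F_ge R J; have h2 := F_le R J; clear -h1 h2 J64; apply/andP; split; lra.
have rN : (al * n - J)%:R = A * n%:R - J%:R :> R.
  by rewrite natrB ?natrM //; apply: leq_trans nJA; rewrite leq_pmull.
have nJr : 2 * J%:R <= n%:R :> R by rewrite -natrM ler_nat.
have e1J : (6 + 4 * A) / J%:R <= e1.
  rewrite ler_pdivrMr; last by clear -J64; lra.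
  by move: JA; rewrite ler_pdivrMr // [leRHS]mulrC.
have Jp : 0 < J%:R :> R by clear -J64; lra.
have small (c : R) i : 0 <= c -> (J <= i)%N -> c / i.+1%:R <= c / J%:R :> R.
  by move=> c0 Ji; apply: ler_wpM2l => //; rewrite lef_pV2 ?posrE ?ltr0Sn // ler_nat leqW.
have s1 := Hl (al * n - J)%N; have s2 := Hl (n + J)%N; have s3 := Hl J; have s4 := Hs J.
have r1 : 2 / (al * n - J).+1%:R <= 2 / J%:R :> R by apply: small => //; apply: leq_trans (leq_sub2r J nJA); rewrite mul2n -addnn addnK.
have r2 : 2 / (n + J).+1%:R <= 2 / J%:R :> R by apply: small; rewrite ?leq_addl.
have r3 : 2 / J.+1%:R <= 2 / J%:R :> R by apply: small.
have r4 : 4 / J.+1%:R <= 4 / J%:R :> R by apply: small.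
set Yp : R := T N - ln (T N) - A * (T 0%N - ln (T 0%N)) + A * (F R J - ln (F R J)) + kap.
have Yv : `|Yp - (- J%:R + l0 + kap)| <= (2 + 4 * A) / J%:R.
  have -> : Yp - (- J%:R + l0 + kap) =
    (F R (al * n - J) - ln (F R (al * n - J)) - (al * n - J)%:R - l0) -
    A * (F R (n + J) - ln (F R (n + J)) - (n + J)%:R - l0) + A * (F R J - ln (F R J) - J%:R - l0).
    by rewrite /Yp TN T0 rN natrD; ring.
  have -> : (2 + 4 * A) / J%:R = 2 / J%:R + A * (2 / J%:R) + A * (2 / J%:R) :> R by field; exact: lt0r_neq0.
  have A0 : 0 <= A by clear -A1; lra.
  apply: le_trans (ler_normD _ _) _; apply: lerD.
    apply: le_trans (ler_normB _ _) _; apply: lerD.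
      by exact: le_trans s1 r1.
    by rewrite normrM ger0_norm //; apply: ler_wpM2l => //; exact: le_trans s2 r2.
  by rewrite normrM ger0_norm //; apply: ler_wpM2l => //; exact: le_trans s3 r3.
have Yv1 : (2 + 4 * A) / J%:R + 4 / J%:R <= e1.
  by apply: le_trans e1J; rewrite -mulrDl; apply: ler_wpM2r; [rewrite invr_ge0|clear; lra].
have j4 : 0 <= 4 / J%:R :> R by rewrite divr_ge0.
have [e111 e14] := e11.
have Yv2 : `|Yp - (- J%:R + l0 + kap)| <= 1.
  by apply: le_trans Yv _; clear -Yv1 e111 j4; lra.
have YJ : - (3 * J%:R) <= Yp <= - (J%:R / 2).
  move: Yv2; rewrite ler_norml => /andP[y1 y2].
  have a1 := ler_norm l0; have a2 := ler_norm (- l0); have a3 := ler_norm kap; have a4 := ler_norm (- kap).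
  rewrite normrN in a2; rewrite normrN in a4.
  by clear -y1 y2 a1 a2 a3 a4 Jl; apply/andP; split; lra.
have sA : T N <= 2 * A * T 0%N.
  rewrite TN T0; have h1 := F_ge R (n + J); have h2 := F_le R (al * n - J).
  rewrite rN in h2; rewrite natrD in h1.
  have h3 : A * (n%:R + J%:R + 4) <= A * F R (n + J) by apply: ler_wpM2l => //; clear -A1; lra.
  have h4 : 0 <= A * n%:R by rewrite mulr_ge0 // ler0n.
  have h5 : 0 <= A * J%:R by rewrite mulr_ge0 // ler0n.
  by clear -h1 h2 h3 h4 h5 A1 J0r; lra.
have u0' : u 0%N = - (T 0%N / F R J) by rewrite T0.
have [B1 B2 B3] := Ht T u (F R J) N rp Tt u0' X0J YJ sA.
have {}B3 : `|- (F R (al * n - J) / u N) - ln (F R (al * n - J) / u N) - Yp| <= e1 by rewrite -TN.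
have sp : 0 < F R (al * n - J) by have := F_ge R (al * n - J); have := ler0n R (al * n - J); clear; lra.
set p := F R (al * n - J) / u N in B3 *.
have p0 : 0 < p by exact: divr_gt0.
have S4 := SS4 R J; have S0 : 0 < SS R J by clear -S4; lra.
pose h : R := p + ln p - (SS R J + ln (SS R J)).
have hk : `|h + kp| <= 2 * e1.
  have -> : h + kp = - (- p - ln p - Yp) - (Yp - (- J%:R + l0 + kap)) - (SS R J + ln (SS R J) - J%:R - l1).
    by rewrite /h /kp; ring.
  apply: le_trans (ler_normB _ _) _; apply: le_trans (lerD (ler_normB _ _) (lexx _)) _.
  rewrite normrN.
  have s4' := le_trans s4 r4.
  have h5 := le_trans (lerD Yv s4') Yv1.
  by rewrite -addrA; apply: le_trans (lerD B3 h5) _; clear; lra.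
have hK : `|h| <= K.
  have -> : h = (h + kp) - kp by ring.
  by apply: le_trans (ler_normB _ _) _; rewrite /K; clear -hk e111; lra.
have SJ := SS_ge R J; have SJ2 := SS_le R J.
have KS : 2 * K <= SS R J by clear -SJ JK J64; lra.
have [d1 d2] := ln_shift p0 S0 (erefl h) hK KS.
have dK : 2 * K / SS R J <= e / 4.
  rewrite ler_pdivrMr //; move: JKe; rewrite ler_pdivrMr // => JKe.
  have : e * (4 / 5 * J%:R) <= e * SS R J by rewrite ler_pM2l //; clear -SJ; lra.
  by clear -JKe; lra.
split => //.
- by move=> m mN; rewrite -T0; exact: B1.
- by move: d1; rewrite ler_norml => /andP[c1 c2]; clear -c1 c2 SJ SJ2 JK J64; apply/andP; split; lra.
have -> : - p + SS R J - kp = - (p - SS R J - h) - (h + kp) by ring.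
apply: le_trans (ler_normB _ _) _; rewrite normrN.
by clear -d2 hk dK e14 e0; lra.
Qed.

(** * Comparison of a complex passage with the real one *)

Section Compare.
Variables (R : realType).
Local Notation C := R[i].
Definition Gc (b : R) (u : C) : C := u ^+ 2 + u + (cc b)%:C.

Lemma Gc_real b (x : R) : Gc b x%:C = (G b x)%:C.
Proof. by rewrite /Gc /G -rmorphXn -!rmorphD. Qed.

Lemma Gc_shift b (u d : C) : Gc b (u + d) = Gc b u + d * (2 * u + 1) + d ^+ 2.
Proof. by rewrite /Gc; ring. Qed.

Lemma E_alg (th t1 g h D : C) : th != 0 -> t1 != 0 -> g != 0 -> 1 + th != 0 -> 1 + th * h + th ^+ 2 * g != 0 ->
  let Q := 1 + th * h + th ^+ 2 * g in
  let z := t1^-1 - th^-1 in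
  let T2 := 1 + th^-1 in
  let T2' := T2 + 1 + th in
  let z' := T2 + z + 1 + t1 - T2' in
  (g * D + t1 * (g + g * D * h + (g * D) ^+ 2) - th * g) / (g * Q) - z' / T2' - (D - z / T2) =
  ((t1 - th) * (D * h - th * h - th ^+ 2 * g) + g * D * (t1 * D - th ^+ 2)) / Q + z * th * t1 * (z - 1 - th) / T2'.
Proof.
move=> th0 t10 g0 th1 Q0 /=.
have E : th + 1 + th + th * th = (1 + th) ^+ 2 by ring.
by field; rewrite E Q0 th0 t10 g0 [th + 1]addrC th1 expf_neq0.
Qed.

(** To first order D = (u - uh) / G(uh) is the difference of the flow times of the two orbits, and z
    / T2 that of their ln T. Their difference E is thus the linearized first integral, and a step
    changes it only by th^2 times th, th q or th g. *)
Lemma E_step (b T2 uh K B q : R) (z D : C) : 0 < b -> 9 <= T2 ->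
  let th := (T2 - 1)^-1 in let g := G b uh in
  md z <= K -> th * K <= 1 / 2 -> 0 <= q -> q ^+ 2 = g -> th * q <= 1 / 8 -> 0 <= B -> md D <= B * th ->
  let t1 := (T2%:C + z - 1)^-1 in
  let u1 := uh%:C + g%:C * D in
  let T2' := T2 + 1 + th in let uh' := uh + th * g in
  let z' := T2%:C + z + 1 + t1 - T2'%:C in
  let D' := (u1 + t1 * Gc b u1 - uh'%:C) / (G b uh')%:C in
  md (t1 - th%:C) <= 2 * K * th ^+ 2 /\ md (D' - z' / T2'%:C - (D - z / T2%:C)) <=
    2 * K * (K + 2) * th ^+ 3 + 4 * K * (2 * B + 3) * th ^+ 2 * (th * q) + 2 * B * (2 * B + 1) * th ^+ 2 * (th * g).
Proof.
move=> b0 T9 th g zK thK q0 qg thq B0 DB t1 u1 T2' uh' z' D'.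
have T1 : 0 < T2 - 1 by clear -T9; lra.
have th0 : 0 < th by rewrite invr_gt0.
have th8 : th <= 1 / 8 by rewrite /th -[leLHS]div1r ler_pdivrMr //; clear -T9; lra.
have g0 : 0 < g by exact: G_gt0.
have K0 : 0 <= K by exact: le_trans (md_ge0 z) zK.
have thE : th^-1 = T2 - 1 by rewrite /th invrK.
pose tc : C := th%:C.
have tc0 : tc != 0 by rewrite -md_gt0 md_real gtr0_norm.
have tcE : tc^-1 = T2%:C - 1 by rewrite /tc -fmorphV thE rmorphB.
have tz : 1 / 2 <= md (1 + tc * z).
  apply: le_trans (md_lb _ _); rewrite md1 mdM md_real gtr0_norm //.
  by have : th * md z <= th * K by [rewrite ler_pM2l]; move: thK; clear; lra.
have tz0 : 1 + tc * z != 0 by rewrite -md_gt0; apply: lt_le_trans tz; rewrite divr_gt0.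
have t1E : t1 = tc / (1 + tc * z).
  have -> : t1 = (tc^-1 + z)^-1 by rewrite tcE /t1; congr (_^-1); ring.
  by rewrite -[tc / _]invrK invf_div; congr (_^-1); rewrite mulrDl mul1r [tc * z]mulrC mulfK.
have t10 : t1 != 0 by rewrite t1E mulf_neq0 ?invr_eq0.
have mt1 : md t1 <= 2 * th.
  rewrite t1E mdf md_real gtr0_norm // ler_pdivrMr; last by apply: lt_le_trans tz; rewrite divr_gt0.
  by have : 2 * th * (1 / 2) <= 2 * th * md (1 + tc * z); [apply: ler_wpM2l => //; clear -th0; lra|clear; lra].
have zE : z = t1^-1 - tc^-1 by rewrite t1E invf_div mulrDl mulrAC mulfV // !mul1r addrAC subrr add0r.
have dt : t1 - tc = - z * (t1 * tc).
  rewrite zE; field; by rewrite t10 tc0.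
have mdt : md (t1 - tc) <= 2 * K * th ^+ 2.
  rewrite dt mdM mdN mdM md_real gtr0_norm //.
  have -> : 2 * K * th ^+ 2 = K * (2 * th * th) by ring.
  by apply: ler_pM => //; rewrite ?mulr_ge0 ?md_ge0 // ?ler_pM2r // ltW.
split=> //.
pose h : R := 2 * uh + 1.
have hq : `|h| <= 2 * q.
  rewrite -(@ler_pXn2r _ 2) ?nnegrE ?normr_ge0 ?mulr_ge0 //.
  rewrite real_normK ?num_real // exprMn qg /g GE /h; have := sqr_ge0 b; clear; lra.
pose Qr : R := 1 + th * h + th ^+ 2 * g.
have tq0 : 0 <= th * q by rewrite mulr_ge0 // ltW.
have thh : `|th * h| <= 2 * (th * q).
  by rewrite normrM gtr0_norm // mulrCA ler_pM2l.
have t2g : th ^+ 2 * g = (th * q) ^+ 2 by rewrite -qg exprMn.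
have tqs : (th * q) ^+ 2 <= (th * q) * (1 / 8) by rewrite expr2; exact: ler_wpM2l.
have Q12 : 1 / 2 <= Qr.
  move: thh; rewrite ler_norml => /andP[a1 _]; rewrite /Qr.
  have a2 : 0 <= th ^+ 2 * g by rewrite t2g sqr_ge0.
  by clear -a1 a2 thq; lra.
have mQ : `|- (th * h) - th ^+ 2 * g| <= 3 * (th * q).
  apply: le_trans (ler_normB _ _) _; rewrite normrN t2g (ger0_norm (sqr_ge0 _)).
  by clear -thh tqs tq0; lra.
have gc0 : g%:C != 0 :> C by rewrite -md_gt0 md_real gtr0_norm.
have th1 : 1 + tc != 0.
  have -> : 1 + tc = (1 + th)%:C by rewrite rmorphD rmorph1.
  by rewrite -md_gt0 md_real gtr0_norm; clear -th0; lra.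
have QcE : 1 + tc * h%:C + tc ^+ 2 * g%:C = Qr%:C.
  have H (x y w : R) : 1 + x%:C * y%:C + x%:C ^+ 2 * w%:C = (1 + x * y + x ^+ 2 * w)%:C :> C.
    by rewrite !rmorphD rmorph1 (rmorphM _ x) (rmorphM _ (x ^+ 2)) rmorphXn.
  exact: H.
have Qc0 : 1 + tc * h%:C + tc ^+ 2 * g%:C != 0.
  by rewrite QcE -md_gt0 md_real gtr0_norm; clear -Q12; lra.
have T2E : T2%:C = 1 + tc^-1 by rewrite tcE addrC subrK.
have T2'E : T2'%:C = T2%:C + 1 + tc by rewrite /T2' !rmorphD.
have E := @E_alg tc t1 g%:C h%:C D tc0 t10 gc0 th1 Qc0.
rewrite /= -zE -T2E -T2'E QcE in E.
have u1E : Gc b u1 = g%:C + g%:C * D * h%:C + (g%:C * D) ^+ 2.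
  have hc : h%:C = 2 * uh%:C + 1 :> C by rewrite /h rmorphD rmorph1 mulr_natl rmorphMn -mulr_natl.
  by rewrite /u1 Gc_shift Gc_real hc.
have g'E : (G b uh')%:C = g%:C * Qr%:C.
  rewrite -rmorphM; congr (_%:C).
  have -> : G b uh' = G b uh + (th * g) * (2 * uh + 1) + (th * g) ^+ 2 by rewrite /uh' /G; ring.
  by rewrite -/g /Qr /h; ring.
have D'E : D' = (g%:C * D + t1 * (g%:C + g%:C * D * h%:C + (g%:C * D) ^+ 2) - tc * g%:C) / (g%:C * Qr%:C).
  have uE : uh'%:C = uh%:C + tc * g%:C by rewrite /uh' (rmorphD _ uh) (rmorphM _ th).
  rewrite /D' g'E u1E uE /u1; congr (_ / _); ring.
rewrite -/z' in E; rewrite D'E E.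
have b1 : md ((t1 - tc) * (D * h%:C - tc * h%:C - tc ^+ 2 * g%:C)) <= 2 * K * th ^+ 2 * ((2 * B + 3) * (th * q)).
  rewrite mdM; apply: ler_pM; rewrite ?md_ge0 //.
  have -> : D * h%:C - tc * h%:C - tc ^+ 2 * g%:C = D * h%:C + (- (th * h) - th ^+ 2 * g)%:C.
    by rewrite rmorphB rmorphN /= !rmorphM /= addrA.
  apply: le_trans (mdD _ _) _; rewrite md_real mulrDl; apply: lerD => //.
  rewrite mdM md_real; apply: le_trans (_ : _ <= (B * th) * (2 * q)) _.
    by apply: ler_pM; rewrite ?md_ge0.
  by rewrite le_eqVlt; apply/orP; left; apply/eqP; ring.
have b2 : md (g%:C * D * (t1 * D - tc ^+ 2)) <= B * (2 * B + 1) * th ^+ 2 * (th * g).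
  rewrite mdM mdM md_real gtr0_norm //.
  apply: le_trans (_ : _ <= (g * (B * th)) * ((2 * th) * (B * th) + th ^+ 2)) _.
    apply: ler_pM; rewrite ?mulr_ge0 ?md_ge0 ?(ltW g0) //.
      by rewrite ler_pM2l.
    apply: le_trans (mdB _ _) _; rewrite mdX md_real gtr0_norm // lerD2r mdM.
    by apply: ler_pM; rewrite ?md_ge0.
  by rewrite le_eqVlt; apply/orP; left; apply/eqP; ring.
have T2'0 : 0 < T2' by rewrite /T2'; clear -T9 th0; lra.
have T2'i : T2'^-1 <= th.
  by rewrite /th lef_pV2 ?posrE // /T2'; clear -th0; lra.
have b3 : md (z * tc * t1 * (z - 1 - tc) / T2'%:C) <= 2 * K * (K + 2) * th ^+ 3.
  rewrite mdf !mdM !md_real (gtr0_norm th0) (gtr0_norm T2'0).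
  have -> : 2 * K * (K + 2) * th ^+ 3 = K * th * (2 * th) * (K + 2) * th by ring.
  apply: ler_pM; rewrite ?mulr_ge0 ?md_ge0 ?(ltW th0) ?invr_ge0 ?(ltW T2'0) //.
  apply: ler_pM; rewrite ?mulr_ge0 ?md_ge0 ?(ltW th0) //.
    by apply: ler_pM; rewrite ?mulr_ge0 ?md_ge0 ?(ltW th0) // ler_pM2r.
  apply: le_trans (mdB _ _) _; apply: le_trans (lerD (mdB _ _) (lexx _)) _.
  by rewrite md1 md_real gtr0_norm //; clear -zK th8; lra.
have Qp : 0 < Qr by clear -Q12; lra.
apply: le_trans (mdD _ _) _; rewrite [md (_ / Qr%:C)]mdf (md_real Qr) (gtr0_norm Qp).
have Q2 : Qr^-1 <= 2 by rewrite -[leLHS]div1r ler_pdivrMr; clear -Q12; lra.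
have b12 := le_trans (mdD _ _) (lerD b1 b2).
have Qi0 : 0 <= Qr^-1 by rewrite invr_ge0; clear -Q12; lra.
have b4 := ler_pM (md_ge0 _) Qi0 b12 Q2.
move: (lerD b4 b3) => b5; apply: le_trans b5 _; rewrite le_eqVlt; apply/orP; left; apply/eqP; by field.
Qed.

Definition E5 (A K0 K3 : R) : R :=
  let K := 2 * K0 in let B := 2 * A * (K3 + 1 + 2 * K0) in
  16 * A * (2 * K * (K + 2)) + 512 * A ^+ 2 * (4 * K * (2 * B + 3)) + 128 * A * (2 * B * (2 * B + 1)).

(** A bootstrap: the bounds for z and E at time m give the bound for D ([main]) under which [E_step]
    applies. The bound for z is stated with 1/t - 1/T2 because the increments of the latter dominate
    th^2 / 4. *)
Lemma E_orbit (b A J K0 K3 : R) (T2 uh : nat -> R) (T u : nat -> C) (N : nat) :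
  let z m := T m - (T2 m)%:C in
  let D m := (u m - (uh m)%:C) / (G b (uh m))%:C in
  let E m := D m - z m / (T2 m)%:C in
  0 < b -> 1 <= A -> 1 <= K0 -> 0 <= K3 -> 512 * A <= J -> E5 A K0 K3 <= J ->
  J * (1 + b) <= T2 0%N -> 16 * K0 <= T2 0%N ->
  (forall m, T2 m.+1 = T2 m + 1 + (T2 m - 1)^-1) ->
  (forall m, uh m.+1 = uh m + (T2 m - 1)^-1 * G b (uh m)) ->
  (forall m, T m.+1 = T m + 1 + (T m - 1)^-1) ->
  (forall m, u m.+1 = u m + (T m - 1)^-1 * Gc b (u m)) ->
  md (z 0%N) <= K0 -> md (E 0%N) <= K3 / T2 0%N ->
  (forall m, (m <= N)%N -> `|uh m| <= 16 * A * T2 0%N / J) -> T2 N <= 2 * A * T2 0%N ->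
  forall m, (m <= N)%N -> [/\ md (z m - z 0%N) <= 16 * K0 / T2 0%N,
    md (D m) <= (K3 + 1 + 2 * K0) / T2 0%N & md (E m - E 0%N) <= E5 A K0 K3 / (T2 0%N * J)].
Proof.
move=> z D E b0 A1 K01 K30 J5 JE tJ tK T2r uhr Tr ur z0 E0 uU TN.
set t := T2 0%N in tJ tK E0 uU TN *.
have J512 : 512 <= J by clear -A1 J5; lra.
have Jp : 0 < J by clear -J512; lra.
have tJ1 : J <= t by have : 0 < J * b by [exact: mulr_gt0]; clear -tJ; lra.
have t9 : 9 <= t by clear -tJ1 J512; lra.
have t0 : 0 < t by clear -t9; lra.
pose U : R := 16 * A * t / J.
pose K : R := 2 * K0; pose K4 : R := K3 + 1 + 2 * K0; pose B : R := 2 * A * K4.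
have K41 : 1 <= K4 by rewrite /K4; clear -K30 K01; lra.
have B0 : 0 <= B by rewrite /B !mulr_ge0 //; clear -A1 K41; lra.
pose c1 : R := 2 * K * (K + 2); pose c2 : R := 4 * K * (2 * B + 3); pose c3 : R := 2 * B * (2 * B + 1).
have K0' : 0 <= K by rewrite /K; clear -K01; lra.
have c10 : 0 <= c1 by rewrite /c1; apply: mulr_ge0; clear -K0'; lra.
have c20 : 0 <= c2 by rewrite /c2; apply: mulr_ge0; clear -K0' B0; lra.
have c30 : 0 <= c3 by rewrite /c3; apply: mulr_ge0; clear -B0; lra.
have E5E : E5 A K0 K3 = 16 * A * c1 + 512 * A ^+ 2 * c2 + 128 * A * c3 by [].
pose th m : R := (T2 m - 1)^-1.
have Tm m : t <= T2 m by case: (T_incr T2r t9 m).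
have th0 m : 0 < th m by exact: (tau_gt0 T2r t9 m).
have th2 m : th m <= 2 / t by exact: (tau_le T2r t9 m).
have UJ : U * J = 16 * A * t by rewrite /U divfK // lt0r_neq0.
have U0 : 0 < U by rewrite /U divr_gt0 // !mulr_gt0 //; clear -A1; lra.
have Ub : 1 / 2 + b ^+ 2 <= U ^+ 2.
  have h : 1 + b <= U.
    rewrite -(ler_pM2r Jp) UJ; have : 1 * t <= A * t by rewrite ler_pM2r.
    by clear -tJ t0; lra.
  have : (1 + b) ^+ 2 <= U ^+ 2 by rewrite ler_pXn2r ?nnegrE //; clear -b0 U0; lra.
  have -> : (1 + b) ^+ 2 = 1 + 2 * b + b ^+ 2 by ring.
  by clear -b0; lra.
have gU m : (m <= N)%N -> G b (uh m) <= 3 * U ^+ 2.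
  by move=> mN; have := G_le b (uU m mN); rewrite -/U; clear -Ub; lra.
have [q [q0 qg]] : exists q : nat -> R, (forall m, 0 <= q m) /\ (forall m, q m ^+ 2 = G b (uh m)).
  exists (fun m => Num.sqrt (G b (uh m))); split=> m; first exact: sqrtr_ge0.
  by rewrite sqr_sqrtr // ltW // G_gt0.
have thq m : (m <= N)%N -> th m * q m <= 64 * A / J.
  have AJ : 0 <= 64 * A / J by apply: divr_ge0; [clear -A1; lra|exact: ltW].
  have tq : 0 <= th m * q m by apply: mulr_ge0; [exact: ltW|exact: q0].
  move=> mN; rewrite -(@ler_pXn2r _ 2) ?nnegrE //.
  rewrite exprMn qg; apply: le_trans (_ : _ <= (2 / t) ^+ 2 * (3 * U ^+ 2)) _.
    apply: ler_pM; rewrite ?sqr_ge0 ?(ltW (G_gt0 b0 _)) ?gU //.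
    by rewrite ler_pXn2r ?nnegrE ?(ltW (th0 m)) // divr_ge0 // ltW.
  have -> : (2 / t) ^+ 2 * (3 * U ^+ 2) = 3072 * (A / J) ^+ 2 by rewrite /U; field; rewrite !lt0r_neq0.
  have -> : (64 * A / J) ^+ 2 = 4096 * (A / J) ^+ 2 by field; rewrite lt0r_neq0.
  by have := sqr_ge0 (A / J); clear; lra.
have thq8 m : (m <= N)%N -> th m * q m <= 1 / 8.
  by move=> mN; apply: le_trans (thq m mN) _; rewrite ler_pdivrMr //; clear -J5; lra.
pose s1 : R := c1 * (8 / t ^+ 3) + c2 * (4 / t ^+ 2) * (64 * A / J).
have s10 : 0 <= s1.
  have AJ : 0 <= 64 * A / J by apply: divr_ge0; [clear -A1; lra|exact: ltW].
  have i3 : 0 <= 8 / t ^+ 3 by rewrite divr_ge0 // exprn_ge0 // ltW.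
  have i2 : 0 <= 4 / t ^+ 2 by rewrite divr_ge0 // exprn_ge0 // ltW.
  by apply: addr_ge0; apply: mulr_ge0 => //; exact: mulr_ge0.
have NT m : m%:R + t <= T2 m.
  elim: m => [|m IH]; first by rewrite add0r.
  by rewrite T2r -natr1; have := th0 m; rewrite /th; clear -IH; lra.
have T2N m : (m <= N)%N -> T2 m <= 2 * A * t by move=> mN; apply: le_trans (T_le T2r t9 mN) TN.
(* A passage has at most 2 A t steps, each contributing s1; the remaining error telescopes with
   uh. *)
have tot m : (m <= N)%N -> m%:R * s1 + c3 * (4 / t ^+ 2) * (uh m - uh 0%N) <= E5 A K0 K3 / (t * J).
  move=> mN; have mt : m%:R <= 2 * A * t by have := NT m; have := T2N m mN; clear -t0; lra.
  apply: le_trans (_ : _ <= 2 * A * t * s1 + c3 * (4 / t ^+ 2) * (2 * U)) _.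
    apply: lerD; first exact: ler_wpM2r.
    apply: ler_wpM2l; first by rewrite mulr_ge0 // divr_ge0 // exprn_ge0 // ltW.
    have := uU m mN; have := uU 0%N (leq0n N); rewrite -/U !ler_norml => /andP[a1 a2] /andP[a3 a4].
    by clear -a1 a2 a3 a4; lra.
  have -> : 2 * A * t * s1 + c3 * (4 / t ^+ 2) * (2 * U) =
     (16 * A * c1 * (J / t) + 512 * A ^+ 2 * c2 + 128 * A * c3) / (t * J).
    by rewrite /s1 /U; field; rewrite !lt0r_neq0.
  rewrite ler_pM2r ?invr_gt0 ?mulr_gt0 // E5E !lerD2r -[leRHS]mulr1.
  apply: ler_wpM2l; first by apply: mulr_ge0 => //; clear -A1; lra.
  by rewrite ler_pdivrMr // mul1r.
have E5J : E5 A K0 K3 / (t * J) <= 1 / t.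
  by rewrite ler_pdivrMr ?mulr_gt0 // mulrA divfK ?lt0r_neq0 // mul1r.
have zK m : md (z m - z 0%N) <= 16 * K0 * (t^-1 - (T2 m)^-1) -> md (z m) <= K.
  move=> h; rewrite -(subrK (z 0%N) (z m)); apply: le_trans (mdD _ _) _.
  have Ti : 0 <= (T2 m)^-1 by rewrite invr_ge0; have := Tm m; clear -t0; lra.
  have : 16 * K0 * (t^-1 - (T2 m)^-1) <= 16 * K0 * t^-1.
    by apply: ler_wpM2l; [clear -K01; lra|clear -Ti; lra].
  have : 16 * K0 * t^-1 <= 1 by rewrite ler_pdivrMr // mul1r.
  by rewrite /K; clear -h z0 K01; lra.
have main m : (m <= N)%N -> md (z m - z 0%N) <= 16 * K0 * (t^-1 - (T2 m)^-1) /\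
   md (E m - E 0%N) <= m%:R * s1 + c3 * (4 / t ^+ 2) * (uh m - uh 0%N) -> md (D m) <= K4 / t.
  move=> mN [h1 h2]; have zm := zK m h1.
  have -> : D m = (E m - E 0%N) + E 0%N + z m / (T2 m)%:C by rewrite /E; ring.
  apply: le_trans (mdD _ _) _; apply: le_trans (lerD (mdD _ _) (lexx _)) _.
  have -> : K4 / t = 1 / t + K3 / t + K / t by rewrite /K4 /K; ring.
  apply: lerD; first apply: lerD => //.
    by apply: le_trans h2 _; apply: le_trans (tot m mN) _.
  have Tp : 0 < T2 m by have := Tm m; clear -t0; lra.
  rewrite mdf md_real (gtr0_norm Tp); apply: ler_pM => //; rewrite ?md_ge0 ?invr_ge0 ?(ltW Tp) //.
  by rewrite lef_pV2 ?posrE.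
have ind m : (m <= N)%N -> md (z m - z 0%N) <= 16 * K0 * (t^-1 - (T2 m)^-1) /\
   md (E m - E 0%N) <= m%:R * s1 + c3 * (4 / t ^+ 2) * (uh m - uh 0%N).
  elim: m => [|m IH] mN; first by rewrite !subrr md0 mul0r mulr0 mulr0 addr0.
  have {IH} [h1 h2] := IH (ltnW mN).
  have dm := main m (ltnW mN) (conj h1 h2).
  have zm := zK m h1.
  have Tp : 0 < T2 m by have := Tm m; clear -t0; lra.
  have T9 : 9 <= T2 m by have := Tm m; clear -t9; lra.
  have thK : th m * K <= 1 / 2.
    apply: le_trans (_ : _ <= 2 / t * K) _; first exact: ler_wpM2r.
    by rewrite mulrAC ler_pdivrMr // /K; clear -tK K01; lra.
  have DB : md (D m) <= B * th m.
    apply: le_trans dm _; have -> : B * th m = K4 * (2 * A * th m) by rewrite /B; ring.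
    apply: ler_wpM2l; first by clear -K41; lra.
    rewrite -[leLHS]div1r ler_pdivrMr //.
    have h3 : th m * (T2 m - 1) = 1 by rewrite /th mulVf // lt0r_neq0 //; clear -T9; lra.
    have h4 : th m * T2 m <= th m * (2 * A * t) by rewrite ler_pM2l //; exact: T2N (ltnW mN).
    by have := th0 m; clear -h3 h4; lra.
  have gp : (G b (uh m))%:C != 0 :> C by rewrite -md_gt0 md_real gtr0_norm G_gt0.
  have uE : u m = (uh m)%:C + (G b (uh m))%:C * D m by rewrite /D mulrCA mulfV // mulr1 addrC subrK.
  have TE : T m = (T2 m)%:C + z m by rewrite /z addrC subrK.
  have [mt1 ES] := E_step b0 T9 zm thK (q0 m) (qg m) (thq8 m (ltnW mN)) B0 DB.
  rewrite -/(th m) in mt1 ES.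
  have zE : z m.+1 = T m + 1 + (T m - 1)^-1 - (T2 m + 1 + th m)%:C by rewrite /z Tr T2r.
  have DE : D m.+1 = (u m + (T m - 1)^-1 * Gc b (u m) - (uh m + th m * G b (uh m))%:C) / (G b (uh m + th m * G b (uh m)))%:C.
    by rewrite /D ur uhr.
  have EE : E m.+1 = D m.+1 - z m.+1 / (T2 m + 1 + th m)%:C by rewrite /E T2r.
  rewrite -TE -uE -zE -DE -EE -/(E m) in ES mt1.
  split.
    have -> : z m.+1 - z 0%N = (z m.+1 - z m) + (z m - z 0%N) by ring.
    apply: le_trans (mdD _ _) _.
    have -> : 16 * K0 * (t^-1 - (T2 m.+1)^-1) = 16 * K0 * ((T2 m)^-1 - (T2 m.+1)^-1) + 16 * K0 * (t^-1 - (T2 m)^-1) by ring.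
    apply: lerD => //.
    have -> : z m.+1 - z m = (T m - 1)^-1 - (th m)%:C.
      by rewrite /z Tr T2r -/(th m) !rmorphD rmorph1; ring.
    apply: le_trans mt1 _.
    have -> : 2 * K * th m ^+ 2 = 16 * K0 * (th m ^+ 2 / 4) by rewrite /K; field.
    apply: ler_wpM2l; first by clear -K01; lra.
    have T'E := T2r m; rewrite -/(th m) in T'E.
    have T'0 : 0 < T2 m.+1 by rewrite T'E; have := th0 m; clear -Tp; lra.
    have -> : (T2 m)^-1 - (T2 m.+1)^-1 = (1 + th m) / (T2 m * T2 m.+1).
      have T'n : T2 m + 1 + th m != 0 by rewrite -T'E lt0r_neq0.
      by rewrite T'E; field; rewrite T'n lt0r_neq0.
    rewrite ler_pdivlMr ?mulr_gt0 //.
    have t8 : th m <= 1 by apply: le_trans (th2 m) _; rewrite ler_pdivrMr //; clear -t9; lra.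
    have h3 : T2 m * T2 m.+1 <= (2 * (T2 m - 1)) * (2 * (T2 m - 1)).
      by rewrite T'E; apply: ler_pM; have := th0 m; clear -Tp T9 t8; lra.
    have h4 : th m * (T2 m - 1) = 1 by rewrite /th mulVf // lt0r_neq0 //; clear -T9; lra.
    have h5 : th m ^+ 2 / 4 * (T2 m * T2 m.+1) <= th m ^+ 2 / 4 * ((2 * (T2 m - 1)) * (2 * (T2 m - 1))).
      by apply: ler_wpM2l => //; rewrite divr_ge0 ?sqr_ge0.
    have h6 : th m ^+ 2 / 4 * ((2 * (T2 m - 1)) * (2 * (T2 m - 1))) = (th m * (T2 m - 1)) ^+ 2 by field.
    by rewrite h6 h4 expr1n in h5; have := th0 m; clear -h5; lra.
  have -> : E m.+1 - E 0%N = (E m.+1 - E m) + (E m - E 0%N) by ring.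
  apply: le_trans (mdD _ _) _; rewrite -natr1.
  have -> : (m%:R + 1) * s1 + c3 * (4 / t ^+ 2) * (uh m.+1 - uh 0%N) =
    (s1 + c3 * (4 / t ^+ 2) * (uh m.+1 - uh m)) + (m%:R * s1 + c3 * (4 / t ^+ 2) * (uh m - uh 0%N)) by ring.
  apply: lerD => //; apply: le_trans ES _.
  have th2' : th m ^+ 2 <= 4 / t ^+ 2.
    have -> : 4 / t ^+ 2 = (2 / t) ^+ 2 by field; rewrite lt0r_neq0.
    by rewrite ler_pXn2r ?nnegrE ?(ltW (th0 m)) // divr_ge0 // ltW.
  have th3' : th m ^+ 3 <= 8 / t ^+ 3.
    have -> : 8 / t ^+ 3 = (2 / t) ^+ 3 by field; rewrite lt0r_neq0.
    by rewrite ler_pXn2r ?nnegrE ?(ltW (th0 m)) // divr_ge0 // ltW.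
  rewrite -/c1 -/c2 -/c3 /s1; apply: lerD; first apply: lerD.
  - exact: (ler_wpM2l c10 th3').
  - apply: ler_pM; [apply: mulr_ge0 => //; exact: sqr_ge0|exact: mulr_ge0 (ltW (th0 m)) (q0 m)|
      exact: (ler_wpM2l c20 th2')|exact: thq (ltnW mN)].
  - have -> : uh m.+1 - uh m = th m * G b (uh m) by rewrite uhr /th; ring.
    apply: ler_wpM2r; first by rewrite mulr_ge0 ?(ltW (th0 m)) // ltW // G_gt0.
    exact: (ler_wpM2l c30 th2').
move=> m mN; have [h1 h2] := ind m mN; split.
- apply: le_trans h1 _; apply: ler_wpM2l; first by clear -K01; lra.
  by rewrite gerBl invr_ge0; have := Tm m; clear -t0; lra.
- exact: main.
- by apply: le_trans h2 _; exact: tot.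
Qed.
End Compare.

(** * The complex passage in terms of phases *)

Section Conv.
Variables (R : realType).
Local Notation C := R[i].

Lemma nat_above (x : R) : exists n : nat, x <= n%:R.
Proof. by exists (Num.truncn x).+1; exact/ltW/truncnS_gt. Qed.

Lemma md_div1 (y g : C) (d : R) : 0 <= d -> md (y - 1) <= d -> md (g - 1) <= 1 / 2 -> md (g - 1) <= d ->
  md (y / g - 1) <= 4 * d.
Proof.
move=> d0 h1 h2 h3.
have g12 : 1 / 2 <= md g.
  have := md_lb 1 (g - 1); rewrite addrCA subrr addr0 md1; clear -h2; lra.
have g0 : g != 0 by rewrite -md_gt0; clear -g12; lra.
have -> : y / g - 1 = ((y - 1) - (g - 1)) / g by field.
rewrite mdf ler_pdivrMr; last by clear -g12; lra.
apply: le_trans (mdB _ _) _; have : 4 * d * (1 / 2) <= 4 * d * md g by apply: ler_wpM2l => //; clear -d0; lra.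
by clear -h1 h3; lra.
Qed.

Lemma gam_near (b J t2 X2 : R) (dl : R) : 1 <= J -> `|X2| <= 6 * J -> 36 * (1 + cc b) * J ^+ 2 <= dl * t2 ->
  0 < cc b -> 0 < dl <= 1 -> `|X2 / t2| <= dl /\ `|- (X2 / t2) + cc b * (X2 / t2) ^+ 2| <= dl.
Proof.
move=> J1 X6 tb c0 /andP[d0 d1].
have t0 : 0 < t2.
  have : 0 < dl * t2 by apply: lt_le_trans tb; rewrite !mulr_gt0 ?exprn_gt0 //; clear -c0 J1; lra.
  by rewrite pmulr_rgt0.
have h : `|X2 / t2| * (6 * (1 + cc b)) <= dl.
  rewrite normrM normfV (gtr0_norm t0) mulrAC ler_pdivrMr //.
  apply: le_trans tb; apply: le_trans (_ : _ <= (6 * J) * (6 * (1 + cc b))) _.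
    by rewrite ler_pM2r //; clear -c0; lra.
  have -> : 6 * J * (6 * (1 + cc b)) = 36 * (1 + cc b) * J by ring.
  by apply: ler_wpM2l; [clear -c0; lra|rewrite expr2; clear -J1; nra].
have n0 := normr_ge0 (X2 / t2).
have h1 : `|X2 / t2| <= dl by clear -h n0 c0; nra.
split=> //; apply: le_trans (ler_normD _ _) _; rewrite normrN (normrM (cc b)) (gtr0_norm c0) normrX expr2.
by clear -h h1 n0 c0 d1; nra.
Qed.

(** Near entry G(uh) is (t2 / X2)^2 up to a factor 1 + O(1/J), so that with u = -T / X the
    difference of flow times is about (X - X2) / t2. *)
Lemma conv_in (b J t2 X2 K : R) (z X : C) : 0 < b -> 1 <= K -> 8 * K <= J -> J / 2 <= X2 <= 3 * J ->
  36 * (1 + cc b) * J ^+ 3 <= t2 -> md z <= K -> md (X - X2%:C) <= K ->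
  let uh := - (t2 / X2) in
  let D := (- ((t2%:C + z) / X) - uh%:C) / (G b uh)%:C in
  is_true (md (t2%:C * (D - z / t2%:C) - ((X - X2%:C) - z)) <= 40 * K ^+ 2 / J).
Proof.
move=> b0 K1 KJ /andP[X1 X3] tJ zK XK uh D.
have c0 : 0 < cc b by exact: cc_gt0.
have J8 : 8 <= J by clear -K1 KJ; lra.
have J0 : 0 < J by clear -J8; lra.
have tJ' : 36 * (1 + cc b) * J ^+ 2 <= J^-1 * t2.
  by rewrite [leRHS]mulrC ler_pdivlMr // -[leLHS]mulrA -exprSr.
have X20 : 0 < X2 by clear -X1 J0; lra.
have [g1 g2] : `|X2 / t2| <= J^-1 /\ `|- (X2 / t2) + cc b * (X2 / t2) ^+ 2| <= J^-1.
  apply: (@gam_near b J t2 X2 J^-1) => //; [clear -J8; lra|rewrite gtr0_norm //; clear -X3 J0; lra|].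
  by rewrite invr_gt0 J0 invf_le1 //; clear -J8; lra.
have t0 : 0 < t2.
  by apply: lt_le_trans tJ; rewrite !mulr_gt0 ?exprn_gt0 //; clear -c0; lra.
pose a : R := X2 / t2.
pose ga : R := 1 + (- a + cc b * a ^+ 2).
have gaE : (G b uh) = (t2 / X2) ^+ 2 * ga.
  by rewrite /uh /ga /a /G; field; rewrite !lt0r_neq0.
have Xn : J / 4 <= md X.
  have := md_lb X2%:C (X - X2%:C); rewrite addrCA subrr addr0 md_real gtr0_norm //; clear -X1 XK KJ K1; lra.
have X00 : X != 0 by rewrite -md_gt0; clear -Xn J0; lra.
have JV : J^-1 <= 1 / 8 by rewrite -[leLHS]div1r ler_pdivrMr //; clear -J8; lra.
have ga0 : 0 < ga by move: g2; rewrite -/a ler_norml /ga => /andP[h _]; clear -h JV; lra.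
pose y : C := X2%:C / X.
have X2c : X2%:C != 0 :> C by rewrite -md_gt0 md_real gtr0_norm.
have t2c : t2%:C != 0 :> C by rewrite -md_gt0 md_real gtr0_norm.
have gac : ga%:C != 0 :> C by rewrite -md_gt0 md_real gtr0_norm.
have DE : t2%:C * D = ((X - X2%:C) - z * a%:C) * (y / ga%:C).
  have dE (x v : R) : (x / v)%:C = x%:C / v%:C :> C by rewrite rmorphM fmorphV.
  have gE : (G b uh)%:C = (t2%:C / X2%:C) ^+ 2 * ga%:C by rewrite gaE (rmorphM _ _ ga) rmorphXn /= dE.
  rewrite /D gE /uh /y /a rmorphN !dE.
  by field; rewrite X2c gac X00 t2c.
have y1 : md (y - 1) <= 4 * K / J.
  have -> : y - 1 = - (X - X2%:C) / X by rewrite /y; field.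
  rewrite mdf mdN ler_pdivrMr; last by clear -Xn J0; lra.
  apply: le_trans XK _; rewrite mulrAC ler_pdivlMr // -mulrA [K * J]mulrC.
  by have : K * (J / 4) <= K * md X by [apply: ler_wpM2l => //; clear -K1; lra]; clear; lra.
have JK : J^-1 <= 4 * K / J.
  by rewrite -[leLHS]mul1r ler_pM2r ?invr_gt0 //; clear -K1; lra.
have mga : md (ga%:C - 1) <= J^-1.
  have -> : ga%:C - 1 = (- a + cc b * a ^+ 2)%:C :> C by rewrite /ga rmorphD rmorph1 addrC addKr.
  by rewrite md_real.
have yg : md (y / ga%:C - 1) <= 4 * (4 * K / J).
  apply: md_div1 => //; first by rewrite divr_ge0 //; [clear -K1; lra|exact: ltW].
    by apply: le_trans mga _; clear -JV; lra.
  exact: le_trans mga JK.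
have za : md (z * a%:C) <= K / J by rewrite mdM md_real; apply: ler_pM; rewrite ?md_ge0.
have KJ1 : K / J <= K.
  by rewrite ler_pdivrMr // -[leLHS]mulr1; apply: ler_wpM2l; clear -K1 J8; lra.
have -> : t2%:C * (D - z / t2%:C) - (X - X2%:C - z) =
  ((X - X2%:C) - z * a%:C) * (y / ga%:C - 1) - z * a%:C.
  by rewrite mulrBr DE [t2%:C * (z / _)]mulrC divfK //; ring.
apply: le_trans (mdB _ _) _; rewrite mdM.
apply: le_trans (lerD (ler_pM (md_ge0 _) (md_ge0 _) (_ : _ <= 2 * K) yg) za) _.
  by apply: le_trans (mdB _ _) _; clear -XK za KJ1; lra.
have -> : 2 * K * (4 * (4 * K / J)) + K / J = (32 * K ^+ 2 + K) / J by field; rewrite lt0r_neq0.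
by rewrite ler_pM2r ?invr_gt0 // expr2; clear -K1; nra.
Qed.

(** The same on exit, where D is only known to be O(1 / t2). This first shows that u is uh up to a
    factor 1 + O(1/J), so that T / u can be expanded. *)
Lemma conv_out (b J t2 p K : R) (z u : C) : 0 < b -> 1 <= K -> 64 * K <= J -> J / 4 <= p <= 6 * J ->
  36 * (1 + cc b) * J ^+ 3 <= t2 -> md z <= K ->
  let uh := t2 / p in
  let D := (u - uh%:C) / (G b uh)%:C in
  md (t2%:C * D) <= K ->
  [/\ u != 0, md (u - uh%:C) <= uh & md (- ((t2%:C + z) / u) + p%:C - t2%:C * D) <= 200 * K ^+ 2 / J].
Proof.
move=> b0 K1 KJ /andP[p1 p6] tJ zK uh D DK.
have c0 : 0 < cc b by exact: cc_gt0.
have J8 : 64 <= J by clear -K1 KJ; lra.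
have J0 : 0 < J by clear -J8; lra.
have tJ' : 36 * (1 + cc b) * J ^+ 2 <= J^-1 * t2.
  by rewrite [leRHS]mulrC ler_pdivlMr // -[leLHS]mulrA -exprSr.
have p0 : 0 < p by clear -p1 J0; lra.
have [g1 g2] : `|- p / t2| <= J^-1 /\ `|- (- p / t2) + cc b * (- p / t2) ^+ 2| <= J^-1.
  apply: (@gam_near b J t2 (- p) J^-1) => //; [clear -J8; lra|rewrite normrN gtr0_norm //|].
  by rewrite invr_gt0 J0 invf_le1 //; clear -J8; lra.
have t0 : 0 < t2.
  by apply: lt_le_trans tJ; rewrite !mulr_gt0 ?exprn_gt0 //; clear -c0; lra.
pose a : R := - p / t2.
pose ga : R := 1 + (- a + cc b * a ^+ 2).
have gaE : G b uh = (t2 / p) ^+ 2 * ga.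
  by rewrite /uh /ga /a /G; field; rewrite !lt0r_neq0.
have JV : J^-1 <= 1 / 64 by rewrite -[leLHS]div1r ler_pdivrMr //; clear -J8; lra.
have JVp : 0 < J^-1 by rewrite invr_gt0.
have ga2 : 1 / 2 <= ga <= 2.
  by move: g2; rewrite -/a ler_norml /ga => /andP[h1 h2]; clear -h1 h2 JV; apply/andP; split; lra.
have ga0 : 0 < ga by case/andP: ga2 => h _; clear -h; lra.
have X2c : p%:C != 0 :> C by rewrite -md_gt0 md_real gtr0_norm.
have t2c : t2%:C != 0 :> C by rewrite -md_gt0 md_real gtr0_norm.
have gac : ga%:C != 0 :> C by rewrite -md_gt0 md_real gtr0_norm.
pose e : C := ga%:C * (t2%:C * D) / p%:C.
have me : md e <= 8 * K / J.
  rewrite /e mdf mdM !md_real !gtr0_norm // ler_pdivrMr //.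
  apply: le_trans (_ : _ <= 2 * K) _; first by apply: ler_pM; rewrite ?md_ge0 ?(ltW ga0) //; case/andP: ga2.
  have -> : 2 * K = 8 * K / J * (J / 4) by field; rewrite lt0r_neq0.
  by apply: ler_wpM2l => //; rewrite divr_ge0 ?(ltW J0) //; clear -K1; lra.
have KJ8 : 8 * K / J <= 1 / 8 by rewrite ler_pdivrMr //; clear -KJ; lra.
have uE : u = uh%:C * (1 + e).
  have -> : u = uh%:C + (G b uh)%:C * D.
    by rewrite /D mulrCA mulfV ?mulr1 ?[_ + (u - _)]addrC ?subrK // -md_gt0 md_real gtr0_norm // G_gt0.
  have dE (x v : R) : (x / v)%:C = x%:C / v%:C :> C by rewrite rmorphM fmorphV.
  have gE : (G b uh)%:C = (t2%:C / p%:C) ^+ 2 * ga%:C by rewrite gaE (rmorphM _ _ ga) rmorphXn /= dE.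
  by rewrite gE /e /uh dE; field; rewrite X2c.
have uh0 : 0 < uh by exact: divr_gt0.
have uhc : uh%:C != 0 :> C by rewrite -md_gt0 md_real gtr0_norm.
have e1 : 1 / 2 <= md (1 + e) by have := md_lb 1 e; rewrite md1; clear -me KJ8; lra.
have e10 : 1 + e != 0 by rewrite -md_gt0; clear -e1; lra.
have u0 : u != 0 by rewrite uE mulf_neq0.
split => //.
  have -> : u - uh%:C = uh%:C * e by rewrite uE; ring.
  by rewrite mdM md_real gtr0_norm // -[leRHS]mulr1 ler_pM2l //; clear -me KJ8; lra.
have JJ : 36 * J ^+ 2 <= t2.
  apply: le_trans tJ; rewrite -mulrA; apply: ler_wpM2l => //.
  have h : J ^+ 2 <= J ^+ 3 by apply: ler_weXn2l => //; clear -J8; lra.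
  have h0 : 0 <= J ^+ 2 by exact: sqr_ge0.
  by clear -h h0 c0; nra.
pose zp : C := z * p%:C / t2%:C.
have mzp : md zp <= K / J / 2.
  rewrite /zp mdf mdM !md_real !gtr0_norm // ler_pdivrMr //.
  apply: le_trans (_ : _ <= K * (6 * J)) _; first by apply: ler_pM; rewrite ?md_ge0 // ltW.
  have -> : K * (6 * J) = K / J / 2 * (12 * J ^+ 2) by field; rewrite lt0r_neq0.
  apply: ler_wpM2l; first by rewrite !divr_ge0 ?(ltW J0) //; clear -K1; lra.
  by have := sqr_ge0 J; clear -JJ; lra.
have mga : md (ga%:C - 1) <= J^-1.
  have -> : ga%:C - 1 = (- a + cc b * a ^+ 2)%:C :> C by rewrite /ga rmorphD rmorph1 addrC addKr.
  by rewrite md_real.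
have KJp : J^-1 <= K / J.
  by rewrite -[leLHS]mul1r ler_pM2r ?invr_gt0.
have h0 : 0 <= 8 * K / J by apply: le_trans me; exact: md_ge0.
have yg : md (ga%:C / (1 + e) - 1) <= 4 * (8 * K / J).
  apply: md_div1 => //.
  - apply: le_trans mga _; rewrite -mulrA.
    by move: (KJp) (JVp) => k1 k2; clear -k1 k2; lra.
  - by rewrite addrAC subrr add0r; clear -me KJ8; lra.
  - by rewrite addrAC subrr add0r.
have -> : - ((t2%:C + z) / u) + p%:C - t2%:C * D =
   (t2%:C * D) * (ga%:C / (1 + e) - 1) - zp / (1 + e).
  have -> : t2%:C * D = e * p%:C / ga%:C by rewrite /e divfK // [ga%:C * _]mulrC mulfK.
  by rewrite uE /zp /uh rmorphM fmorphV; field; rewrite X2c gac t2c e10.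
have m2 : md (zp / (1 + e)) <= K / J.
  rewrite mdf ler_pdivrMr; last by clear -e1; lra.
  apply: le_trans mzp _; apply: ler_wpM2l => //; last by clear -e1; lra.
  by apply: le_trans KJp; exact: ltW.
apply: le_trans (mdB _ _) _; rewrite mdM.
apply: le_trans (lerD (ler_pM (md_ge0 _) (md_ge0 _) DK yg) m2) _.
have -> : K * (4 * (8 * K / J)) + K / J = (32 * K ^+ 2 + K) / J by field; rewrite lt0r_neq0.
by rewrite ler_pM2r ?invr_gt0 // expr2; clear -K1; nra.
Qed.

(** By [F_log], F n is n + ln (F n) + O(1), and the logarithm is negligible against F n. *)
Lemma F_ratio (al J : nat) (e : R) : (1 < al)%N -> 0 < e -> exists n0 : nat, forall n : nat, (n0 <= n)%N -> (J <= al * n)%N ->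
  `|F R (al * n - J) / F R (n + J) - al%:R| <= e.
Proof.
move=> al1 e0; have [l Hl] := F_log R.
pose A : R := al%:R; have A2 : 2 <= A by rewrite ler_nat.
pose K' : R := J%:R + `|l| + 6.
have Ap : 0 < 1 + A by clear -A2; lra.
have [U U1 HU] := @ln_sq_small R K' (e / (1 + A)) (divr_gt0 e0 Ap).
have [n0 hn0] := nat_above U.
exists n0 => n nn Jn.
set s := F R (al * n - J); set t := F R (n + J).
have J0 : 0 <= J%:R :> R by exact: ler0n.
have n0r : 0 <= n%:R :> R by exact: ler0n.
have ht := F_ge R (n + J); rewrite natrD -/t in ht.
have Ut : U <= t.
  by apply: le_trans hn0 _; have : n0%:R <= n%:R :> R by [rewrite ler_nat]; clear -ht J0; lra.
have t1 : 1 <= t by clear -U1 Ut; lra.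
have rN : (al * n - J)%:R = A * n%:R - J%:R :> R by rewrite natrB // natrM.
have hs := F_ge R (al * n - J); have hs2 := F_le R (al * n - J); rewrite -/s in hs hs2.
have An : 0 <= A * n%:R by rewrite mulr_ge0 // ler0n.
have s1 : 1 <= s by have := ler0n R (al * n - J); clear -hs; lra.
have sA : s <= 4 * A * t.
  rewrite rN in hs2; have : A * (n%:R + J%:R + 4) <= A * t by apply: ler_wpM2l => //; clear -A2; lra.
  have : 0 <= A * J%:R by rewrite mulr_ge0 // ler0n.
  by clear -hs2 A2 J0 An; lra.
have ls : ln s <= 4 * A + ln t.
  have h : ln s <= ln (4 * A * t) by rewrite ler_ln ?posrE //; clear -s1 sA; lra.
  apply: le_trans h _; rewrite lnM ?posrE; [|clear -A2; lra|clear -t1; lra].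
  by rewrite lerD2r; apply: ltW; apply: ln_sublinear; clear -A2; lra.
have ls0 := ln_ge0 s1; have lt0 := ln_ge0 t1.
have e1 := Hl (al * n - J)%N; have e2 := Hl (n + J)%N; rewrite -/s rN in e1; rewrite -/t natrD in e2.
have b2 i : 2 / i.+1%:R <= 2 :> R by rewrite ler_pdivrMr ?ltr0Sn // ler_peMr // ler1n.
have {}e1 := le_trans e1 (b2 _); have {}e2 := le_trans e2 (b2 _).
have tp : 0 < t by clear -t1; lra.
have h := HU _ Ut.
have K1 : 1 <= K' + ln t by rewrite /K'; have := normr_ge0 l; clear -J0 lt0; lra.
have h2 : K' + ln t <= e / (1 + A) * t.
  by apply: le_trans h; rewrite expr2 ler_peMr //; clear -K1; lra.
have -> : s / t - A = (s - A * t) / t by field; rewrite lt0r_neq0.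
rewrite normrM normfV (gtr0_norm tp) ler_pdivrMr //.
apply: le_trans (_ : _ <= (1 + A) * (K' + ln t)) _; last first.
  apply: le_trans (ler_wpM2l (ltW Ap) h2) _; rewrite le_eqVlt; apply/orP; left; apply/eqP.
  by field; rewrite lt0r_neq0.
have -> : s - A * t = - ((1 + A) * J%:R) + (1 - A) * l + ln s - A * ln t +
   (s - ln s - (A * n%:R - J%:R) - l) - A * (t - ln t - (n%:R + J%:R) - l) by ring.
move: e1 e2; rewrite !ler_norml => /andP[c1 c2] /andP[d1 d2].
have a1 : `|(1 - A) * l| <= (1 + A) * `|l|.
  by rewrite normrM ler_wpM2r // ler_norml; clear -A2; apply/andP; split; lra.
move: a1; rewrite ler_norml => /andP[a1 a2].
have q1 : - (2 * A) <= A * (t - ln t - (n%:R + J%:R) - l).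
  have : A * (- 2) <= A * (t - ln t - (n%:R + J%:R) - l) by apply: ler_wpM2l => //; clear -A2; lra.
  by clear; lra.
have q2 : A * (t - ln t - (n%:R + J%:R) - l) <= 2 * A.
  have : A * (t - ln t - (n%:R + J%:R) - l) <= A * 2 by apply: ler_wpM2l => //; clear -A2; lra.
  by clear; lra.
have q3 : 0 <= A * ln t by rewrite mulr_ge0 // ler0n.
have q4 : 0 <= (1 + A) * J%:R by rewrite mulr_ge0 // ltW.
have -> : (1 + A) * (K' + ln t) = (1 + A) * J%:R + (1 + A) * `|l| + 6 * (1 + A) + ln t + A * ln t.
  by rewrite /K'; ring.
set v := A * (t - ln t - (n%:R + J%:R) - l) in q1 q2 *.
set v2 := s - ln s - (A * n%:R - J%:R) - l in c1 c2 *.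
clearbody v v2; clear -q1 q2 c1 c2 ls ls0 lt0 a1 a2 q3 q4 A2.
by apply/andP; split; (move: ls ls0 a1 a2 q3 q4 q1 q2 c1 c2; drop; lra).
Qed.

Lemma md6 (x1 x2 x3 x4 x5 x6 : C) :
  md (x1 + x2 + x3 + x4 + x5 + x6) <= md x1 + md x2 + md x3 + md x4 + md x5 + md x6.
Proof.
by do 5![apply: le_trans (mdD _ _) _; apply: lerD => //].
Qed.

(** On entry t E is about xi - z, with xi = X - F J and z the deviation of T; on exit the deviation
    of -T / u is about s D = s E + z. Since E is nearly conserved and s / t is close to al, the
    deviation on exit is al (xi - z) + z. *)
Lemma passage_compare (b : R) (al : nat) : 0 < b -> (1 < al)%N -> Lb b = ln al%:R -> exists kap : R,
  forall K e : R, 1 <= K -> 0 < e -> exists J0 : nat, (0 < J0)%N /\ forall J : nat, (J0 <= J)%N ->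
  exists n0 : nat, (2 * J <= n0)%N /\ forall n : nat, (n0 <= n)%N ->
  forall (T u : nat -> C) (X : C) (N : nat),
  (forall m, T m.+1 = T m + 1 + (T m - 1)^-1) ->
  (forall m, u m.+1 = u m + (T m - 1)^-1 * Gc b (u m)) ->
  (n + J + N = al * n - J)%N ->
  md (T 0%N - (F R (n + J))%:C) <= K -> u 0%N = - (T 0%N / X) -> md (X - (F R J)%:C) <= K ->
  [/\ forall m, (m <= N)%N -> md (u m) <= F R (n + J) / 8 /\ F R (n + J) / 2 <= md (T m), u N != 0 &
    md (- (T N / u N) + (SS R J)%:C - kap%:C -
       (al%:R * (X - (F R J)%:C) + (1 - al%:R) * (T 0%N - (F R (n + J))%:C))) <= e].
Proof.
move=> b0 al1 LA; have [kap Hk] := reference b0 al1 LA.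
exists kap => K e K1 e0.
pose A : R := al%:R; have A2 : 2 <= A by rewrite ler_nat.
have A1 : 1 <= A by clear -A2; lra.
have e20 : 0 < e / 2 by exact: divr_gt0.
have [J1 [J10 HJ]] := Hk _ e20.
have c0 : 0 < cc b by exact: cc_gt0.
pose K3 : R := 40 * K ^+ 2 + 2 * K.
have K2 : K <= K ^+ 2 by rewrite expr2 ler_peMr //; clear -K1; lra.
have K30 : 0 <= K3 by rewrite /K3; clear -K2 K1; lra.
pose K4 : R := 2 * A * (K3 + 1 + 2 * K).
have K41 : 2 * K <= K4 /\ 1 <= K4.
  have : 1 * (K3 + 1 + 2 * K) <= 2 * A * (K3 + 1 + 2 * K).
    by rewrite ler_pM2r; [clear -A2; lra|clear -K30 K1; lra].
  by rewrite /K4 mul1r => h; clear -h K30 K1; split; lra.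
pose Ctot : R := 200 * K4 ^+ 2 + 2 * A * E5 A K K3 + 2 * A * (40 * K ^+ 2) + 2.
have [N2 hN2] := nat_above (E5 A K K3); have [N3 hN3] := nat_above (64 * K4 + 1024 * A).
have [N4 hN4] := nat_above (2 * Ctot / e).
exists (J1 + N2 + N3 + N4)%N; split; first by rewrite !addn_gt0 J10.
move=> J JJ.
have [JN1 JN2 JN3 JN4] : [/\ (J1 <= J)%N, (N2 <= J)%N, (N3 <= J)%N & (N4 <= J)%N] by clear -JJ; split; lia.
have Jge (a : nat) (x : R) : (a <= J)%N -> x <= a%:R -> x <= J%:R.
  by move=> h h2; apply: le_trans h2 _; rewrite ler_nat.
have JE : E5 A K K3 <= J%:R by exact: (Jge N2).
have J3 : 64 * K4 + 1024 * A <= J%:R by exact: (Jge N3).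
have J4 : 2 * Ctot / e <= J%:R by exact: (Jge N4).
have J512 : 512 * A <= J%:R by case: K41 => _ h; clear -J3 h A2; lra.
have Jr : 512 <= J%:R :> R by clear -J512 A2; lra.
have Jp : 0 < J%:R :> R by clear -Jr; lra.
have [n1 [n1J Hn]] := HJ J JN1.
have er : 0 < (2 * K * J%:R)^-1 by rewrite invr_gt0 !mulr_gt0 //; clear -K1; lra.
have [n2 Hn2] := F_ratio J al1 er.
have [n3 hn3] := nat_above (J%:R * (1 + b)); have [n4 hn4] := nat_above (36 * (1 + cc b) * J%:R ^+ 3).
have [n5 hn5] := nat_above (16 * K * J%:R).
exists (n1 + n2 + n3 + n4 + n5)%N; split; first by clear -n1J; lia.
move=> n nn.
have [nn1 nn2 nn3 [nn4 nn5]] : [/\ (n1 <= n)%N, (n2 <= n)%N, (n3 <= n)%N & (n4 <= n)%N /\ (n5 <= n)%N] by clear -nn; split; [lia|lia|lia|split; lia].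
move=> T u X N Tr ur EN z0 u0 XK.
set t := F R (n + J) in z0 *.
have nt (a : nat) (x : R) : (a <= n)%N -> x <= a%:R -> x <= t.
  move=> h h2; apply: le_trans h2 _; have := F_ge R (n + J); rewrite -/t natrD.
  have : a%:R <= n%:R :> R by rewrite ler_nat.
  by clear -Jp; lra.
have t3 : J%:R * (1 + b) <= t by exact: (nt n3).
have t4 : 36 * (1 + cc b) * J%:R ^+ 3 <= t by exact: (nt n4).
have t5 : 16 * K * J%:R <= t by exact: (nt n5).
have tJ : J%:R <= t by have : 0 < J%:R * b by [exact: mulr_gt0]; clear -t3; lra.
have tp : 0 < t by clear -tJ Jp; lra.
have nJA : (J <= al * n)%N by apply: leq_trans (_ : _ <= n)%N _; [clear -n1J nn1; lia|rewrite leq_pmull // ltnW].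
pose T2 m := F R (n + J + m).
pose uh := fix uh (m : nat) : R := if m is k.+1 then uh k + (T2 k - 1)^-1 * G b (uh k) else - (t / F R J).
have uhr m : uh m.+1 = uh m + (T2 m - 1)^-1 * G b (uh m) by [].
have T2r m : T2 m.+1 = T2 m + 1 + (T2 m - 1)^-1 by rewrite /T2 addnS F_S.
have T20 : T2 0%N = t by rewrite /T2 addn0.
have [R1 R2 R3 R4] := Hn n nn1 uh N (erefl _) uhr EN.
set s := F R (al * n - J) in R3 R4.
have T2N : T2 N = s by rewrite /T2 EN.
have rat : `|s / t - A| <= (2 * K * J%:R)^-1 by exact: Hn2.
have rat1 : (2 * K * J%:R)^-1 <= 1.
  rewrite invf_le1 ?mulr_gt0 //; last by clear -K1; lra.
  have : 2 * 1 <= 2 * K * J%:R by apply: ler_pM => //; clear -K1 Jr; lra.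
  by clear; lra.
have sA : s <= 2 * A * t.
  by move: rat; rewrite ler_norml => /andP[_ h]; rewrite -ler_pdivrMr //; clear -h rat1 A2; lra.
have FJ := F_ge R J; have FJ2 := F_le R J.
have X2J : J%:R / 2 <= F R J <= 3 * J%:R by clear -FJ FJ2 Jr; apply/andP; split; lra.
pose z m := T m - (T2 m)%:C.
have z0E : z 0%N = T 0%N - t%:C by rewrite /z T20.
have z0K : md (z 0%N) <= K by rewrite z0E.
pose D m := (u m - (uh m)%:C) / (G b (uh m))%:C.
pose E m := D m - z m / (T2 m)%:C.
have TE m : T m = (T2 m)%:C + z m by rewrite /z addrC subrK.
have KJ8 : 8 * K <= J%:R by case: K41 => h _; clear -h J3 A2 K1; lra.
have Ein : md (t%:C * E 0%N - ((X - (F R J)%:C) - z 0%N)) <= 40 * K ^+ 2 / J%:R.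
  have := @conv_in b J%:R t (F R J) K (z 0%N) X b0 K1 KJ8 X2J t4 z0K XK.
  by rewrite /= /E /D u0 TE T20.
have tc0 : t%:C != 0 :> C by rewrite -md_gt0 md_real gtr0_norm.
have JV : 40 * K ^+ 2 / J%:R <= 40 * K ^+ 2.
  by rewrite ler_pdivrMr // ler_peMr //; [clear -K2 K1; lra|clear -Jr; lra].
have E0 : md (E 0%N) <= K3 / T2 0%N.
  rewrite T20 ler_pdivlMr // mulrC -[X in X * _ <= _](gtr0_norm tp) -md_real -mdM.
  rewrite -[t%:C * _](subrK (X - (F R J)%:C - z 0%N)).
  apply: le_trans (mdD _ _) _; apply: le_trans (lerD Ein (mdB _ _)) _.
  by rewrite /K3; clear -XK z0K JV; lra.
have t16 : 16 * K <= t.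
  apply: le_trans t5; rewrite ler_peMr //; [clear -K1; lra|clear -Jr; lra].
have Eo m : (m <= N)%N -> [/\ md (z m - z 0%N) <= 16 * K / t,
    md (D m) <= (K3 + 1 + 2 * K) / t & md (E m - E 0%N) <= E5 A K K3 / (t * J%:R)].
  rewrite -T20; apply: (@E_orbit R b A J%:R K K3 T2 uh T u N b0 A1 K1 K30 J512 JE) => //; rewrite ?T20 //.
  by rewrite T2N.
have zb m : (m <= N)%N -> md (z m) <= 2 * K.
  move=> mN; have [h _ _] := Eo m mN; rewrite -(subrK (z 0%N) (z m)); apply: le_trans (mdD _ _) _.
  have : 16 * K / t <= 1 by rewrite ler_pdivrMr // mul1r.
  by rewrite /z in h *; clear -h z0K K1; rewrite /z in z0K; lra.
have [zN DN EN'] := Eo N (leqnn N).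
have sp : 0 < s by have := F_ge R (al * n - J); rewrite -/s; have := ler0n R (al * n - J); clear; lra.
set p := s / uh N in R3 R4.
have uhN : uh N = s / p by rewrite /p invf_div mulrCA mulfV ?mulr1 // lt0r_neq0.
have st : t <= s.
  have : A - 1 <= s / t by move: rat; rewrite ler_norml => /andP[h _]; clear -h rat1; lra.
  rewrite ler_pdivlMr // => h; have : 1 * t <= (A - 1) * t by rewrite ler_pM2r //; clear -A2; lra.
  by clear -h; lra.
have K42 : 2 * K <= K4 by case: K41.
have K412 : 1 <= K4 by case: K41.
have sD : md (s%:C * D N) <= K4.
  rewrite mdM md_real gtr0_norm //; apply: le_trans (_ : _ <= (2 * A * t) * ((K3 + 1 + 2 * K) / t)) _.
    by apply: ler_pM; rewrite ?md_ge0 // ltW.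
  by rewrite /K4 le_eqVlt; apply/orP; left; apply/eqP; field; rewrite lt0r_neq0.
have K4J : 64 * K4 <= J%:R by clear -J3 A2; lra.
have zN4 : md (z N) <= K4 by apply: le_trans (zb N (leqnn N)) _.
have s4 : 36 * (1 + cc b) * J%:R ^+ 3 <= s by exact: le_trans st.
have sD' : md (s%:C * ((u N - (s / p)%:C) / (G b (s / p))%:C)) <= K4 by rewrite -uhN.
have [uN0 uNd Eout] := conv_out b0 K412 K4J R3 s4 zN4 sD'.
rewrite -uhN -/(D N) in uNd Eout.
split => //.
  move=> m mN; have [zm Dm _] := Eo m mN.
  split; last first.
    rewrite TE; apply: le_trans (md_lb _ _).
    have h1 : t <= T2 m by rewrite -T20; case: (@T_incr _ T2 T2r _ m) => //; rewrite T20; clear -tJ Jr; lra.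
    rewrite md_real gtr0_norm; last by clear -h1 tp; lra.
    by have := zb m mN; clear -h1 t16 K1; lra.
  have hu := R1 m mN.
  have gp := G_gt0 b0 (uh m).
  have uE : u m = (uh m)%:C + (G b (uh m))%:C * D m.
    by rewrite /D mulrCA mulfV ?mulr1 ?[_ + (u m - _)]addrC ?subrK // -md_gt0 md_real gtr0_norm.
  pose U : R := 16 * A * t / J%:R.
  have hU : `|uh m| <= U by exact: hu.
  have Ut : U <= t / 32.
    rewrite /U ler_pdivrMr //; have : t * (512 * A) <= t * J%:R by rewrite ler_pM2l.
    by clear; lra.
  have gU := G_le b hU.
  have U0 : 0 < U by rewrite /U divr_gt0 // !mulr_gt0 //; clear -A2; lra.
  have gU3 : G b (uh m) <= 3 * U ^+ 2.
    have h : 1 + b <= U.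
      rewrite /U ler_pdivlMr // mulrC; apply: le_trans t3 _; rewrite ler_peMl ?(ltW tp) //; clear -A1; lra.
    have : (1 + b) ^+ 2 <= U ^+ 2 by rewrite ler_pXn2r ?nnegrE //; clear -b0 U0; lra.
    have -> : (1 + b) ^+ 2 = 1 + 2 * b + b ^+ 2 by ring.
    by move: gU; clear -b0; lra.
  have gD : md ((G b (uh m))%:C * D m) <= t / 16.
    rewrite mdM md_real gtr0_norm //.
    apply: le_trans (_ : _ <= 3 * U ^+ 2 * ((K3 + 1 + 2 * K) / t)) _.
      by apply: ler_pM; rewrite ?md_ge0 // ltW.
    have -> : 3 * U ^+ 2 * ((K3 + 1 + 2 * K) / t) = 3 * U * (U / t * (K3 + 1 + 2 * K)) by ring.
    have h1 : U / t * (K3 + 1 + 2 * K) <= 1 / 4.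
      have -> : U / t * (K3 + 1 + 2 * K) = 8 * K4 / J%:R by rewrite /U /K4; field; rewrite !lt0r_neq0.
      by rewrite ler_pdivrMr //; clear -K4J K412; lra.
    have h2 : 3 * U * (U / t * (K3 + 1 + 2 * K)) <= 3 * U * (1 / 4) by apply: ler_wpM2l => //; clear -U0; lra.
    by apply: le_trans h2 _; clear -Ut tp; lra.
  rewrite uE; apply: le_trans (mdD _ _) _; rewrite md_real.
  by clear -hU Ut gD tp; lra.
rewrite -/t -z0E.
have TN : T N = s%:C + z N by rewrite TE T2N.
pose xi := X - (F R J)%:C.
have sr : s%:C = (s / t)%:C * t%:C by rewrite -rmorphM divfK // lt0r_neq0.
(* In this order: conversion on exit, reference passage, change of E, conversion on entry, the ratio
   s / t against al, and the drift of z. *)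
have -> : - (T N / u N) + (SS R J)%:C - kap%:C - (al%:R * (X - (F R J)%:C) + (1 - al%:R) * z 0%N) =
  (- ((s%:C + z N) / u N) + p%:C - s%:C * D N) + (- p + SS R J - kap)%:C + s%:C * (E N - E 0%N) +
  (s / t)%:C * (t%:C * E 0%N - (xi - z 0%N)) + ((s / t - A)%:C * (xi - z 0%N)) + (z N - z 0%N).
  have sE : s%:C * D N = s%:C * E N + z N.
    by rewrite /E T2N mulrBr [s%:C * (z N / _)]mulrC divfK ?subrK // -md_gt0 md_real gtr0_norm.
  have e1 : s%:C * E 0%N = (s / t)%:C * (t%:C * E 0%N) by rewrite mulrA -sr.
  have eA : (s / t - A)%:C = (s / t)%:C - al%:R by rewrite rmorphB /= /A rmorph_nat.
  have eS : (- p + SS R J - kap)%:C = - p%:C + (SS R J)%:C - kap%:C :> C by rewrite rmorphB rmorphD rmorphN.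
  by rewrite TN sE [s%:C * (E N - _)]mulrBr e1 eA eS -/xi; ring.
have b1 : md (s%:C * (E N - E 0%N)) <= 2 * A * (E5 A K K3) / J%:R.
  rewrite mdM md_real gtr0_norm //; apply: le_trans (_ : _ <= (2 * A * t) * (E5 A K K3 / (t * J%:R))) _.
    by apply: ler_pM; rewrite ?md_ge0 // ltW.
  by rewrite le_eqVlt; apply/orP; left; apply/eqP; field; rewrite !lt0r_neq0.
have st2 : s / t <= 2 * A by rewrite ler_pdivrMr.
have st0 : 0 < s / t by exact: divr_gt0.
have b2 : md ((s / t)%:C * (t%:C * E 0%N - (xi - z 0%N))) <= 2 * A * (40 * K ^+ 2) / J%:R.
  rewrite mdM md_real gtr0_norm // -[leRHS]mulrA; apply: ler_pM; rewrite ?md_ge0 //; exact: ltW.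
have b3 : md ((s / t - A)%:C * (xi - z 0%N)) <= 1 / J%:R.
  rewrite mdM md_real; apply: le_trans (_ : _ <= (2 * K * J%:R)^-1 * (2 * K)) _.
    apply: ler_pM; rewrite ?md_ge0 ?normr_ge0 //.
    by apply: le_trans (mdB _ _) _; clear -XK z0K; rewrite /xi; lra.
  rewrite le_eqVlt; apply/orP; left; apply/eqP; field; rewrite !lt0r_neq0 //; clear -K1; lra.
have b4 : md (z N - z 0%N) <= 1 / J%:R.
  apply: le_trans zN _; rewrite ler_pdivlMr // mulrAC ler_pdivrMr // mul1r.
  exact: t5.
have b5 : md (- p + SS R J - kap)%:C <= e / 2 by rewrite md_real.
have b6 : 200 * K4 ^+ 2 / J%:R + 2 * A * (E5 A K K3) / J%:R + 2 * A * (40 * K ^+ 2) / J%:R + 1 / J%:R + 1 / J%:R <= e / 2.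
  rewrite -!mulrDl ler_pdivrMr //.
  have -> : 200 * K4 ^+ 2 + 2 * A * E5 A K K3 + 2 * A * (40 * K ^+ 2) + 1 + 1 = Ctot by rewrite /Ctot; ring.
  by move: J4; rewrite ler_pdivrMr // => h; clear -h; lra.
apply: le_trans (md6 _ _ _ _ _ _) _.
apply: le_trans (lerD (lerD (lerD (lerD (lerD Eout b5) b1) b2) b3) b4) _.
by clear -b6; lra.
Qed.
End Conv.

(** * Phases of incoming and outgoing orbits *)

Section Products.
Variables (R : realType).
Local Notation C := R[i].

Lemma small_frac (K e : R) : 0 < e -> exists n : nat, forall i, (n <= i)%N -> K / i.+1%:R <= e.
Proof.
move=> e0; have [n hn] := nat_above (K / e); exists n => i ni.
rewrite ler_pdivrMr ?ltr0Sn // mulrC -ler_pdivrMr //; apply: le_trans hn _.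
by rewrite ler_nat; exact: leqW.
Qed.

Lemma lim_le (h : nat -> C) (l x : C) (K B : R) (n : nat) :
  (forall i, md (h i - l) <= K / i.+1%:R) -> (forall j, (n <= j)%N -> md (h j - x) <= B) -> md (l - x) <= B.
Proof.
move=> H1 H2; apply/ler_addgt0Pr => e e0; have [m hm] := small_frac K e0.
have h1 := le_trans (H1 (n + m)%N) (hm (n + m)%N (leq_addl n m)).
have h2 := H2 (n + m)%N (leq_addr m n).
by apply: le_trans (md_tri (h (n + m)%N) _ _) _; rewrite md_distC [leRHS]addrC; exact: lerD.
Qed.

Lemma frac_split (K : R) (i : nat) : K / (i.+1%:R * i.+2%:R) = K / i.+1%:R - K / i.+2%:R.
Proof.
have n0 : i.+1%:R != 0 :> R by rewrite pnatr_eq0.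
have n1 : i.+1%:R + 1 != 0 :> R by rewrite natr1 pnatr_eq0.
by rewrite -[i.+2%:R]natr1; move: (i.+1%:R : R) n0 n1 => y n0 n1; field; apply/andP; split.
Qed.

(** The product of the factors 1 + K / ((j + 1)(j + 2)) from i on is at most exp(K / (i + 1)),
    because the sum telescopes. *)
Lemma prod_tail (h r : nat -> C) (K : R) (i : nat) : 0 <= K -> (forall j, h j.+1 = h j * (1 + r j)) ->
  (forall j, md (r j) <= K / (j.+1%:R * j.+2%:R)) -> forall d : nat,
  md (h (i + d)%N) <= md (h i) * expR K /\
  md (h (i + d)%N - h i) <= md (h i) * (expR K * K / i.+1%:R).
Proof.
move=> K0 hr rb.
have Kf j : 0 <= K / j.+1%:R by rewrite divr_ge0.
suff H d : md (h (i + d)%N) <= md (h i) * expR (K / i.+1%:R - K / (i + d).+1%:R) /\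
   md (h (i + d)%N - h i) <= md (h i) * (expR K * (K / i.+1%:R - K / (i + d).+1%:R)).
  move=> d; have [h1 h2] := H d; split.
    apply: le_trans h1 _; apply: ler_wpM2l; first exact: md_ge0.
    rewrite ler_expR; apply: le_trans (_ : _ <= K / i.+1%:R) _; first by rewrite gerBl.
    by rewrite ler_pdivrMr ?ltr0Sn // ler_peMr // ler1n.
  apply: le_trans h2 _; apply: ler_wpM2l; first exact: md_ge0.
  by rewrite -mulrA; apply: ler_wpM2l; [exact: expR_ge0|rewrite gerBl].
elim: d => [|d [IH1 IH2]]; first by rewrite addn0 !subrr md0 expR0 mulr1 !mulr0.
have rj := rb (i + d)%N; rewrite frac_split in rj.
rewrite addnS; split.
  rewrite hr mdM; apply: le_trans (_ : _ <= (md (h i) * expR (K / i.+1%:R - K / (i + d).+1%:R)) * expR (K / (i + d).+1%:R - K / (i + d).+2%:R)) _.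
    apply: ler_pM; rewrite ?md_ge0 //; apply: le_trans (mdD _ _) _; rewrite md1.
    by apply: le_trans (expR_ge1Dx _); rewrite lerD2l.
  by rewrite -mulrA -expRD addrA subrK.
have -> : h (i + d).+1 - h i = h (i + d)%N * r (i + d)%N + (h (i + d)%N - h i) by rewrite hr; ring.
apply: le_trans (mdD _ _) _; rewrite mdM.
have -> : K / i.+1%:R - K / (i + d).+2%:R = (K / (i + d).+1%:R - K / (i + d).+2%:R) + (K / i.+1%:R - K / (i + d).+1%:R) by rewrite [RHS]addrC addrA subrK.
rewrite (mulrDr (expR K)) (mulrDr (md (h i))); apply: lerD => //.
rewrite mulrA; apply: ler_pM; rewrite ?md_ge0 //; apply: le_trans IH1 _.
apply: ler_wpM2l; first exact: md_ge0.
rewrite ler_expR; apply: le_trans (_ : _ <= K / i.+1%:R) _; first by rewrite gerBl.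
by rewrite ler_pdivrMr ?ltr0Sn // ler_peMr // ler1n.
Qed.

(** The rate is uniform in the parameter e. The limit is not zero because the tail of the product
    beyond a large n is within 1/2 of 1. *)
Lemma prod_lim (I : Type) (D : I -> Prop) (h r : nat -> I -> C) (K M : R) : 0 <= K ->
  (forall e j, D e -> h j.+1 e = h j e * (1 + r j e)) ->
  (forall e j, D e -> md (r j e) <= K / (j.+1%:R * j.+2%:R)) -> (forall e, D e -> md (h 0%N e) <= M) ->
  exists (l : I -> C) (K' : R), [/\ 0 <= K', forall e i, D e -> md (h i e - l e) <= K' / i.+1%:R &
     (forall e, D e -> (forall i, h i e != 0) -> l e != 0)].
Proof.
move=> K0 hr rb hM.
pose K' : R := Num.max 0 M * expR K * (expR K * K).
have M0 : 0 <= Num.max 0 M by rewrite le_max lexx.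
have E0 := expR_ge0 K.
have B e i : D e -> md (h i e) <= Num.max 0 M * expR K.
  move=> De; have [h1 _] := @prod_tail (h ^~ e) (r ^~ e) K 0 K0 (hr e ^~ De) (rb e ^~ De) i; rewrite add0n in h1.
  by apply: le_trans h1 _; apply: ler_wpM2r => //; rewrite le_max hM // orbT.
have K'0 : 0 <= K' by rewrite /K' !mulr_ge0.
have ex e : exists l, D e -> forall i, md (h i e - l) <= K' / i.+1%:R.
  case: (pselect (D e)) => De; last by exists 0.
  have [|e1 e10|l Hl] := @ccauchy _ (h ^~ e) (fun i => K' / i.+1%:R); last by exists l.
    move=> i j ij.
    have [_ h2] := @prod_tail (h ^~ e) (r ^~ e) K i K0 (hr e ^~ De) (rb e ^~ De) (j - i)%N.
    rewrite subnKC // in h2; apply: le_trans h2 _.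
    apply: le_trans (_ : _ <= (Num.max 0 M * expR K) * (expR K * K / i.+1%:R)) _.
      by apply: ler_wpM2r; [rewrite divr_ge0 // mulr_ge0|exact: B].
    by rewrite mulrA.
  have [n hn] := small_frac K' (divr_gt0 e10 (ltr0n R 2)); exists n.
  by apply: le_lt_trans (hn n (leqnn n)) _; rewrite ltr_pdivrMr // ltr_pMr // ltr1n.
have [l Hl] := choice ex.
exists l, K'; split => //; first by move=> e i De; exact: Hl.
have h12 : 0 < 1 / 2 :> R by rewrite divr_gt0.
move=> e De hn; have [n Hn] := small_frac (expR K * K) h12.
have hlim : md (l e - h n e) <= md (h n e) * (1 / 2).
  apply: (lim_le (n := n) (Hl e De)) => j nj.
  have [_ h2] := @prod_tail (h ^~ e) (r ^~ e) K n K0 (hr e ^~ De) (rb e ^~ De) (j - n)%N.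
  rewrite subnKC // in h2; apply: le_trans h2 _.
  by apply: ler_wpM2l; [exact: md_ge0|exact: Hn].
apply/eqP => l0; rewrite l0 sub0r mdN in hlim.
by have := hn n; rewrite -md_gt0; move: hlim; clear; lra.
Qed.

Definition Xseq (X : nat -> C) : Prop :=
  (forall i, X i.+1 = X i + 1 + (X i - 1)^-1) /\ forall i, 7 / 2 + i%:R / 2 <= complex.Re (X i).

Lemma Re_le (z : C) : complex.Re z <= md z.
Proof. exact: le_trans (ler_norm _) (Re_md z). Qed.

Lemma Re_ge (z w : C) : complex.Re z - md (w - z) <= complex.Re w.
Proof.
have := Re_md (w - z); rewrite ReD ReN ler_norml => /andP[h _]; clear -h; lra.
Qed.

Lemma Re1 : complex.Re (1 : C) = 1. Proof. by []. Qed.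

Lemma Xseq_start (X : nat -> C) : (forall i, X i.+1 = X i + 1 + (X i - 1)^-1) -> 7 / 2 <= complex.Re (X 0%N) -> Xseq X.
Proof.
move=> Xr X0; split=> //; elim=> [|i IH]; first by rewrite mul0r addr0.
have hn := ler0n R i.
have h1 : 2 <= md (X i - 1) by apply: le_trans (Re_le _); rewrite ReD ReN Re1; clear -IH hn; lra.
have h2 : md (X i - 1)^-1 <= 1 / 2 by rewrite mdV -[leLHS]div1r ler_pdivrMr; clear -h1; lra.
have := Re_ge (X i + 1) (X i.+1); rewrite Xr [_ + _^-1 - _]addrAC subrr add0r ReD Re1 -natr1.
by clear -IH h2; lra.
Qed.

(** A step multiplies the difference of two orbits by 1 - 1 / ((X1 - 1)(X2 - 1)), a summable
    perturbation of 1. This is what makes phases exist. *)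
Lemma Xseq_pair (X1 X2 : nat -> C) : Xseq X1 -> Xseq X2 -> forall i,
  let r := - ((X1 i - 1) * (X2 i - 1))^-1 in
  X1 i.+1 - X2 i.+1 = (X1 i - X2 i) * (1 + r) /\ md r <= 4 / (i.+1%:R * i.+2%:R).
Proof.
move=> [r1 b1] [r2 b2] i r; have hn := ler0n R i.
have k1 : (i%:R + 2) / 2 <= md (X1 i - 1).
  by apply: le_trans (Re_le _); rewrite ReD ReN Re1; have := b1 i; clear -hn; lra.
have k2 : (i%:R + 2) / 2 <= md (X2 i - 1).
  by apply: le_trans (Re_le _); rewrite ReD ReN Re1; have := b2 i; clear -hn; lra.
have n1 : X1 i - 1 != 0 by rewrite -md_gt0; clear -k1 hn; lra.
have n2 : X2 i - 1 != 0 by rewrite -md_gt0; clear -k2 hn; lra.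
split; first by rewrite r1 r2 /r; field; rewrite n1 n2.
rewrite /r mdN mdV mdM ler_pdivlMr ?mulr_gt0 ?ltr0Sn // mulrC ler_pdivrMr; last by rewrite mulr_gt0 // md_gt0.
have h : (i%:R + 2) / 2 * ((i%:R + 2) / 2) <= md (X1 i - 1) * md (X2 i - 1) by apply: ler_pM => //; clear -hn; lra.
rewrite -[i.+2%:R]natr1 -[i.+1%:R]natr1; clear -h hn; nra.
Qed.

Definition Sseq (c1 : R) (S : nat -> C) : Prop :=
  (forall i, S i.+1 = S i + 1 - (S i.+1 + 1)^-1) /\ forall i, c1 * i.+1%:R <= complex.Re (S i).

Lemma Sseq_pair (c1 : R) : 0 < c1 -> exists2 K : R, 0 <= K & forall S1 S2 : nat -> C, Sseq c1 S1 -> Sseq c1 S2 ->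
  exists r : nat -> C, forall i, [/\ S1 i.+1 - S2 i.+1 = (S1 i - S2 i) * (1 + r i),
    1 + r i = (1 - ((S1 i.+1 + 1) * (S2 i.+1 + 1))^-1)^-1, 1 + r i != 0 & md (r i) <= K / (i.+1%:R * i.+2%:R)].
Proof.
move=> c0; pose q : R := 1 - ((1 + c1) ^+ 2)^-1.
have q0 : 0 < q.
  rewrite /q subr_gt0 invf_lt1; last by rewrite exprn_gt0 //; clear -c0; lra.
  by rewrite expr2; clear -c0; nra.
exists ((c1 ^+ 2)^-1 / q); first by rewrite divr_ge0 ?invr_ge0 ?sqr_ge0 // ltW.
move=> S1 S2 [r1 b1] [r2 b2].
pose t i : C := ((S1 i.+1 + 1) * (S2 i.+1 + 1))^-1.
exists (fun i => t i / (1 - t i)) => i; have hn := ler0n R i.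
have kk (S : nat -> C) : (forall i, c1 * i.+1%:R <= complex.Re (S i)) -> 1 + c1 * (i%:R + 2) <= md (S i.+1 + 1).
  move=> b; apply: le_trans (Re_le _); rewrite ReD Re1; have := b i.+1.
  by rewrite -[i.+2%:R]natr1 -[i.+1%:R]natr1; clear; lra.
have k1 := kk _ b1; have k2 := kk _ b2.
have ci : 0 <= c1 * i%:R by rewrite mulr_ge0 // ltW.
have n1 : S1 i.+1 + 1 != 0 by rewrite -md_gt0; clear -k1 ci c0; lra.
have n2 : S2 i.+1 + 1 != 0 by rewrite -md_gt0; clear -k2 ci c0; lra.
have mt : md (t i) <= ((1 + c1 * (i%:R + 2)) ^+ 2)^-1.
  have p0 : 0 < 1 + c1 * (i%:R + 2) by clear -ci c0; lra.
  rewrite /t mdV mdM lef_pV2 ?posrE ?exprn_gt0 ?mulr_gt0 ?md_gt0 // expr2.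
  by apply: ler_pM => //; exact: ltW.
have mt1 : md (t i) <= 1 - q.
  apply: le_trans mt _; rewrite /q subKr lef_pV2 ?posrE ?exprn_gt0 //; [|clear -ci c0; lra|clear -c0; lra].
  by rewrite ler_pXn2r ?nnegrE //; clear -ci c0; lra.
have mt2 : md (t i) <= (c1 ^+ 2)^-1 / (i.+1%:R * i.+2%:R).
  apply: le_trans mt _; rewrite -invfM lef_pV2 ?posrE ?exprn_gt0 ?mulr_gt0 ?exprn_gt0 ?ltr0Sn //; last by clear -ci c0; lra.
  rewrite expr2 -[i.+2%:R]natr1 -[i.+1%:R]natr1 expr2.
  have -> : c1 * c1 * ((i%:R + 1) * (i%:R + 1 + 1)) = (c1 * (i%:R + 1)) * (c1 * (i%:R + 1 + 1)) by ring.
  by apply: ler_pM; clear -ci c0 hn; lra.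
have qt : q <= md (1 - t i) by have := md_lbB 1 (t i); rewrite md1; clear -mt1; lra.
have t1 : 1 - t i != 0 by rewrite -md_gt0; exact: lt_le_trans qt.
have E : 1 + t i / (1 - t i) = (1 - t i)^-1 by field.
split.
- have e1 := r1 i; have e2 := r2 i; rewrite E.
  apply: (mulIf t1); rewrite mulfVK //.
  have -> : S1 i = S1 i.+1 - 1 + (S1 i.+1 + 1)^-1 by rewrite {1}e1; ring.
  have -> : S2 i = S2 i.+1 - 1 + (S2 i.+1 + 1)^-1 by rewrite {1}e2; ring.
  by rewrite /t; field; rewrite n1 n2.
- exact: E.
- by rewrite E invr_eq0.
- rewrite mdf ler_pdivrMr; last exact: lt_le_trans qt.
  apply: le_trans mt2 _; set d : R := i.+1%:R * i.+2%:R.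
  have d0 : 0 < d by rewrite mulr_gt0.
  rewrite -[X in _ <= X * _]mulrA [q^-1 * _]mulrC mulrA -[leRHS]mulrA ler_peMr //.
    by rewrite mulr_ge0 ?invr_ge0 ?sqr_ge0 // ltW.
  by rewrite ler_pdivlMl ?mulr1.
Qed.

(** On the way out of the petal, from index J down to 0, an error is multiplied by factors of at
    most 1 + K / ((i + 1)(i + 2)). The total exp K does not depend on J, and the smallness of e
    keeps V where these bounds hold. *)
Lemma S_down (c1 e : R) (S V : nat -> C) (J : nat) : 0 < c1 ->
  (forall i, (i < J)%N -> S i.+1 = S i + 1 - (S i.+1 + 1)^-1) -> (forall i, (i <= J)%N -> c1 * i.+1%:R <= complex.Re (S i)) ->
  (forall i, (i < J)%N -> V i = V i.+1 - 1 + (V i.+1 + 1)^-1) ->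
  md (V J - S J) <= e -> e * expR ((c1 ^+ 2)^-1) <= c1 / 2 ->
  forall i, (i <= J)%N -> md (V i - S i) <= e * expR ((c1 ^+ 2)^-1).
Proof.
move=> c0 Sr Sb Vr VJ ec; set K : R := (c1 ^+ 2)^-1 in ec *.
have e0 : 0 <= e by exact: le_trans (md_ge0 _) VJ.
have K0 : 0 <= K by rewrite invr_ge0 sqr_ge0.
have EK i : expR (K / i.+1%:R) <= expR K.
  by rewrite ler_expR ler_pdivrMr ?ltr0Sn // ler_peMr // ler1n.
suff H d : (d <= J)%N -> md (V (J - d)%N - S (J - d)%N) <= e * expR (K / (J - d).+1%:R).
  by move=> i iJ; have := H (J - i)%N (leq_subr i J); rewrite subKn // => h; apply: le_trans h _; exact: ler_wpM2l.
elim: d => [_|d IH dJ].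
  by rewrite subn0; apply: le_trans VJ _; rewrite ler_peMr // -[leLHS]expR0 ler_expR divr_ge0.
have {}IH := IH (ltnW dJ).
set i := (J - d.+1)%N; have Ei : (J - d)%N = i.+1 by rewrite /i -subSn.
have iJ : (i < J)%N by rewrite -Ei leq_subr.
rewrite Ei in IH.
have hn := ler0n R i.
have bS := Sb i.+1 iJ; rewrite -[i.+2%:R]natr1 -[i.+1%:R]natr1 in bS.
have bV := Re_ge (S i.+1) (V i.+1).
have hd : md (V i.+1 - S i.+1) <= c1 / 2 by apply: le_trans IH _; apply: le_trans ec; exact: ler_wpM2l.
have ci : 0 <= c1 * i%:R by rewrite mulr_ge0 // ltW.
have k1 : c1 * (i%:R + 2) <= md (S i.+1 + 1).
  by apply: le_trans (Re_le _); rewrite ReD Re1; clear -bS; lra.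
have k2 : c1 * (i%:R + 1) <= md (V i.+1 + 1).
  by apply: le_trans (Re_le _); rewrite ReD Re1; clear -bS bV hd c0; lra.
have n1 : S i.+1 + 1 != 0 by rewrite -md_gt0; clear -k1 ci c0; lra.
have n2 : V i.+1 + 1 != 0 by rewrite -md_gt0; clear -k2 ci c0; lra.
have Si : S i = S i.+1 - 1 + (S i.+1 + 1)^-1 by rewrite {1}(Sr i iJ); ring.
have -> : V i - S i = (V i.+1 - S i.+1) * (1 - ((V i.+1 + 1) * (S i.+1 + 1))^-1).
  by rewrite Si (Vr i iJ); field; rewrite n1 n2.
rewrite mdM.
have hr : md (1 - ((V i.+1 + 1) * (S i.+1 + 1))^-1) <= 1 + K / (i.+1%:R * i.+2%:R).
  apply: le_trans (mdB _ _) _; rewrite md1 lerD2l mdV mdM /K -invfM.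
  rewrite lef_pV2 ?posrE ?mulr_gt0 ?md_gt0 ?exprn_gt0 ?ltr0Sn //.
  rewrite -[i.+2%:R]natr1 -[i.+1%:R]natr1 expr2.
  have -> : c1 * c1 * ((i%:R + 1) * (i%:R + 1 + 1)) = (c1 * (i%:R + 1)) * (c1 * (i%:R + 2)) by ring.
  by apply: ler_pM => //; clear -ci c0; lra.
apply: le_trans (_ : _ <= (e * expR (K / i.+2%:R)) * expR (K / (i.+1%:R * i.+2%:R))) _.
  by apply: ler_pM; rewrite ?md_ge0 //; apply: le_trans hr (expR_ge1Dx _).
by rewrite -mulrA -expRD frac_split addrCA subrr addr0.
Qed.
End Products.

(** * The inverse branch of the parabolic map in the upper half plane *)

Section Branch.
Variables (R : realType).
Local Notation C := R[i].
Local Notation Re := complex.Re.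
Local Notation Im := complex.Im.

(** The two preimages r and -1 - r have opposite imaginary parts. The upper one gives a branch that
    maps the open first quadrant into itself, where backward orbits tend to 0 through the repelling
    petal. *)
Definition g (a : C) : C :=
  let r := (sqrtc (1 + 4 * a) - 1) / 2 in if 0 <= Im r then r else - 1 - r.

Lemma g_q (a : C) : g a + g a ^+ 2 = a.
Proof.
have E : let r : C := (sqrtc (1 + 4 * a) - 1) / 2 in r + r ^+ 2 = a.
  move=> r; transitivity ((sqrtc (1 + 4 * a) ^+ 2 - 1) / 4); first by rewrite /r; field.
  by rewrite sqr_sqrtc; field.
by rewrite /g; case: ifP => _; [exact: E|rewrite -[RHS]E; ring].
Qed.

Lemma Im1 : Im (1 : C) = 0. Proof. by []. Qed.

Lemma g_im (a : C) : 0 <= Im (g a).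
Proof.
rewrite /g; case: ifP => // /negbT; rewrite -ltNge => h.
by rewrite ImD !ImN Im1; clear -h; lra.
Qed.

Lemma g_ReIm (a : C) : Re a = Re (g a) + Re (g a) ^+ 2 - Im (g a) ^+ 2 /\ Im a = Im (g a) * (1 + 2 * Re (g a)).
Proof.
have E := g_q a; split; rewrite -[in LHS]E; [rewrite ReD expr2 ReM|rewrite ImD expr2 ImM]; ring.
Qed.

Lemma g_pos (a : C) : 0 < Im a -> 0 < Im (g a) /\ - (1 / 2) < Re (g a).
Proof.
have [_ E] := g_ReIm a; have h := g_im a; rewrite E => p.
have i0 : 0 < Im (g a).
  rewrite lt_neqAle h andbT eq_sym; apply/eqP => z; rewrite z mul0r ltxx in p; exact: (notF p).
split=> //; move: p; rewrite pmulr_rgt0 //; clear; lra.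
Qed.

Lemma g_re (a : C) : 0 < Im a -> 0 < Re a -> 0 < Re (g a).
Proof.
move=> ia ra; have [i0 r0] := g_pos ia; have [E _] := g_ReIm a; rewrite E in ra.
set x := Re (g a) in ra r0 *; set y := Im (g a) in ra i0.
case: (ltP 0 x) => // x0; have : x * (1 + x) <= 0 by apply: mulr_le0_ge0; clear -x0 r0; lra.
by have := sqr_ge0 y; clear -ra; lra.
Qed.

Lemma g_diff (a b : C) : (g a - g b) * (1 + g a + g b) = a - b.
Proof. by rewrite -[in RHS](g_q a) -[in RHS](g_q b); ring. Qed.

(** This bounds the denominator in g a - g b = (a - b) / (1 + g a + g b), and so gives continuity of
    [g] at points b with Im (g b) > 0 without any study of the square root. *)
Lemma g_den (a b : C) : Im (g b) <= md (1 + g a + g b).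
Proof.
apply: le_trans (Im_md _); rewrite !ImD Im1 add0r; apply: le_trans (ler_norm _).
by rewrite lerDr g_im.
Qed.

Lemma g_cont (T : Type) (F : set_system T) (FF : Filter F) (f : T -> C) (l : C) :
  0 < Im (g l) -> f @ F --> l -> g (f x) @[x --> F] --> g l.
Proof.
move=> il /cvg_mdP fl; apply/cvg_mdP => e e0.
have d0 : 0 < e * Im (g l) by exact: mulr_gt0.
apply: filterS (fl _ d0) => x hx.
have den : Im (g l) <= md (1 + g (f x) + g l) by exact: g_den.
rewrite -(ltr_pM2r il); apply: le_lt_trans hx; rewrite -(g_diff (f x) l) mdM.
by apply: ler_wpM2l; [exact: md_ge0|].
Qed.

(** Two steps of [g] are enough to bring -1 and [y0] into the open first quadrant, see [good_m1] and
    [good_y0]. *)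
Definition V (a : C) : C := g (g a).
(** The backward orbit of a, counted from [V a], in the coordinate 1/w; it obeys the recursion of
    [SS]. *)
Definition Sa (a : C) (i : nat) : C := (iter i g (V a))^-1.
Definition good (e : C) : Prop := [/\ 0 < Im (g e), 0 < Im (V e) & 0 < Re (V e)].

Lemma iter_pos (a : C) : 0 < Im (V a) -> 0 < Re (V a) -> forall i, 0 < Im (iter i g (V a)) /\ 0 < Re (iter i g (V a)).
Proof.
move=> h1 h2; elim=> [//|i [i1 i2]] /=; split; first by have [] := g_pos i1.
exact: g_re.
Qed.

Lemma ReV (z : C) : z != 0 -> Re z^-1 = Re z / md z ^+ 2.
Proof.
move=> z0; rewrite md_sq; case: z z0 => x y z0 /=.
by rewrite /GRing.inv /=.
Qed.

Lemma Sa_rec (a : C) : 0 < Im (V a) -> 0 < Re (V a) -> forall i,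
  [/\ Sa a i != 0, Sa a i.+1 = Sa a i + 1 - (Sa a i.+1 + 1)^-1, 0 < Re (Sa a i) &
      Re (Sa a i) + Re (Sa a i.+1) / (1 + Re (Sa a i.+1)) <= Re (Sa a i.+1)].
Proof.
move=> h1 h2 i; have [i1 i2] := iter_pos h1 h2 i; have [j1 j2] := iter_pos h1 h2 i.+1.
pose v := iter i g (V a); pose v' := iter i.+1 g (V a).
have v0 : v != 0 by apply/eqP => z; rewrite -/v z ltxx in i2; exact: (notF i2).
have v'0 : v' != 0 by apply/eqP => z; rewrite -/v' z ltxx in j2; exact: (notF j2).
have mp (z : C) : z != 0 -> 0 < md z ^+ 2 by move=> z0; rewrite exprn_gt0 // md_gt0.
have S0 : 0 < Re (Sa a i) by rewrite /Sa ReV // divr_gt0 // mp.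
have S1 : 0 < Re (Sa a i.+1) by rewrite /Sa ReV // divr_gt0 // mp.
have n1 : Sa a i.+1 + 1 != 0.
  by rewrite -md_gt0; apply: lt_le_trans (Re_le _); rewrite ReD Re1; clear -S1; lra.
have q : v = v' + v' ^+ 2 by rewrite /v' /= -/v g_q.
have E : Sa a i.+1 = Sa a i + 1 - (Sa a i.+1 + 1)^-1.
  have n1' : v'^-1 + 1 != 0 by exact: n1.
  have n2 : 1 + v' != 0.
    have -> : 1 + v' = v' * (v'^-1 + 1) by rewrite mulrDr mulfV // mulr1.
    by rewrite mulf_neq0.
  rewrite /Sa -/v -/v' q; have -> : v' + v' ^+ 2 = v' * (1 + v') by ring.
  have -> : v'^-1 + 1 = (1 + v') / v' by field.
  by field; rewrite n2 v'0.
split => //; first by rewrite /Sa invr_eq0.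
set s := Sa a i.+1 in S1 n1 E *.
have b : Re (s + 1)^-1 <= 1 / (1 + Re s).
  rewrite ReV // ReD Re1.
  have m : (1 + Re s) ^+ 2 <= md (s + 1) ^+ 2.
    by rewrite ler_pXn2r ?nnegrE ?md_ge0 //; [apply: le_trans (Re_le _); rewrite ReD Re1 addrC|clear -S1; lra].
  have p : 0 < 1 + Re s by clear -S1; lra.
  rewrite ler_pdivrMr ?mp // mulrC mulrA mulr1 ler_pdivlMr //; apply: le_trans m.
  by rewrite expr2 [Re s + 1]addrC.
have p : 0 < 1 + Re s by clear -S1; lra.
have -> : Re s / (1 + Re s) = 1 - 1 / (1 + Re s) by field; rewrite lt0r_neq0.
have E2 : Re s = Re (Sa a i) + 1 - Re (s + 1)^-1 by rewrite {1}E !ReD ReN Re1.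
by clear -E2 b; lra.
Qed.

(** By [Sa_rec] the real part stays at least r and grows at each step by at least r / (1 + r). *)
Lemma Sa_Sseq (a : C) (r : R) : 0 < Im (V a) -> 0 < Re (V a) -> 0 < r -> r <= Re (Sa a 0) ->
  Sseq (r / (1 + r)) (Sa a).
Proof.
move=> h1 h2 r0 hr; have H := Sa_rec h1 h2.
have p : 0 < 1 + r by clear -r0; lra.
have mono i : r <= Re (Sa a i).
  elim: i => // i IH; have [_ _ _ h] := H i; have [_ _ s0 _] := H i.+1.
  apply: le_trans h; have : 0 <= Re (Sa a i.+1) / (1 + Re (Sa a i.+1)).
    by rewrite divr_ge0 //; clear -s0; lra.
  by clear -IH; lra.
split; first by move=> i; have [] := H i.
elim=> [|i IH].
  rewrite mulr1 ler_pdivrMr //; apply: le_trans (hr) _; rewrite ler_peMr //; last by clear -r0; lra.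
  by apply: le_trans hr; exact: ltW.
have [_ _ _ h] := H i; apply: le_trans h; rewrite -natr1 mulrDr mulr1; apply: lerD => //.
have m := mono i.+1; rewrite ler_pdivrMr // mulrAC ler_pdivlMr; clear -m r0; nra.
Qed.

(** The difference quotient of [Sa] in its first argument, see [hh_diff]. Unlike the quotient, this
    product makes sense on the diagonal, and it is continuous there. *)
Fixpoint hh (i : nat) (p : C * C) : C :=
  if i is j.+1 then hh j p * (1 - ((Sa p.1 i + 1) * (Sa p.2 i + 1))^-1)^-1
  else - (V p.1 * V p.2 * (1 + g p.1 + g p.2) * (1 + V p.1 + V p.2))^-1.

Section PointwiseLimits.
Variables (T : Type) (F : set_system T).
Context (FF : Filter F).
Implicit Types (f h : T -> C) (a b : C).
Lemma climD f h a b : f @ F --> a -> h @ F --> b -> f x + h x @[x --> F] --> a + b.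
Proof. by move=> h1 h2; apply: cvgD; [exact: h1|exact: h2]. Qed.
Lemma climM f h a b : f @ F --> a -> h @ F --> b -> f x * h x @[x --> F] --> a * b.
Proof. by move=> h1 h2; apply: cvgM; [exact: h1|exact: h2]. Qed.
Lemma climN f a : f @ F --> a -> - f x @[x --> F] --> - a.
Proof. by move=> h1; apply: cvgN; exact: h1. Qed.
Lemma climV f a : a != 0 -> f @ F --> a -> (f x)^-1 @[x --> F] --> a^-1.
Proof. by move=> h0 h1; apply: cvgV; [exact: h0|exact: h1]. Qed.
Lemma clim1 : (fun=> 1 : C) @ F --> (1 : C).
Proof. exact: cvg_cst. Qed.
End PointwiseLimits.

Lemma cvg_Sa (T : Type) (F : set_system T) (FF : Filter F) (f : T -> C) (e : C) : good e -> f @ F --> e ->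
  (V (f x) @[x --> F] --> V e) * (forall i, Sa (f x) i @[x --> F] --> Sa e i).
Proof.
move=> [g1 g2 g3] fe.
have c1 : V (f x) @[x --> F] --> V e.
  exact: (@g_cont T F FF (fun x => g (f x)) (g e) g2 (@g_cont T F FF f e g1 fe)).
split; [exact: c1|move=> i].
have [_ i2] := iter_pos g2 g3 i.
apply: climV; first by apply/eqP => z; rewrite z ltxx in i2; exact: (notF i2).
elim: i {i2} => [//|i IH] /=.
have [h _] := iter_pos g2 g3 i.+1.
exact: (@g_cont T F FF (fun x => iter i g (V (f x))) (iter i g (V e)) h IH).
Qed.

Lemma cvg_hh (T : Type) (F : set_system T) (FF : Filter F) (f1 f2 : T -> C) (e : C) : good e ->
  f1 @ F --> e -> f2 @ F --> e -> forall i, hh i (f1 x, f2 x) @[x --> F] --> hh i (e, e).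
Proof.
move=> ge h1 h2; have [g1 g2 g3] := ge.
have [v1 s1] := cvg_Sa FF ge h1; have [v2 s2] := cvg_Sa FF ge h2.
have k1 : g (f1 x) @[x --> F] --> g e by exact: (@g_cont T F FF f1 e g1 h1).
have k2 : g (f2 x) @[x --> F] --> g e by exact: (@g_cont T F FF f2 e g1 h2).
have Vn : V e != 0 by apply/eqP => z; rewrite z ltxx in g3; exact: (notF g3).
have den (a : C) : 0 < Im (g a) -> 1 + g a + g a != 0.
  by move=> p; rewrite -md_gt0; apply: lt_le_trans p (g_den a a).
have cc1 := clim1 FF.
elim=> [|i IH] /=.
  have nz : V e * V e * (1 + g e + g e) * (1 + V e + V e) != 0.
    by rewrite !mulf_neq0 ?den //; exact: (den (g e)).
  have w := climM FF (climM FF (climM FF v1 v2) (climD FF (climD FF cc1 k1) k2)) (climD FF (climD FF cc1 v1) v2).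
  exact: (climN FF (climV FF nz w)).
have [S1 S2 S3 _] := Sa_rec g2 g3 i.+1.
have p1 : 1 < md (Sa e i.+1 + 1) by apply: lt_le_trans (Re_le _); rewrite ReD Re1 ltrDr.
have n1 : Sa e i.+1 + 1 != 0 by rewrite -md_gt0; exact: lt_trans p1.
have n2 : 1 - ((Sa e i.+1 + 1) * (Sa e i.+1 + 1))^-1 != 0.
  rewrite -md_gt0; apply: lt_le_trans (md_lbB _ _); rewrite md1 subr_gt0 mdV mdM invf_lt1.
    by clear -p1; nra.
  by clear -p1; nra.
have n3 : (Sa e i.+1 + 1) * (Sa e i.+1 + 1) != 0 by rewrite mulf_neq0.
have w := climD FF cc1 (climN FF (climV FF n3 (climM FF (climD FF (s1 i.+1) cc1) (climD FF (s2 i.+1) cc1)))).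
exact: (climM FF IH (climV FF n2 w)).
Qed.

Lemma good_nbhd (e : C) : good e -> exists d c1 M : R, [/\ 0 < d, 0 < c1, 0 <= M & forall a, md (a - e) <= d ->
  [/\ Sseq c1 (Sa a), good a, md (Sa a 0%N) <= M & forall a', md (a' - e) <= d -> md (hh 0 (a, a')) <= M]].
Proof.
move=> ge; have [g1 g2 g3] := ge.
pose F : set_system C := nbhs e.
have ide : (fun a : C => a) @ nbhs e --> e by exact: cvg_id.
have [v1 s1] := cvg_Sa (nbhs_filter e) ge ide.
have k1 : g a @[a --> nbhs e] --> g e by exact: (@g_cont _ _ (nbhs_filter e) (fun a => a) e g1 ide).
have [_ _ r0 _] := Sa_rec g2 g3 0%N.
have Vn : V e != 0 by apply/eqP => z; rewrite z ltxx in g3; exact: (notF g3).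
have mv : 0 < md (V e) / 2 by rewrite divr_gt0 // md_gt0.
set r := Re (Sa e 0%N) in r0.
have n1 : \forall a \near nbhs e, md (V a - V e) < Num.min (md (V e) / 2) (Num.min (Re (V e) / 2) (Im (V e) / 2)).
  by move/cvg_mdP: v1; apply; rewrite !lt_min mv !divr_gt0.
have n2 : \forall a \near nbhs e, md (Sa a 0%N - Sa e 0%N) < r / 2.
  by move/cvg_mdP: (s1 0%N); apply; rewrite divr_gt0.
have n3 : \forall a \near nbhs e, md (g a - g e) < Im (g e) / 2.
  by move/cvg_mdP: k1; apply; rewrite divr_gt0.
have nn : \forall a \near nbhs e, [/\ md (V a - V e) < Num.min (md (V e) / 2) (Num.min (Re (V e) / 2) (Im (V e) / 2)),
   md (Sa a 0%N - Sa e 0%N) < r / 2 & md (g a - g e) < Im (g e) / 2] by near=> a; split; near: a.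
have [d d0 Hd] := (iffLR (nbhs_mdP _ _)) nn.
pose m : R := md (V e) / 2; pose i1 : R := Im (g e) / 2; pose i2 : R := Im (V e) / 2.
have m0 : 0 < m by []. have i10 : 0 < i1 by rewrite divr_gt0. have i20 : 0 < i2 by rewrite divr_gt0.
pose M : R := m^-1 + (m * m * i1 * i2)^-1.
have Pp := mulr_gt0 (mulr_gt0 (mulr_gt0 m0 m0) i10) i20; have P0 := ltW Pp.
have M0 : 0 <= M by apply: addr_ge0; rewrite invr_ge0 // ltW.
have r20 : 0 < r / 2 by rewrite divr_gt0.
have ImS (z w : C) : Im z - md (w - z) <= Im w.
  by have := Im_md (w - z); rewrite ImD ImN ler_norml => /andP[h _]; clear -h; lra.
exists (d / 2), (r / 2 / (1 + r / 2)), M; split => //; [exact: divr_gt0|by rewrite divr_gt0 //; clear -r20; lra|].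
have base a : md (a - e) <= d / 2 -> [/\ m <= md (V a), good a, r / 2 <= Re (Sa a 0), i1 <= Im (g a) & i2 <= Im (V a)].
  move=> ha; have had : md (a - e) < d by clear -ha d0; lra.
  have [q1 q2 q3] := Hd a had.
  move: q1; rewrite !lt_min => /and3P[q1 q4 q5].
  have l1 := md_lb (V e) (V a - V e); rewrite addrCA subrr addr0 in l1.
  have l2 := Re_ge (V e) (V a); have l3 := ImS (V e) (V a); have l4 := ImS (g e) (g a).
  have l5 := Re_ge (Sa e 0%N) (Sa a 0%N).
  have z1 : i1 <= Im (g a) by rewrite /i1; clear -l4 q3; lra.
  have z2 : i2 <= Im (V a) by rewrite /i2; clear -l3 q5; lra.
  split => //; [rewrite /m; clear -l1 q1; lra|split; [exact: lt_le_trans z1|exact: lt_le_trans z2|clear -l2 q4 g3; lra]|].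
  by rewrite -/r in l5; clear -l5 q2; lra.
move=> a ha; have [b1 [b2 b3 b4] b5 b6 b7] := base a ha.
have mV : (md (V a))^-1 <= m^-1 by rewrite lef_pV2 ?posrE // (lt_le_trans m0).
split => //.
- exact: Sa_Sseq.
- by rewrite /Sa mdV; apply: le_trans mV _; rewrite lerDl invr_ge0.
move=> a' ha'; have [c1 _ c5 c6 c7] := base a' ha'.
rewrite /= mdN mdV !mdM; apply: le_trans (_ : _ <= (m * m * i1 * i2)^-1) _; last by rewrite lerDr invr_ge0 ltW.
have e1 := le_trans c6 (g_den a a'); have e2 := le_trans c7 (g_den (g a) (g a')).
have mm : m * m * i1 * i2 <= md (V a) * md (V a') * md (1 + g a + g a') * md (1 + V a + V a').
  have mm0 := mulr_ge0 (ltW m0) (ltW m0).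
  by apply: ler_pM (ler_pM _ _ (ler_pM _ _ b1 c1) e1) e2; rewrite ?(ltW m0) ?(ltW i10) ?(ltW i20) // mulr_ge0 // ltW.
by rewrite lef_pV2 ?posrE //; exact: lt_le_trans mm.
Unshelve. all: by end_near.
Qed.

Lemma hh_diff (a b : C) (c1 : R) : 0 < c1 -> good a -> good b -> Sseq c1 (Sa a) -> Sseq c1 (Sa b) ->
  forall i, Sa a i - Sa b i = (a - b) * hh i (a, b).
Proof.
move=> c10 [a1 a2 a3] [b1 b2 b3] Sa1 Sb1.
have [K K0 HK] := Sseq_pair c10; have [r Hr] := HK _ _ Sa1 Sb1.
have Vn (z : C) : 0 < Re z -> z != 0 by move=> p; apply/eqP => e; rewrite e ltxx in p; exact: (notF p).
elim=> [|i IH]; last by have [h1 h2 _ _] := Hr i; rewrite h1 h2 IH /= mulrA.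
have d1 : 1 + g a + g b != 0 by rewrite -md_gt0; apply: lt_le_trans b1 (g_den a b).
have d2 : 1 + V a + V b != 0 by rewrite -md_gt0; apply: lt_le_trans b2 (g_den (g a) (g b)).
have e1 := g_diff a b; have e2 := g_diff (g a) (g b); rewrite -/(V a) -/(V b) in e2.
rewrite -e1 -e2 /Sa /=; field.
by rewrite d2 d1 !Vn.
Qed.

Lemma SS_Sseq (c1 : R) : 0 < c1 <= 4 / 5 -> Sseq c1 (fun i => (SS R i)%:C).
Proof.
move=> /andP[c0 c1']; split=> i.
  have [_ h] := SS_step (SS4 R i).
  by rewrite {1}h !rmorphD rmorphN fmorphV rmorphD rmorph1.
have := SS_ge R i; have := ler0n R i => hn h; rewrite /= -natr1.
have : c1 * (i%:R + 1) <= 4 / 5 * (i%:R + 1) by apply: ler_wpM2r => //; clear -hn; lra.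
by clear -h; lra.
Qed.
End Branch.

(** * The outgoing phase *)

Section PhaseOut.
Variables (R : realType).
Local Notation C := R[i].
Local Notation Re := complex.Re.
Local Notation Im := complex.Im.

Lemma Sseq_le (c c' : R) (S : nat -> C) : c' <= c -> Sseq c S -> Sseq c' S.
Proof.
move=> cc [h1 h2]; split=> // i; apply: le_trans (h2 i); exact: ler_wpM2r.
Qed.

(** Written so that 1 + rr is literally the factor in [hh]. *)
Definition rr (S1 S2 : nat -> C) (i : nat) : C := (1 - ((S1 i.+1 + 1) * (S2 i.+1 + 1))^-1)^-1 - 1.

Lemma Sseq_pair' (c1 : R) : 0 < c1 -> exists2 K : R, 0 <= K & forall S1 S2 : nat -> C, Sseq c1 S1 -> Sseq c1 S2 ->
  forall i, [/\ S1 i.+1 - S2 i.+1 = (S1 i - S2 i) * (1 + rr S1 S2 i), 1 + rr S1 S2 i != 0 &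
    md (rr S1 S2 i) <= K / (i.+1%:R * i.+2%:R)].
Proof.
move=> c0; have [K K0 HK] := Sseq_pair c0; exists K => // S1 S2 s1 s2 i.
have [r Hr] := HK _ _ s1 s2; have [h1 h2 h3 h4] := Hr i.
have E : rr S1 S2 i = r i by rewrite /rr -h2 addrAC subrr add0r.
by rewrite E.
Qed.

(** W a is the limit of SS i - Sa a i, and hinf that of [hh i (e, e)], which is not zero as a
    convergent product of nonzero factors. Since [hh] converges uniformly, continuity of a single
    [hh n] at (e, e) makes the later difference quotients uniformly close to hinf: strict
    differentiability at e. *)
Lemma phase_out (e : C) : good e -> exists (d c1 K : R) (W : C -> C) (hinf : C), [/\ 0 < d, 0 < c1 & 0 <= K] /\ [/\ hinf != 0,
  forall a, md (a - e) <= d -> [/\ Sseq c1 (Sa a), good a & forall i, md ((SS R i)%:C - Sa a i - W a) <= K / i.+1%:R] &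
  forall eta : R, 0 < eta -> exists (dl : R) (i0 : nat), 0 < dl <= d /\ forall a b, md (a - e) <= dl -> md (b - e) <= dl ->
    forall i, (i0 <= i)%N -> md (Sa a i - Sa b i - hinf * (a - b)) <= eta * md (a - b)].
Proof.
move=> ge; have [d [c1' [M [d0 c10' M0 Hd]]]] := good_nbhd ge.
pose c1 : R := Num.min c1' (4 / 5).
have c10 : 0 < c1 by rewrite /c1 lt_min c10' divr_gt0.
have c1l : c1 <= c1' by rewrite /c1 ge_min lexx.
have c14 : c1 <= 4 / 5 by rewrite /c1 ge_min lexx orbT.
have [K K0 HK] := Sseq_pair' c10.
have sS : Sseq c1 (fun i => (SS R i)%:C) by apply: SS_Sseq; rewrite c10.
have sA a : md (a - e) <= d -> Sseq c1 (Sa a) by move=> /Hd[h _ _ _]; exact: Sseq_le h.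
pose D1 a := md (a - e) <= d.
have [W [K1 [K10 HW _]]] := @prod_lim R C D1 (fun i a => (SS R i)%:C - Sa a i) (fun i a => rr (fun i => (SS R i)%:C) (Sa a) i) K (4 + M) K0
  (fun a j Da => let: And3 h _ _ := HK _ _ sS (sA a Da) j in h)
  (fun a j Da => let: And3 _ _ h := HK _ _ sS (sA a Da) j in h)
  (fun a Da => ltac:(idtac; have [_ _ h _] := Hd a Da; apply: le_trans (mdB _ _) _; rewrite md_real ger0_norm //= lerD2l; exact h)).
pose D2 (p : C * C) := md (p.1 - e) <= d /\ md (p.2 - e) <= d.
have [H [K2 [K20 HH Hn]]] := @prod_lim R (C * C)%type D2 (fun i p => hh i p) (fun i p => rr (Sa p.1) (Sa p.2) i) K M K0
  (fun p j Dp => ltac:(by rewrite /= /rr addrCA subrr addr0))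
  (fun p j Dp => let: And3 _ _ h := HK _ _ (sA p.1 (proj1 Dp)) (sA p.2 (proj2 Dp)) j in h)
  (fun p Dp => ltac:(idtac; have [_ _ _ h] := Hd p.1 (proj1 Dp); have := h p.2 (proj2 Dp); by case: (p))).
have De : D2 (e, e) by split; rewrite /= subrr md0 ltW.
have nz : H (e, e) != 0.
  apply: Hn => //; have [g1 g2 g3] := ge.
  have Vn : V e != 0 by apply/eqP => z; rewrite z ltxx in g3; exact: (notF g3).
  have den (a : C) : 0 < Im (g a) -> 1 + g a + g a != 0.
    by move=> p; rewrite -md_gt0; apply: lt_le_trans p (g_den a a).
  elim=> [|i IH] /=.
    by rewrite oppr_eq0 invr_eq0 !mulf_neq0 ?den //; exact: (den (g e)).
  apply: mulf_neq0 => //; have [_ h _] := HK _ _ (sA e (proj1 De)) (sA e (proj1 De)) i.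
  by move: h; rewrite /rr addrCA subrr addr0.
exists d, c1, K1, W, (H (e, e)); split=> //; split=> //.
  by move=> a Da; have [h1 h2 _ _] := Hd a Da; split => //; [exact: sA|move=> i; exact: HW].
move=> eta eta0.
have eta4 : 0 < eta / 4 by rewrite divr_gt0.
have [n hn] := small_frac K2 eta4.
have c1f : (fun p : C * C => p.1) @ nbhs (e, e) --> e by exact: cvg_fst.
have c2f : (fun p : C * C => p.2) @ nbhs (e, e) --> e by exact: cvg_snd.
have FF : Filter (nbhs ((e, e) : C * C)) by apply: nbhs_filter.
have cv := @cvg_hh R (C * C)%type (nbhs ((e, e) : C * C)) FF (fun p => p.1) (fun p => p.2) e ge c1f c2f n.
move: cv => /cvg_mdP/(_ _ eta4)[[A B] /= [/nbhs_mdP[d1 d10 H1] /nbhs_mdP[d2 d20 H2]] AB].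
pose dl : R := Num.min d (Num.min (d1 / 2) (d2 / 2)).
exists dl, n; split.
  by rewrite /dl !lt_min d0 !divr_gt0 //= ge_min lexx.
move=> a b ha hb i ni.
have [ad ad1] : md (a - e) <= d /\ md (a - e) < d1.
  move: ha; rewrite /dl !le_min => /and3P[h1 h2 _]; split => //; clear -h2 d10; lra.
have [bd bd2] : md (b - e) <= d /\ md (b - e) < d2.
  move: hb; rewrite /dl !le_min => /and3P[h1 _ h2]; split => //; clear -h2 d20; lra.
have Dp : D2 (a, b) by [].
have k1 : md (hh n (a, b) - hh n (e, e)) < eta / 4.
  by apply: (AB (a, b)); split; [exact: H1|exact: H2].
have k2 := le_trans (HH _ n Dp) (hn n (leqnn n)); have k3 := le_trans (HH _ n De) (hn n (leqnn n)).
have k4 := le_trans (HH _ i Dp) (hn i ni).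
have [s1 g1 _ _] := Hd a ad; have [s2 g2 _ _] := Hd b bd.
rewrite (hh_diff c10' g1 g2 s1 s2) [_ * hh _ _]mulrC -mulrBl mdM.
apply: ler_wpM2r; first exact: md_ge0.
have -> : hh i (a, b) - H (e, e) = (hh i (a, b) - H (a, b)) - (hh n (a, b) - H (a, b)) +
  (hh n (a, b) - hh n (e, e)) + (hh n (e, e) - H (e, e)) by ring.
apply: le_trans (mdD _ _) _; apply: le_trans (lerD (mdD _ _) (lexx _)) _.
apply: le_trans (lerD (lerD (mdB _ _) (lexx _)) (lexx _)) _.
by clear -k1 k2 k3 k4; lra.
Qed.

Definition y0 : C := (-1 +i* 1) / 2.

(** Here Re g(-1) = -1/2 and (Im g(-1))^2 = 3/4. If Re V <= 0, then Im V >= Im g(-1), and V + V^2 =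
    g(-1) would have real part at most -3/4. *)
Lemma good_m1 : good (-1 : C).
Proof.
have [e1 e2] := g_ReIm (-1 : C); have i0 := g_im (-1 : C).
rewrite ReN ImN Re1 Im1 oppr0 in e1 e2.
set x := Re (g (-1)) in e1 e2 *; set y := Im (g (-1)) in e1 e2 i0 *.
have y0 : 0 < y.
  rewrite lt_neqAle i0 andbT; apply/eqP => z; rewrite -z in e1.
  by have := sqr_ge0 (2 * x + 1); clear -e1; nra.
have xE : 1 + 2 * x = 0 by move/eqP: e2; rewrite eq_sym mulf_eq0 (gt_eqF y0) /= => /eqP.
have [v1 v2] := g_pos (y0 : 0 < Im (g (-1))).
have [f1 f2] := g_ReIm (g (-1 : C)); rewrite -/(V (-1)) -/x -/y in f1 f2 v1 v2.
split => //.
set p := Re (V (-1)) in f1 f2 v2 *; set q := Im (V (-1)) in f1 f2 v1.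
rewrite ltNge; apply/negP => p0.
have x12 : x = - (1 / 2) by clear -xE; lra.
have y34 : y ^+ 2 = 3 / 4 by clear -e1 x12; rewrite x12 in e1; lra.
have qy : y <= q by rewrite f2; clear -p0 v1 v2; nra.
have q2 : y ^+ 2 <= q ^+ 2 by rewrite ler_pXn2r ?nnegrE // ltW.
have pp : p + p ^+ 2 <= 0.
  have -> : p + p ^+ 2 = p * (1 + p) by ring.
  by apply: mulr_le0_ge0 => //; clear -v2; lra.
by clear -f1 pp q2 y34 x12; lra.
Qed.

(** As for -1: Re V <= 0 would give Re g(y0) <= -(Im g(y0))^2, which the equation of g(y0)
    excludes. *)
Lemma good_y0 : good y0.
Proof.
have [r1 r2] : Re y0 = - (1 / 2) /\ Im y0 = 1 / 2.
  have -> : y0 = ((- (1 / 2)) +i* (1 / 2)) by apply/eqP; rewrite eq_complex /y0 /=; apply/andP; split; apply/eqP; field.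
  by [].
have y0p : 0 < Im y0 by rewrite r2 divr_gt0.
have [i1 i2] := g_pos y0p; have [e1 e2] := g_ReIm y0; rewrite r1 r2 in e1 e2.
have [v1 v2] := g_pos i1; have [f1 f2] := g_ReIm (g y0); rewrite -/(V y0) in f1 f2 v1 v2.
split => //.
set x := Re (g y0) in e1 e2 f1 i2; set y := Im (g y0) in e1 e2 f2 i1.
set p := Re (V y0) in f1 f2 v2 *; set q := Im (V y0) in f1 f2 v1.
rewrite ltNge; apply/negP => p0.
have qy : y <= q by rewrite f2; clear -p0 v1 v2; nra.
have q2 : y ^+ 2 <= q ^+ 2 by rewrite ler_pXn2r ?nnegrE // ltW.
have pp : p + p ^+ 2 <= 0.
  have -> : p + p ^+ 2 = p * (1 + p) by ring.
  by apply: mulr_le0_ge0 => //; clear -v2; lra.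
have xy : x <= - (y ^+ 2) by rewrite f1; clear -pp q2; lra.
have yy : x + x ^+ 2 + 1 / 2 = y ^+ 2 by clear -e1; lra.
have x1 : 2 * x + x ^+ 2 + 1 / 2 <= 0 by clear -xy yy; lra.
have x2 : x <= - (1 / 4) by clear -x1 i2; nra.
have y1 : 1 <= y by clear -e2 x2 i1; nra.
by clear -yy x2 y1 i2; nra.
Qed.
End PhaseOut.

(** * The incoming phase *)

Section PhaseIn.
Variables (R : realType).
Local Notation C := R[i].
Local Notation Re := complex.Re.
Local Notation Im := complex.Im.

Definition fc (X : C) : C := X + 1 + (X - 1)^-1.
Definition Xs (X : C) (i : nat) : C := iter i fc X.

Lemma four_re : Re (4 : C) = 4.
Proof. by rewrite -[4]/(4%:R) -(rmorph_nat (real_complex R)). Qed.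

Lemma Xs_Xseq (X : C) : md (X - 4) <= 1 / 2 -> Xseq (Xs X).
Proof.
move=> h; apply: Xseq_start => //; have -> : Xs X 0 = X by [].
by have := Re_ge 4 X; rewrite four_re; clear -h; lra.
Qed.

Lemma F_Xseq : Xseq (fun i => (F R (i + 2))%:C).
Proof.
apply: Xseq_start => [i|].
  by rewrite addSn F_S !rmorphD fmorphV rmorphB rmorph1.
by have := F_ge R 2; rewrite add0n /=; clear; lra.
Qed.

(** The counterpart of [hh]: the difference quotient of [Xs] in its starting point, as a product. *)
Fixpoint kk (i : nat) (p : C * C) : C :=
  if i is j.+1 then kk j p * (1 + - ((Xs p.1 j - 1) * (Xs p.2 j - 1))^-1) else 1.

Lemma Xseq_n1 (X : nat -> C) i : Xseq X -> X i - 1 != 0 /\ 1 < md ((X i - 1) ^+ 2).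
Proof.
move=> [_ h]; have hn := ler0n R i; have := h i => hi.
have m : 2 <= md (X i - 1) by apply: le_trans (Re_le _); rewrite ReD ReN Re1; clear -hi hn; lra.
split; first by rewrite -md_gt0; clear -m; lra.
by rewrite mdX expr2; clear -m; nra.
Qed.

Lemma cvg_kk (T : Type) (F0 : set_system T) (FF : Filter F0) (f1 f2 : T -> C) :
  f1 @ F0 --> (4 : C) -> f2 @ F0 --> (4 : C) -> forall i, kk i (f1 x, f2 x) @[x --> F0] --> kk i (4, 4).
Proof.
move=> h1 h2.
have s4 : Xseq (Xs 4) by apply: Xs_Xseq; rewrite subrr md0 divr_ge0.
have c1 := @clim1 R T F0 FF; have cm := climN FF c1.
have cX (f : T -> C) : f @ F0 --> (4 : C) -> forall i, Xs (f x) i @[x --> F0] --> Xs 4 i.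
  move=> hf; elim=> [|i IH]; first exact: hf.
  have [n1 _] := Xseq_n1 i s4.
  exact: (climD FF (climD FF IH c1) (climV FF n1 (climD FF IH cm))).
elim=> [|i IH]; first exact: c1.
have [n1 _] := Xseq_n1 i s4.
have n2 : (Xs 4 i - 1) * (Xs 4 i - 1) != 0 by rewrite mulf_neq0.
exact: (climM FF IH (climD FF c1 (climN FF (climV FF n2 (climM FF (climD FF (cX _ h1 i) cm) (climD FF (cX _ h2 i) cm)))))).
Qed.

(** As in [phase_out], here with Phi a - Phi b = (a - b) H (a, b) exactly. The reference has index i
    + 2 because the start near 4 is reached from y0 + x in two steps, and time is counted from
    there. *)
Lemma phase_in : exists (K : R) (Phi : C -> C) (b1 : C), [/\ 0 <= K, b1 != 0,
  forall X, md (X - 4) <= 1 / 2 -> forall i, md (Xs X i - (F R (i + 2))%:C - Phi X) <= K / i.+1%:R &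
  forall eta : R, 0 < eta -> exists dl : R, 0 < dl <= 1 / 2 /\ forall a b, md (a - 4) <= dl -> md (b - 4) <= dl ->
    md (Phi a - Phi b - b1 * (a - b)) <= eta * md (a - b)].
Proof.
pose D1 (a : C) := md (a - 4) <= 1 / 2.
have s4 : Xseq (Xs 4) by apply: Xs_Xseq; rewrite subrr md0 divr_ge0.
have F2 : 0 <= (4 : R) by [].
have [Phi [K1 [K10 HP _]]] := @prod_lim R C D1 (fun i a => Xs a i - (F R (i + 2))%:C)
  (fun i a => - ((Xs a i - 1) * ((F R (i + 2))%:C - 1))^-1) 4 (5 + F R (0 + 2)) F2
  (fun a j Da => (Xseq_pair (Xs_Xseq Da) F_Xseq j).1)
  (fun a j Da => (Xseq_pair (Xs_Xseq Da) F_Xseq j).2)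
  (fun a (Da : D1 a) => ltac:(idtac; apply: le_trans (mdB _ _) _; rewrite md_real ger0_norm; [rewrite lerD2r -(subrK 4 (Xs a 0)); apply: le_trans (mdD _ _) _; rewrite mdn; move: Da; rewrite /D1 /=; clear; lra|have := F_ge R (0 + 2); clear; have := ler0n R (0+2); lra])).
pose D2 (p : C * C) := D1 p.1 /\ D1 p.2.
have [H [K2 [K20 HH Hn]]] := @prod_lim R (C * C)%type D2 (fun i p => kk i p) (fun i p => - ((Xs p.1 i - 1) * (Xs p.2 i - 1))^-1) 4 1 F2
  (fun p j Dp => erefl _)
  (fun p j Dp => (Xseq_pair (Xs_Xseq (proj1 Dp)) (Xs_Xseq (proj2 Dp)) j).2)
  (fun p Dp => ltac:(by rewrite /= md1)).
have De : D2 (4, 4) by split; rewrite /D1 /= subrr md0 divr_ge0.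
have nz : H (4, 4) != 0.
  apply: Hn => //; elim=> [|i IH] /=; first exact: oner_neq0.
  apply: mulf_neq0 => //; have [n1 n2] := Xseq_n1 i s4.
  rewrite -expr2 -md_gt0; apply: lt_le_trans (md_lbB _ _); rewrite md1 subr_gt0 mdV invf_lt1 //.
  exact: lt_trans n2.
exists K1, Phi, (H (4, 4)); split => //; first by move=> X hX i; exact: HP.
move=> eta eta0.
have eta4 : 0 < eta / 4 by rewrite divr_gt0.
have [n hn] := small_frac K2 eta4.
have c1f : (fun p : C * C => p.1) @ nbhs ((4, 4) : C * C) --> (4 : C) by exact: cvg_fst.
have c2f : (fun p : C * C => p.2) @ nbhs ((4, 4) : C * C) --> (4 : C) by exact: cvg_snd.
have FF : Filter (nbhs ((4, 4) : C * C)) by apply: nbhs_filter.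
have cv := @cvg_kk (C * C)%type (nbhs ((4, 4) : C * C)) FF (fun p => p.1) (fun p => p.2) c1f c2f n.
move: cv => /cvg_mdP/(_ _ eta4)[[A B] /= [/nbhs_mdP[d1 d10 H1] /nbhs_mdP[d2 d20 H2]] AB].
pose dl : R := Num.min (1 / 2) (Num.min (d1 / 2) (d2 / 2)).
exists dl; split.
  by rewrite /dl !lt_min !divr_gt0 //= ge_min lexx.
move=> a b ha hb.
have [ad ad1] : D1 a /\ md (a - 4) < d1.
  move: ha; rewrite /dl !le_min => /and3P[h1 h2 _]; split => //; clear -h2 d10; lra.
have [bd bd2] : D1 b /\ md (b - 4) < d2.
  move: hb; rewrite /dl !le_min => /and3P[h1 _ h2]; split => //; clear -h2 d20; lra.
have Dp : D2 (a, b) by [].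
have k1 : md (kk n (a, b) - kk n (4, 4)) < eta / 4.
  by apply: (AB (a, b)); split; [exact: H1|exact: H2].
have k2 := le_trans (HH _ n Dp) (hn n (leqnn n)); have k3 := le_trans (HH _ n De) (hn n (leqnn n)).
have E i : Xs a i - Xs b i = (a - b) * kk i (a, b).
  elim: i => [|i IH]; first by rewrite mulr1.
  by rewrite (Xseq_pair (Xs_Xseq ad) (Xs_Xseq bd) i).1 IH mulrA.
have lim : md (Phi a - Phi b - (a - b) * H (a, b)) <= 0.
  apply/ler_addgt0Pr => e e0; rewrite add0r.
  have [m hm] := small_frac (2 * K1 + md (a - b) * K2) e0.
  apply: le_trans (hm m (leqnn m)).
  have -> : Phi a - Phi b - (a - b) * H (a, b) = - (Xs a m - (F R (m + 2))%:C - Phi a) +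
     (Xs b m - (F R (m + 2))%:C - Phi b) + (a - b) * (kk m (a, b) - H (a, b)).
    by rewrite mulrBr -E; ring.
  apply: le_trans (mdD _ _) _; apply: le_trans (lerD (mdD _ _) (lexx _)) _; rewrite mdN mdM.
  have -> : (2 * K1 + md (a - b) * K2) / m.+1%:R = K1 / m.+1%:R + K1 / m.+1%:R + md (a - b) * (K2 / m.+1%:R) by ring.
  apply: lerD; first by apply: lerD; exact: HP.
  by apply: ler_wpM2l; [exact: md_ge0|exact: HH].
have E0 : Phi a - Phi b = (a - b) * H (a, b).
  by apply/eqP; rewrite -subr_eq0 -md_eq0 eq_le lim md_ge0.
rewrite E0 mulrC -mulrBl mdM; apply: ler_wpM2r; first exact: md_ge0.
have -> : H (a, b) - H (4, 4) = - (kk n (a, b) - H (a, b)) +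
  (kk n (a, b) - kk n (4, 4)) + (kk n (4, 4) - H (4, 4)) by ring.
apply: le_trans (mdD _ _) _; apply: le_trans (lerD (mdD _ _) (lexx _)) _; rewrite mdN.
by clear -k1 k2 k3 eta0; lra.
Qed.

(** The coordinate -1/w of q0 (q0 (y0 + x)), in the form given by [q0_y0]. *)
Definition X0 (x : C) : C := 4 / (1 + 4 * (x ^+ 2 * (1 - 'i * x) ^+ 2)).

Lemma sqri : ('i : C) ^+ 2 = -1. Proof. by apply/eqP; rewrite eq_complex /=; apply/andP; split; apply/eqP; ring. Qed.

Lemma q0_y0 (x : C) : q0 (q0 (y0 R + x)) = - (1 / 4) - x ^+ 2 * (1 - 'i * x) ^+ 2.
Proof.
have y0E : y0 R = (-1 + 'i) / 2 by apply/eqP; rewrite eq_complex /y0 /=; apply/andP; split; apply/eqP; ring.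
have i3 : 'i ^+ 3 = - 'i :> C by rewrite exprS sqri mulrN1.
have i4 : 'i ^+ 4 = 1 :> C by rewrite (exprM _ 2 2) sqri sqrrN expr1n.
have E1 : q0 (y0 R + x) = - (1 / 2) + 'i * x + x ^+ 2.
  transitivity (- (1 / 4) + ('i ^+ 2) / 4 + 'i * x + x ^+ 2); first by rewrite /q0 y0E; field.
  by rewrite sqri; field.
rewrite E1 /q0; transitivity (- (1 / 4) + 'i ^+ 2 * x ^+ 2 + 2 * 'i * x ^+ 3 + x ^+ 4); first by field.
transitivity (- (1 / 4) - x ^+ 2 * (1 - 2 * 'i * x + 'i ^+ 2 * x ^+ 2)); last by ring.
by rewrite sqri; ring.
Qed.

Lemma X0_near (x : C) : md x <= 1 / 20 ->
  [/\ md (4 * (x ^+ 2 * (1 - 'i * x) ^+ 2)) <= 5 * md x ^+ 2, 1 + 4 * (x ^+ 2 * (1 - 'i * x) ^+ 2) != 0 & md (X0 x - 4) <= 40 * md x ^+ 2].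
Proof.
move=> hx; have x0 := md_ge0 x.
have h1 : md (1 - 'i * x) <= 21 / 20.
  by apply: le_trans (mdB _ _) _; rewrite md1 mdM md_i; clear -hx; lra.
have h2 : md (1 - 'i * x) ^+ 2 <= 5 / 4.
  by rewrite expr2; have := ler_pM (md_ge0 _) (md_ge0 _) h1 h1; clear; lra.
pose m := 4 * (x ^+ 2 * (1 - 'i * x) ^+ 2).
have mm : md m <= 5 * md x ^+ 2.
  rewrite /m (mdM 4) (mdM (x ^+ 2)) mdn !mdX; have : md x ^+ 2 * md (1 - 'i * x) ^+ 2 <= md x ^+ 2 * (5 / 4) by apply: ler_wpM2l => //; exact: sqr_ge0.
  by clear; lra.
have x2 : md x ^+ 2 <= 1 / 400 by rewrite expr2; have := ler_pM x0 x0 hx hx; clear; lra.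
have n12 : 1 / 2 <= md (1 + m) by have := md_lb 1 m; rewrite md1; clear -mm x2; lra.
have n0 : 1 + m != 0 by rewrite -md_gt0; clear -n12; lra.
split=> //; have -> : X0 x - 4 = - (4 * m) / (1 + m) by rewrite /X0 -/m; field.
rewrite mdf mdN mdM mdn ler_pdivrMr; last by clear -n12; lra.
have : 40 * md x ^+ 2 * (1 / 2) <= 40 * md x ^+ 2 * md (1 + m) by apply: ler_wpM2l => //; rewrite mulr_ge0 // sqr_ge0.
by clear -mm; lra.
Qed.

Lemma X0_diff (x1 x2 : C) : md x1 <= 1 / 40 -> md x2 <= 1 / 40 ->
  md (X0 x1 - X0 x2 + 16 * (x1 ^+ 2 - x2 ^+ 2)) <= 200 * (md x1 + md x2) ^+ 2 * md (x1 - x2).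
Proof.
move=> h1 h2; set s : R := md x1 + md x2.
have p1 := md_ge0 x1; have p2 := md_ge0 x2.
have [m1 n1 _] : [/\ md (4 * (x1 ^+ 2 * (1 - 'i * x1) ^+ 2)) <= 5 * md x1 ^+ 2, 1 + 4 * (x1 ^+ 2 * (1 - 'i * x1) ^+ 2) != 0 & md (X0 x1 - 4) <= 40 * md x1 ^+ 2].
  by apply: X0_near; clear -h1; lra.
have [m2 n2 _] : [/\ md (4 * (x2 ^+ 2 * (1 - 'i * x2) ^+ 2)) <= 5 * md x2 ^+ 2, 1 + 4 * (x2 ^+ 2 * (1 - 'i * x2) ^+ 2) != 0 & md (X0 x2 - 4) <= 40 * md x2 ^+ 2].
  by apply: X0_near; clear -h2; lra.
pose a1 := 4 * (x1 ^+ 2 * (1 - 'i * x1) ^+ 2); pose a2 := 4 * (x2 ^+ 2 * (1 - 'i * x2) ^+ 2).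
rewrite -/a1 in m1 n1; rewrite -/a2 in m2 n2.
pose S := x1 + x2; pose t := x1 ^+ 2 + x2 ^+ 2.
pose nu : C := - 'i * t - 'i * S ^+ 2 - S * t.
pose n : C := (1 + a1) * (1 + a2).
have n0 : n != 0 by rewrite mulf_neq0.
have s0 : 0 <= s by rewrite addr_ge0.
have s20 : s <= 1 / 20 by rewrite /s; clear -h1 h2; lra.
have s2 : 0 <= s ^+ 2 by exact: sqr_ge0.
have ss : md x1 ^+ 2 + md x2 ^+ 2 <= s ^+ 2 by rewrite /s expr2 !expr2; clear -p1 p2; nra.
have mS : md S <= s by exact: mdD.
have mt : md t <= s ^+ 2 by apply: le_trans (mdD _ _) _; rewrite !mdX.
have mS2 : md (S ^+ 2) <= s ^+ 2 by rewrite mdX ler_pXn2r ?nnegrE ?md_ge0.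
have mnu : md nu <= 3 * s ^+ 2.
  rewrite /nu; apply: le_trans (mdB _ _) _; apply: le_trans (lerD (mdB _ _) (lexx _)) _.
  rewrite (mdM (- 'i) t) (mdM 'i (S ^+ 2)) (mdM S t) mdN md_i !mul1r.
  have : md S * md t <= 1 * s ^+ 2 by apply: ler_pM; rewrite ?md_ge0 //; clear -mS s20; lra.
  by clear -mt mS2; lra.
have q1 : md x1 ^+ 2 <= s ^+ 2 by have := sqr_ge0 (md x2); clear -ss; lra.
have q2 : md x2 ^+ 2 <= s ^+ 2 by have := sqr_ge0 (md x1); clear -ss; lra.
have s2s : s ^+ 2 <= 1 / 400 by rewrite expr2; have := ler_pM s0 s0 s20 s20; clear; lra.
have mn : md (n - 1) <= 6 * s ^+ 2.
  have -> : n - 1 = a1 + a2 + a1 * a2 by rewrite /n; ring.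
  apply: le_trans (mdD _ _) _; apply: le_trans (lerD (mdD _ _) (lexx _)) _; rewrite mdM.
  have : md a1 * md a2 <= (5 * s ^+ 2) * (1 / 80).
    by apply: ler_pM; rewrite ?md_ge0 //; [clear -m1 q1; lra|clear -m2 q2 s2s; lra].
  by clear -m1 m2 ss s2; lra.
have n12 : 1 / 2 <= md n by have := md_lb 1 (n - 1); rewrite addrCA subrr addr0 md1; clear -mn s2s; lra.
have E : X0 x1 - X0 x2 + 16 * (x1 ^+ 2 - x2 ^+ 2) = 16 * (x1 - x2) * ((S * (n - 1) - nu) / n).
  have dm : a1 - a2 = 4 * (x1 - x2) * (S + nu).
    rewrite /a1 /a2 /nu /S /t; transitivity (4 * (x1 - x2) * (1 - 'i * (x1 + x2)) * (x1 + x2 - 'i * (x1 ^+ 2 + x2 ^+ 2))).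
      ring.
    transitivity (4 * (x1 - x2) * (x1 + x2 - 'i * (x1 ^+ 2 + x2 ^+ 2) - 'i * (x1 + x2) ^+ 2 + 'i ^+ 2 * ((x1 + x2) * (x1 ^+ 2 + x2 ^+ 2)))); first by ring.
    by rewrite sqri; ring.
  have -> : X0 x1 - X0 x2 = - 4 * (a1 - a2) / n by rewrite /X0 -/a1 -/a2 /n; field; rewrite n1 n2.
  by rewrite dm /S; field.
rewrite E (mdM (16 * (x1 - x2))) (mdM 16) mdn mdf.
have b : md (S * (n - 1) - nu) <= 4 * s ^+ 2.
  apply: le_trans (mdB _ _) _; rewrite mdM.
  have : md S * md (n - 1) <= (1 / 20) * (6 * s ^+ 2) by apply: ler_pM; rewrite ?md_ge0 //; exact: le_trans s20.
  by clear -mnu s2; lra.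
have b2 : md (S * (n - 1) - nu) / md n <= 8 * s ^+ 2.
  rewrite ler_pdivrMr; last by clear -n12; lra.
  have : 8 * s ^+ 2 * (1 / 2) <= 8 * s ^+ 2 * md n by apply: ler_wpM2l => //; rewrite mulr_ge0.
  by clear -b; lra.
have d0 := md_ge0 (x1 - x2).
have : md (x1 - x2) * (md (S * (n - 1) - nu) / md n) <= md (x1 - x2) * (8 * s ^+ 2) by apply: ler_wpM2l.
have : 0 <= s ^+ 2 * md (x1 - x2) by exact: mulr_ge0.
by clear; lra.
Qed.

Lemma q0_inv (X : C) : X != 0 -> X - 1 != 0 -> - (q0 (- X^-1))^-1 = fc X.
Proof.
move=> h1 h2; rewrite /q0 /fc.
have -> : - X^-1 + (- X^-1) ^+ 2 = - ((X - 1) / X ^+ 2) by field.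
by rewrite invrN opprK invf_div; field.
Qed.

Lemma q0_iter_X (x : C) : md x <= 1 / 20 -> Xseq (Xs (X0 x)) /\
  forall i, iter (i + 2) (@q0 R) (y0 R + x) = - (Xs (X0 x) i)^-1 /\ Xs (X0 x) i != 0.
Proof.
move=> hx; have [m1 n1 m2] := X0_near hx.
have x2 : md x ^+ 2 <= 1 / 400 by rewrite expr2; have := ler_pM (md_ge0 x) (md_ge0 x) hx hx; clear; lra.
have Xq : Xseq (Xs (X0 x)) by apply: Xs_Xseq; clear -m2 x2; lra.
have nz i : Xs (X0 x) i != 0.
  have [_ h] := Xq; rewrite -md_gt0; apply: lt_le_trans (Re_le _).
  by apply: lt_le_trans (h i); have := ler0n R i; clear; lra.
split=> //; elim=> [|i [IH _]].
  split => //; rewrite add0n /= q0_y0 /Xs /= /X0 invf_div.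
  by field.
split=> //; rewrite addSn iterS IH.
have [n2 _] := Xseq_n1 i Xq.
have E := q0_inv (nz i) n2; rewrite -[LHS]opprK -[- q0 _]invrK invrN E.
by [].
Qed.

(** To leading order X0 x is 4 - 16 x^2, whence b0 = 16 b1. *)
Lemma phase_in_x : exists (K : R) (Phi : C -> C) (b0 : C), [/\ 0 <= K, b0 != 0,
  forall x, md x <= 1 / 20 -> forall i, md (Xs (X0 x) i - (F R (i + 2))%:C - Phi x) <= K / i.+1%:R &
  forall eta : R, 0 < eta -> exists dl : R, 0 < dl <= 1 / 40 /\ forall a b, md a <= dl -> md b <= dl ->
    md (Phi a - Phi b + b0 * (a ^+ 2 - b ^+ 2)) <= eta * (md a + md b) * md (a - b)].
Proof.
have [K [Phi [b1 [K0 b10 H1 H2]]]] := phase_in.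
have near x : md x <= 1 / 20 -> md (X0 x - 4) <= 1 / 2 /\ md (X0 x - 4) <= 2 * md x.
  move=> hx; have [_ _ m2] := X0_near hx; have x0 := md_ge0 x.
  have x2 : md x ^+ 2 <= md x * (1 / 20) by rewrite expr2; apply: ler_wpM2l.
  by clear -m2 x2 hx; split; lra.
exists K, (fun x => Phi (X0 x)), (16 * b1); split => //.
- by rewrite mulf_neq0 // -md_gt0 mdn.
- by move=> x hx i; apply: H1; have [] := near x hx.
move=> eta eta0.
have mb : 0 < md b1 by rewrite md_gt0.
have e1 : 0 < eta / 64 by rewrite divr_gt0.
have [d1 [/andP[d10 d12] Hd]] := H2 _ e1.
pose dl : R := Num.min (1 / 40) (Num.min (d1 / 2) (eta / (800 * md b1))).
have b800 : 0 < 800 * md b1 by apply: mulr_gt0; [exact: ltr0Sn|exact: mb].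
have p800 : 0 < eta / (800 * md b1) by exact: divr_gt0.
have dl0 : 0 < dl by rewrite /dl !lt_min p800 !divr_gt0.
exists dl; split; first by rewrite dl0 /dl ge_min lexx.
move=> a b ha hb.
have sp (x : C) : md x <= dl -> [/\ md x <= 1 / 40, md x <= d1 / 2 & md x <= eta / (800 * md b1)].
  by rewrite /dl !le_min => /and3P[].
have [a1 a2 a3] := sp a ha; have [b1' b2 b3] := sp b hb.
have a20 : md a <= 1 / 20 by clear -a1; lra.
have b20 : md b <= 1 / 20 by clear -b1'; lra.
have [_ na] := near a a20; have [_ nb] := near b b20.
have D := X0_diff a1 b1'.
have h1 : md (Phi (X0 a) - Phi (X0 b) - b1 * (X0 a - X0 b)) <= eta / 64 * md (X0 a - X0 b).
  by apply: Hd; [clear -na a2; lra|clear -nb b2; lra].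
set s := md a + md b in D *; set d := md (a - b) in D *.
have s0 : 0 <= s by rewrite addr_ge0 ?md_ge0.
have d0 : 0 <= d by exact: md_ge0.
have sd0 : 0 <= s * d by exact: mulr_ge0.
have sD : md (a ^+ 2 - b ^+ 2) <= s * d.
  by rewrite subr_sqr mdM mulrC; apply: ler_wpM2r => //; exact: mdD.
have s20 : s <= 1 / 20 by rewrite /s; clear -a1 b1'; lra.
have D2 : md (X0 a - X0 b) <= 26 * (s * d).
  have -> : X0 a - X0 b = (X0 a - X0 b + 16 * (a ^+ 2 - b ^+ 2)) - 16 * (a ^+ 2 - b ^+ 2) by ring.
  apply: le_trans (mdB _ _) _; rewrite mdM mdn.
  have : 200 * s ^+ 2 * d <= 10 * (s * d).
    have -> : 200 * s ^+ 2 * d = 200 * s * (s * d) by ring.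
    by apply: ler_wpM2r => //; clear -s20; lra.
  by clear -D sD; lra.
have -> : Phi (X0 a) - Phi (X0 b) + 16 * b1 * (a ^+ 2 - b ^+ 2) =
  (Phi (X0 a) - Phi (X0 b) - b1 * (X0 a - X0 b)) + b1 * (X0 a - X0 b + 16 * (a ^+ 2 - b ^+ 2)) by ring.
apply: le_trans (mdD _ _) _; rewrite mdM.
have k1 : eta / 64 * md (X0 a - X0 b) <= eta / 64 * (26 * (s * d)) by apply: ler_wpM2l => //; exact: ltW.
have k2 : md b1 * md (X0 a - X0 b + 16 * (a ^+ 2 - b ^+ 2)) <= eta / 2 * (s * d).
  apply: le_trans (_ : _ <= md b1 * (200 * s ^+ 2 * d)) _; first by apply: ler_wpM2l; rewrite ?md_ge0.
  have -> : md b1 * (200 * s ^+ 2 * d) = (200 * md b1 * s) * (s * d) by ring.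
  apply: ler_wpM2r => //.
  have : s <= eta / (800 * md b1) * 2 by rewrite /s; clear -a3 b3; lra.
  move=> h; have : 200 * md b1 * s <= 200 * md b1 * (eta / (800 * md b1) * 2) by apply: (ler_wpM2l _ h); apply: mulr_ge0; [exact: ler0n|exact: ltW].
  have -> : 200 * md b1 * (eta / (800 * md b1) * 2) = eta / 2 by field; rewrite lt0r_neq0.
  by [].
have esd : 0 <= eta * (s * d) by rewrite mulr_ge0 // ltW.
by rewrite -[eta * s * d]mulrA; clear -h1 k1 k2 esd; lra.
Qed.
End PhaseIn.

(** * The chain of preimages of the critical point and the passage estimate *)

Section Chain.
Variables (R : realType).
Local Notation C := R[i].
Local Notation Re := complex.Re.
Local Notation Im := complex.Im.

Lemma inv_mul_near (p q : C) (v : R) : v <= 1 / 8 -> md (p - 1) <= v -> md (q - 1) <= v ->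
  p * q != 0 /\ md ((p * q)^-1) <= 2 /\ md ((p * q)^-1 - 1) <= 5 * v.
Proof.
move=> v8 hp hq.
have p0 := md_ge0 (p - 1).
have v0 : 0 <= v by exact: le_trans p0 hp.
have pq : md (p * q - 1) <= (1 + 1 / 8) * v + v.
  have -> : p * q - 1 = (1 + (p - 1)) * (q - 1) + (p - 1) by ring.
  apply: le_trans (mdD _ _) _; apply: lerD => //; rewrite mdM; apply: ler_pM; rewrite ?md_ge0 //.
  by apply: le_trans (mdD _ _) _; rewrite md1; apply: lerD => //; exact: le_trans v8.
have lo : 1 / 2 <= md (p * q).
  have := md_lb 1 (p * q - 1); rewrite md1 addrCA subrr addr0; clear -pq v8; lra.
have n0 : p * q != 0 by rewrite -md_gt0; clear -lo; lra.
have i2 : md ((p * q)^-1) <= 2.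
  by rewrite mdV -[2]invrK lef_pV2 ?posrE ?invr_gt0 ?ltr0n //; [clear -lo; lra|clear -lo; lra].
split=> //; split=> //.
have -> : (p * q)^-1 - 1 = - ((p * q)^-1 * (p * q - 1)) by rewrite mulrBr mulVf // mulr1 opprB.
rewrite mdN mdM; apply: le_trans (_ : _ <= 2 * ((1 + 1 / 8) * v + v)) _; last by clear -v0; lra.
by apply: ler_pM; rewrite ?md_ge0.
Qed.

Lemma phase_diff (h : C) (W : C -> C) (K eta : R) (i0 : nat) (a b : C) :
  (forall i, md ((SS R i)%:C - Sa a i - W a) <= K / i.+1%:R) ->
  (forall i, md ((SS R i)%:C - Sa b i - W b) <= K / i.+1%:R) ->
  (forall i, (i0 <= i)%N -> md (Sa a i - Sa b i - h * (a - b)) <= eta * md (a - b)) ->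
  md (W a - W b + h * (a - b)) <= eta * md (a - b).
Proof.
move=> Ha Hb H; apply/ler_addgt0Pr => e e0.
have e2 : 0 < e / 2 by rewrite divr_gt0.
have [n hn] := small_frac K e2.
pose i := (n + i0)%N.
have h1 := le_trans (Ha i) (hn i (leq_addr _ _)).
have h2 := le_trans (Hb i) (hn i (leq_addr _ _)).
have h3 := H i (leq_addl _ _).
have -> : W a - W b + h * (a - b) = ((SS R i)%:C - Sa b i - W b) - ((SS R i)%:C - Sa a i - W a) -
  (Sa a i - Sa b i - h * (a - b)) by ring.
apply: le_trans (mdB _ _) _; have := mdB ((SS R i)%:C - Sa b i - W b) ((SS R i)%:C - Sa a i - W a).
by clear -h1 h2 h3; lra.
Qed.

Lemma Sa_size (a : C) : 0 < Im (V a) -> 0 < Re (V a) -> exists2 M : R, 0 < M &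
  forall i, md (Sa a i) <= M * i.+1%:R.
Proof.
move=> h1 h2; have H := Sa_rec h1 h2.
exists (md (Sa a 0%N) + 2); first by have := md_ge0 (Sa a 0%N); clear; lra.
have p := md_ge0 (Sa a 0%N).
elim=> [|i IH]; first by rewrite mulr1; clear; lra.
have [_ -> _ _] := H i; have [_ _ r0 _] := H i.+1.
have i1 : md (Sa a i.+1 + 1)^-1 <= 1.
  rewrite mdV -[leRHS]invr1 lef_pV2 ?posrE ?ltr01 //.
    by apply: le_trans (Re_le _); rewrite ReD Re1; clear -r0; lra.
  by apply: lt_le_trans (Re_le _); rewrite ReD Re1; clear -r0; lra.
apply: le_trans (mdB _ _) _; have := mdD (Sa a i) 1; rewrite md1.
by rewrite -[i.+2%:R]natr1; move: IH i1 p; clear; lra.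
Qed.

Lemma Sa_gap (a : C) (c : R) : 0 < Im (V a) -> 0 < Re (V a) -> 0 < c -> Sseq c (Sa a) -> forall i k,
  c / (1 + c) * k%:R <= Re (Sa a (i + k)) - Re (Sa a i).
Proof.
move=> h1 h2 c0 [_ cS] i; elim=> [|k IH]; first by rewrite addn0 subrr mulr0.
have [_ _ _] := Sa_rec h1 h2 (i + k).
rewrite addnS -natr1 => h.
have c1 : c <= Re (Sa a (i + k).+1).
  apply: le_trans (cS _); by rewrite ler_peMr ?ler1n // ltW.
have : c / (1 + c) <= Re (Sa a (i + k).+1) / (1 + Re (Sa a (i + k).+1)).
  set r := Re _ in c1 *.
  have p1 : 0 < 1 + c by clear -c0; lra.
  have p2 : 0 < 1 + r by clear -c1 p1; lra.
  rewrite ler_pdivrMr // mulrAC ler_pdivlMr //; clear -c1; nra.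
by move: IH h; clear; lra.
Qed.

Lemma q0_back (a : C) i : iter i (@q0 R) (iter i (@g R) a) = a.
Proof. by elim: i => // i IH; rewrite iterSr /= /q0 g_q. Qed.

(** v = (Sa u i)^-1 is the (i + 2)-nd backward iterate of u, and -1 - v has the same image under
    [q0]. Two steps lead from V (-1 - v) to -1 - v, and i + 2 more to u. *)
Lemma q0_chain (u : C) i : Sa u i != 0 -> iter (i + 4) (@q0 R) (V (- 1 - (Sa u i)^-1)) = u.
Proof.
move=> n0; rewrite iterD.
have -> : iter i (@q0 R) (iter 4 (@q0 R) (V (- 1 - (Sa u i)^-1))) =
  iter i.+2 (@q0 R) (- 1 - (Sa u i)^-1).
  by rewrite !iterSr /= /V /q0 !g_q.
rewrite /Sa invrK iterSr.
have -> : q0 (- 1 - iter i (@g R) (V u)) = q0 (iter i (@g R) (V u)) by rewrite /q0; ring.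
by rewrite -iterSr /V -[g (g u)]/(iter 2 (@g R) u) -iterD addn2 -addn1 addnC q0_back.
Qed.

(** W i x is the outgoing phase of a_i(x) = -1 - 1 / S_i(x), where S_i(x) is [Sa (y0 R + x) i]. The
    chain rule gives c i = -h1 h2 / S_i(0)^2, of order i^-2. The gaps between the phases are those
    between the numbers 1 / S_i(0), up to a factor, because h1 is not zero. *)
Lemma chain : exists (rho0 c1 K kap0 B : R) (W : nat -> C -> C) (c : nat -> C) (i1 : nat),
  [/\ 0 < rho0, 0 < c1, 0 <= K, 0 < kap0 & 0 < B] /\
  [/\ forall i x, (i1 <= i)%N -> md x <= rho0 -> exists a : C, [/\ Sseq c1 (Sa a),
        forall J, md ((SS R J)%:C - Sa a J - W i x) <= K / J.+1%:R & iter (i + 4) (@q0 R) (V a) = y0 R + x],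
     forall eta : R, 0 < eta -> exists (dl : R) (i0 : nat), 0 < dl <= rho0 /\ forall i, (i0 <= i)%N -> forall x1 x2,
        md x1 <= dl -> md x2 <= dl -> md (W i x1 - W i x2 - c i * (x1 - x2)) <= eta * md (c i) * md (x1 - x2),
     forall i, (i1 <= i)%N -> c i != 0 /\ md (c i) <= B / i.+1%:R ^+ 2,
     forall i j, (i1 <= i < j)%N -> kap0 / (i.+1%:R * i.+2%:R) <= md (W i 0 - W j 0) &
     forall e : R, 0 < e -> exists i0, forall i j, (i0 <= i)%N -> (i0 <= j)%N -> md (W i 0 - W j 0) <= e].
Proof.
have [d1 [c1 [K [W [h1 [[d10 c10 K0] [h10 HW1 HW2]]]]]]] := phase_out (good_m1 R).
have [d2 [c2 [K2 [W' [h2 [[d20 c20 _] [h20 HS1 HS2]]]]]]] := phase_out (good_y0 R).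
have m1 : 0 < md h1 by rewrite md_gt0.
have m2 : 0 < md h2 by rewrite md_gt0.
pose S i x := Sa (y0 R + x) i.
pose a i x : C := - 1 - (S i x)^-1.
have inS x : md x <= d2 -> md (y0 R + x - y0 R) <= d2 by rewrite addrAC subrr add0r.
have Slo i x : md x <= d2 -> c2 * i.+1%:R <= md (S i x) /\ S i x != 0.
  move=> /inS /HS1 [[_ h] _ _]; have k := le_trans (h i) (Re_le _); split => //.
  by rewrite -md_gt0; apply: lt_le_trans k; rewrite mulr_gt0 // ltr0n.
have Slo1 i x : md x <= d2 -> c2 <= md (S i x).
  by move=> /(Slo i)[h _]; apply: le_trans h; rewrite ler_peMr ?ler1n // ltW.
have a1E i x : a i x - - 1 = - (S i x)^-1 by rewrite /a opprK addrAC addNr add0r.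
have a_small i x : md x <= d2 -> md (a i x - - 1) <= (c2)^-1 / i.+1%:R.
  move=> hx; have [h n0] := Slo i x hx.
  rewrite a1E mdN mdV -invfM lef_pV2 ?posrE //; first by rewrite md_gt0.
  by rewrite mulr_gt0 // ltr0n.
have near e : 0 < e -> exists n, forall i x, (n <= i)%N -> md x <= d2 -> md (a i x - - 1) <= e.
  move=> e0; have [n hn] := small_frac (c2)^-1 e0; exists n => i x ni hx.
  exact: le_trans (a_small i x hx) (hn i ni).
have Wlip (eta : R) : 0 < eta -> exists i0, forall i j x x', (i0 <= i)%N -> (i0 <= j)%N -> md x <= d2 -> md x' <= d2 ->
  md (W (a i x) - W (a j x') + h1 * (a i x - a j x')) <= eta * md (a i x - a j x').
  move=> eta0; have [dl [m [/andP[dl0 dl1] H]]] := HW2 _ eta0.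
  have [n hn] := near _ dl0; exists n => i j x x' ni nj hx hx'.
  have k1 := hn i x ni hx; have k2 := hn j x' nj hx'.
  have [_ _ p1] := HW1 _ (le_trans k1 dl1); have [_ _ p2] := HW1 _ (le_trans k2 dl1).
  apply: phase_diff (p1) (p2) _; exact: H k1 k2.
have [i1 Hi1] := near _ d10.
have z2 : md (0 : C) <= d2 by rewrite md0 ltW.
pose c i : C := - (h1 * h2) / S i 0 ^+ 2.
have mc i : md (c i) = md h1 * md h2 / md (S i 0) ^+ 2 by rewrite /c mdf mdN mdM mdX.
have e12 : 0 < md h1 / 2 by rewrite divr_gt0.
have [i2 Hi2] := Wlip _ e12.
have [_ [v1 v2 v3] _] := HS1 (y0 R + 0) (inS 0 z2).
have [M M0 HM] := Sa_size v2 v3.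
have [sq0 _ _] := HS1 (y0 R + 0) (inS 0 z2).
have gap := Sa_gap v2 v3 c20 sq0.
pose kp : R := c2 / (1 + c2).
have kp0 : 0 < kp by rewrite divr_gt0 //; clear -c20; lra.
have adiff i j x x' : md x <= d2 -> md x' <= d2 -> a i x - a j x' = (S i x - S j x') / (S i x * S j x').
  move=> hx hx'; have [_ n1] := Slo i x hx; have [_ n2] := Slo j x' hx'.
  by rewrite /a; field; rewrite n1 n2.
exists d2, c1, K, (md h1 / 2 * kp / M ^+ 2), (md h1 * md h2 / c2 ^+ 2), (fun i x => W (a i x)), c, (maxn i1 i2).
have M2 : 0 < M ^+ 2 by rewrite exprn_gt0.
have c22 : 0 < c2 ^+ 2 by rewrite exprn_gt0.
have kk0 : 0 < md h1 / 2 * kp / M ^+ 2 by rewrite divr_gt0 // mulr_gt0.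
have BB0 : 0 < md h1 * md h2 / c2 ^+ 2 by rewrite divr_gt0 // mulr_gt0.
split; first by split.
split.
- move=> i x; rewrite geq_max => /andP[hi _] hx; exists (a i x).
  have [p1 p2 p3] := HW1 _ (Hi1 i x hi hx); have [_ n0] := Slo i x hx.
  by split => //; exact: q0_chain.
(* 9 = 2 + 7: an error 2 v comes from the outgoing phase and 7 v from the difference quotient of 1 /
   S_i. *)
- move=> eta eta0; pose v : R := Num.min (eta / 9) (1 / 8).
  have v0 : 0 < v by rewrite /v lt_min !divr_gt0.
  have v9 : v <= eta / 9 by rewrite /v ge_min lexx.
  have v8 : v <= 1 / 8 by rewrite /v ge_min lexx orbT.
  have vh : 0 < v * md h2 by rewrite mulr_gt0.
  have vh1 : 0 < v * md h1 by rewrite mulr_gt0.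
  have [dl [m [/andP[dl0 dl1] H]]] := HS2 _ vh.
  have [n Hn] := Wlip _ vh1.
  pose r : R := v * c2 / (2 * md h2).
  have r0 : 0 < r by rewrite divr_gt0 ?mulr_gt0.
  have z0 : md (0 : C) <= Num.min dl r by rewrite md0 le_min !ltW.
  exists (Num.min dl r), (maxn m n); split; first by rewrite lt_min dl0 r0 ge_min dl1.
  move=> i; rewrite geq_max => /andP[mi ni].
  have Sd x x' : md x <= Num.min dl r -> md x' <= Num.min dl r -> md (S i x - S i x' - h2 * (x - x')) <= v * md h2 * md (x - x').
    rewrite !le_min => /andP[k1 _] /andP[k2 _].
    have -> : x - x' = (y0 R + x) - (y0 R + x') by ring.
    by apply: H => //; rewrite addrAC subrr add0r.
  have near1 x : md x <= Num.min dl r -> md (S i x / S i 0 - 1) <= v.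
    move=> hx; have k := Sd x 0 hx z0; rewrite subr0 in k.
    have [_ n0] := Slo i 0 z2.
    have -> : S i x / S i 0 - 1 = (S i x - S i 0) / S i 0 by field.
    rewrite mdf ler_pdivrMr ?md_gt0 //; apply: le_trans (_ : _ <= v * c2) _; last first.
      by apply: ler_wpM2l; [exact: ltW|exact: Slo1].
    have hr : md x <= r by move: hx; rewrite le_min => /andP[].
    have rE : 2 * md h2 * r = v * c2 by rewrite /r; field; exact: lt0r_neq0.
    have k1 : 2 * md h2 * md x <= v * c2 by rewrite -rE; apply: ler_wpM2l => //; rewrite mulr_ge0 // ltW.
    have k2 : v * (md h2 * md x) <= 1 * (md h2 * md x) by apply: ler_wpM2r; [rewrite mulr_ge0 ?md_ge0|clear -v8; lra].
    have -> : S i x - S i 0 = (S i x - S i 0 - h2 * x) + h2 * x by ring.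
    by apply: le_trans (mdD _ _) _; rewrite (mdM h2); clear -k k1 k2; lra.
  move=> x x' hx hx'.
  have hx2 : md x <= d2 by move: hx; rewrite le_min => /andP[h _]; exact: le_trans h dl1.
  have hx'2 : md x' <= d2 by move: hx'; rewrite le_min => /andP[h _]; exact: le_trans h dl1.
  have [n0 [iv2 iv5]] := inv_mul_near v8 (near1 x hx) (near1 x' hx').
  set pq := S i x / S i 0 * _ in n0 iv2 iv5.
  have [_ q1] := Slo i x hx2; have [_ q2] := Slo i x' hx'2; have [_ q3] := Slo i 0 z2.
  have E : a i x - a i x' = (S i x - S i x') / pq / S i 0 ^+ 2.
    by rewrite adiff // /pq; field; rewrite q1 q2 q3.
  have sd := Sd x x' hx hx'.
  set D := x - x' in sd *.
  have D0 := md_ge0 D.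
  have vD : 0 <= md h2 * md D by rewrite mulr_ge0 // ltW.
  have A1 : md ((S i x - S i x') / pq - h2 * D) <= 7 * v * (md h2 * md D).
    have -> : (S i x - S i x') / pq - h2 * D = (S i x - S i x' - h2 * D) / pq + h2 * D * (pq^-1 - 1) by ring.
    apply: le_trans (mdD _ _) _; rewrite (mdM (h2 * D)) (mdM h2) (mdM (_ - _)).
    have := ler_pM (md_ge0 _) (md_ge0 _) sd iv2.
    have : md h2 * md D * md (pq^-1 - 1) <= md h2 * md D * (5 * v) by apply: ler_wpM2l.
    by clear; lra.
  have A2 : md ((S i x - S i x') / pq) <= 2 * (md h2 * md D).
    have -> : (S i x - S i x') / pq = ((S i x - S i x') / pq - h2 * D) + h2 * D by ring.
    apply: le_trans (mdD _ _) _; rewrite (mdM h2).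
    have : v * (md h2 * md D) <= 1 / 8 * (md h2 * md D) by apply: ler_wpM2r.
    by move: A1 vD; clear; lra.
  have wl := Hn i i x x' ni ni hx2 hx'2.
  have s0 : 0 < md (S i 0) ^+ 2 by rewrite exprn_gt0 // md_gt0.
  have -> : W (a i x) - W (a i x') - c i * D =
    (W (a i x) - W (a i x') + h1 * (a i x - a i x')) - h1 * (((S i x - S i x') / pq - h2 * D) / S i 0 ^+ 2).
    by rewrite E /c; field; rewrite q3.
  apply: le_trans (mdB _ _) _; rewrite (mdM h1) (mdf _ (S i 0 ^+ 2)) (mdX _ 2).
  have B1 : md (a i x - a i x') <= 2 * (md h2 * md D) / md (S i 0) ^+ 2.
    by rewrite E (mdf _ (S i 0 ^+ 2)) (mdX _ 2) ler_pM2r ?invr_gt0.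
  have B2 : md h1 * (md ((S i x - S i x') / pq - h2 * D) / md (S i 0) ^+ 2) <= md h1 * (7 * v * (md h2 * md D) / md (S i 0) ^+ 2).
    by apply: ler_wpM2l; [exact: ltW|rewrite ler_pM2r ?invr_gt0].
  have B3 : v * md h1 * md (a i x - a i x') <= v * md h1 * (2 * (md h2 * md D) / md (S i 0) ^+ 2).
    by apply: ler_wpM2l => //; exact: ltW.
  have B4 : 9 * v * (md (c i) * md D) <= eta * (md (c i) * md D).
    by apply: ler_wpM2r; [rewrite mulr_ge0 ?md_ge0|clear -v9; lra].
  have E4 : 9 * v * (md (c i) * md D) = v * md h1 * (2 * (md h2 * md D) / md (S i 0) ^+ 2) +
    md h1 * (7 * v * (md h2 * md D) / md (S i 0) ^+ 2).
    by rewrite mc; field; rewrite md_eq0.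
  by rewrite -mulrA; move: B4 B3 B2 wl; rewrite E4; clear; lra.
- move=> i _; have [lo n0] := Slo i 0 z2; split.
    by rewrite /c mulf_neq0 ?oppr_eq0 ?mulf_neq0 // invr_eq0 expf_eq0.
  have p1 : 0 < c2 * i.+1%:R by rewrite mulr_gt0 // ltr0n.
  have p2 : 0 < md (S i 0) by rewrite md_gt0.
  have -> : md h1 * md h2 / c2 ^+ 2 / i.+1%:R ^+ 2 = md h1 * md h2 / (c2 * i.+1%:R) ^+ 2.
    by rewrite -[LHS]mulrA -invfM -exprMn.
  rewrite mc; apply: ler_wpM2l; first by rewrite mulr_ge0 // ltW.
  rewrite lef_pV2 ?posrE ?exprn_gt0 //.
  by rewrite ler_pXn2r ?nnegrE // ltW.
- move=> i j /andP[]; rewrite geq_max => /andP[_ k1] ij.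
  have k2 : (i2 <= j)%N by exact: leq_trans k1 (ltnW ij).
  have w := Hi2 i j 0 0 k1 k2 z2 z2.
  have wlo : md h1 / 2 * md (a i 0 - a j 0) <= md (W (a i 0) - W (a j 0)).
    have := md_lbB (W (a i 0) - W (a j 0) + h1 * (a i 0 - a j 0)) (W (a i 0) - W (a j 0)).
    have := mdB (W (a i 0) - W (a j 0) + h1 * (a i 0 - a j 0)) (W (a i 0) - W (a j 0)).
    rewrite [X in md X](_ : _ = h1 * (a i 0 - a j 0)); last by ring.
    by rewrite mdM; move: w; clear; lra.
  apply: le_trans wlo.
  have -> : md h1 / 2 * kp / M ^+ 2 / (i.+1%:R * i.+2%:R) = md h1 / 2 * (kp * (M ^- 2 / (i.+1%:R * i.+2%:R))) by rewrite !mulrA.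
  apply: ler_wpM2l; first exact: ltW.
  have [_ ni] := Slo i 0 z2; have [_ nj] := Slo j 0 z2.
  rewrite adiff // mdf mdM.
  have [k jk] : exists k, j = (i + k.+1)%N by exists (j - i).-1; clear -ij; lia.
  have gp := gap i k.+1.
  have ui : md (S i 0) <= M * i.+1%:R by exact: HM.
  have uj : md (S j 0) <= M * j.+1%:R by exact: HM.
  have n1 : 0 < i.+1%:R :> R by rewrite ltr0n.
  have n2 : 0 < j.+1%:R :> R by rewrite ltr0n.
  have num : kp * k.+1%:R <= md (S i 0 - S j 0).
    rewrite md_distC jk; apply: le_trans gp _; apply: le_trans (Re_le _); rewrite ReD ReN //.
  apply: le_trans (_ : _ <= kp * k.+1%:R / (M * i.+1%:R * (M * j.+1%:R))) _; last first.
    apply: ler_pM => //; first by rewrite mulr_ge0 // ltW.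
      by rewrite invr_ge0 ltW // !mulr_gt0.
    rewrite lef_pV2 ?posrE ?mulr_gt0 ?md_gt0 //.
    by apply: ler_pM; rewrite ?md_ge0.
  have n3 : 0 < i.+2%:R :> R by rewrite ltr0n.
  have n4 : 0 < k.+1%:R :> R by rewrite ltr0n.
  have jE : j.+1%:R = i.+1%:R + k.+1%:R :> R by rewrite jk -natrD; congr (_%:R); clear; lia.
  have i2E : i.+2%:R = i.+1%:R + 1 :> R by rewrite natr1.
  have hk : 1 <= k.+1%:R :> R by rewrite ler1n.
  have -> : kp * (M ^- 2 / (i.+1%:R * i.+2%:R)) = kp / (M ^+ 2 * i.+1%:R) * (i.+2%:R)^-1.
    by field; rewrite !lt0r_neq0.
  have -> : kp * k.+1%:R / (M * i.+1%:R * (M * j.+1%:R)) = kp / (M ^+ 2 * i.+1%:R) * (k.+1%:R / j.+1%:R).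
    by field; rewrite !lt0r_neq0.
  apply: ler_wpM2l; first by rewrite ltW // divr_gt0 // mulr_gt0 // exprn_gt0.
  rewrite ler_pdivlMr // mulrC ler_pdivrMr // jE i2E.
  by clear -hk n1; nra.
- move=> e e0; pose e' : R := e / (4 * md h1).
  have e'0 : 0 < e' by rewrite divr_gt0 // mulr_gt0.
  have [n hn] := near _ e'0; exists (maxn n i2) => i j; rewrite !geq_max => /andP[a1 a2] /andP[a3 a4].
  have w := Hi2 i j 0 0 a2 a4 z2 z2.
  have b1 := hn i 0 a1 z2; have b2 := hn j 0 a3 z2.
  have ad : md (a i 0 - a j 0) <= 2 * e'.
    have -> : a i 0 - a j 0 = (a i 0 - - 1) - (a j 0 - - 1) by ring.
    by apply: le_trans (mdB _ _) _; clear -b1 b2; lra.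
  have hd : md h1 * md (a i 0 - a j 0) <= md h1 * (2 * e') by apply: ler_wpM2l => //; exact: ltW.
  have eE : md h1 * (2 * e') = e / 2 by rewrite /e'; field; rewrite lt0r_neq0.
  have -> : W (a i 0) - W (a j 0) = (W (a i 0) - W (a j 0) + h1 * (a i 0 - a j 0)) - h1 * (a i 0 - a j 0) by ring.
  apply: le_trans (mdB _ _) _; rewrite (mdM h1); move: w hd e0; rewrite eE; clear; lra.
Qed.
End Chain.

(** * The phase of z, and one complete passage *)

Section Pass.
Variables (R : realType).
Local Notation C := R[i].
Local Notation Re := complex.Re.
Local Notation Im := complex.Im.

Definition TR (T : nat -> C) : Prop := forall m, T m.+1 = T m + 1 + (T m - 1)^-1.

Lemma TR_F n : TR (fun m => (F R (n + m))%:C).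
Proof. by move=> m; rewrite addnS F_S !rmorphD fmorphV rmorphB rmorph1. Qed.

Lemma TR_shift (T : nat -> C) k : TR T -> TR (fun m => T (k + m)%N).
Proof. by move=> H m; rewrite addnS H. Qed.

Lemma TR_re (T : nat -> C) (n : nat) : TR T -> n%:R / 2 + 7 / 2 <= Re (T 0%N) ->
  forall m, (n + m)%:R / 2 + 7 / 2 <= Re (T m).
Proof.
move=> Tr T0; elim=> [|m IH]; first by rewrite addn0.
have hn := ler0n R (n + m).
have h1 : 2 <= md (T m - 1) by apply: le_trans (Re_le _); rewrite ReD ReN Re1; clear -IH hn; lra.
have h2 : md (T m - 1)^-1 <= 1 / 2 by rewrite mdV -[leLHS]div1r ler_pdivrMr; clear -h1; lra.
have := Re_ge (T m + 1) (T m.+1); rewrite Tr [_ + _^-1 - _]addrAC subrr add0r ReD Re1 addnS -natr1.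
by clear -IH h2; lra.
Qed.

(** The constant exp K * K of [prod_tail] for K = 4, the constant in [Xseq_pair]. *)
Definition Et : R := expR 4 * 4.
Lemma Et0 : 0 < Et. Proof. by rewrite /Et mulr_gt0 ?expR_gt0. Qed.

(** [prod_tail] gains a factor 1 / (i + 1) at index i. To profit from a late start, the difference
    is regarded as a product over all indices whose first n factors are 1. *)
Lemma T_pair (n : nat) (T1 T2 : nat -> C) : TR T1 -> TR T2 ->
  n%:R / 2 + 7 / 2 <= Re (T1 0%N) -> n%:R / 2 + 7 / 2 <= Re (T2 0%N) ->
  forall m, md ((T1 m - T2 m) - (T1 0%N - T2 0%N)) <= md (T1 0%N - T2 0%N) * (Et / n.+1%:R).
Proof.
move=> r1 r2 b1 b2 m; have B1 := TR_re r1 b1; have B2 := TR_re r2 b2.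
(* For j < n the truncated subtraction gives the initial value. *)
pose h j : C := T1 (j - n)%N - T2 (j - n)%N.
pose r j : C := if (j < n)%N then 0 else - ((T1 (j - n)%N - 1) * (T2 (j - n)%N - 1))^-1.
have k j : (n <= j)%N -> (j%:R + 2) / 2 <= md (T1 (j - n)%N - 1) /\ (j%:R + 2) / 2 <= md (T2 (j - n)%N - 1).
  move=> nj; have := B1 (j - n)%N; have := B2 (j - n)%N; rewrite subnKC // => h1 h2.
  by split; apply: le_trans (Re_le _); rewrite ReD ReN Re1; [clear -h2|clear -h1]; lra.
have hr j : h j.+1 = h j * (1 + r j).
  rewrite /h /r; case: ltnP => nj.
      have -> : (j.+1 - n = 0)%N by clear -nj; lia.
    have -> : (j - n = 0)%N by clear -nj; lia.
    by rewrite addr0 mulr1.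
  have [k1 k2] := k j nj; have hn := ler0n R j.
  have n1 : T1 (j - n)%N - 1 != 0 by rewrite -md_gt0; clear -k1 hn; lra.
  have n2 : T2 (j - n)%N - 1 != 0 by rewrite -md_gt0; clear -k2 hn; lra.
  by rewrite subSn // r1 r2; field; rewrite n1 n2.
have hb j : md (r j) <= 4 / (j.+1%:R * j.+2%:R).
  rewrite /r; case: ltnP => nj; first by rewrite md0 divr_ge0 // mulr_ge0.
  have [k1 k2] := k j nj; have hn := ler0n R j.
  have h0 : (j%:R + 2) / 2 * ((j%:R + 2) / 2) <= md (T1 (j - n)%N - 1) * md (T2 (j - n)%N - 1) by apply: ler_pM => //; clear -hn; lra.
  have p0 : 0 < md (T1 (j - n)%N - 1) * md (T2 (j - n)%N - 1) by apply: lt_le_trans h0; clear -hn; nra.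
  rewrite mdN mdV mdM ler_pdivlMr ?mulr_gt0 ?ltr0Sn // mulrC ler_pdivrMr //.
  by rewrite -[j.+2%:R]natr1 -[j.+1%:R]natr1; clear -h0 hn; nra.
have [_] := prod_tail n (ler0n R 4) hr hb m.
by rewrite /h addKn subnn.
Qed.

Lemma F_re (n m : nat) : n%:R / 2 + 7 / 2 <= Re ((F R (n + m))%:C).
Proof.
rewrite /=; have := F_ge R (n + m); rewrite natrD; have := ler0n R n; have := ler0n R m; clear; lra.
Qed.

(** Z is the phase of z. The first bound gives the rate of convergence, and the second says that Z
    is the initial deviation from [F] up to a relative error O(1/n). *)
Lemma T_limit (n : nat) (T : nat -> C) : TR T -> n%:R / 2 + 7 / 2 <= Re (T 0%N) ->
  exists Z : C, (forall m, md (T m - (F R (n + m))%:C - Z) <= md (T 0%N - (F R n)%:C) * ((1 + Et) * Et) / (n + m).+1%:R) /\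
   md (T 0%N - (F R n)%:C - Z) <= md (T 0%N - (F R n)%:C) * (Et / n.+1%:R).
Proof.
move=> Tr T0; have B := TR_re Tr T0; have e0 := Et0.
set M := md (T 0%N - (F R n)%:C).
have M0 : 0 <= M by exact: md_ge0.
pose d m : C := T m - (F R (n + m))%:C.
have dE : d 0%N = T 0%N - (F R n)%:C by rewrite /d addn0.
have step m k : md (d (m + k)%N - d m) <= md (d m) * (Et / (n + m).+1%:R).
  have := T_pair (TR_shift m Tr) (TR_F (n + m)) _ _ k; rewrite !addn0 /d addnA; apply; first exact: B.
  by have := F_re (n + m) 0; rewrite addn0.
have dM m : md (d m) <= M * (1 + Et).
  have := step 0%N m; rewrite add0n addn0 dE -/M => h.
  have : M * (Et / n.+1%:R) <= M * Et.
    by apply: ler_wpM2l => //; rewrite ler_pdivrMr ?ltr0Sn // ler_peMr ?ler1n // ltW.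
  move=> h'; have h3 := le_trans h h'.
  have -> : d m = (d m - (T 0%N - (F R n)%:C)) + (T 0%N - (F R n)%:C) by rewrite subrK.
  by apply: le_trans (mdD _ _) _; rewrite mulrDr mulr1 addrC; apply: lerD.
have [|e e1|Z HZ] := @ccauchy _ d (fun m => M * ((1 + Et) * Et) / (n + m).+1%:R).
- move=> i j ij; rewrite -(subnKC ij); apply: le_trans (step i _) _.
  rewrite (mulrA M) -(mulrA (M * (1 + Et))); apply: ler_wpM2r; last exact: dM.
  by apply: divr_ge0; [exact: ltW|exact: ler0n].
- have [k hk] := small_frac (M * ((1 + Et) * Et)) (divr_gt0 e1 (ltr0n R 2)); exists k.
  by apply: le_lt_trans (hk (n + k)%N (leq_addl _ _)) _; rewrite ltr_pdivrMr // ltr_pMr // ltr1n.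
exists Z; split; first exact: HZ.
apply/ler_addgt0Pr => e e1; have [k hk] := small_frac (M * ((1 + Et) * Et)) e1.
have h1 := le_trans (HZ k) (hk (n + k)%N (leq_addl _ _)).
have := step 0%N k; rewrite add0n addn0 dE -/M => h2.
have -> : T 0%N - (F R n)%:C - Z = (d k - Z) - (d k - (T 0%N - (F R n)%:C)) by ring.
by apply: le_trans (mdB _ _) _; rewrite addrC lerD.
Qed.

(** J is fixed, so a crude induction is enough: one step multiplies the error by at most 2 B1 +
    2. *)
Lemma q0_perturb (J : nat) (B e : R) : 0 <= B -> 0 < e -> exists dl BB : R, [/\ 0 < dl, 0 <= BB & forall w v : nat -> C,
  md (v 0%N) <= B -> md (w 0%N - v 0%N) <= dl -> (forall m, (m < J)%N -> md (w m.+1 - q0 (w m)) <= dl) ->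
  (forall m, (m < J)%N -> v m.+1 = q0 (v m)) -> forall m, (m <= J)%N -> md (w m - v m) <= e /\ md (w m) <= BB].
Proof.
move=> B0; elim: J e => [|J IH] e e0.
  exists e, (B + e); split => //; first by rewrite addr_ge0 // ltW.
  move=> w v vB h _ _ m; rewrite leqn0 => /eqP ->; split => //.
  by have := mdD (w 0%N - v 0%N) (v 0%N); rewrite subrK; clear -h vB; lra.
have [d1 [B1 [d10 B10 H1]]] := IH 1 ltr01.
have p : 0 < 2 * B1 + 2 by clear -B10; lra.
pose e' : R := Num.min 1 (Num.min e (e / (2 * (2 * B1 + 2)))).
have e'0 : 0 < e' by rewrite /e' !lt_min ltr01 e0 divr_gt0 // mulr_gt0.
have e'1 : e' <= 1 by rewrite /e' ge_min lexx.
have e'e : e' <= e by rewrite /e' !ge_min lexx orbT.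
have e'2 : e' * (2 * B1 + 2) <= e / 2.
  rewrite -ler_pdivlMr // -mulrA -invfM; rewrite /e' !ge_min lexx !orbT //.
have [dl [BB [dl0 BB0 H]]] := IH _ e'0.
have q1 := sqr_ge0 B1.
exists (Num.min dl (e / 2)), (BB + B1 + B1 ^+ 2 + e); split.
- by rewrite lt_min dl0 divr_gt0.
- by clear -BB0 e0 B10 q1; lra.
move=> w v vB; rewrite le_min => /andP[h _] hw hv.
have hw1 m : (m < J)%N -> md (w m.+1 - q0 (w m)) <= dl.
  by move=> mJ; have := hw m (ltnW mJ); rewrite le_min => /andP[].
have hv1 m : (m < J)%N -> v m.+1 = q0 (v m) by move=> mJ; exact: hv m (ltnW mJ).
have K := H w v vB h hw1 hv1.
have vB2 : md (v J) <= B1.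
  have [] // := H1 v v vB _ _ hv1 J (leqnn J); rewrite ?subrr ?md0 ?ltW // => m mJ.
  by rewrite hv1 // subrr md0 ltW.
have [k1 _] := K J (leqnn J).
have wB : md (w J) <= B1 + 1.
  by have := mdD (w J - v J) (v J); rewrite subrK; clear -k1 e'1 vB2; lra.
have last : md (w J.+1 - v J.+1) <= e.
  have h1 : md (w J.+1 - q0 (w J)) <= e / 2 by have := hw J (ltnSn J); rewrite le_min => /andP[].
  have -> : w J.+1 - v J.+1 = (w J.+1 - q0 (w J)) + (w J - v J) * (1 + w J + v J).
    by rewrite (hv J (ltnSn J)) /q0; ring.
  apply: le_trans (mdD _ _) _; rewrite (mdM (w J - v J)).
  have h2 : md (1 + w J + v J) <= 2 * B1 + 2.
    apply: le_trans (mdD _ _) _; have := mdD 1 (w J); rewrite md1; clear -wB vB2; lra.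
  have := ler_pM (md_ge0 _) (md_ge0 _) k1 h2; move: h1 e'2; clear; lra.
move=> m; rewrite leq_eqVlt => /orP[/eqP ->|mJ].
  split=> //; have := mdD (w J.+1 - v J.+1) (v J.+1); rewrite subrK.
  have : md (v J.+1) <= B1 + B1 ^+ 2.
    rewrite hv // /q0; apply: le_trans (mdD _ _) _; rewrite mdX; apply: lerD => //.
    by rewrite ler_pXn2r ?nnegrE ?md_ge0.
  by clear -last BB0; lra.
have [k2 k3] := K m mJ; split; first exact: le_trans k2 e'e.
by clear -k3 B10 q1 e0; lra.
Qed.

Lemma u_rec_of_w (b : R) (T w : nat -> C) (m : nat) : T m != 0 -> T m - 1 != 0 -> T m.+1 = T m + 1 + (T m - 1)^-1 ->
  w m.+1 = q0 (w m) + (cc b)%:C / T m ^+ 2 ->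
  w m.+1 * T m.+1 = w m * T m + (T m - 1)^-1 * Gc b (w m * T m).
Proof. by move=> n0 n1 -> ->; rewrite /q0 /Gc; field; rewrite n0 n1. Qed.

Lemma inv_near (p q : C) (d : R) : 0 < d -> d <= md p -> d <= md q -> md (p^-1 - q^-1) <= md (p - q) / d ^+ 2.
Proof.
move=> d0 hp hq.
have n1 : p != 0 by rewrite -md_gt0; exact: lt_le_trans hp.
have n2 : q != 0 by rewrite -md_gt0; exact: lt_le_trans hq.
have -> : p^-1 - q^-1 = (q - p) / (p * q) by field; rewrite n1 n2.
rewrite mdf mdM md_distC; apply: ler_wpM2l; first exact: md_ge0.
have p0 : 0 < d * d by exact: mulr_gt0.
have h : d * d <= md p * md q by apply: ler_pM => //; exact: ltW.
by rewrite expr2 lef_pV2 ?posrE //; exact: lt_le_trans h.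
Qed.

(** Steps of [q0] lead from w down the petal to the vicinity of [V a]; in the coordinate 1/w this is
    [S_down]. *)
Lemma out_back (c1 e : R) (a w : C) (J : nat) : 0 < c1 -> Sseq c1 (Sa a) -> w != 0 -> md (w^-1 - Sa a J) <= e ->
  e * expR ((c1 ^+ 2)^-1) <= c1 / 2 -> exists v : nat -> C, [/\ v 0%N = w,
   forall m, (m < J)%N -> v m.+1 = q0 (v m), forall m, (m <= J)%N -> md (v m) <= 2 / c1 &
   md (v J - V a) <= e * expR ((c1 ^+ 2)^-1) * (4 / c1 ^+ 2)].
Proof.
move=> c0 [S1 S2] w0 he ec.
pose f (X : C) := X - 1 + (X + 1)^-1.
pose VV i : C := iter (J - i) f (w^-1).
have VS i : (i < J)%N -> VV i = VV i.+1 - 1 + (VV i.+1 + 1)^-1.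
  by move=> iJ; rewrite /VV (_ : (J - i)%N = (J - i.+1).+1) //; clear -iJ; lia.
have near : forall i, (i <= J)%N -> md (VV i - Sa a i) <= e * expR ((c1 ^+ 2)^-1).
  by apply: (S_down c0) => //; rewrite /VV subnn.
have re i : (i <= J)%N -> c1 / 2 <= Re (VV i).
  move=> iJ; have := Re_ge (Sa a i) (VV i); have := S2 i; have := near i iJ.
  have : c1 <= c1 * i.+1%:R by rewrite ler_peMr ?ler1n // ltW.
  by clear -ec; lra.
have c20 : 0 < c1 / 2 by rewrite divr_gt0.
have mdv i : (i <= J)%N -> c1 / 2 <= md (VV i) by move=> iJ; exact: le_trans (re i iJ) (Re_le _).
have nz i : (i <= J)%N -> VV i != 0 by move=> iJ; rewrite -md_gt0; exact: lt_le_trans (mdv i iJ).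
exists (fun m => (VV (J - m)%N)^-1); split.
- by rewrite subn0 /VV subnn invrK.
- move=> m mJ; have -> : (J - m = (J - m.+1).+1)%N by clear -mJ; lia.
  have l1 : (J - m.+1 < J)%N by clear -mJ; lia.
  rewrite VS // /q0; have n0 := nz _ l1.
  have n1 : VV (J - m.+1).+1 + 1 != 0.
    by rewrite -md_gt0; apply: lt_le_trans (Re_le _); rewrite ReD Re1; have := re _ l1; clear -c0; lra.
  have n2 : VV (J - m.+1).+1 - 1 + (VV (J - m.+1).+1 + 1)^-1 != 0.
    by rewrite -VS //; apply: nz; exact: ltnW.
  move: (VV _) n0 n1 n2 => X n0 n1 n2.
  have E : X - 1 + (X + 1)^-1 = X ^+ 2 / (X + 1) by field.
  by rewrite E; field; rewrite n0 n1.
- move=> m mJ; rewrite mdV -[2 / c1]invf_div lef_pV2 ?posrE ?md_gt0 ?nz ?leq_subr //.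
  exact: mdv (leq_subr _ _).
rewrite subnn; have -> : V a = (Sa a 0%N)^-1 by rewrite /Sa invrK.
have s0 : c1 / 2 <= md (Sa a 0%N).
  by apply: le_trans (Re_le _); have := S2 0%N; rewrite mulr1; clear -c0; lra.
apply: le_trans (inv_near c20 (mdv 0%N (leq0n _)) s0) _.
have -> : (c1 / 2) ^- 2 = 4 / c1 ^+ 2 by field; exact: lt0r_neq0.
by apply: ler_wpM2r; [rewrite divr_ge0 // sqr_ge0|exact: near].
Qed.

(** Four pieces: J steps of [q0] from y0 + x ([HA]), the transit, J steps down the repelling petal
    to [V a] ([HC]), and s further steps ([Hs]). The equation for Wv says that the exit phase is the
    phase of a. The accuracies are fixed from the end backwards, with J after e2 and n last. *)
Lemma pass (b : R) (al : nat) (Kp : R) (Phi : C -> C) : 0 < b -> (1 < al)%N -> Lb b = ln al%:R -> 0 <= Kp ->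
  (forall x, md x <= 1 / 20 -> forall i, md (Xs (X0 x) i - (F R (i + 2))%:C - Phi x) <= Kp / i.+1%:R) ->
  exists kap : R, forall (c1 Kw M e : R) (s : nat), 0 < c1 -> 0 <= Kw -> 0 <= M -> 0 < e ->
  exists (n0 : nat) (BB : R), forall n, (n0 <= n)%N -> forall (T w : nat -> C) (Z x a Wv : C),
  TR T -> (forall m, w m.+1 = q0 (w m) + (cc b)%:C / T m ^+ 2) -> md Z <= M ->
  (forall m, md (T m - (F R (n + m))%:C - Z) <= M / (n + m).+1%:R) ->
  w 0%N = y0 R + x -> md x <= 1 / 20 -> Sseq c1 (Sa a) -> (forall J, md ((SS R J)%:C - Sa a J - Wv) <= Kw / J.+1%:R) ->
  Wv = al%:R * Phi x + (1 - al%:R) * Z + kap%:C ->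
  md (w (al * n - n + s)%N - iter s (@q0 R) (V a)) <= e /\ forall m, (m <= al * n - n + s)%N -> md (w m) <= BB.
Proof.
move=> b0 al1 LA Kp0 HPhi; have [kap Hk] := passage_compare b0 al1 LA.
exists kap => c1 Kw M e s c0 Kw0 M0 e0.
pose A : R := al%:R; have A2 : 2 <= A by rewrite ler_nat.
have c10 : 0 <= c1^-1 by rewrite invr_ge0 ltW.
have c20 : 0 <= 2 / c1 by rewrite divr_ge0 // ltW.
pose PB : R := Kp + 5 + F R 2.
have F2 := F_ge R 2.
have HPB x : md x <= 1 / 20 -> md (Phi x) <= PB.
  move=> hx; have h := HPhi x hx 0%N; rewrite divr1 add0n in h; have [m1 _ m2] := X0_near hx.
  have x2 : md x ^+ 2 <= 1 / 400 by rewrite expr2; have := ler_pM (md_ge0 x) (md_ge0 x) hx hx; clear; lra.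
  have x4 : md (X0 x) <= 5.
    have := mdD (X0 x - 4) 4; rewrite subrK mdn; clear -m2 x2; lra.
  have E1 : Phi x = X0 x - (F R 2)%:C - (X0 x - (F R 2)%:C - Phi x) by ring.
  rewrite E1.
  apply: le_trans (mdB _ _) _; have := mdB (X0 x) (F R 2)%:C.
  rewrite md_real ger0_norm; last by clear -F2; lra.
  by rewrite /PB; move: h x4; clear; lra.
have [ds [Bs [ds0 Bs0 Hs]]] := q0_perturb s c10 e0.
pose E := expR ((c1 ^+ 2)^-1); have E0 : 0 < E by exact: expR_gt0.
have c12 : 0 < c1 ^+ 2 by rewrite exprn_gt0.
(* The accuracy needed on exit: the first entry brings the orbit within ds / 2 of [V a], the second
   is the smallness required by [out_back]. *)
pose e2 : R := Num.min (ds / 2 / (E * (4 / c1 ^+ 2))) (c1 / 2 / E).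
have e20 : 0 < e2 by rewrite /e2 lt_min !divr_gt0 // mulr_gt0 // divr_gt0.
have mk (p q t : R) : 0 < t -> p <= q / t -> p * t <= q by move=> t0; rewrite ler_pdivlMr.
have Ec0 : 0 < E * (4 / c1 ^+ 2) by apply: mulr_gt0 => //; exact: divr_gt0.
have e2a : e2 * E * (4 / c1 ^+ 2) <= ds / 2.
  by rewrite -(mulrA e2); apply: (mk _ _ _ Ec0); rewrite /e2 ge_min lexx.
have e2b : e2 * E <= c1 / 2 by apply: (mk _ _ _ E0); rewrite /e2 ge_min lexx orbT.
pose KK : R := PB + Kp + 2 + 2 * M.
have PB0 : 0 <= PB by rewrite /PB; clear -Kp0 F2; lra.
have KK1 : 1 <= KK by rewrite /KK; clear -PB0 Kp0 M0; lra.
have e40 : 0 < e2 / 4 by rewrite divr_gt0.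
have [J0 [J00 HJ0]] := Hk KK (e2 / 4) KK1 e40.
have [J1 HJ1] := small_frac Kw e40.
have [J2 HJ2] := small_frac (A * Kp) (divr_gt0 e20 (ltr0n R 8)).
pose J := (J0 + J1 + J2 + 2)%N.
have JJ0 : (J0 <= J)%N by rewrite /J; clear; lia.
have [n1 [n12 Hn1]] := HJ0 J JJ0.
have hJw : Kw / J.+1%:R <= e2 / 4 by apply: HJ1; rewrite /J; clear; lia.
have hJp : A * Kp / (J - 2).+1%:R <= e2 / 8 by apply: HJ2; rewrite /J; clear; lia.
have J2E : ((J - 2) + 2 = J)%N by rewrite /J; clear; lia.
have FJ := F_ge R J.
pose XB : R := F R J + PB + Kp.
have XB1 : 1 <= XB by rewrite /XB; have := ler0n R J; clear -FJ PB0 Kp0; lra.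
pose e1 : R := Num.min 1 (e2 / (16 * A)).
have e10 : 0 < e1 by rewrite /e1 lt_min ltr01 divr_gt0 // mulr_gt0 //; clear -A2; lra.
have e1a : A * e1 <= e2 / 16.
  rewrite mulrC -ler_pdivlMr; last by clear -A2; lra.
  by rewrite -mulrA -invfM /e1 ge_min lexx orbT.
have e11 : e1 <= 1 by rewrite /e1 ge_min lexx.
pose d1 : R := (2 * XB)^-1.
have XB2 : 0 < 2 * XB by clear -XB1; lra.
have d10 : 0 < d1 by rewrite invr_gt0.
pose eA : R := Num.min d1 (e1 * d1 ^+ 2).
have d12 : 0 < d1 ^+ 2 by rewrite exprn_gt0.
have eA0 : 0 < eA by rewrite /eA lt_min d10 mulr_gt0.
have [dA [BA [dA0 BA0 HA]]] := q0_perturb J (@ler01 R) eA0.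
have ds20 : 0 < ds / 2 by rewrite divr_gt0.
have [dC [BC [dC0 BC0 HC]]] := q0_perturb J c20 ds20.
pose dd : R := Num.min dA (Num.min dC ds).
have dd0 : 0 < dd by rewrite /dd !lt_min dA0 dC0 ds0.
have cb0 : 0 < cc b by rewrite /cc; have := sqr_ge0 b; clear; lra.
have [n2 Hn2] := nat_above (4 * cc b / dd).
have [n3 Hn3] := nat_above (4 * M + 1).
have [n4 Hn4] := small_frac (A * M) (divr_gt0 e20 (ltr0n R 8)).
exists (n1 + n2 + n3 + n4 + 1)%N, (BA + (1 / 4) + BC + Bs) => n hn T w Z x a Wv Tr wr ZM TZ w0 hx Ss SW EW.
have nn1 : (n1 <= n)%N by clear -hn; lia.
have nn4 : (n4 <= n)%N by clear -hn; lia.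
have n1R : 1 <= n%:R :> R by rewrite ler1n; clear -hn; lia.
have n2R : 4 * cc b / dd <= n%:R by apply: le_trans Hn2 _; rewrite ler_nat; clear -hn; lia.
have n3R : 4 * M + 1 <= n%:R by apply: le_trans Hn3 _; rewrite ler_nat; clear -hn; lia.
have TF m : md (T m - (F R (n + m))%:C) <= 2 * M.
  have h : M / (n + m).+1%:R <= M by rewrite ler_pdivrMr ?ltr0Sn // ler_peMr // ler1n.
  have := mdD (T m - (F R (n + m))%:C - Z) Z; rewrite subrK.
  by have := le_trans (TZ m) h; clear -ZM; lra.
have Tre m : n%:R / 2 + 7 / 2 <= Re (T m).
  have := Re_ge ((F R (n + m))%:C) (T m); have := TF m; have := F_ge R (n + m); rewrite natrD /=.
  by have := ler0n R m; clear -n3R n1R; lra.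
have Tmd m : n%:R / 2 + 7 / 2 <= md (T m) by exact: le_trans (Tre m) (Re_le _).
have T0 m : T m != 0 by rewrite -md_gt0; have := Tmd m; clear -n1R; lra.
have T1 m : T m - 1 != 0.
  by rewrite -md_gt0; apply: lt_le_trans (Re_le _); rewrite ReD ReN Re1; have := Tre m; clear -n1R; lra.
have pert m : md (w m.+1 - q0 (w m)) <= dd.
  rewrite wr addrAC subrr add0r mdf mdX md_real ger0_norm; last exact: ltW.
  have t1 := Tmd m; have t2 : n%:R / 4 <= md (T m) ^+ 2 by rewrite expr2; move: t1; clear -n1R; nra.
  have t0 : 0 < md (T m) ^+ 2 by apply: lt_le_trans t2; clear -n1R; lra.
  rewrite ler_pdivrMr //; have := n2R; rewrite ler_pdivrMr // => h.
  have : dd * (n%:R / 4) <= dd * md (T m) ^+ 2 by apply: ler_wpM2l => //; exact: ltW.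
  by clear -h; lra.
have pA m : md (w m.+1 - q0 (w m)) <= dA by apply: le_trans (pert m) _; rewrite /dd ge_min lexx.
have pC m : md (w m.+1 - q0 (w m)) <= dC by apply: le_trans (pert m) _; rewrite /dd !ge_min lexx orbT.
have pS m : md (w m.+1 - q0 (w m)) <= ds by apply: le_trans (pert m) _; rewrite /dd !ge_min lexx !orbT.
have [Xq XE] := q0_iter_X hx.
have vA0 : md (y0 R + x) <= 1.
  have y01 : md (y0 R) <= 3 / 4.
    rewrite /y0 mdf mdn ler_pdivrMr //; have : md (-1 +i* 1 : C) ^+ 2 = 2 by rewrite md_sq /=; ring.
    by have := md_ge0 (-1 +i* 1 : C); clear; nra.
  by apply: le_trans (mdD _ _) _; clear -y01 hx; lra.
have KA : forall m, (m <= J)%N -> md (w m - iter m (@q0 R) (y0 R + x)) <= eA /\ md (w m) <= BA.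
  by apply: HA => //; rewrite w0 subrr md0 ltW.
have [kJ _] := KA J (leqnn J).
have [XEJ XnJ] := XE (J - 2)%N; rewrite J2E in XEJ.
set XJ := Xs (X0 x) (J - 2) in XEJ XnJ.
have XJF : md (XJ - (F R J)%:C - Phi x) <= Kp / (J - 2).+1%:R by have := HPhi x hx (J - 2)%N; rewrite J2E.
have KpJ : Kp / (J - 2).+1%:R <= Kp by rewrite ler_pdivrMr ?ltr0Sn // ler_peMr // ler1n.
have XJB : md XJ <= XB.
  have -> : XJ = XJ - (F R J)%:C - Phi x + Phi x + (F R J)%:C by ring.
  apply: le_trans (mdD _ _) _; have := mdD (XJ - (F R J)%:C - Phi x) (Phi x); rewrite md_real ger0_norm; last first.
    by have := ler0n R J; clear -FJ; lra.
  by have := HPB x hx; rewrite /XB; have := le_trans XJF KpJ; clear; lra.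
have vlo : 2 * d1 <= md (iter J (@q0 R) (y0 R + x)).
  rewrite XEJ mdN mdV /d1 invfM mulrA divff ?mul1r ?pnatr_eq0 // lef_pV2 ?posrE ?md_gt0 //.
  by clear -XB1; lra.
have eAd : eA <= d1 by rewrite /eA ge_min lexx.
have wlo : d1 <= md (w J).
  have := mdB (iter J (@q0 R) (y0 R + x)) (iter J (@q0 R) (y0 R + x) - w J); rewrite opprB addrCA subrr addr0.
  have := mdD (w J) (iter J (@q0 R) (y0 R + x) - w J); rewrite addrCA subrr addr0 md_distC.
  by move: kJ eAd vlo; clear; lra.
have vlo1 : d1 <= md (iter J (@q0 R) (y0 R + x)) by move: vlo d10; clear; lra.
have wJ0 : w J != 0 by rewrite -md_gt0; exact: lt_le_trans wlo.
pose X : C := - (w J)^-1.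
have XX : md (X - XJ) <= e1.
  have -> : X - XJ = - ((w J)^-1 - (iter J (@q0 R) (y0 R + x))^-1).
    by rewrite XEJ /X invrN invrK; ring.
  rewrite mdN; apply: le_trans (inv_near d10 wlo vlo1) _.
  by rewrite ler_pdivrMr //; apply: le_trans kJ _; rewrite /eA ge_min lexx orbT.
have XF : md (X - (F R J)%:C - Phi x) <= e1 + Kp / (J - 2).+1%:R.
  have -> : X - (F R J)%:C - Phi x = (X - XJ) + (XJ - (F R J)%:C - Phi x) by ring.
  by apply: le_trans (mdD _ _) _; exact: lerD.
have XK : md (X - (F R J)%:C) <= KK.
  have := mdD (X - (F R J)%:C - Phi x) (Phi x); rewrite subrK; have := HPB x hx.
  have := le_trans XF (lerD e11 KpJ); rewrite /KK; move: M0; clear; lra.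
pose N := (al * n - J - (n + J))%N.
have nJ : (2 * J <= n)%N by exact: leq_trans n12 nn1.
have NE : (n + J + N = al * n - J)%N.
  rewrite /N subnKC //; have : (2 * n <= al * n)%N by rewrite leq_mul2r al1 orbT.
  by clear -nJ; lia.
have U1 m : w (J + m.+1)%N * T (J + m.+1)%N = w (J + m)%N * T (J + m)%N + (T (J + m)%N - 1)^-1 * Gc b (w (J + m)%N * T (J + m)%N).
  by rewrite addnS; apply: u_rec_of_w.
have U2 : md (T (J + 0)%N - (F R (n + J))%:C) <= KK.
  by rewrite addn0; apply: le_trans (TF J) _; rewrite /KK; move: PB0 Kp0; clear; lra.
have U3 : w (J + 0)%N * T (J + 0)%N = - (T (J + 0)%N / X).
  by rewrite addn0 /X invrN invrK mulrN opprK mulrC.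
have [c1' c2' c3'] := Hn1 n nn1 (fun m => T (J + m)%N) (fun m => w (J + m)%N * T (J + m)%N) X N
  (TR_shift J Tr) U1 NE U2 U3 XK.
rewrite addn0 in c3'.
set L := (J + N)%N in c2' c3'.
have wL0 : w L != 0 by move: c2'; rewrite mulf_eq0 negb_or => /andP[].
have TW : T L / (w L * T L) = (w L)^-1 by field; rewrite wL0 T0.
rewrite TW in c3'.
have outE : md ((w L)^-1 - Sa a J) <= e2.
  have TJ : md (T J - (F R (n + J))%:C - Z) <= M / (n + J).+1%:R by exact: TZ.
  have MJ : A * M / (n + J).+1%:R <= e2 / 8 by apply: Hn4; clear -nn4; lia.
  (* The errors of the transit, of the outgoing phase at index J, of the incoming phase at time J,
     and of the phase of z at time n + J. *)
  have -> : (w L)^-1 - Sa a J = (- (- (w L)^-1 + (SS R J)%:C - kap%:C - (al%:R * (X - (F R J)%:C) + (1 - al%:R) * (T J - (F R (n + J))%:C))))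
    + ((SS R J)%:C - Sa a J - Wv) + (- (al%:R * (X - (F R J)%:C - Phi x))) + (- ((1 - al%:R) * (T J - (F R (n + J))%:C - Z))).
    by rewrite EW; ring.
  have mA : md (al%:R : C) = A by rewrite mdn.
  have mA1 : md (1 - al%:R : C) <= A.
    have -> : (1 - al%:R : C) = (1 - A)%:C by rewrite rmorphB rmorph1 rmorph_nat.
    by rewrite md_real ler0_norm; clear -A2; lra.
  apply: le_trans (mdD _ _) _; rewrite mdN.
  have q1 := mdD (- (- (w L)^-1 + (SS R J)%:C - kap%:C - (al%:R * (X - (F R J)%:C) + (1 - al%:R) * (T J - (F R (n + J))%:C)))
    + ((SS R J)%:C - Sa a J - Wv)) (- (al%:R * (X - (F R J)%:C - Phi x))).
  have q2 := mdD (- (- (w L)^-1 + (SS R J)%:C - kap%:C - (al%:R * (X - (F R J)%:C) + (1 - al%:R) * (T J - (F R (n + J))%:C))))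
    ((SS R J)%:C - Sa a J - Wv).
  rewrite mdN in q2; rewrite mdN (mdM al%:R) mA in q1.
  have r1 : md (1 - al%:R : C) * md (T J - (F R (n + J))%:C - Z) <= A * (M / (n + J).+1%:R) by apply: ler_pM; rewrite ?md_ge0.
  rewrite mulrA in r1.
  have r2 : A * md (X - (F R J)%:C - Phi x) <= A * (e1 + Kp / (J - 2).+1%:R) by apply: ler_wpM2l => //; clear -A2; lra.
  rewrite mulrDr mulrA in r2; have r5 := le_trans r2 (lerD e1a hJp).
  have r3 := le_trans (SW J) hJw.
  rewrite (mdM (1 - _)).
  have r4 := le_trans r1 MJ.
  move: q1 q2 c3' r3 r5 r4 e20; clear; lra.
have [v [v0 vr vB vE]] := out_back c0 Ss wL0 outE e2b.
have C1 : md (w (L + 0)%N - v 0%N) <= dC by rewrite addn0 v0 subrr md0 ltW.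
have C2 m : (m < J)%N -> md (w (L + m.+1)%N - q0 (w (L + m)%N)) <= dC by move=> _; rewrite addnS; exact: pC.
have KC := HC (fun m => w (L + m)%N) v (vB 0%N (leq0n J)) C1 C2 vr.
have [kC _] := KC J (leqnn J).
have start : md (w (L + J)%N - V a) <= ds.
  have := mdD (w (L + J)%N - v J) (v J - V a); rewrite addrA subrK.
  by move: kC vE e2a; rewrite /E; clear; lra.
have Va : md (V a) <= c1^-1.
  have -> : V a = (Sa a 0%N)^-1 by rewrite /Sa invrK.
  have [_ h] := Ss; have := h 0%N; rewrite mulr1 => h0.
  have h1 := le_trans h0 (Re_le _).
  by rewrite mdV lef_pV2 ?posrE //; exact: lt_le_trans h1.
have S1 : md (w (L + J + 0)%N - V a) <= ds by rewrite addn0.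
have S2 m : (m < s)%N -> md (w (L + J + m.+1)%N - q0 (w (L + J + m)%N)) <= ds by move=> _; rewrite addnS; exact: pS.
have S3 m : (m < s)%N -> iter m.+1 (@q0 R) (V a) = q0 (iter m (@q0 R) (V a)) by [].
have KS := Hs (fun m => w (L + J + m)%N) (fun m => iter m (@q0 R) (V a)) Va S1 S2 S3.
have LE : (al * n - n = L + J)%N by rewrite /L; move: NE nJ; clear; lia.
rewrite LE; split; first by have [] := KS s (leqnn s).
move=> m hm; case: (leqP m J) => mJ.
  by have [_ h] := KA m mJ; move: h BC0 Bs0; clear; lra.
case: (leqP m L) => mL.
  have mN : (m - J <= N)%N by rewrite /L in mL; clear -mL; lia.
  have [h1 h2] := c1' (m - J)%N mN; rewrite (subnKC (ltnW mJ)) in h1 h2.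
  have FP : 0 < F R (n + J) by have := F_ge R (n + J); have := ler0n R (n + J); clear; lra.
  have : md (w m) <= 1 / 4.
    rewrite mdM in h1; move: h1 h2 (md_ge0 (w m)) FP.
    by move: (F R (n + J)) (md (w m)) (md (T m)) => f y t; clear; nra.
  by move: BC0 Bs0 BA0; clear; lra.
case: (leqP m (L + J)) => mLJ.
  have h1 : (m - L <= J)%N by clear -mLJ; lia.
  have [_] := KC (m - L)%N h1; rewrite (subnKC (ltnW mL)).
  by move: BA0 Bs0; clear; lra.
have h1 : (m - (L + J) <= s)%N by clear -hm; lia.
have [_] := KS (m - (L + J))%N h1; rewrite (subnKC (ltnW mLJ)).
by move: BA0 BC0; clear; lra.
Qed.
End Pass.

(** * Normality in C^2 *)

Section Normality.
Variables (R : realType).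
Local Notation C := R[i].
Local Notation C2 := (R[i] * R[i])%type.
Local Notation Re := complex.Re.
Local Notation Im := complex.Im.

Lemma small_frac' (e : R) : 0 < e -> exists N, forall j, (N <= j)%N -> (j.+1%:R)^-1 <= e.
Proof.
move=> e0; exists (Num.truncn e^-1) => j hj; rewrite -[e]invrK lef_pV2 ?posrE ?invr_gt0 ?ltr0n //.
by apply: ltW; apply: lt_le_trans (truncnS_gt _) _; rewrite ler_nat ltnS.
Qed.

Definition near2 (d : R) (p q : C2) : Prop := md (q.1 - p.1) < d /\ md (q.2 - p.2) < d.

Lemma near2C d p q : near2 d p q -> near2 d q p.
Proof. by rewrite /near2 !(md_distC q.1) !(md_distC q.2). Qed.

Lemma near2_refl (d : R) p : 0 < d -> near2 d p p.
Proof. by rewrite /near2 !subrr !md0. Qed.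

Lemma near2_le (d d' : R) p q : d <= d' -> near2 d p q -> near2 d' p q.
Proof. by move=> dd [h1 h2]; split; [exact: lt_le_trans h1 dd|exact: lt_le_trans h2 dd]. Qed.

Lemma near2_tri (d d' : R) p q s : near2 d p q -> near2 d' q s -> near2 (d + d') p s.
Proof.
move=> [h1 h2] [k1 k2]; split.
  by apply: le_lt_trans (md_tri q.1 _ _) _; rewrite addrC ltrD.
by apply: le_lt_trans (md_tri q.2 _ _) _; rewrite addrC ltrD.
Qed.

Lemma ball_near2 (d : R) (p q : C2) : ball p d%:C q <-> near2 d p q.
Proof.
have E (a b : C) : ball a d%:C b <-> md (b - a) < d.
  by rewrite -ball_normE /= distrC mdE ltcR.
by split=> -[h1 h2]; split; apply/E.
Qed.

Lemma nbhs_near2 (p : C2) (A : set C2) : nbhs p A <-> exists2 d : R, 0 < d & forall q, near2 d p q -> A q.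
Proof.
split.
  move=> /nbhs_ballP[e /= /ltc_real[r r0 ->] H]; exists r => // q hq.
  by apply: H; apply/ball_near2.
move=> [d d0 H]; apply/nbhs_ballP; exists d%:C => /=; first by rewrite ltcR.
by move=> q /ball_near2 /H.
Qed.

Lemma entourage_near2 (E : set (C2 * C2)) : entourage E -> exists2 d : R, 0 < d & forall p q, near2 d p q -> E (p, q).
Proof.
rewrite -(@entourage_ballE _ C2) => -[e /= /ltc_real[r r0 ->] H]; exists r => // p q hq.
by apply: H => /=; apply/ball_near2.
Qed.

Lemma near2_entourage (d : R) : 0 < d -> entourage [set x : C2 * C2 | near2 d x.1 x.2].
Proof.
move=> d0; rewrite -(@entourage_ballE _ C2); exists d%:C => /=; first by rewrite ltcR.
by move=> -[p q] /= /ball_near2.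
Qed.

Lemma uniform_family (U : set C2) (g : nat -> C2 -> C2) (l : C2 -> C2) :
  (forall e : R, 0 < e -> exists N, forall n, (N <= n)%N -> forall q, U q -> near2 e (l q) (g n q)) ->
  {family compactly_in U, g @ \oo --> l}.
Proof.
move=> H; apply/fam_cvgP => K [KU _]; move=> A /uniform_nbhs[E [/entourage_near2[d d0 Ed] sub]].
have [N HN] := H d d0; exists N => // n /= Nn; apply: sub => q Kq; apply: Ed.
by apply: HN => //; exact: KU.
Qed.

Lemma family_uniform (U K : set C2) (g : nat -> C2 -> C2) (l : C2 -> C2) :
  {family compactly_in U, g @ \oo --> l} -> K `<=` U -> compact K ->
  forall e : R, 0 < e -> exists N, forall n, (N <= n)%N -> forall q, K q -> near2 e (l q) (g n q).
Proof.
move=> /fam_cvgP H KU cK e e0; have /= HK := H K (conj KU cK).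
have : nbhs (l : {uniform` K -> C2}) [set h : C2 -> C2 | forall y, K y -> near2 e (l y) (h y)].
  by apply/uniform_nbhs; exists [set x : C2 * C2 | near2 e x.1 x.2]; split => //; exact: near2_entourage.
by move=> /HK[N _ HN]; exists N => n Nn q Kq; exact: (HN n Nn q Kq).
Qed.

(** Boxes in the real coordinates, rather than polydiscs, are images of products of segments, whence
    their compactness. *)
Definition box (p : C2) (B : R) : set C2 := [set q | [/\ `|Re (q.1 - p.1)| <= B, `|Im (q.1 - p.1)| <= B,
  `|Re (q.2 - p.2)| <= B & `|Im (q.2 - p.2)| <= B]].

Lemma near2_box (d : R) p q : near2 d p q -> box p d q.
Proof.
move=> [/ltW h1 /ltW h2].
by split; [apply: le_trans (Re_md _) h1|apply: le_trans (Im_md _) h1|apply: le_trans (Re_md _) h2|apply: le_trans (Im_md _) h2].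
Qed.

Lemma box_near2 (d d' : R) p q : 2 * d < d' -> box p d q -> near2 d' p q.
Proof.
move=> dd [h1 h2 h3 h4]; split; apply: le_lt_trans (md_ReIm _) _; apply: le_lt_trans dd; rewrite mulr_natl mulr2n; exact: lerD.
Qed.

Lemma box_compact p (B : R) : compact (box p B).
Proof.
pose f (x : (R * R) * (R * R)) : C2 := (p.1 + (x.1.1 +i* x.1.2), p.2 + (x.2.1 +i* x.2.2)).
pose I : set R := [set x | -B <= x <= B].
have cI : compact I.
  rewrite (_ : I = `[- B, B]%classic); first exact: segment_compact.
  by apply/seteqP; split=> x; rewrite /I /= in_itv.
have cc : compact ((I `*` I) `*` (I `*` I)) by apply: compact_setX; apply: compact_setX.
have fc : continuous f.
  move=> x A /nbhs_near2[d d0 H]; apply/nbhs_ballP; exists (d / 2) => /=; first by rewrite divr_gt0.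
  move=> y [[/= h1 h2] [h3 h4]]; apply: H.
  have aux (a : C) (u v u' v' : R) : ball u (d / 2) u' -> ball v (d / 2) v' -> md (a + (u' +i* v') - (a + (u +i* v))) < d.
    rewrite -!ball_normE /= => k1 k2; have -> : a + (u' +i* v') - (a + (u +i* v)) = ((u' - u) +i* (v' - v)).
      by rewrite opprD addrACA subrr add0r; apply/eqP; rewrite eq_complex /= !eqxx.
    apply: le_lt_trans (md_ReIm _) _; rewrite /= (distrC u') (distrC v') [ltRHS](splitr d); exact: ltrD.
  by split; apply: aux.
rewrite (_ : box p B = f @` ((I `*` I) `*` (I `*` I))); first by apply: continuous_compact => //; exact: continuous_subspaceT.
apply/seteqP; split=> [q [h1 h2 h3 h4]|q [x [[/= i1 i2] [i3 i4]] <-]].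
  exists ((Re (q.1 - p.1), Im (q.1 - p.1)), (Re (q.2 - p.2), Im (q.2 - p.2))); first by do 2?split; rewrite /I /= -ler_norml.
  rewrite /f /=; case: q {h1 h2 h3 h4} => q1 q2 /=; congr pair.
    by rewrite -[X in p.1 + X](_ : q1 - p.1 = _) ?subrKC //; case: (q1 - p.1).
  by rewrite -[X in p.2 + X](_ : q2 - p.2 = _) ?subrKC //; case: (q2 - p.2).
by split; rewrite /f /= addrC addKr /= ler_norml.
Qed.

Lemma ultra_fmap (I J : Type) (F : set_system I) (u : I -> J) : UltraFilter F -> UltraFilter (u @ F).
Proof.
move=> FF; split; first exact: fmap_proper_filter.
move=> G GG sub; apply/seteqP; split=> [A GA|A FA]; last exact: sub.
have [//|FN] := in_ultra_setVsetC (u @^-1` A) FF.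
have GN : G (~` A) by apply: sub; exact: FN.
by have := filter_ex (filterI GA GN); case=> x [h1 h2].
Qed.

Lemma ultra_lim (I : Type) (F : set_system I) (u : I -> C2) (p : C2) (B : R) : UltraFilter F ->
  (forall i, box p B (u i)) -> exists2 l, box p B l & forall e : R, 0 < e -> F [set i | near2 e l (u i)].
Proof.
move=> FF H; have : compact (box p B) by exact: box_compact.
rewrite compact_ultra => cB.
have [|l [Bl Hl]] := cB (u @ F) (ultra_fmap u FF).
  by rewrite /nbhs /=; apply: filterS (filterT) => i _; exact: H.
exists l => // e e0; apply: (Hl [set q | near2 e l q]).
by apply/nbhs_near2; exists e.
Qed.

Lemma ultra_nonempty (I : Type) (F : set_system I) (A : set I) : UltraFilter F -> F A -> exists i, A i.
Proof. by move=> FF FA; apply: filter_ex FA. Qed.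

(** Arzela-Ascoli with an ultrafilter finer than [eventually]: pointwise limits exist by
    compactness, the common Lipschitz constant makes the convergence uniform, and an increasing
    sequence is then picked from the sets of the ultrafilter. *)
Lemma equilip_normal (P : C2 -> C2) (p0 : C2) (r L B : R) : 0 < r -> 0 < L ->
  (forall n q, near2 (3 * r) p0 q -> box 0 B (iter n P q)) ->
  (forall n q q' d, near2 (3 * r) p0 q -> near2 (3 * r) p0 q' -> near2 d q q' -> near2 (L * d) (iter n P q) (iter n P q')) ->
  normal_on P [set q | near2 r p0 q].
Proof.
move=> r0 L0 HB HL n; pose U := [set q | near2 r p0 q].
have [F [FF cofin]] := @ultraFilterLemma nat eventually _.
have big m : F [set j | (m <= j)%N] by apply: cofin; exists m.
pose V := [set q | near2 (3 * r) p0 q].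
have UV q : U q -> V q by apply: near2_le; clear -r0; lra.
have lim q : exists l, V q -> forall e : R, 0 < e -> F [set j | near2 e l (iter (n j) P q)].
  have [Vq|nV] := pselect (V q); last by exists 0.
  have [l _ Hl] := @ultra_lim nat F (fun j => iter (n j) P q) 0 B FF (fun j => HB (n j) q Vq).
  by exists l.
have [l Hl] := choice lim.
have unif (e : R) : 0 < e -> F [set j | forall q, U q -> near2 e (l q) (iter (n j) P q)].
  move=> e0; have [//|FN] := in_ultra_setVsetC [set j | forall q, U q -> near2 e (l q) (iter (n j) P q)] FF.
  exfalso.
  have bad j : exists q, U q /\ ((~` [set j | forall q, U q -> near2 e (l q) (iter (n j) P q)]) j -> ~ near2 e (l q) (iter (n j) P q)).
    have [h|/existsNP[q /not_implyP[Uq nq]]] := pselect (forall q, U q -> near2 e (l q) (iter (n j) P q)).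
      by exists p0; split; [exact: near2_refl|move=> /(_ h)].
    by exists q; split.
  have [q Hq] := choice bad.
  (* Were the convergence not uniform, the bad points q j would converge along the ultrafilter to
     some qs; comparison with the orbit of qs at a single j refutes this. *)
  have [qs Bq limq] := @ultra_lim nat F q p0 r FF (fun j => near2_box (Hq j).1).
  have Vqs : V qs by apply: box_near2 Bq; clear -r0; lra.
  pose d := e / (4 * (1 + L)).
  have L1 : 0 < 4 * (1 + L) by clear -L0; lra.
  have d0 : 0 < d by rewrite divr_gt0.
  have dE : (d + (L * d + d)) + (d + L * d) < e.
    have -> : e = 4 * (1 + L) * d by rewrite /d mulrC divfK // lt0r_neq0.
    by have := mulr_gt0 L0 d0; clear -d0; lra.
  have Fq := limq d d0; have Fl := Hl qs Vqs d d0.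
  have [j [[k1 k2] k3]] := ultra_nonempty FF (filterI (filterI Fq Fl) FN).
  have [Uq nq] := Hq j; apply: (nq k3).
  have m1 : near2 (L * d) (iter (n j) P qs) (iter (n j) P (q j)) by apply: HL => //; exact: UV.
  have m2 : near2 (d + (L * d + d)) (l (q j)) (l qs).
    have [i [i1 i2]] := ultra_nonempty FF (filterI (Hl (q j) (UV _ Uq) d d0) Fl).
    apply: near2_tri (i1 : near2 d (l (q j)) (iter (n i) P (q j))) _.
    apply: near2_tri (near2C (i2 : near2 d (l qs) (iter (n i) P qs))).
    by apply: HL => //; [exact: UV|exact: near2C].
  apply: near2_le (ltW dE) _; apply: near2_tri m2 _; exact: near2_tri k2 m1.
pose S j := [set m | forall q, U q -> near2 (j.+1%:R^-1) (l q) (iter (n m) P q)].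
have pick m j : exists i, (m < i)%N /\ S j i.
  have e0 : 0 < j.+1%:R^-1 :> R by rewrite invr_gt0 ltr0n.
  by have [i [h1 h2]] := ultra_nonempty FF (filterI (big m.+1) (unif _ e0)); exists i.
have [s Hs] := choice (fun mj : nat * nat => pick mj.1 mj.2).
pose k := fix k j := if j is j'.+1 then s (k j', j) else s (0%N, 0%N).
have Sk j : S j (k j) by case: j => [|j]; [have [_ h] := Hs (0%N, 0%N)|have [_ h] := Hs (k j, j.+1)]; exact: h.
exists k; split.
  by apply: homo_ltn => [a b c|j]; [exact: ltn_trans|have [] := Hs (k j, j.+1)].
left; exists l; apply: uniform_family => e e0.
have [N HN] := small_frac' e0.
exists N => j Nj q Uq; apply: near2_le (HN j Nj) _; exact: Sk.
Qed.

(** Bounded orbits are asked for only arbitrarily close to p: one such point already excludes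
    locally uniform divergence. In the remaining case uniform convergence, together with the
    continuity of a single iterate, gives equicontinuity. *)
Lemma normal_equicont (P : C2 -> C2) (U : set C2) (p : C2) (n : nat -> nat) :
  normal_on P U -> open U -> U p ->
  (forall r : R, 0 < r -> exists q B, near2 r p q /\ forall j, box 0 B (iter (n j) P q)) ->
  (forall m q (e : R), 0 < e -> exists2 d : R, 0 < d & forall q', near2 d q q' -> near2 e (iter m P q) (iter m P q')) ->
  forall e : R, 0 < e -> exists2 d : R, 0 < d & forall q, near2 d p q -> forall j, near2 e (iter (n j) P p) (iter (n j) P q).
Proof.
move=> NU oU Up HB HC e e0; apply: contrapT => neg.
have [r r0 Ur] : exists2 r : R, 0 < r & forall q, near2 r p q -> U q.
  by apply/nbhs_near2; apply: open_nbhs_nbhs.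
have r3 : 0 < r / 3 by rewrite divr_gt0.
have bad i : exists qj : C2 * nat, near2 (Num.min (r / 3) (i.+1%:R^-1)) p qj.1 /\ ~ near2 e (iter (n qj.2) P p) (iter (n qj.2) P qj.1).
  apply: contrapT => h; apply: neg; exists (Num.min (r / 3) (i.+1%:R^-1)).
    by rewrite lt_min r3 invr_gt0 ltr0n.
  move=> q hq j; apply: contrapT => nq; apply: h; by exists (q, j).
have [qj Hqj] := choice bad.
have [k [kmono]] := NU (fun i => n (qj i).2); case=> [[l Hl]|Hdiv].
  have KU : box p (r / 3) `<=` U by move=> q /box_near2 h; apply: Ur; apply: h; clear -r0; lra.
  have e5 : 0 < e / 5 by rewrite divr_gt0.
  have [N HN] := family_uniform Hl KU (@box_compact p (r / 3)) e5.
  have [d d0 Hd] := HC (n (qj (k N)).2) p _ e5.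
  have [M HM] := small_frac' d0.
  have klow j : (j <= k j)%N by elim: j => // j IH; exact: leq_ltn_trans IH (kmono _ _ (ltnSn j)).
  pose j := (N + M)%N.
  have [c1 c2] := Hqj (k j); apply: c2.
  set q := (qj (k j)).1 in c1 *.
  have qK : box p (r / 3) q by apply: near2_box; apply: near2_le c1; rewrite ge_min lexx.
  have pK : box p (r / 3) p by apply: near2_box; exact: near2_refl.
  have qd : near2 d p q.
    apply: near2_le c1; rewrite ge_min; apply/orP; right; apply: HM; apply: leq_trans (klow j); exact: leq_addl.
  have a1 := HN j (leq_addr _ _) q qK; have a2 := HN j (leq_addr _ _) p pK.
  have a3 := HN N (leqnn N) q qK; have a4 := HN N (leqnn N) p pK.
  have a5 := Hd q qd.
  have -> : e = e / 5 + (e / 5 + (e / 5 + (e / 5 + e / 5))) by field.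
  apply: near2_tri (near2C a2) _; apply: near2_tri a4 _; apply: near2_tri a5 _; apply: near2_tri (near2C a3) _; exact: a1.
have [q [B [qr qB]]] := HB r r0.
have := Hdiv [set q] (box 0 B) (@compact_set1 _ q) _ (@box_compact 0 B).
case=> [q' ->|N _ HN]; first exact: Ur.
have := HN N (leqnn N).
by apply/eqP/set0P; exists (iter (n (qj (k N)).2) P q); split; [exists q|exact: qB].
Qed.

(** A is shown to be relatively open and closed in Om; the closedness hypothesis is only asked at
    points already known to lie in Om. *)
Lemma component_ind (Om A : set C2) (p0 : C2) : connected Om -> Om p0 -> A p0 ->
  (forall p, Om p -> A p -> exists2 d : R, 0 < d & forall q, Om q -> near2 d p q -> A q) ->
  (forall p, Om p -> (forall d : R, 0 < d -> exists q, [/\ Om q, near2 d p q & A q]) -> A p) -> Om `<=` A.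
Proof.
move=> cO Op0 Ap0 Ho Hc.
have E : Om `&` A = Om.
  apply: cO; first by exists p0.
    exists (interior [set q | Om q -> A q]); first exact: open_interior.
    apply/seteqP; split=> [q [Oq Aq]|q [Oq /interior_subset]]; last by move=> h; split=> //; exact: h.
    split=> //; have [d d0 Hd] := Ho q Oq Aq; apply/nbhs_near2; exists d => // q' h Oq'; exact: Hd.
  exists (closure (Om `&` A)); first exact: closed_closure.
  apply/seteqP; split=> [q [Oq Aq]|q [Oq cq]]; first by split=> //; apply: subset_closure.
  split=> //; apply: Hc => // d d0.
  have [|q' [[Oq' Aq'] h]] := cq [set q' | near2 d q q']; first by apply/nbhs_near2; exists d.
  by exists q'.
by rewrite -E => q [].
Qed.
End Normality.

(** * The return map as a quadratic polynomial *)

Section Step.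
Variables (R : realType).
Local Notation C := R[i].
Local Notation Re := complex.Re.
Local Notation Im := complex.Im.

(** The contraction principle for x - (Wf x - t) / c, as Wf has slope c up to the relative error
    eta. *)
Lemma solve (Wf : C -> C) (c t x0 : C) (eta rr Rr : R) : c != 0 -> 0 <= eta -> eta < 1 -> 0 <= rr -> md x0 + rr <= Rr ->
  (forall x1 x2, md x1 <= Rr -> md x2 <= Rr -> md (Wf x1 - Wf x2 - c * (x1 - x2)) <= eta * md c * md (x1 - x2)) ->
  md (Wf x0 - t) <= (1 - eta) * rr * md c -> exists2 x', md (x' - x0) <= rr & Wf x' = t.
Proof.
move=> c0 e0 e1 r0 rR H H0; have mc : 0 < md c by rewrite md_gt0.
pose G x := x - (Wf x - t) / c.
have inR x : md (x - x0) <= rr -> md x <= Rr.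
  by move=> h; have := mdD (x - x0) x0; rewrite subrK; clear -h rR; lra.
have [||x' h1 h2] := @banach_ball _ G x0 rr eta e0 e1 r0.
- move=> a b ha hb; have -> : G a - G b = - ((Wf a - Wf b - c * (a - b)) / c) by rewrite /G; field.
  by rewrite mdN mdf ler_pdivrMr // mulrAC; exact: H (inR _ ha) (inR _ hb).
- have -> : G x0 - x0 = - ((Wf x0 - t) / c) by rewrite /G; ring.
  by rewrite mdN mdf ler_pdivrMr.
exists x' => //; have : (Wf x' - t) / c = 0 by have := h2; rewrite /G => /eqP; rewrite subr_eq addrC -subr_eq subrr => /eqP <-.
by move=> /eqP; rewrite mulf_eq0 invr_eq0 (negbTE c0) orbF subr_eq0 => /eqP.
Qed.

Lemma quad_small (B e : R) : 0 < e -> 0 <= B -> exists n, forall i, (n <= i)%N -> B / i.+1%:R ^+ 2 <= e.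
Proof.
move=> e0 B0; have [n hn] := small_frac B e0; exists n => i ni; apply: le_trans (hn i ni).
apply: ler_wpM2l => //; rewrite lef_pV2 ?posrE ?exprn_gt0 ?ltr0n //.
by rewrite expr2 ler_peMr ?ler0n // ler1n.
Qed.

(** The orbit exits at the phase W_i(x') = A Phi(x) + (1 - A) Z + kap. To leading order W_i(x') =
    W_i(0) + c_i x' and Phi(x) = Phi(0) - b1 x^2, which gives x' = be x^2 + dc (Z - Zs). With the
    unit of length rho, where |be| rho = 1, the coefficient of the square has modulus 1. *)
Lemma step (b : R) (al : nat) : 0 < b -> (1 < al)%N -> Lb b = ln al%:R ->
  exists (rho : nat -> R) (be dc Zs : nat -> C) (istar : nat), forall i, (istar <= i)%N ->
  [/\ [/\ 0 < rho i, md (be i) * rho i = 1, dc i != 0 & 11 * rho i / md (dc i) <= 1 / 16],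
   forall j, (istar <= j)%N -> md (Zs i - Zs j) <= 1 / 4,
   forall j, (istar <= j)%N -> i != j -> 11 * rho i / md (dc i) + 11 * rho j / md (dc j) < md (Zs i - Zs j) &
   forall M : R, 0 <= M -> exists (n0 : nat) (BB : R), forall n, (n0 <= n)%N -> forall (T w : nat -> C) (Z x : C),
   TR T -> (forall m, w m.+1 = q0 (w m) + (cc b)%:C / T m ^+ 2) -> md Z <= M ->
   (forall m, md (T m - (F R (n + m))%:C - Z) <= M / (n + m).+1%:R) ->
   w 0%N = y0 R + x -> md x <= 6 * rho i -> md (dc i * (Z - Zs i)) <= 11 * rho i ->
   md (w (al * n - n + (i + 4))%N - (y0 R + (be i * x ^+ 2 + dc i * (Z - Zs i)))) <= rho i / 10 /\
   forall m, (m <= al * n - n + (i + 4))%N -> md (w m) <= BB].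
Proof.
move=> b0 al1 LA.
have [Kp [Phi [b1 [Kp0 b10 HPhi DPhi]]]] := phase_in_x R.
have [kap Hpass] := pass b0 al1 LA Kp0 HPhi.
have [rho0 [c1 [K [kap0 [B [W [c [i1 [[r00 c10 K0 k00 B0] [Ha Hii Hiii Hiv Hv]]]]]]]]]] := chain R.
pose A : R := al%:R; have A2 : 2 <= A by rewrite ler_nat.
have A0 : 0 < A by clear -A2; lra.
have A10 : 0 < A - 1 by clear -A2; lra.
have mb : 0 < md b1 by rewrite md_gt0.
have Ab : 0 < A * md b1 by exact: mulr_gt0.
pose rho i : R := md (c i) / (A * md b1).
pose be i : C := - (A%:C * b1) / c i.
pose dc i : C := - (A - 1)%:C / c i.
pose Zs i : C := (A%:C * Phi 0 + kap%:C - W i 0) / (A - 1)%:C.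
have Zdiff i j : Zs i - Zs j = - (W i 0 - W j 0) / (A - 1)%:C.
  by rewrite /Zs -mulrBl; congr (_ / _); ring.
have mZ i j : (A - 1)%:C != 0 :> C -> md (Zs i - Zs j) = md (W i 0 - W j 0) / md (A - 1)%:C.
  by move=> _; rewrite Zdiff mdf mdN.
have A1n : (A - 1)%:C != 0 :> C by rewrite fmorph_eq0 lt0r_neq0.
have An : A%:C != 0 :> C by rewrite fmorph_eq0 lt0r_neq0.
have mA : md A%:C = A by rewrite md_real ger0_norm // ltW.
have mA1 : md (A - 1)%:C = A - 1 by rewrite md_real ger0_norm // ltW.
have alE : al%:R = A%:C :> C by rewrite /A rmorph_nat.
(* With |x0| <= (36 + 11) rho, the relative error eta1 of W_i and the error eta2 |x|^2 of Phi
   together stay below rho / 20 after division by c_i. *)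
pose eta1 : R := 1 / 40 / 50.
have eta10 : 0 < eta1 by rewrite !divr_gt0 // ltr0n.
have [dl1 [i2 [/andP[dl10 dl1r] Hd1]]] := Hii eta1 eta10.
pose eta2 : R := md b1 / 60 / 60.
have eta20 : 0 < eta2 by rewrite !divr_gt0 // ltr0n.
have [dl2 [/andP[dl20 dl240] Hd2]] := DPhi eta2 eta20.
have [i3 Hi3] := Hv _ (divr_gt0 A10 (ltr0n R 4)).
pose dl : R := Num.min dl1 dl2 / 50.
have dl0 : 0 < dl by rewrite divr_gt0 // ?ltr0n // lt_min dl10 dl20.
have dlm : 50 * dl = Num.min dl1 dl2 by rewrite /dl mulrC divfK // pnatr_eq0.
have dlE1 : 50 * dl <= dl1 by rewrite dlm ge_min lexx.
have dlE2 : 50 * dl <= dl2 by rewrite dlm ge_min lexx orbT.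
have BA0 : 0 <= B / (A * md b1) by apply: divr_ge0; exact: ltW.
have [i4 Hi4] := quad_small dl0 BA0.
(* The radius 11 rho / |dc| is 11 |c_i|^2 / ((A - 1) A |b1|), as both rho and 1 / |dc| are
   proportional to |c_i|. *)
pose C4 : R := 11 * B ^+ 2 / ((A - 1) * (A * md b1)).
have C40 : 0 <= C4 by rewrite divr_ge0 ?mulr_ge0 ?sqr_ge0 // ltW.
have h16 : 0 < 1 / 16 :> R by rewrite divr_gt0.
have [i5 Hi5] := quad_small h16 C40.
pose k1 : R := kap0 / (A - 1).
have k10 : 0 < k1 by exact: divr_gt0.
have k14 : 0 < k1 / 5 by rewrite divr_gt0.
have [i6 Hi6] := quad_small k14 C40.
have rhoE i : rho i = md (c i) / (A * md b1) by [].
have tolE i : c i != 0 -> 11 * rho i / md (dc i) = 11 * md (c i) ^+ 2 / ((A - 1) * (A * md b1)).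
  move=> c0; rewrite /rho /dc mdf mdN mA1; field; rewrite !lt0r_neq0 ?md_gt0 //.
have tol i : (i1 <= i)%N -> 11 * rho i / md (dc i) <= C4 / i.+1%:R ^+ 2 / i.+1%:R ^+ 2.
  move=> hi; have [c0 cb] := Hiii i hi; rewrite tolE //.
  have n0 : 0 < i.+1%:R ^+ 2 :> R by rewrite exprn_gt0 // ltr0n.
  have -> : C4 / i.+1%:R ^+ 2 / i.+1%:R ^+ 2 = 11 * (B / i.+1%:R ^+ 2) ^+ 2 / ((A - 1) * (A * md b1)).
    by rewrite /C4; move: (i.+1%:R ^+ 2 : R) n0 => N n0; field; rewrite !lt0r_neq0.
  apply: ler_wpM2r; first by rewrite invr_ge0 ltW // mulr_gt0.
  apply: ler_wpM2l; first exact: ler0n.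
  by rewrite ler_pXn2r ?nnegrE ?md_ge0 // divr_ge0 // ltW.
have sqn i : 1 <= i.+1%:R ^+ 2 :> R by rewrite expr_ge1 // ?ler0n // ler1n.
have tol1 i : (i1 <= i)%N -> (i5 <= i)%N -> 11 * rho i / md (dc i) <= 1 / 16.
  move=> h1 h5; apply: le_trans (tol i h1) _; apply: le_trans (Hi5 i h5).
  rewrite ler_pdivrMr; last by exact: lt_le_trans (sqn i).
  by rewrite ler_peMr // divr_ge0 // (le_trans ler01).
have sep i j : (maxn i1 i6 <= i)%N -> (i < j)%N -> 11 * rho i / md (dc i) + 11 * rho j / md (dc j) < md (Zs i - Zs j).
  rewrite geq_max => /andP[h1 h6] ij.
  have h1j : (i1 <= j)%N by exact: leq_trans h1 (ltnW ij).
  rewrite mZ // mA1 ltr_pdivlMr //.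
  have := Hiv i j; rewrite h1 ij => /(_ isT); apply: lt_le_trans.
  rewrite -ltr_pdivlMr //; have -> : kap0 / (i.+1%:R * i.+2%:R) / (A - 1) = k1 / (i.+1%:R * i.+2%:R) by rewrite /k1 mulrAC.
  have ti := tol i h1; have tj := tol j h1j; have g6 := Hi6 i h6.
  have n1 : 1 <= i.+1%:R :> R by rewrite ler1n.
  have n0 : 0 < i.+1%:R :> R by rewrite ltr0n.
  have mono : C4 / j.+1%:R ^+ 2 / j.+1%:R ^+ 2 <= C4 / i.+1%:R ^+ 2 / i.+1%:R ^+ 2.
    have ji : (i.+1%:R ^+ 2 : R) <= j.+1%:R ^+ 2 by rewrite ler_pXn2r ?nnegrE // ler_nat ltnS ltnW.
    have V : (j.+1%:R ^+ 2)^-1 <= (i.+1%:R ^+ 2)^-1 :> R by rewrite lef_pV2 ?posrE // (lt_le_trans ltr01).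
    have Vj : 0 <= (j.+1%:R ^+ 2)^-1 :> R by rewrite invr_ge0 (le_trans ler01).
    by apply: ler_pM => //; [exact: mulr_ge0|exact: ler_wpM2l].
  have up : C4 / i.+1%:R ^+ 2 / i.+1%:R ^+ 2 <= k1 / 5 / i.+1%:R ^+ 2.
    by apply: ler_wpM2r => //; rewrite invr_ge0 (le_trans ler01).
  have E2 : i.+2%:R = i.+1%:R + 1 :> R by rewrite natr1.
  have fin : 2 * (k1 / 5 / i.+1%:R ^+ 2) < k1 / (i.+1%:R * i.+2%:R).
    rewrite E2; move: (i.+1%:R : R) n1 n0 => N n1 n0.
    have -> : 2 * (k1 / 5 / N ^+ 2) = k1 * (2 / 5 / N ^+ 2) by field; exact: lt0r_neq0.
    have p2 : 0 < N * (N + 1) by rewrite mulr_gt0 //; clear -n0; lra.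
    rewrite ltr_pdivlMr //.
    have -> : k1 * (2 / 5 / N ^+ 2) * (N * (N + 1)) = k1 * (2 / 5 * ((N + 1) / N)) by field; exact: lt0r_neq0.
    have : (N + 1) / N <= 2 by rewrite ler_pdivrMr //; clear -n1; lra.
    move=> q; rewrite -[ltRHS]mulr1 ltr_pM2l //; move: q; move: ((N + 1) / N) => q; clear; lra.
  have ti' := le_trans ti up; have tj' := le_trans tj (le_trans mono up).
  by apply: le_lt_trans (lerD ti' tj') _; rewrite -[X in X < _]mulr2n -[X in X < _]mulr_natl.
exists rho, be, dc, Zs, (i1 + i2 + i3 + i4 + i5 + i6)%N => i hi.
have g1 : (i1 <= i)%N by clear -hi; lia.
have g2 : (i2 <= i)%N by clear -hi; lia.
have g3 : (i3 <= i)%N by clear -hi; lia.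
have g4 : (i4 <= i)%N by clear -hi; lia.
have g5 : (i5 <= i)%N by clear -hi; lia.
have g6 : (maxn i1 i6 <= i)%N by clear -hi; lia.
have [ci0 cib] := Hiii i g1.
have mc : 0 < md (c i) by rewrite md_gt0.
have r0 : 0 < rho i by exact: divr_gt0.
have rdl : rho i <= dl.
  apply: le_trans (Hi4 i g4); rewrite /rho mulrAC; apply: ler_wpM2r => //.
  by rewrite invr_ge0 ltW.
split.
- split => //; last exact: tol1.
    by rewrite /be /rho mdf mdN mdM mA; field; rewrite !lt0r_neq0.
  by rewrite /dc mulf_neq0 ?oppr_eq0 // invr_eq0.
- move=> j hj; have g3j : (i3 <= j)%N by clear -hj; lia.
  rewrite mZ // mA1 ler_pdivrMr //; apply: le_trans (Hi3 i j g3 g3j) _; clear; lra.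
- move=> j hj ij; have g6j : (maxn i1 i6 <= j)%N by clear -hj; lia.
  case: (ltngtP i j) ij => // [ij _|ji _]; first exact: sep.
  by rewrite addrC md_distC; exact: sep.
move=> M M0; have e0 : 0 < rho i / 20 by rewrite divr_gt0 // ltr0n.
have [n0 [BB HB]] := Hpass c1 K M (rho i / 20) (i + 4)%N c10 K0 M0 e0.
exists n0, BB => n hn T w Z x Tr wr ZM TZ w0 hx hD.
set D := dc i * (Z - Zs i) in hD *.
pose x0 := be i * x ^+ 2 + D.
have m0 := md_ge0 x.
have bex : md (be i * x ^+ 2) <= 36 * rho i.
  rewrite mdM mdX; have : md (be i) * md x ^+ 2 <= md (be i) * (6 * rho i) ^+ 2.
    by apply: ler_wpM2l; rewrite ?md_ge0 // ler_pXn2r ?nnegrE // (le_trans m0).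
  have -> : md (be i) * (6 * rho i) ^+ 2 = 36 * (md (be i) * rho i) * rho i by ring.
  have -> : md (be i) * rho i = 1 by rewrite /be /rho mdf mdN mdM mA; field; rewrite !lt0r_neq0.
  by rewrite mulr1.
have x0b : md x0 <= 47 * rho i by apply: le_trans (mdD _ _) _; clear -bex hD; lra.
have x2b : md x <= dl2 by clear -hx rdl dlE2 dl0; lra.
pose t := A%:C * Phi x + (1 - A%:C) * Z + kap%:C.
have e01 : 0 <= eta1 by exact: ltW.
have e11 : eta1 < 1 by rewrite /eta1; clear; lra.
have rr0 : 0 <= rho i / 20 by exact: ltW.
(* x0 is the predicted return. The exact solution x' of the phase equation is within rho / 20 of it,
   and [pass] adds another rho / 20. *)
have [||| x' hx' Wx'] := @solve (W i) (c i) t x0 eta1 (rho i / 20) dl1 ci0 e01 e11 rr0.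
- by clear -x0b rdl dlE1 r0; lra.
- move=> a1 a2 ha1 ha2; exact: Hd1.
- have z1 : md (0 : C) <= dl1 by rewrite md0 ltW.
  have z2 : md (0 : C) <= dl2 by rewrite md0 ltW.
  have x01 : md x0 <= dl1 by clear -x0b rdl dlE1 r0; lra.
  have E1 := Hd1 i g2 x0 0 x01 z1; rewrite subr0 in E1.
  have E2 := Hd2 x 0 x2b z2; rewrite md0 addr0 expr0n /= !subr0 in E2.
  have -> : W i x0 - t = (W i x0 - W i 0 - c i * x0) - A%:C * (Phi x - Phi 0 + b1 * x ^+ 2).
    have cx : c i * x0 = - (A%:C * b1) * x ^+ 2 - (A - 1)%:C * (Z - Zs i).
      by rewrite /x0 /D /be /dc; field.
    have AZ : (A - 1)%:C * Zs i = A%:C * Phi 0 + kap%:C - W i 0 by rewrite /Zs mulrC divfK.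
    by rewrite cx mulrBr AZ /t rmorphB rmorph1; ring.
  apply: le_trans (mdB _ _) _; rewrite (mdM A%:C) mA.
  have B1 : eta1 * md (c i) * md x0 <= eta1 * md (c i) * (47 * rho i).
    by apply: ler_wpM2l => //; apply: mulr_ge0 => //; exact: ltW.
  have B2 : A * (eta2 * md x * md x) <= A * (eta2 * (6 * rho i) * (6 * rho i)).
    apply: ler_wpM2l; first exact: ltW.
    by apply: ler_pM => //; [apply: mulr_ge0 => //; exact: ltW|apply: ler_wpM2l => //; exact: ltW].
  have E3 : A * (eta2 * (6 * rho i) * (6 * rho i)) = md (c i) * rho i / 100.
    by rewrite /eta2 /rho; field; rewrite !lt0r_neq0.
  have B3 : A * md (Phi x - Phi 0 + b1 * x ^+ 2) <= A * (eta2 * md x * md x) by apply: ler_wpM2l => //; exact: ltW.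
  have cr : 0 < md (c i) * rho i by exact: mulr_gt0.
  have E4 : eta1 * md (c i) * (47 * rho i) = 47 / 40 / 50 * (md (c i) * rho i) by rewrite /eta1; field.
  have E5 : (1 - eta1) * (rho i / 20) * md (c i) = (1 - eta1) / 20 * (md (c i) * rho i) by field.
  rewrite E5 /eta1; move: (le_trans E1 B1) (le_trans B3 B2) cr; rewrite E4 E3.
  by move: (md (c i) * rho i) => q; clear; lra.
have x'r : md x' <= rho0.
  have := mdD (x' - x0) x0; rewrite subrK; move: hx' x0b rdl dlE1 r0 dl1r; clear; lra.
have [a [Sa1 SaW Saq]] := Ha i x' g1 x'r.
have x20 : md x <= 1 / 20 by clear -x2b dl240; lra.
have Wt : W i x' = al%:R * Phi x + (1 - al%:R) * Z + kap%:C by rewrite Wx' alE.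
have [r1 r2] := HB n hn T w Z x a (W i x') Tr wr ZM TZ w0 x20 Sa1 SaW Wt.
split => //; rewrite Saq in r1.
have -> : w (al * n - n + (i + 4))%N - (y0 R + (be i * x ^+ 2 + D)) =
  (w (al * n - n + (i + 4))%N - (y0 R + x')) + (x' - x0) by rewrite /x0; ring.
apply: le_trans (mdD _ _) _; clear -r1 hx'; lra.
Qed.
End Step.

(** * Elementary properties of the skew product *)

Section Skew.
Variables (R : realType).
Local Notation C := R[i].
Local Notation C2 := (R[i] * R[i])%type.
Local Notation Re := complex.Re.
Local Notation Im := complex.Im.

Lemma F_gap (N k : nat) : k%:R <= F R (N + k) - F R N /\ F R (N + k) - F R N <= k%:R + k%:R / N.+1%:R.
Proof.
elim: k => [|k [h1 h2]]; first by rewrite addn0 subrr mul0r addr0.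
have hF := F_ge R (N + k); have n0 : 0 < N.+1%:R :> R by rewrite ltr0n.
have p1 : 0 <= (F R (N + k) - 1)^-1 by rewrite invr_ge0; have := ler0n R (N + k); clear -hF; lra.
have p2 : (F R (N + k) - 1)^-1 <= N.+1%:R^-1.
  have k0 := ler0n R k; have N0 := ler0n R N; rewrite natrD in hF.
  have a2 : N.+1%:R <= F R (N + k) - 1 by rewrite -natr1; clear -hF k0; lra.
  by rewrite lef_pV2 ?posrE //; exact: lt_le_trans a2.
rewrite addnS F_S -natr1; split; first by clear -h1 p1; lra.
rewrite mulrDl mul1r; move: h2 p2 => h2 p2.
have -> : F R (N + k) + 1 + (F R (N + k) - 1)^-1 - F R N = (F R (N + k) - F R N) + 1 + (F R (N + k) - 1)^-1 by ring.
have -> : k%:R + 1 + (k%:R / N.+1%:R + N.+1%:R^-1) = (k%:R + k%:R / N.+1%:R) + 1 + N.+1%:R^-1 :> R by ring.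
by apply: lerD => //; apply: lerD.
Qed.

(** As F (n + k) - F n tends to k, the phases of one orbit tail with respect to shifted references
    differ by the integer k = N' + a' - (N + a). A difference below 1 forces k = 0. *)
Lemma phase_shift_le (T T' : nat -> C) (N N' a a' : nat) (Z Z' : C) (M : R) : (N + a <= N' + a')%N ->
  (forall m, md (T m - (F R (N + m))%:C - Z) <= M / (N + m).+1%:R) ->
  (forall m, md (T' m - (F R (N' + m))%:C - Z') <= M / (N' + m).+1%:R) ->
  (forall t, T (a + t)%N = T' (a' + t)%N) -> md (Z - Z') < 1 -> Z = Z'.
Proof.
move=> NN H H' E Z1.
have M0 : 0 <= M.
  have := le_trans (md_ge0 _) (H 0%N); by rewrite pmulr_lge0 // invr_gt0 ltr0n.
pose k := (N' + a' - (N + a))%N; pose K : R := k%:R.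
suff lim : Z - Z' = K%:C.
  have k0 : k = 0%N.
    move: Z1; rewrite lim md_real ger0_norm ?ler0n // -[1]/(1%:R) ltr_nat; by case: (k).
  by apply/eqP; rewrite -subr_eq0 lim /K k0.
apply/eqP; rewrite -subr_eq0 -md_eq0 eq_le md_ge0 andbT.
apply/ler_addgt0Pr => e e0; rewrite add0r.
have [t ht] := small_frac (2 * M + K) e0; have {}ht := ht t (leqnn t).
have h1 := H (a + t)%N; have h2 := H' (a' + t)%N.
have [g1 g2] := F_gap (N + (a + t)) k.
have Ek : (N + (a + t) + k = N' + (a' + t))%N by rewrite /k; clear -NN; lia.
rewrite Ek in g1 g2.
have le1 (x : R) n : (t <= n)%N -> 0 <= x -> x / n.+1%:R <= x / t.+1%:R.
  by move=> tn x0; apply: ler_wpM2l => //; rewrite lef_pV2 ?posrE ?ltr0n // ler_nat ltnS.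
have q1 := le_trans h1 (le1 M (N + (a + t))%N ltac:(clear; lia) M0).
have q2 := le_trans h2 (le1 M (N' + (a' + t))%N ltac:(clear; lia) M0).
have q3 := le_trans g2 (lerD (lexx _) (le1 K (N + (a + t))%N ltac:(clear; lia) (ler0n R k))).
rewrite E in q1.
set d := F R (N' + (a' + t)) - F R (N + (a + t)) in g1 q3.
have -> : Z - Z' - K%:C = - (T' (a' + t)%N - (F R (N + (a + t)))%:C - Z) + (T' (a' + t)%N - (F R (N' + (a' + t)))%:C - Z') + (d - K)%:C.
  by rewrite /d !rmorphB; ring.
apply: le_trans (mdD _ _) _; have := mdD (- (T' (a' + t)%N - (F R (N + (a + t)))%:C - Z)) (T' (a' + t)%N - (F R (N' + (a' + t)))%:C - Z').
rewrite mdN md_real ger0_norm; last by rewrite subr_ge0.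
move=> s1; apply: le_trans ht.
have -> : (2 * M + K) / t.+1%:R = M / t.+1%:R + M / t.+1%:R + K / t.+1%:R by ring.
apply: lerD; first by apply: le_trans s1 _; exact: lerD.
by rewrite lerBlDl.
Qed.

(** Once Z = Z', the values of [F] at the two shifted times come arbitrarily close, so the integer
    shift is 0. *)
Lemma phase_shift (T T' : nat -> C) (N N' a a' : nat) (Z Z' : C) (M M' : R) :
  (forall m, md (T m - (F R (N + m))%:C - Z) <= M / (N + m).+1%:R) ->
  (forall m, md (T' m - (F R (N' + m))%:C - Z') <= M' / (N' + m).+1%:R) ->
  (forall t, T (a + t)%N = T' (a' + t)%N) -> md (Z - Z') < 1 -> Z = Z' /\ (N + a = N' + a')%N.
Proof.
move=> H H' E Z1; pose MM := Num.max M M'.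
have h m : md (T m - (F R (N + m))%:C - Z) <= MM / (N + m).+1%:R.
  by apply: le_trans (H m) _; apply: ler_wpM2r; [rewrite invr_ge0|rewrite /MM le_max lexx].
have h' m : md (T' m - (F R (N' + m))%:C - Z') <= MM / (N' + m).+1%:R.
  by apply: le_trans (H' m) _; apply: ler_wpM2r; [rewrite invr_ge0|rewrite /MM le_max lexx orbT].
have ZE : Z = Z'.
  case: (leqP (N + a) (N' + a')) => NN; first exact: phase_shift_le NN h h' E Z1.
  by apply/esym; apply: phase_shift_le (ltnW NN) h' h _ _ => //; rewrite md_distC.
split=> //; apply/eqP; rewrite -(eqr_nat R); rewrite -subr_eq0 -normr_eq0 eq_le normr_ge0 andbT.
apply/ler_addgt0Pr => e e0; rewrite add0r.
have M0 : 0 <= MM by have := le_trans (md_ge0 _) (h 0%N); rewrite pmulr_lge0 // invr_gt0 ltr0n.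
have e4 : 0 < e / 4 by rewrite divr_gt0.
have [t1 ht1] := small_frac MM e4; have [t2 ht2] := small_frac ((N + a + (N' + a'))%:R) e4.
pose t := (t1 + t2)%N.
have q1 : md (T (a + t)%N - (F R (N + (a + t)))%:C - Z) <= e / 4 by apply: le_trans (h _) _; apply: ht1; rewrite /t; clear; lia.
have q2 : md (T' (a' + t)%N - (F R (N' + (a' + t)))%:C - Z') <= e / 4 by apply: le_trans (h' _) _; apply: ht1; rewrite /t; clear; lia.
have g (u : nat) : (u <= N + a + (N' + a'))%N -> `|F R (t + u) - F R t - u%:R| <= e / 4.
  move=> hu; have [g1 g2] := F_gap t u.
  rewrite ger0_norm; last by rewrite subr_ge0.
  rewrite lerBlDl; apply: le_trans g2 _; apply: lerD => //; apply: le_trans (ht2 t _); last by rewrite /t; clear; lia.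
  by apply: ler_wpM2r; rewrite ?invr_ge0 // ler_nat.
have g1 := g (N + a)%N (leq_addr _ _); have g2 := g (N' + a')%N (leq_addl _ _).
have e1 : (N + (a + t) = t + (N + a))%N by clear; lia.
have e2 : (N' + (a' + t) = t + (N' + a'))%N by clear; lia.
rewrite e1 E in q1; rewrite e2 -ZE in q2.
have fin : `|F R (t + (N + a)) - F R (t + (N' + a'))| <= e / 2.
  rewrite -md_real rmorphB.
  have -> : (F R (t + (N + a)))%:C - (F R (t + (N' + a')))%:C = (T' (a' + t)%N - (F R (t + (N' + a')))%:C - Z) - (T' (a' + t)%N - (F R (t + (N + a)))%:C - Z) by ring.
  by apply: le_trans (mdB _ _) _; clear -q1 q2; lra.
move: g1 g2 fin; rewrite !ler_norml => /andP[? ?] /andP[? ?] /andP[? ?]; apply/andP; split; lra.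
Qed.

(** Cauchy's estimate on circles of radius (r2 - r1) / 2, which stay in the larger disc. *)
Lemma holo_lip (f : C -> C) (z0 : C) (r1 r2 B : R) : 0 < r1 -> r1 < r2 -> (forall z, exists l, cderiv f z l) ->
  (forall z, md (z - z0) < r2 -> md (f z) <= B) ->
  forall a b, md (a - z0) < r1 -> md (b - z0) < r1 -> md (f b - f a) <= 8 * B / (r2 - r1) * md (b - a).
Proof.
move=> r10 r12 Hf HB; have [f' Hf'] := choice Hf.
apply: (cderiv_lip_ball (f' := f')) => [w _|w hw]; first exact: Hf'.
have dr : 0 < r2 - r1 by rewrite subr_gt0.
have -> : 8 * B / (r2 - r1) = 2 * (2 * B) / ((r2 - r1) / 2) by field; exact: lt0r_neq0.
apply: (@cauchy_bound _ f w (f' w) (r2 - r1) ((r2 - r1) / 2) (2 * B)) => //.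
- by rewrite divr_gt0.
- by clear -dr; lra.
move=> v hv; have b1 : md (f v) <= B.
  by apply: HB; apply: le_lt_trans (md_tri w _ _) _; rewrite hv; clear -hw dr; lra.
have b2 : md (f w) <= B by apply: HB; exact: lt_trans hw r12.
by apply: le_trans (mdB _ _) _; clear -b1 b2; lra.
Qed.

Lemma inv_cont (z : C) (e : R) : z != 0 -> 0 < e -> exists2 d : R, 0 < d & forall z', md (z' - z) < d ->
  md (z'^-1 - z^-1) < e.
Proof.
move=> z0 e0; have m0 : 0 < md z by rewrite md_gt0.
have h0 : 0 < md z / 2 by rewrite divr_gt0.
have q0 : 0 < (md z / 2) ^+ 2 by rewrite exprn_gt0.
exists (Num.min (md z / 2) (e * (md z / 2) ^+ 2)); first by rewrite lt_min h0 mulr_gt0.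
move=> z'; rewrite lt_min => /andP[h1 h2].
have lo : md z / 2 <= md z'.
  by have := mdB z' (z' - z); rewrite opprB addrCA subrr addr0; clear -h1; lra.
apply: le_lt_trans (inv_near h0 lo _) _; first by clear -m0; lra.
by rewrite ltr_pdivrMr.
Qed.

Local Notation sk := (@skew_product R).
Definition zcoef (al : nat) : C := (1 / 4 + pi ^+ 2 / ln (al%:R : R) ^+ 2)%:C.

Lemma skew_fst (al : nat) m z w w' : (iter m (sk al) (z, w)).1 = (iter m (sk al) (z, w')).1.
Proof.
elim: m => [//|m]; rewrite !iterS; case: (iter m (sk al) (z, w)) => a b; case: (iter m (sk al) (z, w')) => a' b' /= -> //.
Qed.

Lemma skew_snd (al : nat) m p : (iter m.+1 (sk al) p).2 = q0 (iter m (sk al) p).2 + (zcoef al) / ((iter m (sk al) p).1^-1) ^+ 2.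
Proof. by rewrite iterS; case: (iter m (sk al) p) => a b /=; rewrite /q0 exprVn invrK. Qed.

Lemma skew_TR (al : nat) z w : 7 / 2 <= Re (z^-1) -> TR (fun m => (iter m (sk al) (z, w)).1^-1).
Proof.
move=> h0.
have st (u : C) : 7 / 2 <= Re (u^-1) -> (u - u ^+ 2)^-1 = u^-1 + 1 + (u^-1 - 1)^-1 /\ 7 / 2 <= Re ((u - u ^+ 2)^-1).
  move=> h; have u0 : u != 0 by apply/eqP => u0; rewrite u0 invr0 /= in h; move: h; clear; lra.
  have u1 : u^-1 - 1 != 0 by rewrite -md_gt0; apply: lt_le_trans (Re_le _); rewrite ReD ReN Re1; clear -h; lra.
  have u2 : 1 - u != 0.
    apply/eqP => e; move/eqP: u1; apply.
    by move/eqP: e; rewrite subr_eq0 => /eqP <-; rewrite invr1 subrr.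
  have E : (u - u ^+ 2)^-1 = u^-1 + 1 + (u^-1 - 1)^-1.
    have -> : u - u ^+ 2 = u * (1 - u) by ring.
    have -> : u^-1 - 1 = (1 - u) / u by field.
    by field; rewrite u0 u2.
  split => //; rewrite E !ReD Re1.
  have m1 : 2 <= md (u^-1 - 1) by apply: le_trans (Re_le _); rewrite ReD ReN Re1; clear -h; lra.
  have m2 : md (u^-1 - 1)^-1 <= 1 / 2 by rewrite mdV -[leLHS]div1r ler_pdivrMr; clear -m1; lra.
  by have := Re_md (u^-1 - 1)^-1; rewrite ler_norml => /andP[k _]; clear -h k m2; lra.
have H m : 7 / 2 <= Re ((iter m (sk al) (z, w)).1^-1).
  elim: m => [//|m]; rewrite iterS; case: (iter m (sk al) (z, w)) => a c /= h; exact: (st a h).2.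
move=> m; have := H m; rewrite iterS; case: (iter m (sk al) (z, w)) => a c /= h; exact: (st a h).1.
Qed.

(** Holomorphy in each variable separately is the form in which [holo_lip] uses it. *)
Lemma skew_deriv (al : nat) m : [/\ forall w z, exists l, cderiv (fun z => (iter m (sk al) (z, w)).1) z l,
   forall w z, exists l, cderiv (fun z => (iter m (sk al) (z, w)).2) z l &
   forall z w, exists l, cderiv (fun w => (iter m (sk al) (z, w)).2) w l].
Proof.
have ex f g : f =1 g -> forall z l, cderiv f z l -> cderiv g z l by move=> /funext ->.
have dq (f : C -> C) z l : cderiv f z l -> exists l', cderiv (fun z => f z * f z) z l'.
  by move=> h; have := cderivM h h; exact: (ex_intro _ _).
elim: m => [|m [H1 H2 H3]].
  by split=> u v /=; [exists 1; exact: cderiv_id|exists 0; exact: cderiv_cst|exists 1; exact: cderiv_id].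
have e1 p : (iter m.+1 (sk al) p).1 = (iter m (sk al) p).1 + (-1) * ((iter m (sk al) p).1 * (iter m (sk al) p).1).
  by rewrite iterS; case: (iter m (sk al) p) => a b /=; ring.
have e2 p : (iter m.+1 (sk al) p).2 = (iter m (sk al) p).2 + ((iter m (sk al) p).2 * (iter m (sk al) p).2 + (zcoef al) * ((iter m (sk al) p).1 * (iter m (sk al) p).1)).
  by rewrite iterS; case: (iter m (sk al) p) => a b /=; rewrite -/(zcoef al); ring.
split=> u v.
- have [l h] := H1 u v; have [l' h'] := dq _ _ _ h.
  by eexists; apply: ex (cderivD h (cderivM (cderiv_cst (-1) v) h')) => x; rewrite e1.
- have [l h] := H1 u v; have [l' h'] := dq _ _ _ h; have [k j] := H2 u v; have [k' j'] := dq _ _ _ j.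
  by eexists; apply: ex (cderivD j (cderivD j' (cderivM (cderiv_cst (zcoef al) v) h'))) => x; rewrite e2.
have [k j] := H3 u v; have [k' j'] := dq _ _ _ j.
pose a := (iter m (sk al) (u, 0)).1.
eexists; apply: ex (cderivD j (cderivD j' (cderiv_cst ((zcoef al) * (a * a)) v))) => x.
by rewrite e2 /a (skew_fst al m u x 0).
Qed.

Lemma skew_cont1 (al : nat) p (e : R) : 0 < e -> exists2 d : R, 0 < d & forall q, near2 d p q -> near2 e (sk al p) (sk al q).
Proof.
move=> e0; case: p => a b.
have [cs csE] : exists cs, cs = zcoef al by exists (zcoef al).
have z0 := md_ge0 a; have w0 := md_ge0 b; have c0 := md_ge0 cs.
have cz : 0 <= md cs * (1 + 2 * md a) by apply: mulr_ge0 => //; clear -z0; lra.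
pose K : R := 2 + 2 * md a + 2 * md b + md cs * (1 + 2 * md a).
have K0 : 0 < K by rewrite /K; clear -z0 w0 cz; lra.
pose del := Num.min 1 (e / (2 * K)).
have d0 : 0 < del by rewrite lt_min ltr01 divr_gt0 // mulr_gt0.
have del1 : del <= 1 by rewrite /del ge_min lexx.
have delK : del * K <= e / 2 by rewrite -ler_pdivlMr // -mulrA -invfM /del ge_min lexx orbT.
exists del => // -[a' b'] [/= /ltW h1 /ltW h2].
have D1 : md (a' ^+ 2 - a ^+ 2) <= del * (1 + 2 * md a).
  rewrite subr_sqr mdM; apply: ler_pM; rewrite ?md_ge0 //.
  have -> : a' + a = (a' - a) + 2 * a by ring.
  by apply: le_trans (mdD _ _) _; rewrite mdM mdn; clear -h1 del1; lra.
have D2 : md (b' ^+ 2 - b ^+ 2) <= del * (1 + 2 * md b).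
  rewrite subr_sqr mdM; apply: ler_pM; rewrite ?md_ge0 //.
  have -> : b' + b = (b' - b) + 2 * b by ring.
  by apply: le_trans (mdD _ _) _; rewrite mdM mdn; clear -h2 del1; lra.
have D3 : md cs * md (a' ^+ 2 - a ^+ 2) <= md cs * (del * (1 + 2 * md a)) by apply: ler_wpM2l.
have dw : 0 <= del * md b by apply: mulr_ge0 => //; exact: ltW.
have dz : 0 <= del * md a by apply: mulr_ge0 => //; exact: ltW.
have dc : 0 <= del * (md cs * (1 + 2 * md a)) by apply: mulr_ge0 => //; exact: ltW.
have KE : del * K = del * 2 + 2 * (del * md a) + 2 * (del * md b) + del * (md cs * (1 + 2 * md a)) by rewrite /K; ring.
have CE : md cs * (del * (1 + 2 * md a)) = del * (md cs * (1 + 2 * md a)) by ring.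
rewrite KE in delK; rewrite CE in D3.
split; rewrite /= -/(zcoef al) -?csE.
  have -> : a' - a' ^+ 2 - (a - a ^+ 2) = (a' - a) - (a' ^+ 2 - a ^+ 2) by ring.
  by apply: le_lt_trans (mdB _ _) _; clear -delK h1 D1 dw dc e0; lra.
have -> : b' + b' ^+ 2 + cs * a' ^+ 2 - (b + b ^+ 2 + cs * a ^+ 2) = (b' - b) + (b' ^+ 2 - b ^+ 2) + cs * (a' ^+ 2 - a ^+ 2) by ring.
apply: le_lt_trans (mdD _ _) _; rewrite (mdM cs); have := mdD (b' - b) (b' ^+ 2 - b ^+ 2).
by clear -delK D3 h2 D2 dz e0; lra.
Qed.

Lemma skew_cont (al : nat) m p (e : R) : 0 < e ->
  exists2 d : R, 0 < d & forall q, near2 d p q -> near2 e (iter m (sk al) p) (iter m (sk al) q).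
Proof.
elim: m e => [|m IH] e e0; first by exists e.
have [d d0 Hd] := skew_cont1 al (iter m (sk al) p) e0.
by have [d' d'0 Hd'] := IH _ d0; exists d' => // q /Hd' /Hd.
Qed.

Lemma skew_fibre (al : nat) m z v : finite_set [set w | (iter m (sk al) (z, w)).2 = v].
Proof.
elim: m z => [|m IH] z /=; first by rewrite (_ : [set w | w = v] = [set v]) //; exact: finite_set1.
set A := [set w | (iter m (sk al) (z - z ^+ 2, w)).2 = v].
have fA : finite_set A by exact: IH.
pose r w := g (w - (zcoef al) * z ^+ 2).
apply: (@sub_finite_set _ _ ((r @` A) `|` ((fun w => - 1 - r w) @` A))); last first.
  by rewrite finite_setU; split; exact: finite_image.
move=> w /=; rewrite -iterS iterSr /= -/(zcoef al) => hw.
pose w' := w + w ^+ 2 + (zcoef al) * z ^+ 2.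
have E : (w - r w') * (w + r w' + 1) = 0.
  have h : r w' + r w' ^+ 2 = w + w ^+ 2 by rewrite /r g_q /w' addrK.
  transitivity ((w + w ^+ 2) - (r w' + r w' ^+ 2)); first by ring.
  by rewrite h subrr.
move/eqP: E; rewrite mulf_eq0 subr_eq0 => /orP[/eqP ->|/eqP h]; [left|right]; exists w' => //.
by apply/eqP; rewrite eq_sym -subr_eq0; apply/eqP; rewrite -[RHS]h; ring.
Qed.

(** Only finitely many points of the fibre share an image under an iterate, so among infinitely many
    points near w one has another image. *)
Lemma skew_separate (al : nat) m z w (d : R) : 0 < d -> exists w', md (w' - w) < d /\ (iter m (sk al) (z, w')).2 <> (iter m (sk al) (z, w)).2.
Proof.
move=> d0; apply: contrapT => neg.
pose f k : C := w + (d / k.+2%:R)%:C.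
have fA k : (iter m (sk al) (z, f k)).2 = (iter m (sk al) (z, w)).2.
  apply: contrapT => h; apply: neg; exists (f k); split=> //.
  rewrite /f addrC addKr md_real ger0_norm ?divr_ge0 ?ltW // ltr_pdivrMr ?ltr0n // ltr_pMr // ltr1n //.
have inj k k' : f k = f k' -> k = k'.
  move=> /addrI /complexI /mulfI h; have {}h := h (lt0r_neq0 d0).
  by move/invr_inj/eqP: h; rewrite eqr_nat => /eqP [].
have [gi Hg] : exists gi : C -> nat, forall k, gi (f k) = k.
  have ex x : exists k, (exists k', f k' = x) -> f k = x.
    by have [[k hk]|h] := pselect (exists k', f k' = x); [exists k|exists 0%N => /h].
  have [gi Hgi] := choice ex; exists gi => k; apply: inj; apply: Hgi; by exists k.
apply: infinite_nat; apply: sub_finite_set (finite_image gi (skew_fibre al m z (iter m (sk al) (z, w)).2)).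
by move=> k _; exists (f k); [exact: fA|exact: Hg].
Qed.
End Skew.

(** * Wandering components *)

Section Trap.
Variables (R : realType).
Local Notation C := R[i].
Local Notation C2 := (R[i] * R[i])%type.
Local Notation Re := complex.Re.
Local Notation Im := complex.Im.
Local Notation sk := (@skew_product R).

Lemma fin_bound (f : nat -> R) k : exists B, forall m, (m < k)%N -> f m <= B.
Proof.
elim: k => [|k [B HB]]; first by exists 0.
exists (Num.max B (f k)) => m; rewrite ltnS leq_eqVlt => /orP[/eqP ->|mk]; rewrite le_max ?lexx ?orbT //.
by rewrite HB.
Qed.

Lemma md_box (B : R) (u : C2) : md u.1 <= B -> md u.2 <= B -> box 0 (B + 1) u.
Proof. by move=> h1 h2; apply: near2_box; split; rewrite subr0; [apply: le_lt_trans h1 _|apply: le_lt_trans h2 _]; rewrite ltrDl ltr01. Qed.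

(** In units of rho, |be u^2| >= 10 - 4.5 - 0.1, so |u| >= 2.3 and |v + u| >= 4: the quadratic part
    expands by at least 4. The error term is bounded by 1/10 on the disc of radius 6, hence has
    Lipschitz constant 4/5 on that of radius 5. *)
Lemma expand_step (f : C -> C) (y u v be D : C) (rho : R) : 0 < rho -> md be * rho = 1 ->
  (forall w, exists l, cderiv f w l) ->
  (forall x, md x <= 6 * rho -> md (f (y + x) - y - (be * x ^+ 2 + D)) <= rho / 10) ->
  10 * rho <= md D -> md u <= 9 / 2 * rho -> md (f (y + u) - y) <= 9 / 2 * rho -> md (v - u) <= rho / 10 ->
  2 * md (v - u) <= md (f (y + v) - f (y + u)).
Proof.
move=> r0 bE Hf H D10 u5 fu vu.
have u0 := md_ge0 u.
pose E w := f w + ((- be) * ((w - y) * (w - y)) + (- y - D)).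
have HE w : exists l, cderiv E w l.
  have [l hl] := Hf w.
  have k := cderivD (cderiv_id w) (cderiv_cst (- y) w).
  by eexists; exact: cderivD hl (cderivD (cderivM (cderiv_cst (- be) w) (cderivM k k)) (cderiv_cst (- y - D) w)).
have EB w : md (w - y) < 6 * rho -> md (E w) <= rho / 10.
  move=> hw; have := H (w - y) (ltW hw); rewrite subrKC.
  by rewrite /E; congr (md _ <= _); ring.
have r5 : 0 < 5 * rho by rewrite mulr_gt0.
have r56 : 5 * rho < 6 * rho by clear -r0; lra.
have L := holo_lip r5 r56 HE EB.
have inb x : md x <= 9 / 2 * rho + rho / 10 -> md (y + x - y) < 5 * rho.
  by rewrite addrAC subrr add0r => h; clear -h r0; lra.
have v5 : md v <= 9 / 2 * rho + rho / 10 by have := mdD (v - u) u; rewrite subrK; clear -u5 vu; lra.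
have uu : md u <= 9 / 2 * rho + rho / 10 by clear -u5 r0; lra.
have := L (y + u) (y + v) (inb u uu) (inb v v5).
have -> : 8 * (rho / 10) / (6 * rho - 5 * rho) = 4 / 5 by field; rewrite lt0r_neq0 // -mulrBl; apply: mulr_gt0 => //; clear; lra.
have -> : y + v - (y + u) = v - u by ring.
have EE : E (y + v) - E (y + u) = (f (y + v) - f (y + u)) - be * (v ^+ 2 - u ^+ 2) by rewrite /E; ring.
rewrite EE => lip.
have bu : 58 / 10 * rho - 4 / 10 * rho <= md (be * u ^+ 2).
  have u6 : md u <= 6 * rho by clear -u5 r0; lra.
  have h := H u u6.
  have -> : be * u ^+ 2 = (f (y + u) - y) - D - (f (y + u) - y - (be * u ^+ 2 + D)) by ring.
  have := md_lbB ((f (y + u) - y) - D) (f (y + u) - y - (be * u ^+ 2 + D)).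
  have := md_lbB D (f (y + u) - y); rewrite (md_distC D); move: h fu D10; clear; lra.
have ulo : 23 / 10 * rho <= md u.
  rewrite leNgt; apply/negP => h; move: bu; rewrite mdM mdX.
  have : md be * md u ^+ 2 <= md be * (23 / 10 * rho) ^+ 2.
    by apply: ler_wpM2l; rewrite ?md_ge0 // ler_pXn2r ?nnegrE // ?(ltW h) // mulr_ge0 // ltW.
  have -> : md be * (23 / 10 * rho) ^+ 2 = 529 / 100 * (md be * rho) * rho by field.
  rewrite bE mulr1; clear -r0; lra.
have sum : 4 * rho <= md (v + u).
  have -> : v + u = 2 * u + (v - u) by ring.
  have := md_lb (2 * u) (v - u); rewrite mdM mdn; clear -ulo vu r0; lra.
have big : 4 * md (v - u) <= md (be * (v ^+ 2 - u ^+ 2)).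
  rewrite subr_sqr mdM mdM.
  have : md be * (md (v - u) * (4 * rho)) <= md be * (md (v - u) * md (v + u)) by do 2!(apply: ler_wpM2l; rewrite ?md_ge0 //).
  have -> : md be * (md (v - u) * (4 * rho)) = 4 * md (v - u) * (md be * rho) by ring.
  by rewrite bE mulr1.
have := mdB (f (y + v) - f (y + u)) (f (y + v) - f (y + u) - be * (v ^+ 2 - u ^+ 2)).
rewrite opprB addrCA subrr addr0; move: big lip (md_ge0 (v - u)); clear; lra.
Qed.

(** An invariant is propagated along the component: z lies in the domain, |D| < 10 rho, and the
    returns are eventually within 5 rho. [f1] improves 5 to 4, which leaves room for openness. At a
    limit point equicontinuity still gives 4.1, and |D| >= 10 rho is refuted by expansion in the
    fibre. *)
Lemma trap_component (al : nat) (rho BB : R) (be zb : C) (D : C -> C) (dom : C -> Prop) (tau : nat -> nat) :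
  0 < rho -> md be * rho = 1 -> tau 0%N = 0%N -> (forall j, (tau j < tau j.+1)%N) ->
  (forall p j x, dom p.1 -> md (D p.1) <= 11 * rho -> md x <= 6 * rho ->
    let u := ((iter (tau j) (sk al) p).1, y0 R + x) in
    md ((iter (tau j.+1 - tau j)%N (sk al) u).2 - y0 R - (be * x ^+ 2 + D p.1)) <= rho / 10 /\
    forall m, (m <= tau j.+1 - tau j)%N -> md (iter m (sk al) u).2 <= BB) ->
  (forall z w m, dom z -> md (iter m (sk al) (z, w)).1 <= 1) ->
  (exists2 r : R, 0 < r & forall z, md (z - zb) < r -> dom z /\ md (D z) <= rho / 8) ->
  (forall z, dom z -> md (D z) < 10 * rho -> exists2 d : R, 0 < d & forall z', md (z' - z) < d -> dom z' /\ md (D z') < 10 * rho) ->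
  (forall z, (forall d : R, 0 < d -> exists z', [/\ md (z' - z) < d, dom z' & md (D z') < 10 * rho]) ->
     dom z /\ md (D z) <= 11 * rho) ->
  exists2 Om, fatou_component (sk al) Om & forall p, Om p -> dom p.1 /\ md (D p.1) < 10 * rho.
Proof.
move=> r0 bE t0 tS HP H1 [rb rb0 Hb] Ho Hc.
pose xs j p := (iter (tau j) (sk al) p).2 - y0 R.
have klow j : (j <= tau j)%N by elim: j => // j IH; exact: leq_ltn_trans IH (tS j).
have BB0 : 0 <= BB.
  have [] := Hb zb; first by rewrite subrr md0.
  move=> dz Dz; have [||_ h] := HP (zb, 0) 0%N 0 dz _ _; rewrite ?md0 ?mulr_ge0 ?(ltW r0) //.
    by rewrite /=; clear -Dz r0; lra.
  exact: le_trans (md_ge0 _) (h 0%N (leq0n _)).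
have pass1 p j : dom p.1 -> md (D p.1) <= 11 * rho -> md (xs j p) <= 6 * rho ->
  md (xs j.+1 p - (be * xs j p ^+ 2 + D p.1)) <= rho / 10 /\
  forall m, (tau j <= m <= tau j.+1)%N -> md (iter m (sk al) p).2 <= BB.
  move=> dp Dp xp; have /= [h1 h2] := HP p j (xs j p) dp Dp xp.
  have uE : ((iter (tau j) (sk al) p).1, y0 R + xs j p) = iter (tau j) (sk al) p.
    by rewrite /xs subrKC -surjective_pairing.
  rewrite uE -iterD subnK in h1; last exact: ltnW.
  split => // m /andP[m1 m2]; have := h2 (m - tau j)%N (leq_sub2r _ m2).
  by rewrite uE -iterD subnK.
have bdd p j1 : dom p.1 -> md (D p.1) <= 11 * rho -> (forall j, (j1 <= j)%N -> md (xs j p) <= 6 * rho) ->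
  forall m, (tau j1 <= m)%N -> md (iter m (sk al) p).2 <= BB.
  move=> dp Dp Hx.
  have H k : forall m, (tau j1 <= m <= tau (j1 + k))%N -> md (iter m (sk al) p).2 <= BB.
    elim: k => [|k IH] m /andP[m1 m2].
      have [_ h] := pass1 p j1 dp Dp (Hx j1 (leqnn _)); apply: h; rewrite m1; rewrite addn0 in m2.
      exact: leq_trans m2 (ltnW (tS j1)).
    case: (leqP m (tau (j1 + k))) => mk; first by apply: IH; rewrite m1.
    have [_ h] := pass1 p (j1 + k)%N dp Dp (Hx _ (leq_addr _ _)); apply: h.
    by rewrite (ltnW mk) -addnS.
  by move=> m m1; apply: (H m); rewrite m1; exact: leq_trans (leq_addl j1 m) (klow _).
have qlo k x : 0 <= k -> k * rho <= md x -> k ^+ 2 * rho <= md (be * x ^+ 2).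
  move=> k0 h; rewrite mdM mdX.
  have : md be * (k * rho) ^+ 2 <= md be * md x ^+ 2.
    by apply: ler_wpM2l; rewrite ?md_ge0 // ler_pXn2r ?nnegrE ?md_ge0 // mulr_ge0 // ltW.
  have -> : md be * (k * rho) ^+ 2 = k ^+ 2 * (md be * rho) * rho by ring.
  by rewrite bE mulr1.
have qhi k x : 0 <= k -> md x <= k * rho -> md (be * x ^+ 2) <= k ^+ 2 * rho.
  move=> k0 h; rewrite mdM mdX.
  have : md be * md x ^+ 2 <= md be * (k * rho) ^+ 2.
    by apply: ler_wpM2l; rewrite ?md_ge0 // ler_pXn2r ?nnegrE ?md_ge0 // mulr_ge0 // ltW.
  have -> : md be * (k * rho) ^+ 2 = k ^+ 2 * (md be * rho) * rho by ring.
  by rewrite bE mulr1.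
(* A return beyond 4 rho would be followed by one beyond (16 - 10 - 0.1) rho > 5 rho. *)
have f1 p j1 : dom p.1 -> md (D p.1) < 10 * rho -> (forall j, (j1 <= j)%N -> md (xs j p) <= 5 * rho) ->
  forall j, (j1 <= j)%N -> md (xs j p) <= 4 * rho.
  move=> dp Dp Hx j hj; rewrite leNgt; apply/negP => h.
  have x5 := Hx j hj; have x5' := Hx j.+1 (leqW hj).
  have Dp11 : md (D p.1) <= 11 * rho by clear -Dp r0; lra.
  have x6 : md (xs j p) <= 6 * rho by clear -x5 r0; lra.
  have [e _] := pass1 p j dp Dp11 x6.
  have q := qlo 4 _ (ler0n R 4) (ltW h).
  have := mdB (xs j.+1 p - D p.1) (xs j.+1 p - (be * xs j p ^+ 2 + D p.1)).
  have -> : xs j.+1 p - D p.1 - (xs j.+1 p - (be * xs j p ^+ 2 + D p.1)) = be * xs j p ^+ 2 by ring.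
  by have := mdB (xs j.+1 p) (D p.1); move: q e x5' Dp r0; clear; lra.
pose p0 : C2 := (zb, y0 R).
(* Normality is obtained at radius r6, from Lipschitz bounds at radius 3 r6, from Cauchy's estimate
   with bounds at radius 6 r6. *)
pose r6 : R := Num.min rb (rho / 2) / 6.
have r60 : 0 < r6 by rewrite divr_gt0 // lt_min rb0 divr_gt0.
have r6b : 6 * r6 <= rb by rewrite /r6 mulrC divfK ?pnatr_eq0 // ge_min lexx.
have r6r : 6 * r6 <= rho / 2 by rewrite /r6 mulrC divfK ?pnatr_eq0 // ge_min lexx orbT.
(* 1/4 + 1/8 + 1/10 < 1/2, so the disc of radius rho / 2 is mapped into itself. *)
have trap q : near2 (6 * r6) p0 q -> [/\ dom q.1, md (D q.1) <= rho / 8 & forall j, md (xs j q) <= rho / 2].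
  move=> [/= h1 h2]; have [dq Dq] := Hb q.1 (lt_le_trans h1 r6b); split => //.
  elim=> [|j IH]; first by rewrite /xs t0 /=; apply: ltW; exact: lt_le_trans h2 r6r.
  have Dq11 : md (D q.1) <= 11 * rho by clear -Dq r0; lra.
  have x6 : md (xs j q) <= 6 * rho by clear -IH r0; lra.
  have [e _] := pass1 q j dq Dq11 x6.
  have IH' : md (xs j q) <= 1 / 2 * rho by clear -IH; lra.
  have q2 := qhi (1 / 2) _ ltac:(by rewrite divr_ge0) IH'.
  have := mdD (xs j.+1 q - (be * xs j q ^+ 2 + D q.1)) (be * xs j q ^+ 2 + D q.1); rewrite subrK.
  by have := mdD (be * xs j q ^+ 2) (D q.1); move: q2 e Dq r0; clear; lra.
have small q m : near2 (6 * r6) p0 q -> md (iter m (sk al) q).1 <= BB + 1 /\ md (iter m (sk al) q).2 <= BB + 1.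
  move=> hq; have [dq Dq Hx] := trap q hq; split.
    by have := H1 q.1 q.2 m dq; rewrite -surjective_pairing; clear -BB0; lra.
  have : md (iter m (sk al) q).2 <= BB.
    apply: (bdd q 0%N) => //; first by clear -Dq r0; lra.
      by move=> j _; have := Hx j; clear -r0; lra.
    by rewrite t0.
  by clear; lra.
pose L0 : R := 8 * (BB + 1) / (6 * r6 - 3 * r6).
have L00 : 0 < L0 by rewrite divr_gt0 //; [clear -BB0; lra|clear -r60; lra].
have r63 : 0 < 3 * r6 by rewrite mulr_gt0.
have r36 : 3 * r6 < 6 * r6 by clear -r60; lra.
have n36 q : near2 (3 * r6) p0 q -> near2 (6 * r6) p0 q by apply: near2_le; exact: ltW.
have nrm : normal_on (sk al) [set q | near2 r6 p0 q].
  apply: (@equilip_normal _ _ p0 r6 (2 * L0) (BB + 1 + 1)) => //; first by rewrite mulr_gt0.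
    by move=> n q /n36 /(small q n)[h1 h2]; exact: md_box.
  move=> n q q' d hq hq' [hd1 hd2]; have [k1 k2 k3] := skew_deriv R al n.
  have [a1 a2] := hq; have [a1' a2'] := hq'.
  have l1 : md ((iter n (sk al) q').1 - (iter n (sk al) q).1) <= L0 * md (q'.1 - q.1).
    rewrite (surjective_pairing q') (surjective_pairing q) (skew_fst al n q'.1 q'.2 q.2).
    apply: (holo_lip r63 r36 (k1 q.2) _ a1 a1') => z hz; apply: (small (z, q.2) n _).1; split => //=.
    exact: lt_trans a2 r36.
  have l2 : md ((iter n (sk al) (q'.1, q.2)).2 - (iter n (sk al) q).2) <= L0 * md (q'.1 - q.1).
    rewrite [in X in _ - X](surjective_pairing q).
    apply: (holo_lip r63 r36 (k2 q.2) _ a1 a1') => z hz; apply: (small (z, q.2) n _).2; split => //=.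
    exact: lt_trans a2 r36.
  have l3 : md ((iter n (sk al) q').2 - (iter n (sk al) (q'.1, q.2)).2) <= L0 * md (q'.2 - q.2).
    rewrite [in X in X - _](surjective_pairing q').
    apply: (holo_lip r63 r36 (k3 q'.1) _ a2 a2') => z hz; apply: (small (q'.1, z) n _).2; split => //=.
    exact: lt_trans a1' r36.
  have m1 : L0 * md (q'.1 - q.1) < L0 * d by rewrite ltr_pM2l.
  have m2 : L0 * md (q'.2 - q.2) < L0 * d by rewrite ltr_pM2l.
  have d0 : 0 < L0 * d by rewrite mulr_gt0 //; exact: le_lt_trans (md_ge0 _) hd1.
  split; first by apply: le_lt_trans l1 _; clear -m1 d0; lra.
  apply: le_lt_trans (md_tri (iter n (sk al) (q'.1, q.2)).2 _ _) _; clear -l2 l3 m1 m2; lra.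
have U0o : open [set q | near2 r6 p0 q].
  rewrite openE => q [h1 h2]; apply/nbhs_near2.
  exists (Num.min (r6 - md (q.1 - p0.1)) (r6 - md (q.2 - p0.2))); first by rewrite lt_min !subr_gt0 h1 h2.
  move=> q' []; rewrite !lt_min => /andP[k1 _] /andP[_ k2]; split.
    by apply: le_lt_trans (md_tri q.1 _ _) _; move: k1; rewrite ltrBrDr.
  by apply: le_lt_trans (md_tri q.2 _ _) _; move: k2; rewrite ltrBrDr.
have Fp0 : fatou_set (sk al) p0 by exists [set q | near2 r6 p0 q] => //; exact: near2_refl.
pose Om := connected_component (fatou_set (sk al)) p0.
exists Om; first by exists p0.
pose A p := [/\ dom p.1, md (D p.1) < 10 * rho & exists j1, forall j, (j1 <= j)%N -> md (xs j p) <= 5 * rho].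
suff H : Om `<=` A by move=> p /H[].
have f3 p : A p -> exists B, forall m, box 0 B (iter m (sk al) p).
  move=> [dp Dp [j1 Hx]].
  have [B2 HB2] := fin_bound (fun m => md (iter m (sk al) p).2) (tau j1).
  have hb : forall m, (tau j1 <= m)%N -> md (iter m (sk al) p).2 <= BB.
    apply: bdd => //; first by clear -Dp r0; lra.
    by move=> j /Hx; clear -r0; lra.
  exists (Num.max 1 (Num.max BB B2) + 1) => m; apply: md_box.
    by rewrite le_max; apply/orP; left; have := H1 p.1 p.2 m dp; rewrite -surjective_pairing.
  rewrite !le_max; case: (ltnP m (tau j1)) => mt; first by rewrite HB2 ?orbT.
  by rewrite hb ?orbT.
(* Bounded orbits are known on [A] only; points of [A] arbitrarily near p are enough, also when p is
   merely a limit of them. *)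
have equi p : Om p -> (forall r : R, 0 < r -> exists q, near2 r p q /\ A q) -> forall e : R, 0 < e ->
  exists2 d : R, 0 < d & forall q, near2 d p q -> forall j, md (xs j q - xs j p) < e.
  move=> /connected_component_sub [U [oU nU] Up] Hq e e0.
  have [||d d0 Hd] := @normal_equicont _ (sk al) U p tau nU oU Up _ _ e e0.
  - by move=> r hr; have [q [qr Aq]] := Hq r hr; have [B HB] := f3 q Aq; exists q, B; split.
  - by move=> m q e1 e10; exact: skew_cont.
  exists d => // q hq j; have [_ h] := Hd q hq j.
  by have -> : xs j q - xs j p = (iter (tau j) (sk al) q).2 - (iter (tau j) (sk al) p).2 by rewrite /xs; ring.
have Op0 : Om p0 by exists [set p0] => //; split => //; [by move=> _ ->|exact: connected1].
have cO : connected Om by exact: component_connected.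
have := @component_ind R Om A p0 cO Op0.
apply.
- have p0r : near2 (6 * r6) p0 p0 by apply: near2_refl; rewrite mulr_gt0.
  have [d1 d2 d3] := trap p0 p0r; split => //; first by clear -d2 r0; lra.
  by exists 0%N => j _; have := d3 j; clear -r0; lra.
- move=> p Op [dp Dp [j1 Hx]].
  have Ap : A p by split => //; exists j1.
  have [d d0 Hd] := equi p Op (fun r hr => ex_intro _ p (conj (near2_refl p hr) Ap)) rho r0.
  have [d' d'0 Hd'] := Ho p.1 dp Dp.
  exists (Num.min d d'); first by rewrite lt_min d0 d'0.
  move=> q _ hq.
  have [q1 _] : near2 d' p q by apply: near2_le hq; rewrite ge_min lexx orbT.
  have hqd : near2 d p q by apply: near2_le hq; rewrite ge_min lexx.
  have [dq Dq] := Hd' _ q1; split => //; exists j1 => j hj.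
  have := mdD (xs j q - xs j p) (xs j p); rewrite subrK; have := Hd q hqd j; have := f1 p j1 dp Dp Hx j hj.
  by clear; lra.
move=> p Op Hq.
have Hq' r : 0 < r -> exists q, near2 r p q /\ A q by move=> hr; have [q [_ h1 h2]] := Hq r hr; exists q.
have [dp Dp] : dom p.1 /\ md (D p.1) <= 11 * rho.
  by apply: Hc => d d0; have [q [[h1 _] [k1 k2 _]]] := Hq' d d0; exists q.1.
have r10 : 0 < rho / 10 by rewrite divr_gt0.
have [d d0 Hd] := equi p Op Hq' _ r10.
have [q [qd [dq Dq [j1 Hx]]]] := Hq' d d0.
have px j : (j1 <= j)%N -> md (xs j p) <= 41 / 10 * rho.
  move=> hj; have := f1 q j1 dq Dq Hx j hj; have := Hd q qd j.
  have := mdB (xs j q) (xs j q - xs j p); rewrite opprB addrCA subrr addr0; clear; lra.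
case: (ltP (md (D p.1)) (10 * rho)) => D10.
  by split => //; exists j1 => j /px; clear -r0; lra.
(* Expansion has to start from a positive distance: w' is chosen so that its orbit still differs
   from that of p at the return j1. *)
exfalso; have [w' [w'd w'n]] := skew_separate al (tau j1) p.1 p.2 d0.
have q'd : near2 d p (p.1, w') by split => //=; rewrite subrr md0.
apply: w'n; rewrite -surjective_pairing.
have close j := Hd _ q'd j.
(* The distance at least doubles at each return, while [close] keeps it below rho / 10. *)
have ex k : 2 ^+ k * md (xs j1 (p.1, w') - xs j1 p) <= md (xs (j1 + k)%N (p.1, w') - xs (j1 + k)%N p).
  elim: k => [|k IH]; first by rewrite expr0 mul1r addn0.
  set j := (j1 + k)%N in IH *.
  have hj : (j1 <= j)%N by exact: leq_addr.
  pose f w := (iter (tau j.+1 - tau j)%N (sk al) ((iter (tau j) (sk al) p).1, w)).2.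
  have fE q' : q'.1 = p.1 -> f (y0 R + xs j q') = y0 R + xs j.+1 q'.
    move=> qE; rewrite /f /xs !subrKC.
    have -> : (iter (tau j) (sk al) p).1 = (iter (tau j) (sk al) q').1.
      by rewrite (surjective_pairing p) (surjective_pairing q') qE; exact: skew_fst.
    by rewrite -surjective_pairing -iterD subnK // ltnW.
  have [_ _ k3] := skew_deriv R al (tau j.+1 - tau j)%N.
  have Hf x : md x <= 6 * rho -> md (f (y0 R + x) - y0 R - (be * x ^+ 2 + D p.1)) <= rho / 10.
    by move=> hx; have [] := HP p j x dp Dp hx.
  have p1 : md (xs j p) <= 9 / 2 * rho by have := px j hj; clear -r0; lra.
  have p2 : md (f (y0 R + xs j p) - y0 R) <= 9 / 2 * rho.
    by rewrite fE // addrAC subrr add0r; have := px j.+1 (leqW hj); clear -r0; lra.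
  have := expand_step r0 bE (k3 (iter (tau j) (sk al) p).1) Hf D10 p1 p2 (ltW (close j)).
  rewrite -/(f (y0 R + xs j (p.1, w'))) -/(f (y0 R + xs j p)) !fE //.
  have -> : y0 R + xs j.+1 (p.1, w') - (y0 R + xs j.+1 p) = xs j.+1 (p.1, w') - xs j.+1 p by ring.
  rewrite addnS -/j exprS -mulrA => h; apply: le_trans h; exact: ler_wpM2l.
set a := md (xs j1 (p.1, w') - xs j1 p) in ex.
suff a0 : a = 0.
  move/eqP: a0; rewrite /a md_eq0 subr_eq0 => /eqP; rewrite /xs => /addIr -> //.
apply/eqP; rewrite eq_le md_ge0 andbT leNgt; apply/negP => a0.
have [k hk] := nat_above (rho / 10 / a).
have : rho / 10 < 2 ^+ k * a.
  rewrite -ltr_pdivrMr //; apply: le_lt_trans hk _; rewrite -natrX ltr_nat; exact: ltn_expl.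
by have := ex k; have := close (j1 + k)%N; clear; lra.
Qed.
End Trap.

(** * The components attached to the phases Zs *)

Section Wander.
Variables (R : realType).
Local Notation C := R[i].
Local Notation C2 := (R[i] * R[i])%type.
Local Notation Re := complex.Re.
Local Notation Im := complex.Im.
Local Notation sk := (@skew_product R).

(** Zf is the phase as a function of z. Up to a term with Lipschitz constant 1/8 in 1/z it is 1/z
    plus a constant, so it works as a coordinate; N is large enough for the centre Tb = F N + Zs to
    have a phase within e of Zs. *)
Lemma phase_map (al : nat) (Zs : C) (e : R) : 0 < e -> exists (N0 : nat) (M : R), 0 <= M /\ forall N, (N0 <= N)%N ->
  exists Zf : C -> C, let Tb := (F R N)%:C + Zs in
  [/\ 2 <= md Tb,
   forall z w, md (z^-1 - Tb) <= 1 -> [/\ TR (fun m => (iter m (sk al) (z, w)).1^-1), md (Zf z) <= M,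
     forall m, md ((iter m (sk al) (z, w)).1^-1 - (F R (N + m))%:C - Zf z) <= M / (N + m).+1%:R &
     forall m, md (iter m (sk al) (z, w)).1 <= 1],
   forall z z', md (z^-1 - Tb) <= 1 -> md (z'^-1 - Tb) <= 1 ->
     md ((Zf z - Zf z') - (z^-1 - z'^-1)) <= md (z^-1 - z'^-1) / 8 &
   md (Zf Tb^-1 - Zs) <= e].
Proof.
move=> e0; have E0 := Et0 R; pose M0 : R := md Zs + 1.
have zs0 := md_ge0 Zs.
have M00 : 0 < M0 by rewrite /M0; clear -zs0; lra.
have M1 : 0 <= M0 * ((1 + Et R) * Et R) by rewrite mulr_ge0 ?mulr_ge0 ?(ltW M00) ?(ltW E0) //; clear -E0; lra.
have M2 : 0 <= M0 * (1 + Et R) by apply: mulr_ge0; [exact: ltW|clear -E0; lra].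
pose M := M0 * ((1 + Et R) * Et R) + M0 * (1 + Et R).
have [k1 hk1] := nat_above (2 * M0 + 1); have [k2 hk2] := small_frac (Et R) (divr_gt0 (ltr01 (R := R)) (ltr0n R 8)).
have [k3 hk3] := small_frac (M0 * Et R) e0.
exists (k1 + k2 + k3)%N, M; split; first exact: addr_ge0.
move=> N hN; pose Tb := (F R N)%:C + Zs.
have FN := F_ge R N.
have N1 : 2 * M0 + 1 <= N%:R by apply: le_trans hk1 _; rewrite ler_nat; clear -hN; lia.
have E8 : Et R / N.+1%:R <= 1 / 8 by apply: hk2; clear -hN; lia.
have Ee : M0 * Et R / N.+1%:R <= e by apply: hk3; clear -hN; lia.
have start z : md (z^-1 - Tb) <= 1 -> md (z^-1 - (F R N)%:C) <= M0 /\ N%:R / 2 + 7 / 2 <= Re z^-1.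
  move=> hz; have h : md (z^-1 - (F R N)%:C) <= M0.
    have -> : z^-1 - (F R N)%:C = (z^-1 - Tb) + Zs by rewrite /Tb; ring.
    by apply: le_trans (mdD _ _) _; rewrite /M0; clear -hz; lra.
  by split => //; have := Re_ge (F R N)%:C (z^-1); rewrite /=; clear -h FN N1; lra.
have tr z w : md (z^-1 - Tb) <= 1 -> TR (fun m => (iter m (sk al) (z, w)).1^-1).
  by move=> /start[_ h]; apply: skew_TR; apply: le_trans h; have := ler0n R N; clear; lra.
have ex z : exists Zz, md (z^-1 - Tb) <= 1 ->
   (forall m, md ((iter m (sk al) (z, 0)).1^-1 - (F R (N + m))%:C - Zz) <= M0 * ((1 + Et R) * Et R) / (N + m).+1%:R) /\
   md (z^-1 - (F R N)%:C - Zz) <= M0 * (Et R / N.+1%:R).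
  have [dz|nd] := pselect (md (z^-1 - Tb) <= 1); last by exists 0.
  have [h1 h2] := start z dz.
  have [Zz [H1 H2]] := T_limit (tr z 0 dz) h2; exists Zz => _; rewrite /= in H1 H2.
  split; last by apply: le_trans H2 _; apply: ler_wpM2r => //; rewrite divr_ge0 // ltW.
  move=> m; apply: le_trans (H1 m) _; apply: ler_wpM2r; first by rewrite invr_ge0.
  by apply: ler_wpM2r => //; apply: mulr_ge0; [clear -E0; lra|exact: ltW].
have [Zf HZ] := choice ex; exists Zf.
have dTb : md ((Tb^-1)^-1 - Tb) <= 1 by rewrite invrK subrr md0.
split.
- by apply: le_trans (Re_le _); have [_] := start _ dTb; rewrite invrK -/Tb; have := ler0n R N; clear; lra.
- move=> z w dz; have [h1 h2] := start z dz; have [H1 H2] := HZ z dz.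
  split; first exact: tr.
  + have -> : Zf z = (z^-1 - (F R N)%:C) - (z^-1 - (F R N)%:C - Zf z) by ring.
    apply: le_trans (mdB _ _) _.
    have h3 : M0 * (Et R / N.+1%:R) <= M0 * Et R.
      by apply: ler_wpM2l; [exact: ltW|rewrite ler_pdivrMr ?ltr0Sn // ler_peMr ?ler1n // ltW].
    have h4 := lerD h1 (le_trans H2 h3).
    by apply: le_trans h4 _; rewrite /M mulrDr mulr1 lerDr.
  + move=> m; rewrite (skew_fst al m z w 0); apply: le_trans (H1 m) _.
    by apply: ler_wpM2r; [rewrite invr_ge0|rewrite /M lerDl].
  + move=> m; have T0 : N%:R / 2 + 7 / 2 <= Re ((iter 0 (sk al) (z, w)).1^-1) by [].
    have h := TR_re (tr z w dz) T0 m; rewrite /= in h.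
    have lo : 1 <= md ((iter m (sk al) (z, w)).1^-1).
      by apply: le_trans (Re_le _); have := ler0n R (N + m); clear -h; lra.
    rewrite -[(iter m (sk al) (z, w)).1]invrK mdV -[leRHS]invr1 lef_pV2 ?posrE //.
    exact: lt_le_trans lo.
- move=> z z' dz dz'; have [_ r1] := start z dz; have [_ r2] := start z' dz'.
  have [H1 _] := HZ z dz; have [H1' _] := HZ z' dz'.
  apply/ler_addgt0Pr => e1 e10.
  have e12 : 0 < e1 / 2 by rewrite divr_gt0.
  have [m hm] := small_frac (M0 * ((1 + Et R) * Et R)) e12.
  have a1 := le_trans (H1 m) (hm (N + m)%N (leq_addl _ _)).
  have a2 := le_trans (H1' m) (hm (N + m)%N (leq_addl _ _)).
  have := T_pair (tr z 0 dz) (tr z' 0 dz') r1 r2 m; rewrite /= => a3.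
  have a4 : md (z^-1 - z'^-1) * (Et R / N.+1%:R) <= md (z^-1 - z'^-1) * (1 / 8) by apply: ler_wpM2l; rewrite ?md_ge0.
  have a5 := le_trans a3 a4.
  have -> : Zf z - Zf z' - (z^-1 - z'^-1) = - ((iter m (sk al) (z, 0)).1^-1 - (F R (N + m))%:C - Zf z) +
     ((iter m (sk al) (z', 0)).1^-1 - (F R (N + m))%:C - Zf z') +
     ((iter m (sk al) (z, 0)).1^-1 - (iter m (sk al) (z', 0)).1^-1 - (z^-1 - z'^-1)) by ring.
  apply: le_trans (mdD _ _) _.
  have := mdD (- ((iter m (sk al) (z, 0)).1^-1 - (F R (N + m))%:C - Zf z)) ((iter m (sk al) (z', 0)).1^-1 - (F R (N + m))%:C - Zf z').
  by rewrite mdN; move: a1 a2 a5; clear; lra.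
have [_ H2] := HZ _ dTb; rewrite invrK in H2.
rewrite md_distC; have -> : Zs - Zf Tb^-1 = Tb - (F R N)%:C - Zf Tb^-1 by rewrite /Tb; ring.
by apply: le_trans H2 _; rewrite mulrA.
Qed.

(** The returns take place at the times L j, with L (j + 1) = al L j + s. The domain is |1/z - Tb|
    <= 1, while |D| <= 11 rho forces |1/z - Tb| <= 1/4 ([f2]). The relevant set thus stays off the
    boundary of the domain, which gives the openness and closedness asked by [trap_component]. *)
Lemma wander_comp (al s : nat) (rho : R) (be dc Zs : C) :
  (1 < al)%N -> 0 < rho -> md be * rho = 1 -> dc != 0 -> 11 * rho / md dc <= 1 / 16 ->
  (forall M : R, 0 <= M -> exists (n0 : nat) (BB : R), forall n, (n0 <= n)%N -> forall (T w : nat -> C) (Z x : C),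
   TR T -> (forall m, w m.+1 = q0 (w m) + zcoef R al / T m ^+ 2) -> md Z <= M ->
   (forall m, md (T m - (F R (n + m))%:C - Z) <= M / (n + m).+1%:R) ->
   w 0%N = y0 R + x -> md x <= 6 * rho -> md (dc * (Z - Zs)) <= 11 * rho ->
   md (w (al * n - n + s)%N - (y0 R + (be * x ^+ 2 + dc * (Z - Zs)))) <= rho / 10 /\
   forall m, (m <= al * n - n + s)%N -> md (w m) <= BB) ->
  exists (Om : set C2) (N : nat) (M : R), fatou_component (sk al) Om /\ forall p, Om p -> exists Z, md (Z - Zs) <= 11 * rho / md dc /\
    forall m, md ((iter m (sk al) p).1^-1 - (F R (N + m))%:C - Z) <= M / (N + m).+1%:R.
Proof.
move=> al1 r0 bE dc0 tol HS.
have mc : 0 < md dc by rewrite md_gt0.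
(* The precision of the phase at the centre that makes |D| <= rho / 20 there. *)
pose e : R := rho / (20 * md dc).
have e0 : 0 < e by rewrite divr_gt0 // mulr_gt0.
have eE : md dc * e = rho / 20 by rewrite /e; field; rewrite lt0r_neq0.
have e16 : e <= 1 / 16.
  apply: le_trans tol; have -> : 11 * rho / md dc = 220 * e by rewrite /e; field; rewrite lt0r_neq0.
  by clear -e0; lra.
have [N0 [M [M0 HN]]] := phase_map al Zs e0.
have [n0 [BB HB]] := HS M M0.
pose N := (N0 + n0 + 1)%N.
have [Zf [Tb2 Hdom Hlip Hb]] := HN N ltac:(rewrite /N -addnA; exact: leq_addr).
set Tb := (F R N)%:C + Zs in Tb2 Hdom Hlip Hb.
pose L := fix L j := if j is j'.+1 then (al * L j' + s)%N else N.
have LN j : (N <= L j)%N.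
  elim: j => [//|j IH] /=; apply: leq_trans IH _; apply: leq_trans (leq_addr _ _); exact: leq_pmull (ltnW al1).
have L1 j : (0 < L j)%N by apply: leq_trans (LN j); rewrite /N addn1.
have LS j : (L j < L j.+1)%N.
  have h : (2 * L j <= al * L j)%N by rewrite leq_mul2r al1 orbT.
  by rewrite /=; have := L1 j; clear -h; lia.
pose tau j := (L j - N)%N.
have NL j : (N + tau j = L j)%N by rewrite /tau subnKC.
have tauS j : (tau j.+1 - tau j = al * L j - L j + s)%N.
  have h : (2 * L j <= al * L j)%N by rewrite leq_mul2r al1 orbT.
  by rewrite /tau /=; have := LN j; clear -h; lia.
pose D z := dc * (Zf z - Zs).
pose dom z := md (z^-1 - Tb) <= 1.
have Tb0 : Tb != 0 by rewrite -md_gt0; clear -Tb2; lra.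
pose zb := Tb^-1.
have dzb : dom zb by rewrite /dom /zb invrK subrr md0.
have zb0 : zb != 0 by rewrite invr_eq0.
have lip2 z z' : dom z -> dom z' -> md (Zf z - Zf z') <= 9 / 8 * md (z^-1 - z'^-1).
  move=> h h'; have := mdD (Zf z - Zf z' - (z^-1 - z'^-1)) (z^-1 - z'^-1); rewrite subrK.
  by have := Hlip z z' h h'; clear; lra.
have Dlip z z' : dom z -> dom z' -> md (D z) <= md (D z') + md dc * (9 / 8 * md (z^-1 - z'^-1)).
  move=> h h'; have -> : D z = D z' + dc * (Zf z - Zf z') by rewrite /D; ring.
  by apply: le_trans (mdD _ _) _; rewrite lerD2l mdM; apply: ler_wpM2l; [exact: ltW|exact: lip2].
have Db : md (D zb) <= rho / 20 by rewrite /D mdM -eE; apply: ler_wpM2l; [exact: ltW|exact: Hb].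
have f2 z : dom z -> md (D z) <= 11 * rho -> md (z^-1 - Tb) <= 1 / 4.
  move=> dz Dz.
  have h1 : md (Zf z - Zs) <= 1 / 16 by apply: le_trans tol; rewrite ler_pdivlMr // mulrC -mdM.
  have := Hlip z zb dz dzb; rewrite /zb invrK => h2.
  have := mdB (Zf z - Zf Tb^-1) (Zf z - Zf Tb^-1 - (z^-1 - Tb)); rewrite opprB addrCA subrr addr0.
  have -> : Zf z - Zf Tb^-1 = (Zf z - Zs) - (Zf Tb^-1 - Zs) by ring.
  have := mdB (Zf z - Zs) (Zf Tb^-1 - Zs); move: h2.
  have -> : Zf z - Zf Tb^-1 = (Zf z - Zs) - (Zf Tb^-1 - Zs) by ring.
  by move: h1 Hb e16; clear; lra.
have [|||||||Om HOm HD] := @trap_component R al rho BB be zb D dom tau r0 bE.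
- by rewrite /tau subnn.
- by move=> j; rewrite /tau ltn_sub2r // (leq_ltn_trans (LN j)).
- move=> p j x dp Dp hx u.
  have [Tr ZM TZ _] := Hdom p.1 p.2 dp; rewrite -surjective_pairing in Tr TZ.
  have uT m : (iter m (sk al) u).1 = (iter (tau j + m) (sk al) p).1.
    rewrite addnC iterD [in RHS](surjective_pairing (iter (tau j) (sk al) p)); exact: skew_fst.
  have hL : (n0 <= L j)%N by apply: leq_trans (LN j); rewrite /N; clear; lia.
  have Tr' : TR (fun m => (iter m (sk al) u).1^-1) by move=> m; rewrite !uT addnS; exact: Tr.
  have TZ' m : md ((iter m (sk al) u).1^-1 - (F R (L j + m))%:C - Zf p.1) <= M / (L j + m).+1%:R.
    by rewrite uT -NL -addnA; exact: TZ.
  have ws m : (iter m.+1 (sk al) u).2 = q0 (iter m (sk al) u).2 + zcoef R al / ((iter m (sk al) u).1^-1) ^+ 2 by exact: skew_snd.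
  have [h1 h2] := HB (L j) hL (fun m => (iter m (sk al) u).1^-1) (fun m => (iter m (sk al) u).2) (Zf p.1) x Tr' ws ZM TZ' erefl hx Dp.
  rewrite tauS; split => //.
  by have -> : (iter (al * L j - L j + s) (sk al) u).2 - y0 R - (be * x ^+ 2 + D p.1) =
    (iter (al * L j - L j + s) (sk al) u).2 - (y0 R + (be * x ^+ 2 + D p.1)) by ring.
- by move=> z w m dz; have [_ _ _ h] := Hdom z w dz; exact: h.
- have e1 : 0 < Num.min 1 e by rewrite lt_min ltr01 e0.
  have [d d0 Hd] := inv_cont zb0 e1; exists d => // z hz.
  have := Hd z hz; rewrite lt_min => /andP[h1 h2].
  have dz : dom z by rewrite /dom; move: h1; rewrite /zb invrK => /ltW.
  split=> //; apply: le_trans (Dlip z zb dz dzb) _.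
  have h3 : md dc * (9 / 8 * md (z^-1 - zb^-1)) <= md dc * (9 / 8 * e).
    by apply: ler_wpM2l; [exact: ltW|clear -h2; lra].
  have E : md dc * (9 / 8 * e) = 9 / 8 * (md dc * e) by ring.
  by rewrite E eE in h3; move: h3 Db r0; clear; lra.
- move=> z dz Dz; have Dz11 : md (D z) <= 11 * rho by clear -Dz r0; lra.
  have z4 := f2 z dz Dz11.
  have z0 : z != 0 by apply/eqP => z0; move: z4; rewrite z0 invr0 sub0r mdN; clear -Tb2; lra.
  have g0 : 0 < 10 * rho - md (D z) by rewrite subr_gt0.
  pose e2 : R := Num.min (1 / 2) ((10 * rho - md (D z)) / (2 * md dc)).
  have e20 : 0 < e2 by rewrite lt_min !divr_gt0 // mulr_gt0.
  have [d d0 Hd] := inv_cont z0 e20; exists d => // z' hz'.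
  have := Hd z' hz'; rewrite lt_min => /andP[h1 h2].
  have dz' : dom z'.
    by rewrite /dom; have := md_tri z^-1 z'^-1 Tb; move: h1 z4; clear; lra.
  split=> //; apply: le_lt_trans (Dlip z' z dz' dz) _.
  have h3 : md dc * (9 / 8 * md (z'^-1 - z^-1)) <= md dc * (9 / 8 * ((10 * rho - md (D z)) / (2 * md dc))).
    by apply: ler_wpM2l; [exact: ltW|clear -h2; lra].
  have E : md dc * (9 / 8 * ((10 * rho - md (D z)) / (2 * md dc))) = 9 / 16 * (10 * rho - md (D z)).
    by field; rewrite lt0r_neq0.
  by rewrite E in h3; move: h3 g0; clear; lra.
- move=> z Hz.
  have near d : 0 < d -> exists z', [/\ md (z' - z) < d, dom z', md (D z') < 10 * rho & md (z'^-1 - Tb) <= 1 / 4].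
    move=> d0; have [z' [h1 h2 h3]] := Hz d d0; exists z'; split => //; apply: f2 => //; clear -h3 r0; lra.
  (* Points z' with |1/z'| <= |Tb| + 1 stay away from 0, so their limit z is not 0 and 1/z is
     continuous there. *)
  have dm0 : 0 < (2 * (md Tb + 1))^-1 by rewrite invr_gt0 mulr_gt0 //; clear -Tb2; lra.
  have z0 : z != 0.
    have [z' [h1 _ _ h4]] := near _ dm0.
    have z'i : md z'^-1 <= md Tb + 1 by have := mdD (z'^-1 - Tb) Tb; rewrite subrK; clear -h4; lra.
    have z'0 : z' != 0 by apply/eqP => e1; move: h4; rewrite e1 invr0 sub0r mdN; clear -Tb2; lra.
    have lo : (md Tb + 1)^-1 <= md z'.
      by rewrite -[md z']invrK -mdV lef_pV2 ?posrE ?md_gt0 ?invr_eq0 //; clear -Tb2; lra.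
    apply/eqP => e1; move: h1; rewrite e1 subr0 invfM.
    have := md_ge0 z'; move: lo; clear; lra.
  pose e3 : R := Num.min (1 / 2) (rho / (2 * md dc)).
  have e30 : 0 < e3 by rewrite lt_min !divr_gt0 // mulr_gt0.
  have [d d0 Hd] := inv_cont z0 e30.
  have [z' [h1 h2 h3 h4]] := near d d0.
  have := Hd z' h1; rewrite lt_min => /andP[k1 k2].
  have dz : dom z.
    by rewrite /dom; have := md_tri z'^-1 z^-1 Tb; rewrite (md_distC z^-1 z'^-1); move: k1 h4; clear; lra.
  split=> //; apply: le_trans (Dlip z z' dz h2) _.
  have g3 : md dc * (9 / 8 * md (z^-1 - z'^-1)) <= md dc * (9 / 8 * (rho / (2 * md dc))).
    by apply: ler_wpM2l; [exact: ltW|rewrite md_distC; clear -k2; lra].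
  have E : md dc * (9 / 8 * (rho / (2 * md dc))) = 9 / 16 * rho by field; rewrite lt0r_neq0.
  by rewrite E in g3; move: g3 h3 r0; clear; lra.
exists Om, N, M; split => // p Op; have [dp Dp] := HD p Op.
have [_ _ TZ _] := Hdom p.1 p.2 dp; rewrite -surjective_pairing in TZ.
exists (Zf p.1); split; last exact: TZ.
by rewrite ler_pdivlMr // mulrC -mdM; move: Dp r0; rewrite -/(D p.1); clear; lra.
Qed.
End Wander.

Theorem theorem6p6 (R : realType) (alpha0 : nat) (r : R)
    (phi_in phi_out psi h : R[i] -> R[i]) :
  (1 < alpha0)%N ->
  0 < r ->
  fatou_coordinates r phi_in phi_out psi ->
  horn_map r phi_in psi h ->
  let P := @skew_product R alpha0 in
  let hyp := hyperbolic_component (horn_dom r psi) h alpha0 in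
  exists Omega : set R[i] -> set (R[i] * R[i]),
    (forall U, hyp U ->
       fatou_component P (Omega U) /\ wandering P (Omega U)) /\
    (forall U1 U2, hyp U1 -> hyp U2 -> U1 <> U2 ->
       ~ same_grand_orbit P (Omega U1) (Omega U2)).
Proof.
move=> al1 _ _ [hol _] P hyp.
have ln0 : 0 < ln (alpha0%:R : R) by rewrite ln_gt0 // ltr1n.
pose b : R := pi / ln alpha0%:R.
have b0 : 0 < b by rewrite divr_gt0 // pi_gt0.
have LA : Lb b = ln alpha0%:R.
  by rewrite /Lb /b invf_div mulrCA divff ?mulr1 // lt0r_neq0 // pi_gt0.
have cE : (cc b)%:C%C = zcoef R alpha0 by rewrite /cc /b /zcoef expr_div_n.
have [rho [be [dc [Zs [i0 H]]]]] := step b0 al1 LA.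
(* One component for each index; the attached pair holds the time offset of the reference and the
   constant in the rate of convergence of the phase. *)
have comp k : exists x : set (R[i] * R[i]) * (nat * R), fatou_component P x.1 /\
  forall p, x.1 p -> exists Z, md (Z - Zs (i0 + k)%N) <= 11 * rho (i0 + k)%N / md (dc (i0 + k)%N) /\
    forall m, md ((iter m P p).1^-1 - ((F R (x.2.1 + m))%:C)%C - Z) <= x.2.2 / (x.2.1 + m).+1%:R.
  have [[h1 h2 h3 h4] _ _ HS] := H (i0 + k)%N (leq_addr _ _).
  rewrite cE in HS.
  by have [Om [N [M HO]]] := wander_comp al1 h1 h2 h3 h4 HS; exists (Om, (N, M)).
have [x Hx] := choice comp.
have [code Hcode] := @hyp_code R (horn_dom r psi) h alpha0 hol.
exists (fun U => (x (code U)).1); split.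
  move=> U _; have [h1 h2] := Hx (code U); split => // k m m1; set Om := (x (code U)).1 in h1 h2 *.
  apply/seteqP; split => [v [[p Op pv] [q Oq qv]]|v []].
  have [Z [z1 z2]] := h2 p Op; have [Z' [z1' z2']] := h2 q Oq.
  have [[_ _ _ tol] _ _ _] := H (i0 + code U)%N (leq_addr _ _).
  (* A common point of the images at times k + m and k makes two orbit tails coincide. Both phases
     are close to the same Zs, so the time shift must be 0, against m >= 1. *)
  have [||_ /eqP] := phase_shift (a := (k + m)%N) (a' := k) z2 z2'.
  - by move=> t; rewrite (addnC (k + m)%N t) (addnC k t) (iterD t (k + m)) (iterD t k) pv qv.
  - have -> : Z - Z' = (Z - Zs (i0 + code U)%N) - (Z' - Zs (i0 + code U)%N) by ring.
    apply: le_lt_trans (mdB _ _) _; move: tol z1 z1'; clear; lra.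
  rewrite eqn_add2l -[X in _ == X]addn0 eqn_add2l => /eqP m0.
  by rewrite m0 in m1.
move=> U1 U2 hU1 hU2 U12 [n1 [n2 E]].
have [h1 h2] := Hx (code U1); have [h1' h2'] := Hx (code U2).
have cU : code U1 != code U2 by apply/eqP => /(Hcode U1 U2 hU1 hU2).
have ij : (i0 + code U1)%N != (i0 + code U2)%N by rewrite eqn_add2l.
have [[_ _ _ tol] near sep _] := H (i0 + code U1)%N (leq_addr _ _).
have [[_ _ _ tol'] _ _ _] := H (i0 + code U2)%N (leq_addr _ _).
have [p0 Fp0 EO] := h1.
have Op0 : (x (code U1)).1 p0.
  by rewrite EO; exists [set p0] => //; split => //; [move=> _ ->|exact: connected1].
have : (iter n1 P @` (x (code U1)).1) (iter n1 P p0) by exists p0.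
rewrite E => -[q Oq qE].
have [Z [z1 z2]] := h2 p0 Op0; have [Z' [z1' z2']] := h2' q Oq.
have dZ := sep _ (leq_addr _ _) ij; have nZ := near _ (leq_addr (code U2) i0).
(* By [near], [tol] and [tol'] the two phases differ by less than 1, so a common orbit tail would
   make them equal, which [sep] forbids. *)
have [||ZE _] := phase_shift (a := n1) (a' := n2) z2 z2'.
- by move=> t; rewrite (addnC n1 t) (addnC n2 t) (iterD t n1) (iterD t n2) qE.
- have -> : Z - Z' = (Z - Zs (i0 + code U1)%N) - (Z' - Zs (i0 + code U2)%N) + (Zs (i0 + code U1)%N - Zs (i0 + code U2)%N) by ring.
  apply: le_lt_trans (mdD _ _) _.
  have := mdB (Z - Zs (i0 + code U1)%N) (Z' - Zs (i0 + code U2)%N); move: z1 z1' nZ tol tol'; clear; lra.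
have : md (Zs (i0 + code U1)%N - Zs (i0 + code U2)%N) <= md (Z - Zs (i0 + code U1)%N) + md (Z' - Zs (i0 + code U2)%N).
  have -> : Zs (i0 + code U1)%N - Zs (i0 + code U2)%N = (Z' - Zs (i0 + code U2)%N) - (Z - Zs (i0 + code U1)%N) by rewrite ZE; ring.
  by apply: le_trans (mdB _ _) _; rewrite addrC.
move=> h3; have := lt_le_trans dZ h3; apply/negP; rewrite -leNgt; exact: lerD.
Qed.
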